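(* Let $r>0$ and let $\varphi$ be a toric plurisubharmonic function defined on the polydisk $D(0,r)\subset\mathbf{C}^n$. Then the following are equivalent. (1) $\varphi$ admits a nice toric approximation, i.e. there is a decreasing sequence $(\varphi_m)_{m\ge1}$ of toric plurisubharmonic functions with analytic singularities (defined near the origin) converging pointwise to $\varphi$ and satisfying $\mathcal{J}(\varphi_m)=\mathcal{J}(\varphi)$ for every $m\ge 1$. (2) There exists a polyhedron $P\subseteq\mathbf{R}^n_{\ge0}$ satisfying the following three conditions: (i) $(2/c)P$ is a rational polyhedron for some $c>0$; (ii) $P(\varphi)\subseteq P$ and $P+\mathbf{R}^n_{\ge0}\subseteq P$; (iii) $(\operatorname{int}P)\cap\mathbf{Z}^n_{\ge0}=(\operatorname{int}P(\varphi))\cap\mathbf{Z}^n_{\ge0}$.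
   Context: $D(0,r)$ denotes the polydisk in $\mathbf{C}^n$ with polyradius $(r,\dots,r)$. A plurisubharmonic (psh) function $\varphi$ on $D(0,r)$ is toric if $\varphi(z_1,\dots,z_n)=\varphi(e^{i\theta_1}z_1,\dots,e^{i\theta_n}z_n)$ for all real $\theta_1,\dots,\theta_n$. For such $\varphi$ there is a convex function $g$ on $U=(-\infty,\log r)^n$, increasing in each variable, with $\varphi(z)=g(\log|z_1|,\dots,\log|z_n|)$ (the convex function associated to $\varphi$). The Newton convex body of $\varphi$ is $P(\varphi)=\{x\in\mathbf{R}^n:\sup_{y\in U}(\langle x,y\rangle-g(y))<+\infty\}$. A psh function has analytic singularities if locally it is of the form $c\log(|g_1|^2+\cdots+|g_m|^2)+O(1)$ with $c\ge0$ and $g_j$ holomorphic. $\mathcal{J}(\varphi)$ is the multiplier ideal sheaf: its stalk at $x$ consists of holomorphic germs $f$ with $|f|^2e^{-2\varphi}$ locally Lebesgue integrable near $x$. A polyhedron is a finite intersection of closed half-spaces $\{x\in\mathbf{R}^n:\langle a_i,x\rangle\le b_i\}$; it is rational if the $a_i$ and $b_i$ can all be chosen with rational entries. $\operatorname{int}$ denotes interior in $\mathbf{R}^n$; $\mathbf{R}^n_{\ge0}$, $\mathbf{Z}^n_{\ge0}$ are the $n$-tuples of nonnegative reals, resp. integers. *)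

(* Defs.v *)
From HB Require Import structures.
From mathcomp Require Import all_boot all_order all_algebra.
From mathcomp Require Import all_classical all_reals all_analysis.
From mathcomp Require Import complex.
Set Implicit Arguments. Unset Strict Implicit. Unset Printing Implicit Defensive.
Import Order.TTheory GRing.Theory Num.Theory.
Import numFieldTopology.Exports numFieldNormedType.Exports.
Local Open Scope classical_set_scope.
Local Open Scope ring_scope.

Section Defs.
Variable R : realType.
Local Notation C := R[i].
Variable n : nat.
Local Notation Cn := 'rV[C]_n.
Local Notation Rn := 'rV[R]_n.
Local Notation CnN := (NormedModule.clone C Cn _).

Definition cmod2 (z : C) : R := (complex.Re z) ^+ 2 + (complex.Im z) ^+ 2.
Definition cabs (z : C) : R := Num.sqrt (cmod2 z).

Definition expi (t : R) : C := Complex (cos t) (sin t).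

Definition polydisk (a : Cn) (r : R) : set Cn :=
  [set z | forall j : 'I_n, cabs (z 0 j - a 0 j) < r].

(* upper semicontinuity on Om (polydisks form a neighbourhood basis) *)
Definition usc_on (Om : set Cn) (phi : Cn -> \bar R) : Prop :=
  forall a, Om a -> forall t : R, (phi a < t%:E)%E ->
    exists d : R, 0 < d /\ forall z, polydisk a d z -> (phi z < t%:E)%E.

Definition submean_on (Om : set Cn) (phi : Cn -> \bar R) : Prop :=
  forall a b : Cn, (forall zeta : C, cabs zeta <= 1 -> Om (a + zeta *: b)) ->
    (phi a <= ((2 * pi)^-1)%:E *
       \int[lebesgue_measure]_(t in `[0%R, (2 * pi)%R]) phi (a + expi t *: b)%R)%E.

Definition psh (Om : set Cn) (phi : Cn -> \bar R) : Prop :=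
  (forall z, Om z -> (phi z < +oo)%E) /\ usc_on Om phi /\ submean_on Om phi.

Definition rot (th : 'I_n -> R) (z : Cn) : Cn := \row_j (expi (th j) * z 0 j).

Definition toric (r : R) (phi : Cn -> \bar R) : Prop :=
  forall (th : 'I_n -> R) (z : Cn), polydisk 0 r z -> phi (rot th z) = phi z.

Definition cexp (y : Rn) : Cn := \row_j (Complex (expR (y 0 j)) 0).

Definition dotv (a x : Rn) : R := \sum_(j < n) a 0 j * x 0 j.

(* Newton convex body P(phi) of a toric phi on D(0,r); the associated convex
   function is g(y) = phi(e^{y_1},...,e^{y_n}) on U = (-oo, log r)^n *)
Definition newton (r : R) (phi : Cn -> \bar R) : set Rn :=
  [set x | exists M : R, forall y : Rn, (forall j, y 0 j < ln r) ->
      ((dotv x y)%:E - phi (cexp y) <= M%:E)%E].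

(* holomorphic on S: complex (Frechet, R[i]-linear) differentiable at every
   point of S *)
Definition holo (S : set Cn) (f : Cn -> C) : Prop :=
  forall a, S a -> differentiable (f : CnN -> C^o) (a : CnN).

Definition shiftc (z : Cn) (k : nat) (w : C) : Cn :=
  \row_j (if (j : nat) == k then z 0 j + w else z 0 j).

(* iterated Lebesgue integral of F over the cube
   prod_{j<k} {z_j + s + i t : s,t in [-e,e]} (other coordinates fixed) *)
Fixpoint boxint (F : Cn -> \bar R) (e : R) (k : nat) (z : Cn) : \bar R :=
  match k with
  | 0 => F z
  | k'.+1 =>
      (\int[lebesgue_measure]_(s in `[(- e)%R, e])
        \int[lebesgue_measure]_(t in `[(- e)%R, e])
          boxint F e k' (shiftc z k' (Complex s t)%R))%E
  end.

(* f is (a representative of) a holomorphic germ at x belonging to the stalk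
   J(phi)_x: f holomorphic near x and |f|^2 e^{-2 phi} integrable near x *)
Definition inJ (Om : set Cn) (phi : Cn -> \bar R) (x : Cn) (f : Cn -> C) : Prop :=
  exists e : R, 0 < e /\ polydisk x (2 * e) `<=` Om /\
    holo (polydisk x (2 * e)) f /\
    (boxint (fun z => (cmod2 (f z))%:E * expeR (- (2%:E * phi z))) e n x
       < +oo)%E.

Definition sameJ (Om : set Cn) (phi psi : Cn -> \bar R) : Prop :=
  forall x, Om x -> forall f : Cn -> C, inJ Om phi x f <-> inJ Om psi x f.

Definition analytic_sing (Om : set Cn) (phi : Cn -> \bar R) : Prop :=
  forall x, Om x -> exists e : R, 0 < e /\ polydisk x e `<=` Om /\
    exists (c : R) (k : nat) (g : 'I_k -> Cn -> C) (h : Cn -> R) (M : R),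
      0 <= c /\ (forall j, holo (polydisk x e) (g j)) /\
      (forall z, polydisk x e z -> `|h z| <= M) /\
      (forall z, polydisk x e z ->
         phi z = (c%:E * lne (\sum_(j < k) cmod2 (g j z))%:E + (h z)%:E)%E).

Definition nice_toric_approx (r : R) (phi : Cn -> \bar R) : Prop :=
  exists rho : R, 0 < rho /\ rho <= r /\
  exists phis : nat -> Cn -> \bar R,
    (forall m, psh (polydisk 0 rho) (phis m) /\ toric rho (phis m) /\
               analytic_sing (polydisk 0 rho) (phis m) /\
               sameJ (polydisk 0 rho) (phis m) phi) /\
    (forall m z, polydisk 0 rho z -> (phis m.+1 z <= phis m z)%E) /\
    (forall z, polydisk 0 rho z -> phis m z @[m --> \oo] --> phi z).

Definition polyhedron (P : set Rn) : Prop :=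
  exists (k : nat) (a : 'I_k -> Rn) (b : 'I_k -> R),
    P = [set x | forall i, dotv (a i) x <= b i].

Definition rational_polyhedron (P : set Rn) : Prop :=
  exists (k : nat) (a : 'I_k -> 'rV[rat]_n) (b : 'I_k -> rat),
    P = [set x | forall i, dotv (map_mx ratr (a i)) x <= ratr (b i)].

Definition orthant : set Rn := [set x | forall j, 0 <= x 0 j].

Definition scale_set (c : R) (P : set Rn) : set Rn := (fun x => c *: x) @` P.

Definition latpt (alpha : 'I_n -> nat) : Rn := \row_j (alpha j)%:R.

End Defs.

(* Main.v *)
(* Write [phi z = g (log |z_1|, ..., log |z_n|)] with [g] convex and increasing.  Near a point
   [x] a holomorphic germ [f] is bounded above by a finite sum of monomials in [z - x], and each
   of these monomials is a lower bound for [|f|] on a box of comparable size on every small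
   torus.  Hence [f] lies in the stalk of the multiplier ideal at [x] if and only if, for each
   exponent [gamma] that occurs, [g y >= sum_{x_j = 0} (gamma_j + 1 - delta) y_j - M] for some
   [delta > 0]: if it holds, [|f|^2 e^{-2 phi}] is dominated by a product of integrable powers
   of coordinates; conversely, a finite integral bounds the number of disjoint boxes on which
   the integrand has a given mass, which by convexity of [g] forces linear growth.  At [x = 0]
   this says that [z^(alpha - 1)] belongs to the multiplier ideal if and only if [alpha] is in
   the interior of the Newton convex body.

   If [phi_m] is a nice approximation, the germs defining the singularity of its first term at
   the origin have finitely many exponents [v]; a multiple [P] of (convex hull of the [v]) +
   orthant is rational by Fourier-Motzkin elimination, it contains the Newton body since [phi]
   is below that first term, and it has the same interior lattice points since the two
   multiplier ideals agree at the origin.  Conversely, the support function of [P] on the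
   negative orthant is a maximum of finitely many rational linear forms, so it defines a psh
   function [psi] with analytic singularities; since [phi <= psi + O(1)] by duality, the
   functions [max (phi, psi - m)] have the singularity of [psi], and a germ in their multiplier
   ideal at [x] gives, after a large integer is chosen in the coordinates with [x_j <> 0],
   a lattice point in the interior of [P], hence of the Newton body of [phi]. *)

Require Import Defs.
From HB Require Import structures.
From mathcomp Require Import all_boot all_order all_algebra.
From mathcomp Require Import all_classical all_reals all_analysis.
From mathcomp Require Import measurable_realfun complex.
From mathcomp Require Import ring lra.
Set Implicit Arguments. Unset Strict Implicit. Unset Printing Implicit Defensive.
Import Order.TTheory GRing.Theory Num.Theory.
Import numFieldTopology.Exports numFieldNormedType.Exports.
Local Open Scope classical_set_scope.
Local Open Scope ring_scope.
(** * Moduli of complex numbers and integrals over intervals *)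

(** Several integrands in the definitions are not known to be measurable, so their integrals are
    compared by pointwise domination: upper bounds go through explicit dyadic majorants, lower
    bounds through finite sums of indicators of boxes. Germs are not expanded into convergent power
    series; they are compared with interpolation polynomials on grids of roots of unity, whose error
    decays geometrically. Coefficients then depend on the grid, so that an exponent counts as
    occurring when |f| satisfies a lower bound on every small torus, and Dickson's lemma reduces
    these exponents to finitely many. Convexity of g has to come from upper semicontinuity and the
    mean value inequality alone, without smoothing, hence a viscosity argument. The function
    identically -oo satisfies the hypotheses and is treated apart in both directions. Since c log
    |z^b|^2 is the linear form of slope 2cb in log |z|, factors 2c link the exponents to P
    throughout. *)

Section Cabs.
Variable R : realType.
Local Notation C := R[i].
Implicit Types z w : C.

Lemma cabsE z : `|z| = (cabs z)%:C%C.
Proof. by rewrite normc_def. Qed.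

Lemma cmod2_ge0 z : 0 <= cmod2 z.
Proof. by rewrite addr_ge0 // sqr_ge0. Qed.

Lemma cabs_ge0 z : 0 <= cabs z.
Proof. exact: sqrtr_ge0. Qed.

Lemma cabs_sqr z : cabs z ^+ 2 = cmod2 z.
Proof. by rewrite sqr_sqrtr // cmod2_ge0. Qed.

Lemma cabsM z w : cabs (z * w) = cabs z * cabs w.
Proof. by apply: complexI; rewrite rmorphM /= -!cabsE normrM. Qed.

Lemma cabsD z w : cabs (z + w) <= cabs z + cabs w.
Proof. by rewrite -lecR rmorphD /= -!cabsE ler_normD. Qed.

Lemma cabsN z : cabs (- z) = cabs z.
Proof. by apply: complexI; rewrite -!cabsE normrN. Qed.

Lemma cabsB z w : cabs (z - w) <= cabs z + cabs w.
Proof. by rewrite -(cabsN w) cabsD. Qed.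

Lemma cabs_distC z w : cabs (z - w) = cabs (w - z).
Proof. by rewrite -opprB cabsN. Qed.

Lemma cabs0 : cabs (0 : C) = 0.
Proof. by apply: complexI; rewrite -cabsE normr0. Qed.

Lemma cabs1 : cabs (1 : C) = 1.
Proof. by apply: complexI; rewrite -cabsE normr1. Qed.

Lemma cabs_eq0 z : (cabs z == 0) = (z == 0).
Proof. by rewrite -(normr_eq0 z) cabsE eq_complex /= eqxx andbT. Qed.

Lemma cabs_gt0 z : (0 < cabs z) = (z != 0).
Proof. by rewrite lt_neqAle cabs_ge0 andbT eq_sym cabs_eq0. Qed.

Lemma cabsX z k : cabs (z ^+ k) = cabs z ^+ k.
Proof. by elim: k => [|k IH]; rewrite ?expr0 ?cabs1 // !exprS cabsM IH. Qed.

Lemma cabsV z : cabs z^-1 = (cabs z)^-1.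
Proof. by apply: complexI; rewrite fmorphV /= -!cabsE normfV. Qed.

Lemma cabs_real (x : R) : cabs (Complex x 0) = `|x|.
Proof. by rewrite /cabs /cmod2 /= expr0n /= addr0 sqrtr_sqr. Qed.

Lemma cabs_sum (I : Type) (s : seq I) (P : pred I) (F : I -> C) :
  cabs (\sum_(i <- s | P i) F i) <= \sum_(i <- s | P i) cabs (F i).
Proof.
elim/big_rec2: _ => [|i a b _ IH]; first by rewrite cabs0.
by rewrite (le_trans (cabsD _ _)) // lerD2l.
Qed.

Lemma cabs_prod (I : Type) (s : seq I) (P : pred I) (F : I -> C) :
  cabs (\prod_(i <- s | P i) F i) = \prod_(i <- s | P i) cabs (F i).
Proof. by apply: (big_morph _ cabsM cabs1). Qed.

Lemma cmod2_cabs z : cmod2 z = cabs z ^+ 2.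
Proof. by rewrite cabs_sqr. Qed.

Lemma cmod2M z w : cmod2 (z * w) = cmod2 z * cmod2 w.
Proof. by rewrite !cmod2_cabs cabsM exprMn. Qed.

Lemma cabs_lower z w : cabs z - cabs w <= cabs (z + w).
Proof. by rewrite lerBlDr -{1}(addrK w z) cabsB. Qed.

Lemma Re_le_cabs z : `|complex.Re z| <= cabs z.
Proof.
by rewrite -sqrtr_sqr /cabs ler_wsqrtr // /cmod2 lerDl sqr_ge0.
Qed.

Lemma Im_le_cabs z : `|complex.Im z| <= cabs z.
Proof.
by rewrite -sqrtr_sqr /cabs ler_wsqrtr // /cmod2 lerDr sqr_ge0.
Qed.

Lemma cabs_le_ReIm z : cabs z <= `|complex.Re z| + `|complex.Im z|.
Proof.
rewrite -(ler_pXn2r (n := 2)) ?nnegrE ?cabs_ge0 ?addr_ge0 //.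
rewrite cabs_sqr /cmod2 -(real_normK (num_real (complex.Re z)))
  -(real_normK (num_real (complex.Im z))).
by rewrite sqrrD lerD2r lerDl mulrn_wge0 // mulr_ge0.
Qed.

Lemma cabs_expi (t : R) : cabs (expi t) = 1.
Proof. by rewrite /cabs /cmod2 /= cos2Dsin2 sqrtr1. Qed.

Lemma expiD (s t : R) : expi (s + t) = expi s * expi t :> C.
Proof.
rewrite /expi cosD sinD; apply/eqP; rewrite eq_complex /=.
by rewrite eqxx /= addrC (mulrC (cos s) (sin t)) eqxx.
Qed.

Lemma expi0 : expi 0 = 1 :> C.
Proof. by rewrite /expi cos0 sin0. Qed.

Lemma expiM k (t : R) : expi (t *+ k) = expi t ^+ k :> C.
Proof.
by elim: k => [|k IH]; rewrite ?mulr0n ?expi0 ?expr0 // mulrS expiD IH exprS.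
Qed.

Lemma ReD z w : complex.Re (z + w) = complex.Re z + complex.Re w.
Proof. by case: z => a b; case: w. Qed.
Lemma ImD z w : complex.Im (z + w) = complex.Im z + complex.Im w.
Proof. by case: z => a b; case: w. Qed.
Lemma ReN z : complex.Re (- z) = - complex.Re z.
Proof. by case: z. Qed.
Lemma ImN z : complex.Im (- z) = - complex.Im z.
Proof. by case: z. Qed.
Lemma ReM z w : complex.Re (z * w) =
  complex.Re z * complex.Re w - complex.Im z * complex.Im w.
Proof. by case: z => a b; case: w. Qed.
Lemma ImM z w : complex.Im (z * w) =
  complex.Re z * complex.Im w + complex.Im z * complex.Re w.
Proof. by case: z => a b; case: w. Qed.

Lemma polarP z : exists t : R, - pi <= t <= pi /\ z = Complex (cabs z) 0 * expi t.
Proof.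
have [->|z0] := eqVneq z 0.
  by exists 0; rewrite cabs0 expi0 mulr1 oppr_le0 pi_ge0.
have a0 : 0 < cabs z by rewrite cabs_gt0.
pose x := complex.Re z / cabs z; pose y := complex.Im z / cabs z.
have xy : x ^+ 2 + y ^+ 2 = 1.
  rewrite /x /y !expr_div_n -mulrDl -[X in X / _](cabs_sqr z) divff //.
  by rewrite expf_neq0 // gt_eqF.
have x1 : -1 <= x <= 1.
  by rewrite -ler_norml -(ler_pXn2r (n:=2)) ?nnegrE // real_normK ?num_real //
     expr1n -xy lerDl sqr_ge0.
have key (t : R) : cos t = x -> sin t = y -> z = Complex (cabs z) 0 * expi t.
  move=> ct st; rewrite /expi ct st; apply/eqP; rewrite eq_complex /= !mul0r subr0 addr0.
  by rewrite /x /y ![cabs z * _]mulrC !divfK ?eqxx // gt_eqF.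
have cx := acosK x1.
have sx : sin (acos x) = `|y|.
  by rewrite sin_acos // -xy addrC addKr sqrtr_sqr.
have [y0|y0] := leP 0 y.
  exists (acos x); split; last by apply: key => //; rewrite sx ger0_norm.
  by rewrite acos_lepi // (le_trans _ (acos_ge0 x1)) // oppr_le0 pi_ge0.
exists (- acos x); split.
  by rewrite lerN2 acos_lepi //= (le_trans _ (pi_ge0 R)) // oppr_le0 acos_ge0.
apply: key; first by rewrite cosN.
by rewrite sinN sx ltr0_norm // opprK.
Qed.

End Cabs.

(** * Integrals over intervals *)

Section Integrals.
Variable R : realType.
Local Notation mu := (@lebesgue_measure R).

(** The integral of a nonnegative function is a supremum over the simple functions below it, which
    is monotone for arbitrary functions; positive and negative parts are compared separately. It
    serves for [submean_on] and [boxint], whose integrands are not known to be measurable. *)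
Lemma le_integral_nomeas d (T : measurableType d) (m : {measure set T -> \bar R})
    (D : set T) (f g : T -> \bar R) : (forall x, D x -> (f x <= g x)%E) ->
  (\int[m]_(x in D) f x <= \int[m]_(x in D) g x)%E.
Proof.
move=> fg.
have pos (h k : T -> \bar R) : (forall x, D x -> 0 <= h x)%E ->
    (forall x, D x -> (h x <= k x)%E) ->
    (\int[m]_(x in D) h x <= \int[m]_(x in D) k x)%E.
  move=> h0 hk; rewrite !ge0_integralE //; last first.
    by move=> x Dx; apply: le_trans (hk _ Dx); exact: h0.
  apply: le_ereal_sup => _ /= [s hs <-]; exists s => // x.
  apply: le_trans (hs x) _; rewrite /patch; case: ifP => // Dx.
  by apply: hk; rewrite inE in Dx.
rewrite integralE [leRHS]integralE leeB //; apply: pos => x Dx.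
- exact: funepos_ge0.
- by apply: (@funepos_le _ _ D) (mem_set Dx) => y /set_mem; exact: fg.
- exact: funeneg_ge0.
- by apply: (@funeneg_le _ _ D) (mem_set Dx) => y /set_mem; exact: fg.
Qed.

(** Two-sided continuity, at the endpoints as well, so that restricting or splitting the interval is
    immediate. *)
Definition ctsI (a b : R) (f : R -> R) :=
  forall x, a <= x <= b -> {for x, continuous f}.

Definition rint (a b : R) (f : R -> R) : R := (\int[mu]_(x in `[a, b]) f x)%R.

Lemma ctsI_sub a b a' b' f : ctsI a b f -> a <= a' -> b' <= b -> ctsI a' b' f.
Proof.
move=> cf aa bb x /andP[ax xb]; apply: cf.
by rewrite (le_trans aa ax) (le_trans xb bb).
Qed.

Lemma ctsI_within a b f : ctsI a b f -> {within `[a, b], continuous f}.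
Proof.
move=> cf; apply: continuous_in_subspaceT => x; rewrite inE /= in_itv /= => h.
exact: cf.
Qed.

Lemma ctsI_integrable a b f : ctsI a b f -> mu.-integrable `[a, b] (EFin \o f).
Proof.
move=> cf; apply: continuous_compact_integrable; first exact: segment_compact.
exact: ctsI_within.
Qed.

Lemma rint_EFin a b f : ctsI a b f ->
  (\int[mu]_(x in `[a, b]) (f x)%:E)%E = (rint a b f)%:E.
Proof.
move=> cf; rewrite /rint /Rintegral fineK //.
exact: integrable_fin_num (ctsI_integrable cf).
Qed.

Lemma ctsID a b f g : ctsI a b f -> ctsI a b g -> ctsI a b (fun x => f x + g x).
Proof. by move=> cf cg x h; apply: continuousD; [exact: cf|exact: cg]. Qed.
Lemma ctsIB a b f g : ctsI a b f -> ctsI a b g -> ctsI a b (fun x => f x - g x).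
Proof. by move=> cf cg x h; apply: continuousB; [exact: cf|exact: cg]. Qed.
Lemma ctsIM a b f g : ctsI a b f -> ctsI a b g -> ctsI a b (fun x => f x * g x).
Proof. by move=> cf cg x h; apply: continuousM; [exact: cf|exact: cg]. Qed.
Lemma ctsIc a b c : ctsI a b (fun=> c).
Proof. by move=> x h; exact: cst_continuous. Qed.
Lemma ctsI_sum a b (I : Type) (s : seq I) (P : pred I) (F : I -> R -> R) :
  (forall i, ctsI a b (F i)) -> ctsI a b (fun x => \sum_(i <- s | P i) F i x).
Proof.
move=> cF; elim: s => [|i s IH].
  by under [fun x => _]funext do rewrite big_nil; exact: ctsIc.
case Pi : (P i); under [fun x => _]funext do rewrite big_cons Pi.
  exact: ctsID.
exact: IH.
Qed.

Lemma rintD a b f g : ctsI a b f -> ctsI a b g ->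
  rint a b (fun x => f x + g x) = rint a b f + rint a b g.
Proof. by move=> cf cg; apply: RintegralD => //; exact: ctsI_integrable. Qed.
Lemma rintB a b f g : ctsI a b f -> ctsI a b g ->
  rint a b (fun x => f x - g x) = rint a b f - rint a b g.
Proof. by move=> cf cg; apply: RintegralB => //; exact: ctsI_integrable. Qed.
Lemma rintZ a b c f : ctsI a b f ->
  rint a b (fun x => c * f x) = c * rint a b f.
Proof. by move=> cf; apply: RintegralZl => //; exact: ctsI_integrable. Qed.
Lemma rintc a b c : a <= b -> rint a b (fun=> c) = c * (b - a).
Proof.
move=> ab; rewrite /rint Rintegral_cst //= lebesgue_measure_itv /= lte_fin.
have [//|ba] := ltP a b.
by rewrite (_ : b = a) ?subrr ?mulr0 //; apply/le_anti; rewrite ab ba.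
Qed.
Lemma le_rint a b f g : ctsI a b f -> ctsI a b g ->
  (forall x, a <= x <= b -> f x <= g x) -> rint a b f <= rint a b g.
Proof.
move=> cf cg fg; apply: le_Rintegral => //; try exact: ctsI_integrable.
Qed.
Lemma eq_rint a b f g : (forall x, a <= x <= b -> f x = g x) ->
  rint a b f = rint a b g.
Proof.
by move=> fg; apply: eq_Rintegral => x; rewrite inE /= in_itv /= => h; exact: fg.
Qed.
Lemma rint_sum a b (I : Type) (s : seq I) (P : pred I) (F : I -> R -> R) :
  (forall i, ctsI a b (F i)) -> a <= b ->
  rint a b (fun x => \sum_(i <- s | P i) F i x) = \sum_(i <- s | P i) rint a b (F i).
Proof.
move=> cF ab; elim: s => [|i s IH].
  rewrite big_nil (eq_rint (g := fun=> 0)) ?rintc ?mul0r // => x _.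
  by rewrite big_nil.
rewrite big_cons; case Pi : (P i).
  rewrite -IH -rintD //; last exact: ctsI_sum.
  by apply: eq_rint => x _; rewrite big_cons Pi.
by rewrite -IH; apply: eq_rint => x _; rewrite big_cons Pi.
Qed.
Lemma rint_norm_le a b f M : a <= b -> ctsI a b f ->
  (forall x, a <= x <= b -> `|f x| <= M) -> `|rint a b f| <= M * (b - a).
Proof.
move=> ab cf fM; rewrite ler_norml -mulNr -!rintc //.
by apply/andP; split; apply: le_rint => //; try exact: ctsIc;
  move=> x h; have := fM x h; rewrite ler_norml => /andP[].
Qed.
Lemma rint_cat a m b f : ctsI a b f -> a <= m <= b ->
  rint a b f = rint a m f + rint m b f.
Proof.
move=> cf /andP[am mb]; have ci := ctsI_integrable cf.
have ci2 := ctsI_integrable (ctsI_sub cf am (lexx b)).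
have ci3 : mu.-integrable `]m, b] (EFin \o f).
  apply: integrableS ci2 => //; exact: subset_itv_oc_cc.
apply/eqP; rewrite -subr_eq0 opprD addrA; rewrite /rint.
by rewrite Rintegral_itvB ?bnd_simp // Rintegral_itv_obnd_cbnd // subrr.
Qed.
Lemma rint_FTC a b f F : a < b -> ctsI a b f ->
  (forall x, a <= x <= b -> is_derive x 1 F (f x)) -> rint a b f = F b - F a.
Proof.
move=> ab cf dF.
have cF x : a <= x <= b -> {for x, continuous F}.
  move=> /dF [d _]; apply: differentiable_continuous; exact/derivable1_diffP.
have H : ((\int[mu]_(x in `[a, b]) (f x)%:E)%E = (F b)%:E - (F a)%:E)%E.
  apply: (@continuous_FTC2 R f F a b ab) => //.
  - exact: ctsI_within.
  - have l := ltW ab; split.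
    + move=> x; rewrite in_itv /= => /andP[ax xb]; have /dF[//] : a <= x <= b by rewrite !ltW.
    + by apply: cvg_at_right_filter; apply: cF; rewrite lexx.
    + by apply: cvg_at_left_filter; apply: cF; rewrite lexx ltW.
  - move=> x; rewrite in_itv /= => /andP[ax xb]; rewrite derive1E.
    by have [_ ->] : is_derive x 1 F (f x) by apply: dF; rewrite !ltW.
by rewrite /rint /Rintegral H.
Qed.
End Integrals.

(** * Cauchy's theorem and Taylor expansion in one variable *)

Section Cdiff.
Variable R : realType.
Local Notation C := R[i].

(** Stated with real epsilons and the real-valued modulus [cabs]. By the next two lemmas it agrees
    with [differentiable], from which the rules of calculus are imported. *)
Definition cdiff (f : C -> C) (z : C) : Prop :=
  exists A : C, forall e : R, 0 < e -> exists d : R, 0 < d /\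
   forall h : C, cabs h < d -> cabs (f (z + h) - f z - A * h) <= e * cabs h.

Lemma differentiable_cdiff (f : C -> C) (z : C) :
  differentiable (f : C^o -> C^o) (z : C^o) -> cdiff f z.
Proof.
move=> df.
have /cvg_ex[A /cvgrPdist_le HA] := @diff_derivable C C^o C^o f z 1 df.
exists A => e e0.
have e0' : 0 < (e%:C)%C :> C by rewrite ltcR.
have := HA _ e0'; rewrite near_withinE => /nbhs_ballP[d d0 H].
exists (complex.Re d).
move: d0; rewrite /= ltcE /= => /andP[/eqP d1 d2]; split=> // h hd.
have [->|h0] := eqVneq h 0.
  by rewrite addr0 subrr mulr0 subr0 cabs0 mulr0.
have bh : ball (0 : C^o) d h.
  rewrite -ball_normE /= sub0r normrN cabsE ltcE /= d1 eqxx /=.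
  exact: hd.
have := H h bh h0; rewrite cabsE lecR /= => Hh.
rewrite -cabsN opprB.
have -> : A * h - (f (z + h) - f z) = (A - h^-1 *: (f (h *: (1 : C^o) + z) - f z)) * h.
  rewrite mulrBl; congr (_ - _).
  rewrite -[_ *: (1 : C^o)]/(h * 1) mulr1 (addrC h).
  by rewrite -[_ *: _]/(h^-1 * (f (z + h) - f z)) mulrAC mulVf // mul1r.
by rewrite cabsM ler_wpM2r // cabs_ge0.
Qed.

Lemma cdiff_differentiable (f : C -> C) (z : C) : cdiff f z ->
  differentiable (f : C^o -> C^o) (z : C^o).
Proof.
move=> [A H]; apply/derivable1_diffP; apply/cvg_ex; exists A.
apply/cvgrPdist_le => e; rewrite ltcE /= => /andP[/eqP e1 e0].
have [d [d0 Hd]] := H _ e0.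
rewrite near_withinE; apply/nbhs_ballP; exists (d%:C)%C; first by rewrite /= ltcR.
move=> h; rewrite -ball_normE /= sub0r normrN cabsE ltcR => hd h0.
rewrite cabsE lecE /= e1 eqxx /=.
rewrite -(ler_pM2r (x := cabs h)) ?cabs_gt0 //; apply: le_trans (Hd _ hd).
rewrite -cabsM -cabsN le_eqVlt; apply/orP; left; apply/eqP; congr cabs.
rewrite -[_ *: (1 : C^o)]/(h * 1) mulr1 (addrC h).
rewrite -[_ *: _]/(h^-1 * (f (z + h) - f z)) mulrBl opprB.
by rewrite mulrAC mulVf // mul1r.
Qed.

Lemma cdiff_continuous (f : C -> C) (z : C) : cdiff f z ->
  forall e : R, 0 < e -> exists d : R, 0 < d /\
   forall h : C, cabs h < d -> cabs (f (z + h) - f z) <= e.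
Proof.
move=> [A HA] e e0; have [d [d0 Hd]] := HA _ ltr01.
exists (Num.min d (e / (1 + cabs A))).
have A1 : 0 < 1 + cabs A by rewrite ltr_wpDr // cabs_ge0.
split=> [|h]; first by rewrite lt_min d0 divr_gt0.
rewrite lt_min => /andP[hd he].
rewrite -(subrK (A * h) (f (z + h) - f z)) (le_trans (cabsD _ _)) //.
rewrite (le_trans (lerD (Hd _ hd) (lexx _))) // cabsM -mulrDl.
by rewrite mulrC -ler_pdivlMr // ltW.
Qed.

Lemma cdiffD f g z : cdiff f z -> cdiff g z -> cdiff (fun z => f z + g z) z.
Proof. 
move=> /cdiff_differentiable df /cdiff_differentiable dg.
exact: differentiable_cdiff (@differentiableD C C^o C^o f g z df dg). Qed.
Lemma cdiffB f g z : cdiff f z -> cdiff g z -> cdiff (fun z => f z - g z) z.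
Proof. 
move=> /cdiff_differentiable df /cdiff_differentiable dg.
exact: differentiable_cdiff (@differentiableB C C^o C^o f g z df dg). Qed.
Lemma cdiff_cst c z : cdiff (fun=> c) z.
Proof.
exists 0 => e e0; exists 1; split=> // h _.
by rewrite mul0r subr0 subrr cabs0 mulr_ge0 ?cabs_ge0 // ltW.
Qed.
Lemma cdiff_id z : cdiff id z.
Proof.
exists 1 => e e0; exists 1; split=> // h _.
by rewrite mul1r (addrC z) addrK subrr cabs0 mulr_ge0 ?cabs_ge0 // ltW.
Qed.
Lemma cdiffM f g z : cdiff f z -> cdiff g z -> cdiff (fun z => f z * g z) z.
Proof. 
move=> /cdiff_differentiable df /cdiff_differentiable dg.
exact: differentiable_cdiff (@differentiableM C C^o f g z df dg).
Qed.
Lemma cdiffX f k z : cdiff f z -> cdiff (fun z => f z ^+ k) z.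
Proof.
move=> df; elim: k => [|k IH].
  by under [fun z => _]funext do rewrite expr0; exact: cdiff_cst.
by under [fun z => _]funext do rewrite exprS; exact: cdiffM.
Qed.
Lemma cdiff_comp f g z : cdiff f z -> cdiff g (f z) -> cdiff (fun z => g (f z)) z.
Proof.
move=> /cdiff_differentiable df /cdiff_differentiable dg.
exact: differentiable_cdiff (@differentiable_comp C C^o C^o C^o f g z df dg).
Qed.

Lemma cdiff_inv (z : C) : z != 0 -> cdiff (fun x : C => x^-1) z.
Proof.
move=> z0; exists (- (z^-1 ^+ 2)) => e e0.
have a0 : 0 < cabs z by rewrite cabs_gt0.
exists (Num.min (cabs z / 2) (e * cabs z ^+ 3 / 2)).
split=> [|h]; first by rewrite lt_min !(divr_gt0, mulr_gt0, exprn_gt0).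
rewrite lt_min => /andP[h1 h2].
have zh : cabs z / 2 <= cabs (z + h).
  by have := cabs_lower z h; lra.
have zh0 : z + h != 0 by rewrite -cabs_gt0; lra.
have -> : (z + h)^-1 - z^-1 - - z^-1 ^+ 2 * h = h ^+ 2 / (z ^+ 2 * (z + h)).
  by field; rewrite zh0 z0.
rewrite cabsM cabsV cabsM !cabsX expr2 -mulrA mulrC ler_wpM2r ?cabs_ge0 //.
rewrite ler_pdivrMr ?mulr_gt0 ?exprn_gt0 ?cabs_gt0 //.
apply: le_trans (ltW h2) _.
rewrite (_ : _ / 2 = e * (cabs z ^+ 2 * (cabs z / 2))); last by ring.
by rewrite ler_pM2l // ler_pM2l ?exprn_gt0.
Qed.

Lemma cdiffV f z : cdiff f z -> f z != 0 -> cdiff (fun z => (f z)^-1) z.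
Proof. by move=> df f0; apply: (cdiff_comp df (cdiff_inv f0)). Qed.

Local Notation Rez := complex.Re.
Local Notation Imz := complex.Im.

Definition ctsC (a b : R) (F : R -> C) :=
  ctsI a b (fun t => Rez (F t)) /\ ctsI a b (fun t => Imz (F t)).

Definition cint (a b : R) (F : R -> C) : C :=
  Complex (rint a b (fun t => Rez (F t))) (rint a b (fun t => Imz (F t))).

Lemma ctsC_eps (a b : R) (F : R -> C) :
  (forall t, a <= t <= b -> forall e : R, 0 < e -> exists d : R, 0 < d /\
     forall s, `|s - t| < d -> cabs (F s - F t) <= e) -> ctsC a b F.
Proof.
move=> H; split=> t tab; apply/cvgrPdist_le => e e0;
 have [d [d0 Hd]] := H t tab e e0; apply/nbhs_ballP; exists d => // s;
 rewrite /ball /= distrC => hs;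
 (apply: le_trans (Hd _ hs); rewrite cabs_distC).
- by apply: le_trans (Re_le_cabs _); rewrite ReD ReN.
- by apply: le_trans (Im_le_cabs _); rewrite ImD ImN.
Qed.

Lemma ctsCD (a b : R) F G : ctsC a b F -> ctsC a b G -> ctsC a b (fun t => F t + G t).
Proof.
move=> [f1 f2] [g1 g2]; split.
  by under [fun t => _]funext do rewrite ReD; exact: ctsID.
by under [fun t => _]funext do rewrite ImD; exact: ctsID.
Qed.

Lemma ctsCB (a b : R) F G : ctsC a b F -> ctsC a b G -> ctsC a b (fun t => F t - G t).
Proof.
move=> [f1 f2] [g1 g2]; split.
  by under [fun t => _]funext do rewrite ReD ReN; exact: ctsIB.
by under [fun t => _]funext do rewrite ImD ImN; exact: ctsIB.
Qed.

Lemma ctsCc (a b : R) c : ctsC a b (fun=> c).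
Proof. by split; exact: ctsIc. Qed.

Lemma ctsCM (a b : R) F G : ctsC a b F -> ctsC a b G -> ctsC a b (fun t => F t * G t).
Proof.
move=> [f1 f2] [g1 g2]; split.
  by under [fun t => _]funext do rewrite ReM; apply: ctsIB; exact: ctsIM.
by under [fun t => _]funext do rewrite ImM; apply: ctsID; exact: ctsIM.
Qed.

Lemma ctsC_sum (a b : R) (I : Type) (s : seq I) (F : I -> R -> C) :
  (forall i, ctsC a b (F i)) -> ctsC a b (fun t => \sum_(i <- s) F i t).
Proof.
move=> cF; elim: s => [|i s IH].
  by under [fun x => _]funext do rewrite big_nil; exact: ctsCc.
by under [fun x => _]funext do rewrite big_cons; exact: ctsCD.
Qed.

Lemma cintD (a b : R) F G : ctsC a b F -> ctsC a b G ->
  cint a b (fun t => F t + G t) = cint a b F + cint a b G.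
Proof.
move=> [f1 f2] [g1 g2]; apply/eqP; rewrite eq_complex /=.
by rewrite -!rintD //; apply/andP; split; apply/eqP; apply: eq_rint => x _;
  rewrite ?ReD ?ImD.
Qed.

Lemma cintB (a b : R) F G : ctsC a b F -> ctsC a b G ->
  cint a b (fun t => F t - G t) = cint a b F - cint a b G.
Proof.
move=> [f1 f2] [g1 g2]; apply/eqP; rewrite eq_complex /=.
by rewrite -!rintB //; apply/andP; split; apply/eqP; apply: eq_rint => x _;
  rewrite ?ReD ?ImD ?ReN ?ImN.
Qed.

Lemma cintZ (a b : R) c F : ctsC a b F -> cint a b (fun t => c * F t) = c * cint a b F.
Proof.
move=> [f1 f2]; apply/eqP; rewrite eq_complex ReM ImM /=.
rewrite -!rintZ // -rintB; [|by apply: ctsIM => //; exact: ctsIc..].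
rewrite -rintD; [|by apply: ctsIM => //; exact: ctsIc..].
by apply/andP; split; apply/eqP; apply: eq_rint => x _; rewrite ?ReM ?ImM.
Qed.

Lemma eq_cint (a b : R) F G : (forall t, a <= t <= b -> F t = G t) ->
  cint a b F = cint a b G.
Proof.
by move=> FG; congr Complex; apply: eq_rint => x h; rewrite FG.
Qed.

Lemma cintc (a b : R) c : a <= b -> cint a b (fun=> c) = c * (Complex (b - a) 0).
Proof.
move=> ab; apply/eqP; rewrite eq_complex /= !rintc // ReM ImM /=.
by rewrite !mulr0 subr0 add0r !eqxx.
Qed.

Lemma cint_sum (a b : R) (I : Type) (s : seq I) (F : I -> R -> C) :
  (forall i, ctsC a b (F i)) -> a <= b ->
  cint a b (fun t => \sum_(i <- s) F i t) = \sum_(i <- s) cint a b (F i).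
Proof.
move=> cF ab; elim: s => [|i s IH].
  rewrite big_nil (@eq_cint _ _ _ (fun=> 0)) ?cintc ?mul0r // => x _.
  by rewrite big_nil.
rewrite big_cons -IH -cintD //; last exact: ctsC_sum.
by apply: eq_cint => x _; rewrite big_cons.
Qed.

(** The factor 2 comes from estimating real and imaginary parts separately; it propagates to the
    constants 4, 8, 16, 24 and 32 below. *)
Lemma cint_norm_le (a b : R) F M : a <= b -> ctsC a b F ->
  (forall t, a <= t <= b -> cabs (F t) <= M) ->
  cabs (cint a b F) <= 2 * M * (b - a).
Proof.
move=> ab [f1 f2] FM; apply: le_trans (cabs_le_ReIm _) _ => /=.
rewrite -mulrA mulr_natl mulr2n; apply: lerD.
  by apply: rint_norm_le => // x h; apply: le_trans (FM x h); exact: Re_le_cabs.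
by apply: rint_norm_le => // x h; apply: le_trans (FM x h); exact: Im_le_cabs.
Qed.

Lemma cint_cat (a m b : R) F : ctsC a b F -> a <= m <= b ->
  cint a b F = cint a m F + cint m b F.
Proof.
move=> [f1 f2] h; apply/eqP; rewrite eq_complex /=.
by rewrite -(rint_cat f1 h) -(rint_cat f2 h) !eqxx.
Qed.

(* [rect_int G u0 u1 t0 t1] is the counterclockwise contour integral of [G dw]
   along the boundary of the rectangle [[u0, u1] x [t0, t1]]. *)
Definition rect_int (G : C -> C) (u0 u1 t0 t1 : R) : C :=
  cint u0 u1 (fun u => G (Complex u t0)) - cint u0 u1 (fun u => G (Complex u t1))
  + Complex 0 1 * (cint t0 t1 (fun t => G (Complex u1 t))
                   - cint t0 t1 (fun t => G (Complex u0 t))).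

Definition in_rect (u0 u1 t0 t1 : R) (w : C) :=
  u0 <= Rez w <= u1 /\ t0 <= Imz w <= t1.

Lemma cdiff_ctsH G (u0 u1 t : R) : (forall u, u0 <= u <= u1 -> cdiff G (Complex u t)) ->
  ctsC u0 u1 (fun u => G (Complex u t)).
Proof.
move=> H; apply: ctsC_eps => u hu e e0.
have [d [d0 Hd]] := cdiff_continuous (H u hu) e0.
exists d; split=> // s hs; have := Hd (Complex (s - u) 0).
rewrite cabs_real => /(_ hs).
have -> // : Complex u t + Complex (s - u) 0 = Complex s t :> C.
by apply/eqP; rewrite eq_complex /= addr0 addrC subrK !eqxx.
Qed.

Lemma cabs_imag (x : R) : cabs (Complex 0 x) = `|x|.
Proof. by rewrite /cabs /cmod2 /= expr0n /= add0r sqrtr_sqr. Qed.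

Lemma cdiff_ctsV G (u t0 t1 : R) : (forall t, t0 <= t <= t1 -> cdiff G (Complex u t)) ->
  ctsC t0 t1 (fun t => G (Complex u t)).
Proof.
move=> H; apply: ctsC_eps => t ht e e0.
have [d [d0 Hd]] := cdiff_continuous (H t ht) e0.
exists d; split=> // s hs; have := Hd (Complex 0 (s - t)).
rewrite cabs_imag => /(_ hs).
have -> // : Complex u t + Complex 0 (s - t) = Complex u s :> C.
by apply/eqP; rewrite eq_complex /= addr0 addrC subrK !eqxx.
Qed.

Lemma rect_int_catH G (u0 m u1 t0 t1 : R) : u0 <= m <= u1 ->
  (forall u, u0 <= u <= u1 -> cdiff G (Complex u t0)) ->
  (forall u, u0 <= u <= u1 -> cdiff G (Complex u t1)) ->
  rect_int G u0 u1 t0 t1 = rect_int G u0 m t0 t1 + rect_int G m u1 t0 t1.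
Proof.
move=> um H0 H1; rewrite /rect_int.
rewrite (cint_cat (cdiff_ctsH H0) um) (cint_cat (cdiff_ctsH H1) um).
by ring.
Qed.

Lemma rect_int_catV G (u0 u1 t0 m t1 : R) : t0 <= m <= t1 ->
  (forall t, t0 <= t <= t1 -> cdiff G (Complex u0 t)) ->
  (forall t, t0 <= t <= t1 -> cdiff G (Complex u1 t)) ->
  rect_int G u0 u1 t0 t1 = rect_int G u0 u1 t0 m + rect_int G u0 u1 m t1.
Proof.
move=> um H0 H1; rewrite /rect_int.
rewrite (cint_cat (cdiff_ctsV H0) um) (cint_cat (cdiff_ctsV H1) um).
by ring.
Qed.

(** The function is tested on the boundary only, so that the bound also applies to a square around
    an exceptional point. *)
Lemma rect_int_le G (u0 u1 t0 t1 M : R) : u0 <= u1 -> t0 <= t1 -> 0 <= M ->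
  (forall w, in_rect u0 u1 t0 t1 w ->
     (Rez w = u0 \/ Rez w = u1 \/ Imz w = t0 \/ Imz w = t1) ->
     cdiff G w /\ cabs (G w) <= M) ->
  cabs (rect_int G u0 u1 t0 t1) <= 4 * M * (u1 - u0 + (t1 - t0)).
Proof.
move=> u01 t01 M0 H.
have b1 (t : R) : t = t0 \/ t = t1 -> cabs (cint u0 u1 (fun u => G (Complex u t))) <= 2 * M * (u1 - u0).
  move=> ht; apply: cint_norm_le => //.
    apply: cdiff_ctsH => u hu; apply: (proj1 (H _ _ _)) => //=; last tauto.
    by split=> //=; case: ht => ->; rewrite ?(lexx, t01, u01).
  move=> u hu; apply: (proj2 (H _ _ _)) => //=; last tauto.
  by split=> //=; case: ht => ->; rewrite ?(lexx, t01, u01).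
have b2 (u : R) : u = u0 \/ u = u1 -> cabs (cint t0 t1 (fun t => G (Complex u t))) <= 2 * M * (t1 - t0).
  move=> ht; apply: cint_norm_le => //.
    apply: cdiff_ctsV => t hu; apply: (proj1 (H _ _ _)) => //=; last tauto.
    by split=> //=; case: ht => ->; rewrite ?(lexx, t01, u01).
  move=> t hu; apply: (proj2 (H _ _ _)) => //=; last tauto.
  by split=> //=; case: ht => ->; rewrite ?(lexx, t01, u01).
rewrite /rect_int (le_trans (cabsD _ _)) //.
have c1 : cabs (Complex 0 1 : C) = 1 by rewrite cabs_imag normr1.
rewrite cabsM c1 mul1r (le_trans (lerD (cabsB _ _) (cabsB _ _))) //.
have := b1 t0; have := b1 t1; have := b2 u0; have := b2 u1.
move=> /(_ (or_intror erefl)) h1 /(_ (or_introl erefl)) h2.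
move=> /(_ (or_intror erefl)) h3 /(_ (or_introl erefl)) h4.
by lra.
Qed.
End Cdiff.

(** * Goursat's theorem on rectangles *)

Section Goursat.
Variable R : realType.
Local Notation C := R[i].
Local Notation Rez := complex.Re.
Local Notation Imz := complex.Im.

Lemma rint_id (a b : R) : a <= b -> rint a b id = (b ^+ 2 - a ^+ 2) / 2.
Proof.
rewrite le_eqVlt => /orP[/eqP ->|ab].
  rewrite subrr mul0r; have c : ctsI b b (id : R -> R).
    by move=> x _; exact: cvg_id.
  have := rint_norm_le (M := `|b|) (lexx b) c.
  rewrite subrr mulr0 normr_le0 => H; apply/eqP; apply: H => x /andP[h1 h2].
  by rewrite (_ : x = b) //; apply/le_anti; rewrite h1 h2.
have dF (x : R) : a <= x <= b -> is_derive x 1 (fun x : R => x ^+ 2 / 2) x.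
  move=> _; have -> : (fun x0 : R => x0 ^+ 2 / 2) = (2^-1 : R) \*: (fun x0 : R => x0 ^+ 2).
    by apply/funext => y /=; rewrite mulrC.
  have h := is_deriveZ (2^-1) (is_deriveM (is_derive_id x (1 : R)) (is_derive_id x (1 : R))).
  apply: is_derive_eq h _.
  by rewrite -[_ *: _]/(2^-1 * (x * 1 + x * 1)); field.
have ci : ctsI a b (id : R -> R) by move=> x _; exact: cvg_id.
by rewrite (rint_FTC ab ci dF) mulrBl.
Qed.

Lemma rect_int_affine (A B : C) (u0 u1 t0 t1 : R) : u0 <= u1 -> t0 <= t1 ->
  rect_int (fun w => A + B * w) u0 u1 t0 t1 = 0.
Proof.
move=> u01 t01.
have idc (a b : R) : ctsI a b id by move=> x _; exact: cvg_id.
have e1 (t : R) : cint u0 u1 (fun u => A + B * Complex u t) =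
    A * Complex (u1 - u0) 0 + B * Complex ((u1 ^+ 2 - u0 ^+ 2) / 2) (t * (u1 - u0)).
  have cc : ctsC u0 u1 (fun u => Complex u t) by split => /=; [exact: idc|exact: ctsIc].
  rewrite cintD; [|exact: ctsCc|apply: ctsCM => //; exact: ctsCc].
  rewrite cintc // cintZ //; congr (_ + _ * _).
  by congr Complex => /=; rewrite ?rintc // -rint_id.
have e2 (u : R) : cint t0 t1 (fun t => A + B * Complex u t) =
    A * Complex (t1 - t0) 0 + B * Complex (u * (t1 - t0)) ((t1 ^+ 2 - t0 ^+ 2) / 2).
  have cc : ctsC t0 t1 (fun t => Complex u t) by split => /=; [exact: ctsIc|exact: idc].
  rewrite cintD; [|exact: ctsCc|apply: ctsCM => //; exact: ctsCc].
  rewrite cintc // cintZ //; congr (_ + _ * _).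
  by congr Complex => /=; rewrite ?rintc // -rint_id.
rewrite /rect_int !e1 !e2.
case: A {e1 e2} => a1 a2; case: B => b1 b2.
by apply/eqP; rewrite eq_complex /=; apply/andP; split; apply/eqP; field.
Qed.

Lemma rect_intB G H (u0 u1 t0 t1 : R) :
  (forall w, in_rect u0 u1 t0 t1 w -> cdiff G w) ->
  (forall w, in_rect u0 u1 t0 t1 w -> cdiff H w) -> u0 <= u1 -> t0 <= t1 ->
  rect_int (fun w => G w - H w) u0 u1 t0 t1 =
  rect_int G u0 u1 t0 t1 - rect_int H u0 u1 t0 t1.
Proof.
move=> dG dH u01 t01; rewrite /rect_int.
have h (F : C -> C) (t : R) : (forall w, in_rect u0 u1 t0 t1 w -> cdiff F w) ->
    t0 <= t <= t1 -> ctsC u0 u1 (fun u => F (Complex u t)).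
  by move=> dF ht; apply: cdiff_ctsH => u hu; apply: dF.
have v (F : C -> C) (u : R) : (forall w, in_rect u0 u1 t0 t1 w -> cdiff F w) ->
    u0 <= u <= u1 -> ctsC t0 t1 (fun t => F (Complex u t)).
  by move=> dF ht; apply: cdiff_ctsV => t hu; apply: dF.
have l0 (a b : R) : a <= b -> a <= a <= b by move=> ->; rewrite lexx.
have l1 (a b : R) : a <= b -> a <= b <= b by move=> ->; rewrite lexx.
rewrite !cintB; try (by apply: h => //; auto); try (by apply: v => //; auto).
by ring.
Qed.

Lemma dist_itv (a b x y : R) : a <= x <= b -> a <= y <= b -> `|x - y| <= b - a.
Proof. by move=> /andP[? ?] /andP[? ?]; rewrite ler_norml; lra. Qed.

(** Subtracting the first-order expansion at [p], whose contour integral is zero, leaves an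
    integrand bounded by [k / 4] times the semiperimeter. *)
Lemma rect_int_local G (p : C) (k : R) : 0 < k -> cdiff G p ->
  exists d : R, 0 < d /\ forall u0 u1 t0 t1 : R, in_rect u0 u1 t0 t1 p ->
   (forall w, in_rect u0 u1 t0 t1 w -> cdiff G w) ->
   u1 - u0 + (t1 - t0) < d ->
   cabs (rect_int G u0 u1 t0 t1) <= k * (u1 - u0 + (t1 - t0)) ^+ 2.
Proof.
move=> k0 [A HA]; have [d [d0 Hd]] := HA _ (divr_gt0 k0 (ltr0Sn _ 3)).
exists d; split=> // u0 u1 t0 t1 [pu pt] dG small.
have u01 : u0 <= u1 by case/andP: pu => a; apply: le_trans.
have t01 : t0 <= t1 by case/andP: pt => a; apply: le_trans.
have dL w : cdiff (fun w => (G p - A * p) + A * w) w.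
  by apply: cdiffD; [exact: cdiff_cst|apply: cdiffM; [exact: cdiff_cst|exact: cdiff_id]].
have -> : rect_int G u0 u1 t0 t1 =
    rect_int (fun w => G w - ((G p - A * p) + A * w)) u0 u1 t0 t1.
  by rewrite rect_intB // rect_int_affine // subr0.
rewrite expr2 mulrA [X in X * (_ - _ + _)](_ : _ = 4 * (k / 4 * (u1 - u0 + (t1 - t0)))); last by field.
have s0 : 0 <= u1 - u0 + (t1 - t0) by rewrite addr_ge0 // subr_ge0.
apply: rect_int_le => //; first by rewrite !mulr_ge0 // ?ltW.
move=> w [wu wt] _; split; first by apply: cdiffB; [exact: dG|exact: dL].
have wp : cabs (w - p) <= u1 - u0 + (t1 - t0).
  apply: le_trans (cabs_le_ReIm _) _; rewrite ReD ImD ReN ImN.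
  by apply: lerD; exact: dist_itv.
have -> : G w - (G p - A * p + A * w) = G (p + (w - p)) - G p - A * (w - p).
  by rewrite (addrC p) subrK; ring.
apply: le_trans (Hd _ (le_lt_trans wp small)) _.
by rewrite ler_wpM2l // ltW // divr_gt0.
Qed.

Lemma geom_small (a d : R) : 0 < d -> exists n, a / 2 ^+ n < d.
Proof.
move=> d0; exists (Num.bound (`|a| / d)).
rewrite ltr_pdivrMr ?exprn_gt0 // mulrC -ltr_pdivrMr //.
apply: le_lt_trans (_ : `|a| / d < _).
  by rewrite ler_pM2r ?invr_gt0 // ler_norm.
have /archi_boundP h : 0 <= `|a| / d by rewrite divr_ge0 // ltW.
by apply: lt_trans h _; rewrite -natrX ltr_nat ltn_expl.
Qed.

Lemma nested_intervals (a b : nat -> R) : (forall k, a k <= b k) ->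
  (forall k, a k <= a k.+1) -> (forall k, b k.+1 <= b k) ->
  exists p, forall k, a k <= p <= b k.
Proof.
move=> ab am bm.
have A i j : (i <= j)%N -> a i <= a j.
  by move/subnK <-; elim: (j - i)%N => // n IH; rewrite addSn (le_trans IH).
have B i j : (i <= j)%N -> b j <= b i.
  by move/subnK <-; elim: (j - i)%N => // n IH; rewrite addSn (le_trans (bm _)).
have AB i j : a i <= b j.
  case: (leqP i j) => h; first exact: le_trans (A _ _ h) (ab j).
  exact: le_trans (ab i) (B _ _ (ltnW h)).
have ub j : ubound (range a) (b j) by move=> _ [i _ <-].
have hs : has_sup (range a) by split; [exists (a 0%N); exists 0%N|exists (b 0%N)].
exists (sup (range a)) => k; apply/andP; split.
  by apply: ub_le_sup; [exact: (proj2 hs)|exists k].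
by apply: ge_sup; [exact: (proj1 hs)|exact: ub].
Qed.

(* Goursat: quadrisection keeps one quarter whose integral exceeds [k] times the
   square of its semiperimeter, contradicting [rect_int_local] at the limit. *)
Lemma goursat G (u0 u1 t0 t1 : R) : u0 <= u1 -> t0 <= t1 ->
  (forall w, in_rect u0 u1 t0 t1 w -> cdiff G w) -> rect_int G u0 u1 t0 t1 = 0.
Proof.
move=> u01 t01 dG; apply/eqP; rewrite -cabs_eq0 eq_le cabs_ge0 andbT.
apply/ler_addgt0Pr => k' k'0; rewrite add0r.
pose per (x : R * R * (R * R)) := x.1.2 - x.1.1 + (x.2.2 - x.2.1).
pose I (x : R * R * (R * R)) := cabs (rect_int G x.1.1 x.1.2 x.2.1 x.2.2).
pose ok (x : R * R * (R * R)) := [/\ x.1.1 <= x.1.2, x.2.1 <= x.2.2 &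
   forall w, in_rect x.1.1 x.1.2 x.2.1 x.2.2 w -> in_rect u0 u1 t0 t1 w].
have P0 : 0 <= u1 - u0 + (t1 - t0) by rewrite addr_ge0 // subr_ge0.
have [PP|PP] := eqVneq (u1 - u0 + (t1 - t0)) 0.
  have e1 : u1 = u0 by lra.
  have e2 : t1 = t0 by lra.
  by rewrite /rect_int e1 e2 !subrr mulr0 addr0 cabs0 ltW.
have Ppos : 0 < u1 - u0 + (t1 - t0) by rewrite lt_def PP P0.
(* With this normalisation [k * per ^+ 2] equals [k'] on the initial rectangle, the value assumed to
   be exceeded. *)
pose k := k' / (u1 - u0 + (t1 - t0)) ^+ 2.
have k0 : 0 < k by rewrite divr_gt0 // exprn_gt0.
rewrite leNgt; apply/negP => big.
have step x : ok x /\ k * per x ^+ 2 < I x -> exists y,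
   (ok y /\ k * per y ^+ 2 < I y) /\ [/\ per y = per x / 2, x.1.1 <= y.1.1,
     y.1.2 <= x.1.2, x.2.1 <= y.2.1 & y.2.2 <= x.2.2].
  case: x => -[a b] [c d]; rewrite /ok /per /I /= => -[[ab cd sub] lt].
  pose m := (a + b) / 2; pose n := (c + d) / 2.
  have am : a <= m by rewrite /m; lra.
  have mb : m <= b by rewrite /m; lra.
  have cn : c <= n by rewrite /n; lra.
  have nd : n <= d by rewrite /n; lra.
  have dG' w : in_rect a b c d w -> cdiff G w by move=> /sub /dG.
  have eq : rect_int G a b c d = rect_int G a m c n + rect_int G a m n d +
      (rect_int G m b c n + rect_int G m b n d).
    rewrite -(rect_int_catV (m := n)) ?cn //; last 2 first.
      by move=> t ht; apply: dG'; split=> //=; rewrite lexx.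
      by move=> t ht; apply: dG'; split=> //=; rewrite am mb.
    rewrite -(rect_int_catV (m := n)) ?cn //; last 2 first.
      by move=> t ht; apply: dG'; split=> //=; rewrite am mb.
      by move=> t ht; apply: dG'; split=> //=; rewrite ab lexx.
    apply: rect_int_catH; first by rewrite am mb.
      by move=> t ht; apply: dG'; split=> //=; rewrite lexx.
    by move=> t ht; apply: dG'; split=> //=; rewrite cd lexx.
  apply: contrapT => no.
  have sm (a' b' c' d' : R) : a <= a' -> a' <= b' -> b' <= b -> c <= c' -> c' <= d' -> d' <= d ->
     b' - a' + (d' - c') = (b - a + (d - c)) / 2 ->
     cabs (rect_int G a' b' c' d') <= k * ((b - a + (d - c)) / 2) ^+ 2.
    move=> h1 h2 h3 h4 h5 h6 e; rewrite leNgt; apply/negP => h7; apply: no.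
    exists ((a', b'), (c', d')) => /=; rewrite e; split=> //; split=> //; split=> //.
    move=> w [/andP[w1 w2] /andP[w3 w4]]; apply: sub; split.
      by rewrite (le_trans h1 w1) (le_trans w2 h3).
    by rewrite (le_trans h4 w3) (le_trans w4 h6).
  move: lt; apply/negP; rewrite -leNgt eq.
  rewrite (le_trans (cabsD _ _)) // (le_trans (lerD (cabsD _ _) (cabsD _ _))) //.
  have s1 := sm a m c n (lexx _) am mb (lexx _) cn nd ltac:(rewrite /m /n; lra).
  have s2 := sm a m n d (lexx _) am mb cn nd (lexx _) ltac:(rewrite /m /n; lra).
  have s3 := sm m b c n am mb (lexx _) (lexx _) cn nd ltac:(rewrite /m /n; lra).
  have s4 := sm m b n d am mb (lexx _) cn nd (lexx _) ltac:(rewrite /m /n; lra).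
  rewrite (le_trans (lerD (lerD s1 s2) (lerD s3 s4))) // le_eqVlt; apply/orP; left.
  by apply/eqP; field.
pose T := {x | ok x /\ k * per x ^+ 2 < I x}.
pose nxt (x : T) : T := let y := cid (step _ (svalP x)) in exist _ (sval y) (proj1 (svalP y)).
have x0P : ok ((u0, u1), (t0, t1)) /\ k * per ((u0, u1), (t0, t1)) ^+ 2 < I ((u0, u1), (t0, t1)).
  split; first by split.
  by rewrite /I /per /= /k divfK ?expf_neq0.
pose s n : R * R * (R * R) := sval (iter n nxt (exist _ _ x0P)).
have sS n : [/\ per (s n.+1) = per (s n) / 2, (s n).1.1 <= (s n.+1).1.1,
    (s n.+1).1.2 <= (s n).1.2, (s n).2.1 <= (s n.+1).2.1 & (s n.+1).2.2 <= (s n).2.2].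
  rewrite /s iterS; set x := iter n nxt _.
  exact: (proj2 (svalP (cid (step _ (svalP x))))).
have sok n : ok (s n) := proj1 (svalP (iter n nxt (exist _ _ x0P))).
have sbig n : k * per (s n) ^+ 2 < I (s n) := proj2 (svalP (iter n nxt (exist _ _ x0P))).
have [pu Hpu] : exists p, forall n, (s n).1.1 <= p <= (s n).1.2.
  by apply: nested_intervals => n; [case: (sok n)|case: (sS n)|case: (sS n)].
have [pt Hpt] : exists p, forall n, (s n).2.1 <= p <= (s n).2.2.
  by apply: nested_intervals => n; [case: (sok n)|case: (sS n)|case: (sS n)].
have dp : cdiff G (Complex pu pt).
  by apply: dG; split; [exact: (Hpu 0%N)|exact: (Hpt 0%N)].
have [d [d0 Hd]] := rect_int_local k0 dp.
have pn n : per (s n) = (u1 - u0 + (t1 - t0)) / 2 ^+ n.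
  elim: n => [|n IH]; first by rewrite expr0 divr1.
  by case: (sS n) => -> _ _ _ _; rewrite IH exprSr invfM mulrA.
have [n Hn] : exists n, per (s n) < d.
  have [n Hn] := geom_small (u1 - u0 + (t1 - t0)) d0.
  by exists n; rewrite pn.
have := sbig n; apply/negP; rewrite -leNgt.
apply: (Hd _ _ _ _ _ _ Hn); first by split.
by case: (sok n) => _ _ h w /h /dG.
Qed.


(** Cut out a square of half side [h] about [p]. The four surrounding rectangles have zero integral,
    and boundedness near [p] makes the square contribute at most 16 |B| h, which is arbitrarily
    small. *)
Lemma goursat_except G (u0 u1 t0 t1 : R) (p : C) (B d : R) :
  u0 < Rez p < u1 -> t0 < Imz p < t1 -> 0 < d ->
  (forall w, in_rect u0 u1 t0 t1 w -> w != p -> cdiff G w) ->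
  (forall w, cabs (w - p) < d -> w != p -> cabs (G w) <= B) ->
  rect_int G u0 u1 t0 t1 = 0.
Proof.
case: p => a b /= /andP[ua au] /andP[tb bt] d0 dG GB.
have dG' x y : u0 <= x <= u1 -> t0 <= y <= t1 -> x != a \/ y != b -> cdiff G (Complex x y).
  move=> hx hy ne; apply: dG; first by split.
  by rewrite eq_complex /=; case: ne => /negbTE ->; rewrite ?andbF.
have B0 : 0 <= `|B| by [].
apply/eqP; rewrite -cabs_eq0 eq_le cabs_ge0 andbT.
apply/ler_addgt0Pr => k k0; rewrite add0r.
have c0 : 0 < 1 + 16 * `|B| by lra.
pose h := Num.min (Num.min ((a - u0) / 2) ((u1 - a) / 2))
  (Num.min (Num.min ((b - t0) / 2) ((t1 - b) / 2)) (Num.min (d / 5) (k / (1 + 16 * `|B|)))).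
have [h0 h1 h2 h3 [h4 h5 h6]] : [/\ 0 < h, h <= (a - u0) / 2, h <= (u1 - a) / 2, h <= (b - t0) / 2 &
    [/\ h <= (t1 - b) / 2, h <= d / 5 & h <= k / (1 + 16 * `|B|)]].
  rewrite /h !ge_min !lexx ?orbT; split=> //.
  by rewrite !lt_min !divr_gt0 // subr_gt0.
clearbody h.
have -> : rect_int G u0 u1 t0 t1 = rect_int G u0 (a - h) t0 t1 + rect_int G (a - h) u1 t0 t1.
  by apply: rect_int_catH => [|x hx|x hx]; [lra|apply: dG' => //; try lra; right; apply/eqP; lra..].
have -> : rect_int G (a - h) u1 t0 t1 = rect_int G (a - h) (a + h) t0 t1 + rect_int G (a + h) u1 t0 t1.
  by apply: rect_int_catH => [|x hx|x hx]; [lra|apply: dG' => //; try lra; right; apply/eqP; lra..].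
have -> : rect_int G (a - h) (a + h) t0 t1 = rect_int G (a - h) (a + h) t0 (b - h)
    + rect_int G (a - h) (a + h) (b - h) t1.
  by apply: rect_int_catV => [|x hx|x hx]; [lra|apply: dG' => //; try lra; left; apply/eqP; lra..].
have -> : rect_int G (a - h) (a + h) (b - h) t1 = rect_int G (a - h) (a + h) (b - h) (b + h)
    + rect_int G (a - h) (a + h) (b + h) t1.
  by apply: rect_int_catV => [|x hx|x hx]; [lra|apply: dG' => //; try lra; left; apply/eqP; lra..].
have -> : rect_int G u0 (a - h) t0 t1 = 0.
  by apply: goursat; [lra|lra|move=> [x y] /= [/= hx hy]; apply: dG' => //; try lra].
have -> : rect_int G (a + h) u1 t0 t1 = 0.
  by apply: goursat; [lra|lra|move=> [x y] /= [/= hx hy]; apply: dG' => //; try lra].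
have -> : rect_int G (a - h) (a + h) t0 (b - h) = 0.
  by apply: goursat; [lra|lra|move=> [x y] /= [/= hx hy]; apply: dG' => //; try lra].
have -> : rect_int G (a - h) (a + h) (b + h) t1 = 0.
  by apply: goursat; [lra|lra|move=> [x y] /= [/= hx hy]; apply: dG' => //; try lra].
rewrite !addr0 !add0r.
apply: le_trans (rect_int_le (M := `|B|) _ _ _ _) _ => //; try lra.
  move=> [x y] [/= hx hy] bd.
  have ne : x != a \/ y != b.
    case: (eqVneq x a) => [xa|]; last by left.
    by right; apply/eqP; case: bd => [|[|[]]]; lra.
  split; first by apply: dG' => //; lra.
  apply: le_trans (ler_norm _); apply: GB.
    apply: le_lt_trans (cabs_le_ReIm _) _ => /=.
    have := dist_itv (x := x) (y := a) hx; have := dist_itv (x := y) (y := b) hy.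
    by move=> /(_ ltac:(lra)) ? /(_ ltac:(lra)) ?; lra.
  by rewrite eq_complex /=; case: ne => /negbTE ->; rewrite ?andbF.
rewrite ler_pdivlMr // in h6.
rewrite (_ : 4 * _ * _ = 16 * `|B| * h); last by ring.
by apply: le_trans h6; rewrite mulrC ler_wpM2l ?ltW //; lra.
Qed.

End Goursat.

(** * The Cauchy integral through the exponential *)

Section Cauchy.
Variable R : realType.
Local Notation C := R[i].
Local Notation Rez := complex.Re.
Local Notation Imz := complex.Im.
Lemma is_derive_eps (f : R -> R) (x df : R) : is_derive x 1 f df ->
  forall e : R, 0 < e -> exists d : R, 0 < d /\
  forall h : R, `|h| < d -> `|f (x + h) - f x - df * h| <= e * `|h|.
Proof.
move=> [dx Ddf] e e0.
have : (h^-1 *: ((f \o shift x) (h *: 1) - f x) @[h --> 0^'] --> df).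
  by rewrite -Ddf; exact: dx.
move=> /cvgrPdist_le /(_ _ e0); rewrite near_withinE => /nbhs_ballP[d d0 H].
exists d; split=> // h hd; have [->|h0] := eqVneq h 0.
  by rewrite addr0 subrr mulr0 subr0 normr0 mulr0.
have := H h; rewrite /ball /= sub0r normrN => /(_ hd h0).
rewrite -[_ *: 1]/(h * 1) mulr1 (addrC h) -[_ *: _]/(h^-1 * (f (x + h) - f x)) => Hh.
have -> : f (x + h) - f x - df * h = - (df - h^-1 * (f (x + h) - f x)) * h.
  by rewrite opprB mulrBl mulrAC mulVf // mul1r.
by rewrite normrM normrN ler_wpM2r.
Qed.

Definition cxp (w : C) : C := Complex (expR (Rez w)) 0 * expi (Imz w).

Lemma cxpD w v : cxp (w + v) = cxp w * cxp v.
Proof.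
rewrite /cxp ReD ImD expRD expiD -[Complex (_ * _) 0]/(((_ * _)%R)%:C)%C rmorphM /=.
by rewrite mulrACA.
Qed.

Lemma cabs_cxp w : cabs (cxp w) = expR (Rez w).
Proof. by rewrite cabsM cabs_expi mulr1 cabs_real ger0_norm // expR_ge0. Qed.

Lemma cxp_neq0 w : cxp w != 0.
Proof. by rewrite -cabs_gt0 cabs_cxp expR_gt0. Qed.

Lemma cdiff_cxp w : cdiff cxp w.
Proof.
exists (cxp w) => e e0; set m := expR (Rez w).
have m0 : 0 < m by exact: expR_gt0.
(* In the expansion of [cxp h - 1 - h] the real part will cost 3k|h| and the imaginary part 5k|h|,
   hence the 8; [m] is the modulus of [cxp w]. *)
pose k := Num.min 1 (e / (8 * m)).
have k0 : 0 < k by rewrite lt_min ltr01 divr_gt0 // mulr_gt0.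
have k1 : k <= 1 by rewrite ge_min lexx.
have ke : m * (8 * k) <= e.
  have : k <= e / (8 * m) by rewrite ge_min lexx orbT.
  by rewrite ler_pdivlMr ?mulr_gt0 //; lra.
clearbody k.
have [d1 [d10 H1]] := is_derive_eps (is_derive_expR 0) k0.
have [d2 [d20 H2]] := is_derive_eps (is_derive_cos 0) k0.
have [d3 [d30 H3]] := is_derive_eps (is_derive_sin 0) k0.
exists (Num.min (Num.min d1 d2) (Num.min (Num.min d3 1) k)).
split=> [|h]; first by rewrite !lt_min d10 d20 d30 k0 ltr01.
rewrite !lt_min => /andP[/andP[h1 h2]] /andP[/andP[h3 h4] h5].
have -> : cxp (w + h) - cxp w - cxp w * h = cxp w * (cxp h - 1 - h).
  by rewrite cxpD; ring.
rewrite cabsM cabs_cxp -/m.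
suff H : cabs (cxp h - 1 - h) <= 8 * k * cabs h.
  apply: le_trans (_ : m * (8 * k) * cabs h <= _).
    by rewrite -[m * _ * _]mulrA ler_pM2l.
  by rewrite ler_wpM2r ?cabs_ge0.
move: (Re_le_cabs h) (Im_le_cabs h) (cabs_ge0 h) h1 h2 h3 h4 h5.
case: h => a b; set q := cabs _; clearbody q => /= aq bq q0 h1 h2 h3 h4 h5.
have := H1 a (le_lt_trans aq h1); have := H2 b (le_lt_trans bq h2); have := H3 b (le_lt_trans bq h3).
rewrite !add0r cos0 sin0 expR0 oppr0 mul0r !mul1r !subr0 => I3 I2 I1.
have c1 : `|cos b| <= 1 by rewrite ler_norml cos_geN1 cos_le1.
clear H1 H2 H3 h1 h2 h3 d1 d10 d2 d20 d3 d30 ke e0 m0 m.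
apply: le_trans (cabs_le_ReIm _) _; rewrite /cxp !(ReD, ImD, ReN, ImN, ReM, ImM) /=.
rewrite !mul0r !addr0 !subr0.
set E := expR a in I1 *; set c := cos b in I2 c1 *; set s := sin b in I3 *.
have kq (x : R) : `|x| <= q -> k * `|x| <= k * q by move=> ?; rewrite ler_pM2l.
have {}I1 := le_trans I1 (kq _ aq); have {}I2 := le_trans I2 (kq _ bq).
have {}I3 := le_trans I3 (kq _ bq); rewrite ?addr0 in I3.
have qk : k * q <= q by rewrite ler_piMl.
have E1 : `|E - 1| <= 2 * q.
  rewrite (_ : E - 1 = (E - 1 - a) + a); last by ring.
  by apply: le_trans (ler_normD _ _) _; lra.
have s1 : `|s| <= 2 * q.
  rewrite (_ : s = (s - b) + b); last by ring.
  by apply: le_trans (ler_normD _ _) _; lra.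
have R1 : `|E * c - 1 - a| <= 3 * (k * q).
  rewrite (_ : E * c - 1 - a = (E - 1 - a) * c + (1 + a) * (c - 1)); last by ring.
  apply: le_trans (ler_normD _ _) _; rewrite !normrM.
  have -> : 3 * (k * q) = k * q * 1 + 2 * (k * q) by ring.
  apply: lerD; first exact: ler_pM.
  by apply: ler_pM => //; apply: le_trans (ler_normD _ _) _; rewrite normr1; lra.
have R2 : `|E * s - b| <= 5 * (k * q).
  rewrite (_ : E * s - b = (E - 1) * s + (s - b)); last by ring.
  apply: le_trans (ler_normD _ _) _; rewrite !normrM.
  have -> : 5 * (k * q) = (2 * k) * (2 * q) + k * q by ring.
  apply: lerD => //; apply: ler_pM => //; lra.
rewrite (_ : 8 * k * q = 3 * (k * q) + 5 * (k * q)); last by ring.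
by apply: lerD.
Qed.

Lemma cos_eq1 (x : R) : `|x| < 2 * pi -> cos x = 1 -> x = 0.
Proof.
have key (y : R) : 0 < y < 2 * pi -> cos y <> 1.
  move=> /andP[y0 y2] cy; have : sin (y / 2) ^+ 2 = 0.
    have := cosD (y / 2) (y / 2); rewrite -splitr cy => h.
    have := cos2Dsin2 (y / 2); move: h; rewrite -!expr2; lra.
  move=> /eqP; rewrite sqrf_eq0 gt_eqF // sin_gt0_pi //.
  by apply/andP; split; lra.
rewrite ltr_norml => /andP[h1 h2] cx.
case: (ltrgtP x 0) => // h; exfalso.
  by apply: (key (- x)); [lra|rewrite cosN].
by apply: (key x); [lra|].
Qed.

Lemma expi_inj (s t : R) : `|s - t| < 2 * pi -> expi s = expi t :> C -> s = t.
Proof.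
move=> st e; apply/eqP; rewrite -subr_eq0; apply/eqP; apply: cos_eq1 => //.
have : expi (s - t) = 1 :> C.
  by rewrite expiD e -expiD subrr expi0.
by move=> /(congr1 (fun z => Rez z)).
Qed.

Lemma cxp_inj (w v : C) : `|Imz w - Imz v| < 2 * pi -> cxp w = cxp v -> w = v.
Proof.
case: w => a b; case: v => c d /= bd e.
have ac : a = c.
  by apply: expR_inj; have := congr1 (fun z => cabs z) e; rewrite !cabs_cxp.
move: e; rewrite /cxp /= ac => /mulfI => /(_ _)/expi_inj -> //.
by rewrite eq_complex /= gt_eqF // expR_gt0.
Qed.

Lemma polar_slit (z : C) : (Imz z != 0) || (0 < Rez z) ->
  exists t : R, - pi < t < pi /\ z = Complex (cabs z) 0 * expi t.
Proof.
move=> good; have [t [/andP[t1 t2] e]] := polarP z; exists t; split=> //.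
have no : cos t = -1 -> sin t = 0 -> False.
  move=> ct st; move: good; rewrite e /expi ct st /= !mul0r !mulr0 addr0 eqxx /=.
  by rewrite subr0 mulrN1 oppr_gt0 ltNge cabs_ge0.
rewrite !lt_neqAle t1 t2 !andbT; apply/andP; split; apply/eqP => tp; apply: no.
- by rewrite -tp cosN cospi.
- by rewrite -tp sinN sinpi oppr0.
- by rewrite tp cospi.
- by rewrite tp sinpi.
Qed.

Lemma cxp_ln (r t : R) : 0 < r -> cxp (Complex (ln r) t) = Complex r 0 * expi t.
Proof. by move=> r0; rewrite /cxp /= lnK. Qed.

Lemma cxp_period (u : R) : cxp (Complex u pi) = cxp (Complex u (- pi)).
Proof. by rewrite /cxp /= /expi cosN sinN sinpi oppr0. Qed.

(** In the coordinate log zeta the circle of radius [r] becomes the side Re = ln r of a rectangle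
    |Im| <= pi, whose horizontal sides cancel by periodicity and whose left side contributes little
    when it is far away. The slit keeps log z off the horizontal sides; near log z the integrand is
    bounded because of the difference f zeta - f z, so [goursat_except] applies. The integrand is
    the difference quotient at [z] times zeta. *)
Lemma cauchy_slit (f : C -> C) (z : C) (r rb M : R) :
  (forall w, cabs w < rb -> cdiff f w) -> (forall w, cabs w < rb -> cabs (f w) <= M) ->
  0 < r < rb -> cabs z < r -> (Imz z != 0) || (0 < Rez z) ->
  cint (- pi) pi (fun t => (f (Complex r 0 * expi t) - f z)
                     * (1 - z / (Complex r 0 * expi t))^-1) = 0.
Proof.
move=> df fM /andP[r0 rrb] zr good.
have [th [thp ez]] := polar_slit good.
have z0 : z != 0.
  apply/eqP => z0; move: good; rewrite z0 /= eqxx ltxx //.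
have a0 : 0 < cabs z by rewrite cabs_gt0.
pose p : C := Complex (ln (cabs z)) th.
have cp : cxp p = z by rewrite cxp_ln // -ez.
pose G (w : C) := (f (cxp w) - f z) * (1 - z / cxp w)^-1.
have pipos : 0 < pi :> R := pi_gt0 R.
have ne w : - pi <= Imz w <= pi -> w != p -> 1 - z / cxp w != 0.
  move=> hw; apply: contra => /eqP e; apply/eqP.
  have e2 : cxp w = cxp p.
    rewrite cp -[LHS]mul1r -(subrK (z / cxp w) 1) e add0r divfK //; exact: cxp_neq0.
  apply: cxp_inj e2; move: hw thp => /= ? ?; rewrite ltr_norml; lra.
have dG u0 w : in_rect u0 (ln r) (- pi) pi w -> w != p -> cdiff G w.
  move=> [/andP[hu1 hu2] ht] wp.
  have cw : cabs (cxp w) < rb.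
    rewrite cabs_cxp; apply: le_lt_trans rrb.
    by rewrite -[leRHS](lnK (x := r)) // ler_expR.
  apply: cdiffM.
    apply: cdiffB; last exact: cdiff_cst.
    apply: cdiff_comp; [exact: cdiff_cxp|exact: df].
  apply: cdiffV; last exact: ne.
  apply: cdiffB; first exact: cdiff_cst.
  apply: cdiffM; first exact: cdiff_cst.
  by apply: cdiffV; [exact: cdiff_cxp|exact: cxp_neq0].
have [A HA] := df z (lt_trans zr rrb); have [d [d0 Hd]] := HA _ ltr01.
pose B := (1 + cabs A) * (cabs z + d).
have [d' [d'0 Hd']] := cdiff_continuous (cdiff_cxp p) (divr_gt0 d0 (ltr0Sn _ 1)).
have GB w : cabs (w - p) < d' -> w != p -> cabs (G w) <= B.
  move=> wp wne; have := Hd' _ wp; rewrite (addrC p) subrK cp.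
  set v := cxp w => hv.
  have v0 : v != 0 := cxp_neq0 w.
  have hvd : cabs (v - z) < d by lra.
  have A0 := cabs_ge0 A.
  have fv : cabs (f v - f z) <= (1 + cabs A) * cabs (v - z).
    have := Hd _ hvd; rewrite (addrC z) subrK => h.
    rewrite -(subrK (A * (v - z)) (f v - f z)) (le_trans (cabsD _ _)) // mulrDl.
    by rewrite lerD // cabsM.
  have hB : 0 <= B by rewrite mulr_ge0 //; lra.
  have [vz|vz] := eqVneq (v - z) 0.
    move: fv; rewrite vz cabs0 mulr0 => h; rewrite /G -/v cabsM.
    have -> : cabs (f v - f z) = 0 by apply/le_anti; rewrite h cabs_ge0.
    by rewrite mul0r.
  have -> : G w = (f v - f z) * v / (v - z).
    rewrite /G -/v -mulrA; congr (_ * _).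
    by field; rewrite v0 vz.
  clearbody v; rewrite !cabsM cabsV ler_pdivrMr ?cabs_gt0 //.
  have cv : cabs v <= cabs z + d.
    by rewrite -(subrK z v) addrC (le_trans (cabsD _ _)) // lerD2l ltW.
  rewrite (_ : B * _ = (1 + cabs A) * cabs (v - z) * (cabs z + d)); last by rewrite /B; ring.
  by rewrite ler_pM ?cabs_ge0.
(* The integrals over two vertical sides agree: the rectangle has zero contour integral and its
   horizontal sides cancel. *)
have cst u0 : u0 < ln (cabs z) ->
    cint (- pi) pi (fun t => G (Complex (ln r) t)) = cint (- pi) pi (fun t => G (Complex u0 t)).
  move=> hu.
  have lzr : ln (cabs z) < ln r by rewrite ltr_ln ?posrE.
  have : rect_int G u0 (ln r) (- pi) pi = 0.
    by apply: (goursat_except (p := p) (B := B) (d := d')) => //=; [rewrite hu lzr|exact: dG].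
  rewrite /rect_int (@eq_cint _ u0 _ (fun u => G (Complex u pi)) (fun u => G (Complex u (- pi)))).
    have i0 : (Complex 0 1 : C) != 0 by rewrite -cabs_eq0 cabs_imag normr1 oner_eq0.
    by rewrite subrr add0r => /eqP; rewrite mulf_eq0 (negbTE i0) orFb subr_eq0 => /eqP.
  by move=> u _; rewrite /G cxp_period.
transitivity (cint (- pi) pi (fun t => G (Complex (ln r) t))).
  by apply: eq_cint => t _; rewrite /G cxp_ln.
apply/eqP; rewrite -cabs_eq0 eq_le cabs_ge0 andbT.
apply/ler_addgt0Pr => k k0; rewrite add0r.
have M0 : 0 <= M by apply: le_trans (fM 0 _); rewrite ?cabs_ge0 // cabs0 (lt_trans r0).
(* On the circle of radius [s] the integrand is at most 4Ms/|z|. With the length 2 pi and the factor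
   2 of [cint_norm_le], the integral is at most 16 M pi s/|z|. *)
pose s := Num.min (cabs z / 2) (k * cabs z / (1 + 16 * M * pi)).
have mp : 0 <= M * pi by rewrite mulr_ge0 // ltW.
have s0 : 0 < s by rewrite lt_min !divr_gt0 ?mulr_gt0 //; lra.
have s1 : s <= cabs z / 2 by rewrite ge_min lexx.
have s2 : s * (16 * M * pi) <= k * cabs z.
  have : s <= k * cabs z / (1 + 16 * M * pi) by rewrite ge_min lexx orbT.
  by rewrite ler_pdivlMr; lra.
clearbody s.
rewrite (cst (ln s)); last by rewrite ltr_ln ?posrE //; lra.
apply: (le_trans (cint_norm_le (M := 4 * M * s / cabs z) _ _ _)).
- by lra.
- apply: cdiff_ctsV => t ht; apply: (dG (ln s)).
    split=> //=; rewrite lexx /= ler_ln ?posrE //; lra.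
  rewrite eq_complex /= negb_and; apply/orP; left.
  by rewrite lt_eqF // ltr_ln ?posrE //; lra.
- move=> t ht; rewrite /G cxp_ln //.
  set v := _ * expi t.
  have cv : cabs v = s by rewrite cabsM cabs_expi mulr1 cabs_real gtr0_norm.
  have v0 : v != 0 by rewrite -cabs_gt0 cv.
  have vz : v - z != 0.
    by rewrite -cabs_gt0; have := cabs_lower z (- v); rewrite cabs_distC cabsN cv; lra.
  have -> : (1 - z / v)^-1 = v / (v - z) by field; rewrite v0 vz.
  clearbody v; rewrite !cabsM cabsV cv.
  have f1 : cabs (f v - f z) <= 2 * M.
    apply: le_trans (cabsB _ _) _; rewrite mulr_natl mulr2n lerD // fM // ?cv; lra.
  have -> : 4 * M * s / cabs z = (2 * M) * (s / (cabs z / 2)) by field; rewrite gt_eqF.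
  apply: ler_pM => //; rewrite ?cabs_ge0 ?divr_ge0 ?cabs_ge0 //; first lra.
  rewrite ler_pM2l // lef_pV2 ?posrE ?cabs_gt0 //; last by rewrite divr_gt0.
  by have := cabs_lower z (- v); rewrite cabs_distC cabsN cv; lra.
rewrite (_ : 2 * _ * _ = (s * (16 * M * pi)) / cabs z); last by field; rewrite gt_eqF.
by rewrite ler_pdivrMr.
Qed.
End Cauchy.

(** * Taylor polynomials on a disc *)

Section Taylor.
Variable R : realType.
Local Notation C := R[i].
Local Notation Rez := complex.Re.
Local Notation Imz := complex.Im.

Lemma ctsI_cos_mul (a b k : R) : ctsI a b (fun t => cos (k * t)).
Proof.
move=> x _; apply: continuous_comp; last exact: continuous_cos.
by apply: continuousM; [exact: cst_continuous|exact: cvg_id].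
Qed.

Lemma ctsI_sin_mul (a b k : R) : ctsI a b (fun t => sin (k * t)).
Proof.
move=> x _; apply: continuous_comp; last exact: continuous_sin.
by apply: continuousM; [exact: cst_continuous|exact: cvg_id].
Qed.

Lemma cos_natpi (k : nat) (a : R) : cos (k%:R * (a + 2 * pi)) = cos (k%:R * a).
Proof.
rewrite mulrDr (_ : k%:R * (2 * pi) = (pi *+ 2) *+ k) ?(periodicn (@cosD2pi R)) //.
by rewrite -[RHS]mulr_natl -[pi *+ 2]mulr_natl.
Qed.

Lemma sin_natpi (k : nat) (a : R) : sin (k%:R * (a + 2 * pi)) = sin (k%:R * a).
Proof.
rewrite mulrDr (_ : k%:R * (2 * pi) = (pi *+ 2) *+ k) ?(periodicn (@sinD2pi R)) //.
by rewrite -[RHS]mulr_natl -[pi *+ 2]mulr_natl.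
Qed.

Lemma rint_cos (a : R) (k : nat) : (0 < k)%N ->
  rint a (a + 2 * pi) (fun t => cos (k%:R * t)) = 0.
Proof.
move=> k0; have kn : (k%:R : R) != 0 by rewrite pnatr_eq0 -lt0n.
have dF (x : R) : a <= x <= a + 2 * pi ->
   is_derive x 1 (fun t : R => k%:R^-1 * sin (k%:R * t)) (cos (k%:R * x)).
  move=> _; have h := is_deriveZ (k%:R : R) (is_derive_id x (1 : R)).
  have h3 := is_deriveZ (k%:R^-1 : R) (is_derive1_comp (is_derive_sin (k%:R * x)) h).
  apply: is_derive_eq h3 _.
  rewrite -[_ *: (_ * _)]/(k%:R^-1 * (cos (k%:R * x) * (k%:R * 1))).
  by rewrite mulr1 mulrCA mulVf // mulr1.
have ab : a < a + 2 * pi by rewrite ltrDl mulr_gt0 // pi_gt0.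
by rewrite (rint_FTC ab (@ctsI_cos_mul _ _ _) dF) sin_natpi subrr.
Qed.

Lemma rint_sin (a : R) (k : nat) : (0 < k)%N ->
  rint a (a + 2 * pi) (fun t => sin (k%:R * t)) = 0.
Proof.
move=> k0; have kn : (k%:R : R) != 0 by rewrite pnatr_eq0 -lt0n.
have dF (x : R) : a <= x <= a + 2 * pi ->
   is_derive x 1 (fun t : R => - k%:R^-1 * cos (k%:R * t)) (sin (k%:R * x)).
  move=> _; have h := is_deriveZ (k%:R : R) (is_derive_id x (1 : R)).
  have h3 := is_deriveZ (- k%:R^-1 : R) (is_derive1_comp (is_derive_cos (k%:R * x)) h).
  apply: is_derive_eq h3 _.
  rewrite -[_ *: (_ * _)]/(- k%:R^-1 * (- sin (k%:R * x) * (k%:R * 1))).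
  by field.
have ab : a < a + 2 * pi by rewrite ltrDl mulr_gt0 // pi_gt0.
by rewrite (rint_FTC ab (@ctsI_sin_mul _ _ _) dF) cos_natpi subrr.
Qed.

Lemma expiX (t : R) k : expi t ^+ k = expi (k%:R * t) :> C.
Proof. by rewrite -expiM mulr_natl. Qed.

Lemma expiV (t : R) : (expi t)^-1 = expi (- t) :> C.
Proof.
apply: (mulfI (x := expi t)); first by rewrite -cabs_gt0 cabs_expi.
rewrite -expiD subrr expi0 divff // -cabs_gt0 cabs_expi //.
Qed.

Lemma cint_expiV (k : nat) : (0 < k)%N ->
  cint (- pi) pi (fun t => (expi t)^-1 ^+ k) = 0 :> C.
Proof.
move=> k0; rewrite (@eq_cint _ _ _ _ (fun t => Complex (cos (k%:R * t)) (- sin (k%:R * t)))); last first.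
  by move=> t _; rewrite expiV expiX mulrN /expi cosN sinN.
rewrite [X in cint _ X](_ : pi = (- pi) + 2 * pi); last by ring.
rewrite /cint /= rint_cos //.
rewrite (@eq_rint _ _ _ _ (fun t => (-1) * sin (k%:R * t))); last by move=> t _; rewrite mulN1r.
by rewrite rintZ ?rint_sin ?mulr0 //; exact: ctsI_sin_mul.
Qed.

Lemma geom_split (w : C) K : 1 - w != 0 ->
  (1 - w)^-1 = \sum_(k < K) w ^+ k + w ^+ K / (1 - w).
Proof.
move=> w1; elim: K => [|K IH]; first by rewrite big_ord0 add0r expr0 mul1r.
rewrite big_ord_recr /= [LHS]IH exprS -addrA; congr (_ + _).
by field.
Qed.

Lemma ctsC_circle (f : C -> C) (r a b : R) : 0 < r ->
  (forall w, cabs w = r -> cdiff f w) -> ctsC a b (fun t => f (Complex r 0 * expi t)).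
Proof.
move=> r0 df; under [fun t => _]funext do rewrite -(cxp_ln _ r0).
apply: (cdiff_ctsV (G := fun w => f (cxp w))) => t _.
apply: cdiff_comp; first exact: cdiff_cxp.
by apply: df; rewrite cxp_ln // cabsM cabs_expi mulr1 cabs_real gtr0_norm.
Qed.

(** Cauchy's formula for the k-th Taylor coefficient at 0, over the circle of radius [r]. *)
Definition taylor_coef (f : C -> C) (r : R) (k : nat) : C :=
  (Complex (2 * pi) 0)^-1 * cint (- pi) pi (fun t =>
     f (Complex r 0 * expi t) * (Complex r 0 * expi t)^-1 ^+ k).

(** The kernel 1/(1 - z/zeta) is a finite geometric sum plus a remainder, and after integration f z
    survives only in the term of index 0. The constant 8 is the product of the 2 of [cint_norm_le],
    the 2 of |f zeta - f z| <= 2M, and the 2 of |1 - z/zeta| >= 1/2. *)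
Lemma taylor_slit (f : C -> C) (r rb M : R) :
  (forall w, cabs w < rb -> cdiff f w) -> (forall w, cabs w < rb -> cabs (f w) <= M) ->
  0 < r < rb -> forall K z, (Imz z != 0) || (0 < Rez z) -> cabs z <= r / 2 ->
  cabs (f z - \sum_(k < K) taylor_coef f r k * z ^+ k) <= 8 * M * (cabs z / r) ^+ K.
Proof.
move=> df fM rr K z good zr; have /andP[r0 rrb] := rr.
have M0 : 0 <= M by apply: le_trans (fM 0 _); rewrite ?cabs_ge0 // cabs0 (lt_trans r0).
have zrb : cabs z < rb by lra.
case: K => [|K].
  rewrite big_ord0 subr0 expr0 mulr1; apply: le_trans (fM z zrb) _.
  by lra.
have pipos : 0 < pi :> R := pi_gt0 R.
pose ze (t : R) : C := Complex r 0 * expi t.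
have cz t : cabs (ze t) = r by rewrite cabsM cabs_expi mulr1 cabs_real gtr0_norm.
have ze0 t : ze t != 0 by rewrite -cabs_gt0 cz.
have cw t : cabs (z / ze t) <= 1 / 2 by rewrite cabsM cabsV cz ler_pdivrMr //; lra.
have w1 t : 1 - z / ze t != 0.
  rewrite -cabs_gt0; have := cabs_lower 1 (- (z / ze t)).
  by rewrite cabs1 cabsN; have := cw t; lra.
have dV w : cabs w = r -> cdiff (fun w => w^-1) w.
  by move=> cr; apply: cdiff_inv; rewrite -cabs_gt0 cr.
have cV k a b : ctsC a b (fun t => (ze t)^-1 ^+ k).
  by apply: (ctsC_circle (f := fun w => w^-1 ^+ k)) => // w /dV; exact: cdiffX.
have cg a b : ctsC a b (fun t => f (ze t) - f z).
  apply: ctsCB; last exact: ctsCc.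
  by apply: ctsC_circle => // w cr; apply: df; rewrite cr.
have cgV k a b : ctsC a b (fun t => (f (ze t) - f z) * (ze t)^-1 ^+ k) by exact: ctsCM.
have cK a b : ctsC a b (fun t => (f (ze t) - f z) * ((z / ze t) ^+ K.+1 / (1 - z / ze t))).
  apply: ctsCM => //; apply: (ctsC_circle (f := fun w => (z / w) ^+ K.+1 / (1 - z / w))) => // w cr.
  have dzw : cdiff (fun w => z / w) w by apply: cdiffM; [exact: cdiff_cst|exact: dV].
  apply: cdiffM; first exact: cdiffX.
  apply: cdiffV; first by apply: cdiffB => //; exact: cdiff_cst.
  rewrite -cabs_gt0; have := cabs_lower 1 (- (z / w)).
  rewrite cabs1 cabsN cabsM cabsV cr; have : cabs z / r <= 1 / 2 by rewrite ler_pdivrMr //; lra.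
  lra.
have := cauchy_slit df fM rr (z := z) _ good.
move=> /(_ ltac:(lra)); rewrite -/ze => H.
have m2 : - pi <= pi :> R by lra.
have e1 : cint (- pi) pi (fun t => (f (ze t) - f z) * (1 - z / ze t)^-1) =
   \sum_(k < K.+1) z ^+ k * cint (- pi) pi (fun t => (f (ze t) - f z) * (ze t)^-1 ^+ k)
   + cint (- pi) pi (fun t => (f (ze t) - f z) * ((z / ze t) ^+ K.+1 / (1 - z / ze t))).
  rewrite (@eq_cint _ _ _ _ (fun t => \sum_(k < K.+1) z ^+ k * ((f (ze t) - f z) * (ze t)^-1 ^+ k) +
      (f (ze t) - f z) * ((z / ze t) ^+ K.+1 / (1 - z / ze t)))); last first.
    move=> t _; rewrite [X in _ * X](geom_split K.+1 (w1 t)) mulrDr mulr_sumr; congr (_ + _).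
    by apply: eq_bigr => k _; rewrite exprMn mulrCA.
  have c2 k : ctsC (- pi) pi (fun t => z ^+ k * ((f (ze t) - f z) * (ze t)^-1 ^+ k)).
    by apply: ctsCM => //; exact: ctsCc.
  rewrite cintD //; last by apply: ctsC_sum => k; exact: c2.
  congr (_ + _); rewrite cint_sum //.
  by apply: eq_bigr => k _; rewrite cintZ.
pose tp : C := Complex (2 * pi) 0.
have tp0 : tp != 0 by rewrite -cabs_gt0 cabs_real gtr0_norm; lra.
have e2 k : cint (- pi) pi (fun t => (f (ze t) - f z) * (ze t)^-1 ^+ k) =
    tp * taylor_coef f r k - (if k == 0%N then tp * f z else 0).
  rewrite /taylor_coef mulrA divff // mul1r.
  rewrite (@eq_cint _ _ _ _ (fun t => f (ze t) * (ze t)^-1 ^+ k - f z * (ze t)^-1 ^+ k)); last first.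
    by move=> t _; rewrite mulrBl.
  have c3 : ctsC (- pi) pi (fun t => f (ze t) * (ze t)^-1 ^+ k).
    by apply: ctsCM => //; apply: ctsC_circle => // w cr; apply: df; rewrite cr.
  rewrite cintB //; last by apply: ctsCM => //; exact: ctsCc.
  congr (_ - _); rewrite cintZ //; case: k {c3} => [|k] /=.
    rewrite (@eq_cint _ _ _ _ (fun=> 1)) ?cintc ?mul1r //.
    by rewrite mulrC; congr (_ * _); congr Complex; ring.
  rewrite (@eq_cint _ _ _ _ (fun t => (Complex r 0)^-1 ^+ k.+1 * (expi t)^-1 ^+ k.+1)); last first.
    by move=> t _; rewrite -exprMn -invfM.
  rewrite cintZ ?cint_expiV ?mulr0 //.
  have h1 : ctsC (- pi) pi (fun t => (ze t)^-1 ^+ k.+1) by [].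
  have := ctsCM (@ctsCc R (- pi) pi (Complex r 0 ^+ k.+1)) h1.
  have r0c : Complex r 0 != 0 :> C by rewrite -cabs_gt0 cabs_real gtr0_norm.
  by under [fun t => _ * _]funext do rewrite -exprMn invfM mulrA divff // mul1r.
move: H; rewrite e1 (eq_bigr (fun k : 'I_K.+1 => tp * (taylor_coef f r k * z ^+ k) -
   (if (k : nat) == 0%N then tp * f z else 0))); last first.
  move=> k _; rewrite e2 mulrBr; congr (_ - _); first by ring.
  by case: eqP => [->|]; rewrite ?expr0 ?mul1r ?mulr0.
rewrite sumrB -mulr_sumr [X in _ - X + _ = _]big_ord_recl /= [X in _ - (_ + X) + _]big1 // addr0 -mulrBr.
set S := \sum_(k < K.+1) _; set J := cint _ _ _ => H.
have {H} -> : f z - S = tp^-1 * J.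
  apply: (mulfI tp0); rewrite mulrA divff // mul1r -opprB mulrN.
  by apply/eqP; rewrite eq_sym -addr_eq0 addrC H.
have hJ : cabs J <= 2 * (2 * M * ((cabs z / r) ^+ K.+1 * 2)) * (pi - - pi).
  apply: cint_norm_le => // t _.
  rewrite !cabsM cabsX !cabsV cabsM cabsV cz.
  have q0 : 0 <= (cabs z / r) ^+ K.+1 by rewrite exprn_ge0 // divr_ge0 ?cabs_ge0 // ltW.
  apply: ler_pM; [exact: cabs_ge0|by rewrite mulr_ge0 // invr_ge0 cabs_ge0| |].
    apply: le_trans (cabsB _ _) _; rewrite mulr_natl mulr2n lerD // fM // cz; lra.
  apply: ler_wpM2l => //; rewrite -[2]invrK lef_pV2 ?posrE ?cabs_gt0 ?invr_gt0 //.
  by have := cabs_lower 1 (- (z / ze t)); rewrite cabs1 cabsN; have := cw t; lra.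
rewrite cabsM cabsV cabs_real gtr0_norm ?mulr_gt0 // mulrC ler_pdivrMr ?mulr_gt0 //.
by apply: le_trans hJ _; rewrite le_eqVlt; apply/orP; left; apply/eqP; ring.
Qed.

Lemma taylor1 (f : C -> C) (r rb M : R) :
  (forall w, cabs w < rb -> cdiff f w) -> (forall w, cabs w < rb -> cabs (f w) <= M) ->
  0 < r < rb -> forall K z (s : R), 0 < s <= r / 2 -> cabs z <= s ->
  cabs (f z - \sum_(k < K) taylor_coef f r k * z ^+ k) <= 8 * M * (s / r) ^+ K.
Proof.
move=> df fM rr K z s /andP[s0 sr] zs; have /andP[r0 rrb] := rr.
have M0 : 0 <= M by apply: le_trans (fM 0 _); rewrite ?cabs_ge0 // cabs0 (lt_trans r0).
have mono (v : C) : cabs v <= s -> (Imz v != 0) || (0 < Rez v) ->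
    cabs (f v - \sum_(k < K) taylor_coef f r k * v ^+ k) <= 8 * M * (s / r) ^+ K.
  move=> vs good; apply: le_trans (taylor_slit df fM rr K good (le_trans vs sr)) _.
  apply: ler_wpM2l; first by rewrite mulr_ge0.
  by rewrite lerXn2r ?nnegrE ?divr_ge0 ?cabs_ge0 ?(ltW s0) ?(ltW r0) // ler_pM2r ?invr_gt0.
have [good|] := boolP ((Imz z != 0) || (0 < Rez z)); first exact: mono.
rewrite negb_or negbK -leNgt => /andP[/eqP z1 z2].
have dP : cdiff (fun v => f v - \sum_(k < K) taylor_coef f r k * v ^+ k) z.
  apply: cdiffB; first by apply: df; lra.
  elim: {mono} K => [|K IH].
    by under [fun v => _]funext do rewrite big_ord0; exact: cdiff_cst.
  under [fun v => _]funext do rewrite big_ord_recr; apply: cdiffD => //.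
  apply: cdiffM; [exact: cdiff_cst|apply: cdiffX; exact: cdiff_id].
apply/ler_addgt0Pr => e e0; have [d [d0 Hd]] := cdiff_continuous dP e0.
(* The slit is approached from inside the disc of radius [s]. *)
have [h [hd hs hg]] : exists h, [/\ cabs h < d, cabs (z + h) <= s & (Imz (z + h) != 0) || (0 < Rez (z + h))].
  have [zz|zn0] := eqVneq z 0.
    exists (Complex (Num.min s (d / 2)) 0); rewrite zz add0r cabs_real /=.
    have p0 : 0 < Num.min s (d / 2) by rewrite lt_min s0 divr_gt0.
    rewrite gtr0_norm // p0 orbT; split=> //; last by rewrite ge_min lexx.
    by rewrite gt_min; apply/orP; right; lra.
  have a0 : 0 < cabs z by rewrite cabs_gt0.
  pose q := Num.min 1 (d / (3 * cabs z)).
  have q0 : 0 < q by rewrite lt_min ltr01 divr_gt0 // mulr_gt0.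
  have q1 : q <= 1 by rewrite ge_min lexx.
  have q2 : q * (3 * cabs z) <= d.
    by rewrite -ler_pdivlMr ?mulr_gt0 // ge_min lexx orbT.
  clearbody q.
  (* Here z = -|z|, and z + h is |z| times -(1 - q) + iq, of modulus at most |z| because (1 - q)^2 +
     q^2 <= 1. *)
  exists (Complex (- (q * Rez z)) (q * cabs z)).
  have az : cabs z = - Rez z.
    by rewrite /cabs /cmod2 z1 expr0n /= addr0 sqrtr_sqr ler0_norm.
  split.
  - apply: le_lt_trans (cabs_le_ReIm _) _ => /=.
    rewrite normrN !normrM (gtr0_norm q0) (ler0_norm z2) -az (gtr0_norm a0); nra.
  - apply: le_trans zs; rewrite -(ler_pXn2r (n := 2)) ?nnegrE ?cabs_ge0 //.
    rewrite cabs_sqr /cmod2 ReD ImD /= z1 add0r az; nra.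
  - by rewrite ImD z1 add0r /= mulf_neq0 ?gt_eqF.
have := Hd h hd; have := mono _ hs hg.
set A := f (z + h) - _; set B := f z - _ => h1 h2.
have -> : B = A - (A - B) by ring.
by apply: le_trans (cabsB _ _) _; apply: lerD.
Qed.

(** The Taylor estimate of order one about [a] is used at [z] and at [a]; each contributes 8. *)
Lemma cauchy_lipschitz (f : C -> C) (rb M : R) (a z : C) (r : R) :
  (forall w, cabs (w - a) < rb -> cdiff f w) ->
  (forall w, cabs (w - a) < rb -> cabs (f w) <= M) -> 0 < r < rb ->
  cabs (z - a) <= r / 2 -> cabs (f z - f a) <= 16 * M * (cabs (z - a) / r).
Proof.
move=> df fM rr zr; have [->|za] := eqVneq z a.
  by rewrite !subrr cabs0 mul0r mulr0.
have s0 : 0 < cabs (z - a) by rewrite cabs_gt0 subr_eq0.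
pose g v := f (v + a).
have dg w : cabs w < rb -> cdiff g w.
  move=> h; apply: (cdiff_comp (f := fun v => v + a)).
    by apply: cdiffD; [exact: cdiff_id|exact: cdiff_cst].
  by apply: df; rewrite addrK.
have gM w : cabs w < rb -> cabs (g w) <= M by move=> h; apply: fM; rewrite addrK.
have sr : 0 < cabs (z - a) <= r / 2 by rewrite s0.
have := taylor1 dg gM rr 1 sr (z := z - a) (lexx _).
have := taylor1 dg gM rr 1 sr (z := 0); rewrite cabs0 => /(_ (ltW s0)).
rewrite !big_ord1 !expr0 !expr1 !mulr1 /g subrK add0r => h1 h2.
have -> : f z - f a = (f z - taylor_coef (fun v => f (v + a)) r 0) -
    (f a - taylor_coef (fun v => f (v + a)) r 0) by ring.
apply: le_trans (cabsB _ _) _.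
by rewrite (_ : 16 * M * _ = 8 * M * (cabs (z - a) / r) + 8 * M * (cabs (z - a) / r)); [exact: lerD|ring].
Qed.
End Taylor.

(** * Monomial size of holomorphic germs *)

Section Expansion.
Variable R : realType.
Local Notation C := R[i].

Definition uroot (K : nat) : C := expi (2 * pi / K%:R).

Lemma uroot_expr (K m : nat) : uroot K ^+ m = expi (m%:R * (2 * pi / K%:R)).
Proof. by rewrite /uroot expiX. Qed.

Lemma cabs_uroot K m : cabs (uroot K ^+ m) = 1.
Proof. by rewrite uroot_expr cabs_expi. Qed.

Lemma uroot_neq0 K m : uroot K ^+ m != 0.
Proof. by rewrite -cabs_gt0 cabs_uroot. Qed.

Lemma uroot_order K : (0 < K)%N -> uroot K ^+ K = 1.
Proof.
move=> K0; rewrite uroot_expr mulrC divfK ?pnatr_eq0 -?lt0n //.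
by rewrite /expi mulr_natl cos2pi sin2pi.
Qed.

Lemma uroot_prim K m : (0 < m < K)%N -> uroot K ^+ m != 1.
Proof.
move=> /andP[m0 mK]; have K0 : (0 < K)%N by apply: leq_trans mK.
have Kr : 0 < K%:R :> R by rewrite ltr0n.
have p0 : 0 < pi :> R := pi_gt0 R.
rewrite uroot_expr; apply/eqP => /(congr1 (fun z => complex.Re z)) /= h.
have := cos_eq1 _ h; rewrite ger0_norm; last by rewrite mulr_ge0 // divr_ge0 // mulr_ge0 // ltW.
have -> : m%:R * (2 * pi / K%:R) = (m%:R / K%:R) * (2 * pi) :> R by ring.
move=> H; have : m%:R / K%:R * (2 * pi) = 0 :> R.
  by apply: H; rewrite gtr_pMl ?mulr_gt0 // ltr_pdivrMr // mul1r ltr_nat.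
by apply/eqP; rewrite gt_eqF // mulr_gt0 ?divr_gt0 ?ltr0n // mulr_gt0.
Qed.

Lemma uroot_orth K j k : (j < K)%N -> (k < K)%N ->
  \sum_(l < K) K%:R^-1 * (uroot K ^+ l)^-1 ^+ j * (uroot K ^+ l) ^+ k = (j == k)%:R.
Proof.
move=> jK kK; have K0 : (0 < K)%N by apply: leq_trans jK.
have Kn : K%:R != 0 :> C by rewrite pnatr_eq0 -lt0n.
have [->|jk] := eqVneq j k.
  rewrite (eq_bigr (fun=> K%:R^-1)); last first.
    by move=> l _; rewrite -mulrA -exprMn mulVf ?uroot_neq0 // expr1n mulr1.
  by rewrite sumr_const card_ord -[LHS]mulr_natr mulVf.
pose x := (uroot K ^+ j)^-1 * uroot K ^+ k.
have xK : x ^+ K = 1.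
  rewrite exprMn exprVn -!exprM mulnC (mulnC k) !exprM uroot_order //.
  by rewrite !expr1n invr1 mulr1.
have x1 : x != 1.
  have nz := uroot_neq0 K.
  rewrite /x; case: (ltngtP j k) jk => // h _.
    rewrite -(subnKC (ltnW h)) exprD mulKf ?nz //; apply: uroot_prim.
    by rewrite subn_gt0 h (leq_ltn_trans (leq_subr _ _)).
  rewrite -(subnKC (ltnW h)) exprD invfM -mulrA mulrCA mulVf ?nz // mulr1.
  rewrite invr_eq1; apply: uroot_prim.
  by rewrite subn_gt0 h (leq_ltn_trans (leq_subr _ _)).
rewrite (eq_bigr (fun l : 'I_K => K%:R^-1 * x ^+ l)); last first.
  move=> l _; rewrite -mulrA; congr (_ * _).
  by rewrite /x exprMn !exprVn -!exprM mulnC (mulnC l k).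
rewrite -mulr_sumr; have : (x - 1) * (\sum_(l < K) x ^+ l) = 0.
  by rewrite -subrX1 xK subrr.
by move/eqP; rewrite mulf_eq0 subr_eq0 (negbTE x1) /= => /eqP ->; rewrite mulr0.
Qed.

Section Interpolation.
Variables (rho : R) (rho0 : 0 < rho).

Definition inode (K l : nat) : C := Complex rho 0 * uroot K ^+ l.
(** The cardinal functions of polynomial interpolation: the sum over [l] of
    [ikern K z l * g (inode K l)] is the value at [z] of the polynomial of degree less than [K] that
    agrees with [g] at the nodes. *)
Definition ikern (K : nat) (z : C) (l : nat) : C :=
  \sum_(k < K) K%:R^-1 * (z / inode K l) ^+ k.

Lemma cabs_inode K l : cabs (inode K l) = rho.
Proof. by rewrite cabsM cabs_uroot mulr1 cabs_real gtr0_norm. Qed.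

Lemma rho_neq0 : Complex rho 0 != 0 :> C.
Proof. by rewrite -cabs_gt0 cabs_real gtr0_norm. Qed.

Lemma inode_orth K j k : (j < K)%N -> (k < K)%N ->
  \sum_(l < K) K%:R^-1 * (inode K l)^-1 ^+ j * (inode K l) ^+ k = (j == k)%:R.
Proof.
move=> jK kK; have r0 := rho_neq0.
rewrite (eq_bigr (fun l : 'I_K => ((Complex rho 0)^-1 ^+ j * (Complex rho 0) ^+ k) *
   (K%:R^-1 * (uroot K ^+ l)^-1 ^+ j * (uroot K ^+ l) ^+ k))); last first.
  by move=> l _; rewrite /inode invfM !exprMn; ring.
rewrite -mulr_sumr uroot_orth //; case: eqP => [->|]; last by rewrite mulr0.
by rewrite mulr1 -exprMn mulVf // expr1n.
Qed.

Lemma sum_halves (K : nat) (q : R) : 0 <= q <= 2^-1 -> \sum_(k < K) q ^+ k <= 2.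
Proof.
move=> /andP[q0 q1].
have h : (1 - q) * (\sum_(k < K) q ^+ k) <= 1.
  rewrite -opprB mulNr -subrX1 opprB gerBl exprn_ge0 //.
have s0 : 0 <= \sum_(k < K) q ^+ k by rewrite sumr_ge0 // => i _; rewrite exprn_ge0.
nra.
Qed.

Lemma ikern_sum K z : (0 < K)%N -> cabs z <= rho / 2 ->
  \sum_(l < K) cabs (ikern K z l) <= 2.
Proof.
move=> K0 zr; have Kr : 0 < K%:R :> R by rewrite ltr0n.
have cK : cabs (K%:R^-1 : C) = K%:R^-1.
  by rewrite -[K%:R : C](rmorph_nat (real_complex R)) cabsV cabs_real ger0_norm.
apply: le_trans (_ : \sum_(l < K) K%:R^-1 * 2 <= _); last first.
  by rewrite sumr_const card_ord -[leLHS]mulr_natr mulrAC mulVf ?gt_eqF // mul1r.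
apply: ler_sum => l _; rewrite /ikern; apply: le_trans (cabs_sum _ _ _) _.
rewrite (eq_bigr (fun k : 'I_K => K%:R^-1 * (cabs z / rho) ^+ k)); last first.
  by move=> k _; rewrite cabsM cK cabsX cabsM cabsV cabs_inode.
rewrite -mulr_sumr ler_wpM2l ?invr_ge0 //.
apply: sum_halves; apply/andP; split; first by rewrite divr_ge0 ?cabs_ge0 // ltW.
by rewrite ler_pdivrMr // mulrC.
Qed.

Lemma ikern_poly K (c : nat -> C) z : 
  \sum_(l < K) ikern K z l * (\sum_(j < K) c j * (inode K l) ^+ j) =
  \sum_(k < K) c k * z ^+ k.
Proof.
under eq_bigr => l _ do rewrite /ikern big_distrlr /=.
rewrite exchange_big /=; apply: eq_bigr => k _.
rewrite exchange_big /= (bigD1 k) //= [X in _ + X]big1 ?addr0; last first.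
  move=> j jk; transitivity (c j * z ^+ k *
     (\sum_(l < K) K%:R^-1 * (inode K l)^-1 ^+ k * (inode K l) ^+ j)).
    by rewrite mulr_sumr; apply: eq_bigr => l _; rewrite exprMn; ring.
  rewrite inode_orth // (_ : (k : nat) == j = false) ?mulr0 //.
  by apply/negbTE; rewrite eq_sym; exact: jk.
transitivity (c k * z ^+ k *
   (\sum_(l < K) K%:R^-1 * (inode K l)^-1 ^+ k * (inode K l) ^+ k)).
  by rewrite mulr_sumr; apply: eq_bigr => l _; rewrite exprMn; ring.
by rewrite inode_orth // eqxx mulr1.
Qed.

(** Interpolation is exact on the Taylor polynomial of degree less than [K]. The Taylor error 8M/2^K
    enters twice through the nodes, where the kernels have total mass at most 2, and once at [z];
    hence 24. *)
Lemma interp1 (g : C -> C) (rb M : R) K z : (0 < K)%N ->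
  (forall w, cabs w < rb -> cdiff g w) -> (forall w, cabs w < rb -> cabs (g w) <= M) ->
  2 * rho < rb -> cabs z <= rho / 2 ->
  cabs (\sum_(l < K) ikern K z l * g (inode K l) - g z) <= 24 * M / 2 ^+ K.
Proof.
move=> K0 dg gM rrb zr.
pose r := 2 * rho.
have rr : 0 < r < rb by rewrite /r rrb mulr_gt0.
have sr : 0 < rho <= r / 2 by rewrite rho0 /r; lra.
pose P z := \sum_(k < K) taylor_coef g r k * z ^+ k.
have H v : cabs v <= rho -> cabs (g v - P v) <= 8 * M / 2 ^+ K.
  move=> vr; have := taylor1 dg gM rr K sr vr.
  by rewrite (_ : rho / r = 2^-1) ?exprVn // /r; field; rewrite gt_eqF.
have -> : \sum_(l < K) ikern K z l * g (inode K l) - g z =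
   \sum_(l < K) ikern K z l * (g (inode K l) - P (inode K l)) - (g z - P z).
  under [in RHS]eq_bigr => l _ do rewrite mulrBr.
  by rewrite sumrB ikern_poly -/(P z); ring.
apply: le_trans (cabsB _ _) _.
have -> : 24 * M / 2 ^+ K = 2 * (8 * M / 2 ^+ K) + 8 * M / 2 ^+ K by ring.
have hz : cabs z <= rho by lra.
apply: lerD; last exact: H.
apply: le_trans (cabs_sum _ _ _) _.
apply: le_trans (_ : \sum_(l < K) cabs (ikern K z l) * (8 * M / 2 ^+ K) <= _).
  by apply: ler_sum => l _; rewrite cabsM ler_wpM2l ?cabs_ge0 // H // cabs_inode.
rewrite -mulr_suml ler_wpM2r ?ikern_sum //.
exact: le_trans (cabs_ge0 _) (H _ hz).
Qed.

End Interpolation.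
End Expansion.


(** * Interpolation in several variables and finiteness of exponents *)

Section Multi.
Variable R : realType.
Local Notation C := R[i].
Variable n : nat.

Definition upd (T : Type) (u : 'I_n -> T) (j : 'I_n) (w : T) : 'I_n -> T :=
  fun i => if i == j then w else u i.

Lemma upd_id (T : Type) (u : 'I_n -> T) j : upd u j (u j) = u.
Proof. by apply/funext => i; rewrite /upd; case: eqP => [->|]. Qed.

(** All that is used of holomorphy in several variables: a bound on a polydisk and differentiability
    in each variable separately. *)
Definition sepholo (F : ('I_n -> C) -> C) (rb M : R) : Prop :=
  (forall u, (forall i, cabs (u i) < rb) -> cabs (F u) <= M) /\
  (forall u j, (forall i, cabs (u i) < rb) ->
     forall w, cabs w < rb -> cdiff (fun w => F (upd u j w)) w).

Definition updf K (l : {ffun 'I_n -> 'I_K}) i m : {ffun 'I_n -> 'I_K} :=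
  [ffun x => if x == i then m else l x].

(** The involution exchanging [l i] with [m] permutes the pairs (l, m). This frees one coordinate of
    the multi-index for interpolation in one variable. *)
Lemma sum_ffun_avg K (G : {ffun 'I_n -> 'I_K} -> C) (i : 'I_n) : (0 < K)%N ->
  \sum_l G l = \sum_l \sum_(m < K) K%:R^-1 * G (updf l i m).
Proof.
move=> K0; rewrite pair_big /=.
pose h (p : {ffun 'I_n -> 'I_K} * 'I_K) := (updf p.1 i p.2, p.1 i).
have hK : involutive h.
  move=> [l m]; rewrite /h /=; congr (_, _); last by rewrite ffunE eqxx.
  by apply/ffunP => x; rewrite !ffunE; case: eqP => [->|].
rewrite (reindex_inj (inv_inj hK)) /=.
rewrite (eq_bigr (fun p : {ffun 'I_n -> 'I_K} * 'I_K => K%:R^-1 * G p.1)); last first.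
  move=> [l m] _ /=; congr (_ * G _).
  by apply/ffunP => x; rewrite !ffunE; case: eqP => [->|].
rewrite -(pair_bigA _ (fun l m => K%:R^-1 * G l)) /=; apply: eq_bigr => l _.
rewrite sumr_const card_ord -[RHS]mulr_natl mulrA divff ?mul1r //.
by rewrite pnatr_eq0 -lt0n.
Qed.

Section Interp.
Variables (rho : R) (rho0 : 0 < rho).
Local Notation node := (inode rho).
Local Notation kern := (ikern rho).

Definition wt K (u : 'I_n -> C) (k : nat) (i : 'I_n) (m : 'I_K) : C :=
  if (i < k)%N then kern K (u i) m else K%:R^-1.

Definition mix K (u : 'I_n -> C) (k : nat) (l : {ffun 'I_n -> 'I_K}) (i : 'I_n) : C :=
  if (i < k)%N then node K (l i) else u i.

(** Interpolation in the first [k] variables only. The remaining variables keep their values, and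
    their dummy indices are averaged with weight 1/K, so that the sum ranges over the same
    multi-indices for every [k]: at 0 it is [F u], at [n] a polynomial. *)
Definition hyb K (F : ('I_n -> C) -> C) u k : C :=
  \sum_(l : {ffun 'I_n -> 'I_K}) (\prod_i wt u k i (l i)) * F (mix u k l).

Lemma cabs_natV K : cabs (K%:R^-1 : C) = K%:R^-1.
Proof.
by rewrite -[K%:R : C](rmorph_nat (real_complex R)) cabsV cabs_real ger0_norm.
Qed.

Lemma hyb0 K F u : (0 < K)%N -> hyb K F u 0 = F u.
Proof.
move=> K0; rewrite /hyb.
rewrite (eq_bigr (fun l : {ffun 'I_n -> 'I_K} => (\prod_(i < n) (K%:R^-1 : C)) * F u)); last first.
  by move=> l _; congr (_ * F _).
rewrite -mulr_suml -(bigA_distr_bigA (fun (i : 'I_n) (m : 'I_K) => K%:R^-1 : C)) /=.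
rewrite big1 ?mul1r // => i _; rewrite sumr_const card_ord -[LHS]mulr_natl divff //.
by rewrite pnatr_eq0 -lt0n.
Qed.

(** Only the variable of index [k] changes, where the one-variable estimate applies; the other
    weights have total mass at most 2^n. *)
Lemma hyb_step K F rb M u k : (0 < K)%N -> sepholo F rb M -> 2 * rho < rb ->
  (forall i, cabs (u i) <= rho / 2) -> (k < n)%N ->
  cabs (hyb K F u k.+1 - hyb K F u k) <= 2 ^+ n * (24 * M / 2 ^+ K).
Proof.
move=> K0 [FM dF] rrb uu kn; pose k0 := Ordinal kn.
have Kr : 0 < K%:R :> R by rewrite ltr0n.
have rrb' : rho < rb by rewrite (lt_trans _ rrb) // mulr_natl mulr2n ltrDl.
have urb i : cabs (u i) < rb.
  apply: le_lt_trans (uu i) _; apply: le_lt_trans rrb'.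
  by rewrite ler_pdivrMr // ler_peMr ?ler1n // ltW.
pose Q (l : {ffun 'I_n -> 'I_K}) : C := \prod_(i | i != k0) wt u k i (l i).
have Qupd l m : Q (updf l k0 m) = Q l.
  by apply: eq_bigr => i ik; rewrite ffunE (negbTE ik).
have w0 (m : 'I_K) : wt u k k0 m = K%:R^-1 by rewrite /wt /= ltnn.
have w1 (m : 'I_K) : wt u k.+1 k0 m = kern K (u k0) m by rewrite /wt /= ltnSn.
have wE i (m : 'I_K) : i != k0 -> wt u k.+1 i m = wt u k i m.
  move=> ik; rewrite /wt ltnS leq_eqVlt.
  by rewrite (_ : ((i : nat) == k) = false) //; apply/negbTE; exact: ik.
have E1 (l : {ffun 'I_n -> 'I_K}) : \prod_i wt u k.+1 i (l i) = kern K (u k0) (l k0) * Q l.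
  by rewrite (bigD1 k0) //= w1; congr (_ * _); apply: eq_bigr => i; exact: wE.
have E0 (l : {ffun 'I_n -> 'I_K}) : \prod_i wt u k i (l i) = K%:R^-1 * Q l.
  by rewrite (bigD1 k0) //= w0.
have M1 (l : {ffun 'I_n -> 'I_K}) m : mix u k.+1 (updf l k0 m) = upd (mix u k l) k0 (node K m).
  apply/funext => i; rewrite /mix /upd ffunE; case: eqP => [->|/eqP ik].
    by rewrite /= ltnSn.
  rewrite ltnS leq_eqVlt (_ : ((i : nat) == k) = false) //.
  by apply/negbTE; exact: ik.
have -> : hyb K F u k.+1 - hyb K F u k = \sum_(l : {ffun 'I_n -> 'I_K}) K%:R^-1 * Q l *
    (\sum_(m < K) kern K (u k0) m * F (upd (mix u k l) k0 (node K m)) - F (mix u k l)).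
  rewrite /hyb (sum_ffun_avg _ k0 K0) -sumrB; apply: eq_bigr => l _.
  rewrite mulrBr; congr (_ - _); last by rewrite E0.
  rewrite mulr_sumr; apply: eq_bigr => m _.
  by rewrite E1 Qupd M1 ffunE eqxx; ring.
have e0 : 0 <= 24 * M / 2 ^+ K.
  have M0 : 0 <= M by exact: le_trans (cabs_ge0 _) (FM u urb).
  by rewrite divr_ge0 ?mulr_ge0 ?exprn_ge0.
apply: le_trans (cabs_sum _ _ _) _.
apply: le_trans (_ : \sum_(l : {ffun 'I_n -> 'I_K}) (K%:R^-1 * cabs (Q l)) * (24 * M / 2 ^+ K) <= _).
  apply: ler_sum => l _; rewrite cabsM cabsM cabs_natV ler_wpM2l //.
    by rewrite mulr_ge0 ?cabs_ge0 // invr_ge0 ltW.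
  have mrb i : cabs (mix u k l i) < rb.
    by rewrite /mix; case: ifP => _ //; rewrite cabs_inode.
  have := interp1 rho0 K0 (g := fun w => F (upd (mix u k l) k0 w)) _ _ rrb (uu k0).
  have -> : upd (mix u k l) k0 (u k0) = mix u k l.
    by rewrite -[X in upd _ _ X](_ : mix u k l k0 = _) ?upd_id // /mix ltnn.
  apply; first by move=> w wr; exact: dF.
  by move=> w wr; apply: FM => i; rewrite /upd; case: eqP.
rewrite -mulr_suml ler_wpM2r //.
pose v (i : 'I_n) (m : 'I_K) : R := if i == k0 then K%:R^-1 else cabs (wt u k i m).
rewrite (eq_bigr (fun l : {ffun 'I_n -> 'I_K} => \prod_i v i (l i))); last first.
  move=> l _; rewrite (bigD1 k0) //= {1}/v eqxx /Q cabs_prod; congr (_ * _).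
  by apply: eq_bigr => i ik; rewrite /v (negbTE ik).
have sK : \sum_(m < K) (K%:R^-1 : R) = 1.
  by rewrite sumr_const card_ord -[LHS]mulr_natl divff // gt_eqF.
rewrite -(bigA_distr_bigA v) /=.
apply: le_trans (_ : \prod_(i < n) (2 : R) <= _); last first.
  by rewrite prodr_const card_ord.
apply: ler_prod => i _; rewrite sumr_ge0 /=; last first.
  by move=> m _; rewrite /v; case: ifP => _; rewrite ?invr_ge0 ?cabs_ge0 ?ltW.
rewrite /v; case: eqP => _; first by rewrite sK ler1n.
rewrite /wt; case: (i < k)%N; first exact: ikern_sum.
rewrite (eq_bigr (fun=> K%:R^-1)) ?sK ?ler1n // => m _; exact: cabs_natV.
Qed.

Lemma hyb_approx K F rb M u : (0 < K)%N -> sepholo F rb M -> 2 * rho < rb ->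
  (forall i, cabs (u i) <= rho / 2) ->
  cabs (hyb K F u n - F u) <= n%:R * (2 ^+ n * (24 * M / 2 ^+ K)).
Proof.
move=> K0 sF rrb uu; rewrite -(hyb0 F u K0).
suff H k : (k <= n)%N -> cabs (hyb K F u k - hyb K F u 0) <= k%:R * (2 ^+ n * (24 * M / 2 ^+ K)).
  exact: H.
elim: k => [|k IH] kn; first by rewrite subrr cabs0 mul0r.
rewrite (_ : hyb K F u k.+1 - hyb K F u 0 =
  (hyb K F u k - hyb K F u 0) + (hyb K F u k.+1 - hyb K F u k)); last by ring.
apply: le_trans (cabsD _ _) _; rewrite -natr1 mulrDl mul1r.
by apply: lerD; [exact: IH (ltnW kn)|exact: hyb_step K0 sF rrb uu kn].
Qed.

Definition monom (T : pzRingType) (u : 'I_n -> T) (b : 'I_n -> nat) : T :=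
  \prod_i u i ^+ b i.

(** The coefficient of u^b in the interpolation polynomial [hyb K F u n], a discrete Cauchy
    integral. It depends on [K]. *)
Definition icoef K (F : ('I_n -> C) -> C) (b : 'I_n -> nat) : C :=
  \sum_(l : {ffun 'I_n -> 'I_K})
     (\prod_i (K%:R^-1 * (node K (l i))^-1 ^+ b i)) * F (fun i => node K (l i)).

Lemma hyb_poly K F u : hyb K F u n =
  \sum_(b : {ffun 'I_n -> 'I_K}) icoef K F (fun i => b i) * monom u (fun i => b i).
Proof.
rewrite /hyb.
transitivity (\sum_(l : {ffun 'I_n -> 'I_K}) \sum_(b : {ffun 'I_n -> 'I_K})
   (\prod_i (K%:R^-1 * (u i / node K (l i)) ^+ b i)) * F (fun i => node K (l i))).
  apply: eq_bigr => l _; rewrite -mulr_suml; congr (_ * F _); last first.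
    by apply/funext => i; rewrite /mix ltn_ord.
  rewrite (eq_bigr (fun i => \sum_(k < K) K%:R^-1 * (u i / node K (l i)) ^+ k)); last first.
    by move=> i _; rewrite /wt ltn_ord.
  by rewrite (bigA_distr_bigA (fun i (k : 'I_K) => K%:R^-1 * (u i / node K (l i)) ^+ k)).
rewrite exchange_big /=; apply: eq_bigr => b _; rewrite /icoef mulr_suml.
apply: eq_bigr => l _; rewrite mulrAC; congr (_ * _).
rewrite /monom -big_split /=; apply: eq_bigr => i _.
by rewrite exprMn; ring.
Qed.

Lemma icoef_le K F M b : (0 < K)%N ->
  (forall u, (forall i, cabs (u i) = rho) -> cabs (F u) <= M) ->
  cabs (icoef K F b) <= M * monom (fun=> rho^-1) b.
Proof.
move=> K0 FM; rewrite /icoef; apply: le_trans (cabs_sum _ _ _) _.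
have Kr : 0 < K%:R :> R by rewrite ltr0n.
apply: le_trans (_ : \sum_(l : {ffun 'I_n -> 'I_K}) (\prod_(i < n) (K%:R^-1 * rho^-1 ^+ b i)) * M <= _).
  apply: ler_sum => l _; rewrite cabsM cabs_prod.
  apply: ler_pM; rewrite ?cabs_ge0 //.
  - by apply: prodr_ge0 => i _; exact: cabs_ge0.
  - rewrite le_eqVlt; apply/orP; left; apply/eqP; apply: eq_bigr => i _.
    by rewrite cabsM cabs_natV cabsX cabsV cabs_inode.
  - by apply: FM => i; rewrite cabs_inode.
rewrite -mulr_suml mulrC.
rewrite -(bigA_distr_bigA (fun (i : 'I_n) (m : 'I_K) => K%:R^-1 * rho^-1 ^+ b i)) /=.
rewrite le_eqVlt; apply/orP; left; apply/eqP; congr (_ * _); apply: eq_bigr => i _.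
by rewrite sumr_const card_ord -[LHS]mulr_natl mulrA divff ?mul1r // gt_eqF.
Qed.

Definition mpoly_fun K (c : ('I_n -> nat) -> C) (u : 'I_n -> C) : C :=
  \sum_(g : {ffun 'I_n -> 'I_K}) c (fun i => g i) * monom u (fun i => g i).

(** Orthogonality on the L-th roots of unity, for a grid at least as fine as the degree bound [K].
    This is how coefficients obtained for two different sizes are compared on a common grid. *)
Lemma icoef_poly K L (c : ('I_n -> nat) -> C) (b : 'I_n -> nat) :
  (K <= L)%N -> (forall i, (b i < K)%N) -> icoef L (mpoly_fun K c) b = c b.
Proof.
move=> KL bK; pose b' : {ffun 'I_n -> 'I_K} := [ffun i => Ordinal (bK i)].
have b'E : (fun i => b' i : nat) = b by apply/funext => i; rewrite ffunE.
rewrite /icoef /mpoly_fun; under eq_bigr => l _ do rewrite mulr_sumr.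
rewrite exchange_big /=.
rewrite (eq_bigr (fun g : {ffun 'I_n -> 'I_K} => c (fun i => g i) * (g == b')%:R)).
  rewrite (bigD1 b') //= big1 ?addr0 ?eqxx ?mulr1 ?b'E // => g /negbTE ->.
  by rewrite mulr0.
move=> g _.
transitivity (c (fun i => g i) * \sum_(l : {ffun 'I_n -> 'I_L})
   \prod_i (L%:R^-1 * (node L (l i))^-1 ^+ b i * node L (l i) ^+ g i)).
  rewrite mulr_sumr; apply: eq_bigr => l _.
  by rewrite mulrCA -big_split /=.
congr (_ * _).
rewrite -(bigA_distr_bigA (fun i (m : 'I_L) => L%:R^-1 * (node L m)^-1 ^+ b i * node L m ^+ g i)) /=.
rewrite (eq_bigr (fun i => (b i == g i)%:R)); last first.
  by move=> i _; rewrite inode_orth // (leq_trans _ KL).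
have [->|gb] := eqVneq g b'.
  by rewrite big1 // => i _; rewrite ffunE eqxx.
have [i gi] : exists i, g i != b' i.
  apply/existsP; rewrite -negb_forall; apply: contra gb => /forallP h.
  by apply/eqP/ffunP => i; apply/eqP; exact: h.
rewrite (bigD1 i) //= (_ : b i == g i = false) ?mul0r //.
apply: contraNF gi => /eqP e; apply/eqP/val_inj; rewrite /= -e.
by rewrite -[in LHS]b'E.
Qed.

Lemma icoefB K F1 F2 b :
  icoef K (fun u => F1 u - F2 u) b = icoef K F1 b - icoef K F2 b.
Proof. by rewrite /icoef -sumrB; apply: eq_bigr => l _; rewrite mulrBr. Qed.

End Interp.

Lemma monomM (T : comPzRingType) (u v : 'I_n -> T) b :
  monom (fun i => u i * v i) b = monom u b * monom v b.
Proof. by rewrite /monom -big_split; apply: eq_bigr => i _; rewrite exprMn. Qed.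

Lemma monom_gt0 (s : 'I_n -> R) b : (forall i, 0 < s i) -> 0 < monom s b.
Proof. by move=> s0; apply: prodr_gt0 => i _; rewrite exprn_gt0. Qed.

Lemma monom_ge0 (s : 'I_n -> R) b : (forall i, 0 <= s i) -> 0 <= monom s b.
Proof. by move=> s0; apply: prodr_ge0 => i _; rewrite exprn_ge0. Qed.

Lemma cabs_monom (u : 'I_n -> C) b : cabs (monom u b) = monom (fun i => cabs (u i)) b.
Proof. by rewrite /monom cabs_prod; apply: eq_bigr => i _; rewrite cabsX. Qed.

(** Rescaling the variables by [s] reduces the Cauchy estimate to the unit torus, so that unequal
    radii are allowed. *)
Lemma mpoly_coef_le K c (b : 'I_n -> nat) (s : 'I_n -> R) B : (0 < K)%N ->
  (forall i, 0 < s i) -> (forall i, (b i < K)%N) ->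
  (forall u, (forall i, cabs (u i) = s i) -> cabs (mpoly_fun K c u) <= B) ->
  cabs (c b) * monom s b <= B.
Proof.
move=> K0 s0 bK H.
pose c' (g : 'I_n -> nat) := c g * monom (fun i => Complex (s i) 0 : C) g.
have <- : cabs (c' b) = cabs (c b) * monom s b.
  rewrite /c' cabsM cabs_monom; congr (_ * monom _ _).
  by apply/funext => i; rewrite cabs_real gtr0_norm.
rewrite -(icoef_poly ltr01 c' (leqnn K) bK).
have -> : B = B * monom (fun i : 'I_n => (1 : R)^-1) b.
  by rewrite /monom big1 ?mulr1 // => i _; rewrite invr1 expr1n.
apply: icoef_le => // u u1.
have -> : mpoly_fun K c' u = mpoly_fun K c (fun i => Complex (s i) 0 * u i).
  by apply: eq_bigr => g _; rewrite monomM mulrA.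
by apply: H => i; rewrite cabsM cabs_real u1 mulr1 gtr0_norm.
Qed.

(** * Dickson's lemma *)

Section Dickson.

Lemma nat_nondecreasing_subseq (s : nat -> nat) :
  exists t : nat -> nat, (forall i, (t i < t i.+1)%N) /\ (forall i, (s (t i) <= s (t i.+1))%N).
Proof.
have mn m : exists k, (m <= k)%N /\ forall j, (m <= j)%N -> (s k <= s j)%N.
  have ex : exists v, `[< exists2 k, (m <= k)%N & s k = v >] by exists (s m); apply/asboolP; exists m.
  case: (ex_minnP ex) => v /asboolP[k mk <-] H.
  by exists k; split=> // j mj; apply: H; apply/asboolP; exists j.
have [g Hg] := choice mn.
exists (fun i => iter i (fun k => g k.+1) (g 0%N)); split=> i /=.
  by case: (Hg (iter i (fun k => g k.+1) (g 0%N)).+1).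
have key m : (s (g m) <= s (g (g m).+1))%N.
  have [h1 h2] := Hg m; have [h3 _] := Hg (g m).+1.
  by apply: h2; apply: leq_trans (leq_trans (ltnW _) h3); [exact: h1|].
by case: i => [|i]; exact: key.
Qed.

Lemma ffun_nondecreasing_subseq (s : nat -> {ffun 'I_n -> nat}) :
  exists t : nat -> nat, (forall i, (t i < t i.+1)%N) /\
    (forall i j, (s (t i) j <= s (t i.+1) j)%N).
Proof.
suff H (r : seq 'I_n) : exists t : nat -> nat, (forall i, (t i < t i.+1)%N) /\
    (forall i j, j \in r -> (s (t i) j <= s (t i.+1) j)%N).
  have [t [t1 t2]] := H (enum 'I_n); exists t; split=> // i j.
  by apply: t2; rewrite mem_enum.
elim: r => [|a r [t [t1 t2]]]; first by exists id; split=> // i; exact: ltnSn.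
have [t' [h1 h2]] := nat_nondecreasing_subseq (fun i => s (t i) a).
have mt i j : (i < j)%N -> (t i < t j)%N.
  by elim: j => // j IH; rewrite ltnS leq_eqVlt => /orP[/eqP ->//|/IH h]; apply: ltn_trans h _.
have mono i j k : (i <= j)%N -> k \in r -> (s (t i) k <= s (t j) k)%N.
  move=> ij kr; elim: j ij => [|j IH]; first by rewrite leqn0 => /eqP ->.
  by rewrite leq_eqVlt => /orP[/eqP ->//|/IH h]; apply: leq_trans h _; exact: t2.
exists (t \o t'); split=> [i|i j]; first exact: mt.
rewrite in_cons => /orP[/eqP ->|jr]; first exact: h2.
by apply: mono => //; exact: ltnW.
Qed.

(** Otherwise one chooses in [B], one after the other, exponents that dominate none of their
    predecessors, and a coordinatewise nondecreasing subsequence contradicts this. *)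
Lemma dickson (B : {ffun 'I_n -> nat} -> Prop) : exists V : seq {ffun 'I_n -> nat},
  (forall v, v \in V -> B v) /\
  (forall b, B b -> exists2 v, v \in V & forall i, (v i <= b i)%N).
Proof.
apply: contrapT => no.
have nx (V : seq {ffun 'I_n -> nat}) : exists b, (forall v, v \in V -> B v) ->
    B b /\ forall v, v \in V -> exists i, (b i < v i)%N.
  case: (pselect (forall v, v \in V -> B v)) => [BV|nB]; last by exists [ffun=> 0%N].
  apply: contrapT => no2; apply: no; exists V; split=> // b Bb.
  apply: contrapT => no3; apply: no2; exists b => _; split=> // v vV.
  apply: contrapT => no4; apply: no3; exists v => // i.
  by rewrite leqNgt; apply/negP => h; apply: no4; exists i.
have [g Hg] := choice nx.
pose V k := iter k (fun V => g V :: V) [::].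
have BV k v : v \in V k -> B v.
  elim: k v => [|k IH] v //=; rewrite in_cons => /orP[/eqP ->|]; last exact: IH.
  by case: (Hg (V k)) => // w; exact: IH.
pose s k := g (V k).
have sub i j : (i < j)%N -> s i \in V j.
  elim: j => // j IH; rewrite ltnS leq_eqVlt => /orP[/eqP ->|/IH h].
    by rewrite /= in_cons eqxx.
  by rewrite /= in_cons h orbT.
have [t [t1 t2]] := ffun_nondecreasing_subseq s.
have [_ H] := Hg (V (t 1%N)) (fun v => @BV _ v).
have [i hi] : exists i, (s (t 1%N) i < s (t 0%N) i)%N := H _ (sub _ _ (t1 0%N)).
by move: hi; rewrite ltnNge t2.
Qed.
End Dickson.

(** The substitute for a nonzero Taylor coefficient at [b]: it refers to [F] alone, whereas [icoef]
    depends on the grid. *)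
Definition torus_lower (F : ('I_n -> C) -> C) (sg : R) (b : {ffun 'I_n -> nat}) :=
  exists c : R, 0 < c /\ forall s : 'I_n -> R, (forall i, 0 < s i <= sg) ->
    exists u, (forall i, cabs (u i) = s i) /\ c * monom s b <= cabs (F u).

Lemma sum_box_halves K : \sum_(b : {ffun 'I_n -> 'I_K}) monom (fun=> 2^-1 : R) (fun i => b i) <= 2 ^+ n.
Proof.
rewrite /monom -(bigA_distr_bigA (fun (i : 'I_n) (m : 'I_K) => (2^-1 : R) ^+ m)) /=.
apply: le_trans (_ : \prod_(i < n) (2 : R) <= _); last by rewrite prodr_const card_ord.
apply: ler_prod => i _; rewrite sumr_ge0 /=; last by move=> m _; rewrite exprn_ge0 ?invr_ge0.
by apply: sum_halves; rewrite lexx andbT invr_ge0.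
Qed.

Lemma le_geom_all (a b k : R) : 0 <= k -> (forall K, (0 < K)%N -> a <= b + k / 2 ^+ K) -> a <= b.
Proof.
move=> k0 H; apply/ler_addgt0Pr => e e0.
have [K HK] := geom_small k e0.
apply: le_trans (H K.+1 isT) _; rewrite lerD2l; apply: le_trans (ltW HK).
rewrite exprS invfM ler_wpM2l // ler_piMl ?invr_ge0 ?exprn_ge0 //.
by rewrite invf_le1 // ler1n.
Qed.

Section Finiteness.
Variables (F : ('I_n -> C) -> C) (rb M rho : R).
Hypotheses (rho0 : 0 < rho) (sF : sepholo F rb M) (rrb : 2 * rho < rb).
Let D : R := n%:R * (2 ^+ n * (24 * M)).
Let c K := icoef rho K F.

Lemma sepholo_ge0 : 0 <= M.
Proof.
have [FM _] := sF; apply: le_trans (cabs_ge0 _) (FM (fun=> 0) _) => i.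
rewrite cabs0; apply: lt_trans rrb; exact: mulr_gt0.
Qed.

Let D0 : 0 <= D.
Proof. by rewrite !mulr_ge0 ?exprn_ge0 // sepholo_ge0. Qed.

Lemma mpoly_fun_approx K u : (0 < K)%N -> (forall i, cabs (u i) <= rho / 2) ->
  cabs (mpoly_fun K (c K) u - F u) <= D / 2 ^+ K.
Proof.
move=> K0 uu; rewrite /D.
have -> : n%:R * (2 ^+ n * (24 * M)) / 2 ^+ K = n%:R * (2 ^+ n * (24 * M / 2 ^+ K)) by ring.
by rewrite -[mpoly_fun _ _ _]hyb_poly; exact: hyb_approx sF rrb uu.
Qed.

(** If the torus bound fails, every d > 0 admits a torus on which |F| <= d s^b. On a grid [L] so
    fine that the interpolation error is also below d s^b, the Cauchy estimate bounds the
    coefficient by 2d, and the coefficients for [K] and [L] differ by O(2^-K). *)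
Lemma icoef_small K (b : {ffun 'I_n -> nat}) : ~ torus_lower F (rho / 2) b ->
  (forall i, (b i < K)%N) -> (0 < K)%N ->
  cabs (c K b) * monom (fun=> rho / 2) b <= 2 * (D / 2 ^+ K).
Proof.
move=> nB bK K0; set sg := rho / 2.
have sg0 : 0 < sg by rewrite divr_gt0.
have ms0 : 0 < monom (fun=> sg) b by apply: monom_gt0.
apply/ler_addgt0Pr => e e0.
pose d := e / 2 / monom (fun=> sg) b.
have d0 : 0 < d by rewrite !divr_gt0.
have [s [s0 Hs]] : exists s : 'I_n -> R, (forall i, 0 < s i <= sg) /\
    forall u, (forall i, cabs (u i) = s i) -> cabs (F u) <= d * monom s b.
  apply: contrapT => no; apply: nB; exists d; split=> // s s0.
  apply: contrapT => no2; apply: no; exists s; split=> // u us.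
  rewrite leNgt; apply/negP => h; apply: no2; exists u; split=> //; exact: ltW.
have ms : 0 < monom s b by apply: monom_gt0 => i; case/andP: (s0 i).
have [L0 HL0] := geom_small D (mulr_gt0 d0 ms).
pose L := maxn K L0.
have KL : (K <= L)%N by rewrite leq_maxl.
have L00 : (0 < L)%N by apply: leq_trans KL.
have DKL : D / 2 ^+ L <= D / 2 ^+ K.
  by rewrite ler_wpM2l // lef_pV2 ?posrE ?exprn_gt0 // ler_eXn2l ?ltr1n.
have DL : D / 2 ^+ L <= d * monom s b.
  apply: le_trans (ltW HL0).
  by rewrite ler_wpM2l // lef_pV2 ?posrE ?exprn_gt0 // ler_eXn2l ?ltr1n // leq_maxr.
have bL i : (b i < L)%N by apply: leq_trans (bK i) KL.
have c1 : cabs (c L b) * monom s b <= d * monom s b + d * monom s b.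
  apply: (@mpoly_coef_le L (c L)) => //; first by move=> i; case/andP: (s0 i).
  move=> u us; have uu i : cabs (u i) <= rho / 2 by rewrite us; case/andP: (s0 i).
  have -> : mpoly_fun L (c L) u = (mpoly_fun L (c L) u - F u) + F u by rewrite subrK.
  apply: le_trans (cabsD _ _) _; apply: lerD; last exact: Hs.
  by apply: le_trans (mpoly_fun_approx L00 uu) DL.
have {}c1 : cabs (c L b) <= d + d by rewrite -(ler_pM2r ms) mulrDl.
have c2 : cabs (c K b - c L b) <= (2 * (D / 2 ^+ K)) * monom (fun=> sg^-1) b.
  rewrite -{1}(icoef_poly sg0 (c K) KL bK) -{1}(icoef_poly sg0 (c L) (leqnn L) bL) -icoefB.
  apply: icoef_le => // u us.
  have uu i : cabs (u i) <= rho / 2 by rewrite us.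
  rewrite (_ : _ - _ = (mpoly_fun K (c K) u - F u) - (mpoly_fun L (c L) u - F u)); last by ring.
  apply: le_trans (cabsB _ _) _; rewrite mulr_natl mulr2n; apply: lerD.
    exact: mpoly_fun_approx.
  by apply: le_trans (mpoly_fun_approx L00 uu) DKL.
have mV : monom (fun=> sg^-1) b * monom (fun=> sg) b = 1.
  by rewrite -monomM /monom big1 // => i _; rewrite mulVf ?expr1n // gt_eqF.
have -> : c K b = (c K b - c L b) + c L b by rewrite subrK.
apply: le_trans (_ : (2 * (D / 2 ^+ K) * monom (fun=> sg^-1) b + (d + d)) * monom (fun=> sg) b <= _).
  by rewrite ler_wpM2r ?(ltW ms0) //; apply: le_trans (cabsD _ _) _; exact: lerD.
rewrite mulrDl -mulrA mV mulr1 lerD2l -mulrDl /d.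
by rewrite divfK ?gt_eqF // -splitr.
Qed.

(** Replace [F] by its interpolation polynomial of size [K], with error D/2^K. Exponents with a
    torus lower bound are absorbed by one of the finitely many of Dickson's lemma; all other
    coefficients are O(2^-K). Letting [K] grow removes the errors. *)
Theorem finite_monomial_bound : exists (V : seq {ffun 'I_n -> nat}) (B : R),
  (forall v, v \in V -> torus_lower F (rho / 4) v) /\
  (forall u, (forall i, cabs (u i) <= rho / 4) ->
     cabs (F u) <= B * \sum_(v <- V) monom (fun i => cabs (u i)) v).
Proof.
have [V [VB BV]] := dickson (torus_lower F (rho / 2)).
have M0 := sepholo_ge0; have [FM _] := sF.
(* For t_i <= rho/2 and v <= b one has (t/rho)^b <= (2t/rho)^v 2^-|b|; the last factor keeps the sum
   over [b] below 2^n. *)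
pose q v : R := M * monom (fun=> rho^-1) v * monom (fun=> 2) v.
have q0 (v : {ffun 'I_n -> nat}) : 0 <= q v.
  by rewrite !mulr_ge0 // monom_ge0 // => i; rewrite ?invr_ge0 ltW.
exists V, (2 ^+ n * \sum_(v <- V) q v); split.
  move=> v /VB[d [d0 H]]; exists d; split=> // s s0; apply: H => i.
  have /andP[-> h] := s0 i; apply: le_trans h _.
  by rewrite ler_pM2l // lef_pV2 ?posrE // ler_nat.
move=> u uu.
pose t i := cabs (u i).
have t0 i : 0 <= t i := cabs_ge0 _.
pose W := \sum_(v <- V) q v * monom t v.
have W0 : 0 <= W by apply: sumr_ge0 => v _; rewrite mulr_ge0 // monom_ge0.
apply: le_trans (_ : 2 ^+ n * W <= _); last first.
  rewrite -mulrA ler_wpM2l ?exprn_ge0 // /W mulr_suml big_seq [leRHS]big_seq.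
  apply: ler_sum => v vV; rewrite ler_wpM2l //.
  rewrite (big_rem v) //= lerDl; apply: sumr_ge0 => w _; exact: monom_ge0.
apply: (@le_geom_all _ _ ((2 ^+ n * 2 + 1) * D)).
  by rewrite mulr_ge0 // addr_ge0 // mulr_ge0 // exprn_ge0.
move=> K K0.
have uu2 i : cabs (u i) <= rho / 2.
  by apply: le_trans (uu i) _; rewrite ler_pM2l // lef_pV2 ?posrE // ler_nat.
have P1 := mpoly_fun_approx K0 uu2.
have -> : F u = mpoly_fun K (c K) u - (mpoly_fun K (c K) u - F u) by ring.
apply: le_trans (cabsB _ _) _.
have -> : 2 ^+ n * W + (2 ^+ n * 2 + 1) * D / 2 ^+ K =
  (W + 2 * (D / 2 ^+ K)) * 2 ^+ n + D / 2 ^+ K by ring.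
apply: lerD => //.
have E0 : 0 <= W + 2 * (D / 2 ^+ K) by rewrite addr_ge0 // mulr_ge0 // divr_ge0 // exprn_ge0.
apply: le_trans (_ : (W + 2 * (D / 2 ^+ K)) *
  \sum_(b : {ffun 'I_n -> 'I_K}) monom (fun=> 2^-1 : R) (fun i => b i) <= _); last first.
  by rewrite ler_wpM2l // sum_box_halves.
rewrite /mpoly_fun; apply: le_trans (cabs_sum _ _ _) _; rewrite mulr_sumr.
apply: ler_sum => b _; rewrite cabsM cabs_monom -/t.
pose b' : {ffun 'I_n -> nat} := [ffun i => b i : nat].
have b'E : (fun i => b i : nat) = b' by apply/funext => i; rewrite ffunE.
have bK i : (b' i < K)%N by rewrite ffunE.
rewrite !b'E; case: (pselect (torus_lower F (rho / 2) b')) => [Bb|nB].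
  have [v vV vb] := BV _ Bb.
  have h1 : cabs (c K b') <= M * monom (fun=> rho^-1) b'.
    apply: icoef_le => // w wr; apply: FM => i; rewrite wr.
    by apply: lt_trans rrb; rewrite mulr_natl mulr2n ltrDl.
  apply: le_trans (_ : q v * monom t v * monom (fun=> 2^-1) b' <= _); last first.
    apply: ler_wpM2r; first by apply: monom_ge0 => i; rewrite invr_ge0.
    apply: le_trans (_ : W <= _); last by rewrite lerDl mulr_ge0 // divr_ge0 // exprn_ge0.
    rewrite /W (big_rem v) //= lerDl; apply: sumr_ge0 => w _.
    by rewrite mulr_ge0 // monom_ge0.
  apply: le_trans (_ : M * monom (fun=> rho^-1) b' * monom t b' <= _).
    by rewrite ler_wpM2r // monom_ge0.
  rewrite /q -!mulrA; apply: ler_wpM2l => //; rewrite !mulrA -!monomM /monom -big_split /=.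
  apply: ler_prod => i _; rewrite exprn_ge0 /=; last by rewrite mulr_ge0 ?invr_ge0 // ltW.
  set x := rho^-1 * t i.
  have x0 : 0 <= x by rewrite mulr_ge0 ?invr_ge0 // ltW.
  have x1 : x <= 2^-1.
    rewrite /x mulrC ler_pdivrMr //; apply: le_trans (uu2 i) _; by rewrite mulrC.
  have -> : rho^-1 * 2 * t i = x * 2 by rewrite /x; ring.
  clearbody x; rewrite -(subnK (vb i)) !exprD exprMn.
  set k := (b' i - v i)%N.
  have -> : x ^+ v i * 2 ^+ v i * (2^-1 ^+ k * 2^-1 ^+ v i) =
     2^-1 ^+ k * x ^+ v i * (2 * 2^-1) ^+ v i by rewrite exprMn; ring.
  rewrite divff // expr1n mulr1 ler_wpM2r ?exprn_ge0 //.
  by rewrite lerXn2r ?nnegrE ?invr_ge0.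
have h := icoef_small nB bK K0.
have tt : monom t b' <= monom (fun=> rho / 2) b' * monom (fun=> 2^-1) b'.
  rewrite -monomM /monom; apply: ler_prod => i _; rewrite exprn_ge0 //= lerXn2r ?nnegrE //.
    by rewrite mulr_ge0 ?invr_ge0 // divr_ge0 // ltW.
  by apply: le_trans (uu i) _; rewrite -mulrA ler_pM2l //; lra.
apply: le_trans (_ : cabs (c K b') * (monom (fun=> rho / 2) b' * monom (fun=> 2^-1) b') <= _).
  by rewrite ler_wpM2l // cabs_ge0.
rewrite [leLHS]mulrA; apply: ler_wpM2r; first by apply: monom_ge0 => i; rewrite invr_ge0.
by apply: le_trans h _; rewrite lerDr.
Qed.
End Finiteness.

End Multi.

(** * Holomorphic germs of a vector variable *)

Section Holo.
Variable R : realType.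
Local Notation C := R[i].
Variable n : nat.
Local Notation Cn := 'rV[C]_n.
Local Notation CnN := (NormedModule.clone C Cn _).

Lemma differentiable_slice (f : Cn -> C) (a v : Cn) :
  differentiable (f : CnN -> C^o) (a : CnN) -> cdiff (fun h => f (a + h *: v)) 0.
Proof.
move=> df.
have /cvg_ex[A /cvgrPdist_le HA] := @diff_derivable C CnN C^o f a v df.
exists A => e e0.
have e0' : 0 < (e%:C)%C :> C by rewrite ltcR.
have := HA _ e0'; rewrite near_withinE => /nbhs_ballP[d d0 H].
exists (complex.Re d).
move: d0; rewrite /= ltcE /= => /andP[/eqP d1 d2]; split=> // h hd.
have [->|h0] := eqVneq h 0.
  by rewrite addr0 subrr mulr0 subr0 cabs0 mulr0.
have bh : ball (0 : C^o) d h.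
  rewrite -ball_normE /= sub0r normrN cabsE ltcE /= d1 eqxx /=.
  exact: hd.
have := H h bh h0; rewrite cabsE lecR /= => Hh.
rewrite -cabsN opprB add0r scale0r addr0.
have -> : A * h - (f (a + h *: v) - f a) = (A - h^-1 *: (f (h *: v + a) - f a)) * h.
  rewrite mulrBl; congr (_ - _); rewrite (addrC (h *: v)).
  by rewrite -[h^-1 *: _]/(h^-1 * (f (a + h *: v) - f a)) mulrAC mulVf // mul1r.
by rewrite cabsM ler_wpM2r // cabs_ge0.
Qed.

Lemma differentiable_locally_bounded (f : Cn -> C) (a : Cn) :
  differentiable (f : CnN -> C^o) (a : CnN) ->
  exists d : R, 0 < d /\ forall z, polydisk a d z -> cabs (f z) <= cabs (f a) + 1.
Proof.
move=> /differentiable_continuous /cvgrPdist_le /(_ _ (ltr01 : 0 < 1 :> C)) /nbhs_ballP[d d0 H].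
move: (d0); rewrite /= ltcE /= => /andP[/eqP d1 d2].
exists (complex.Re d); split=> // z hz.
have : ball (a : CnN) d z.
  split=> // i j; rewrite ord1 -ball_normE /= distrC cabsE ltcE /= d1 eqxx /=.
  exact: hz.
move=> /H; rewrite /= cabsE -[1]/(1%:C)%C lecR => h.
rewrite (_ : f z = f a - (f a - f z)); last by ring.
by apply: le_trans (cabsB _ _) _; rewrite lerD2l.
Qed.

Definition rowf (T : Type) (u : 'I_n -> T) : 'rV[T]_n := \row_j u j.

Lemma holo_sepholo (f : Cn -> C) (x : Cn) (r : R) : 0 < r -> holo (polydisk x r) f ->
  exists rb M, [/\ 0 < rb, rb <= r & sepholo (fun u => f (x + rowf u)) rb M].
Proof.
move=> r0 hf.
have hx : polydisk x r x by move=> j; rewrite subrr cabs0.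
have [d [d0 Hd]] := differentiable_locally_bounded (hf x hx).
exists (Num.min d r), (cabs (f x) + 1); split; first by rewrite lt_min d0.
  by rewrite ge_min lexx orbT.
split=> [u hu|u j hu w hw].
  apply: Hd => j; rewrite !mxE (addrC (x 0 j)) addrK.
  by apply: lt_le_trans (hu j) _; rewrite ge_min lexx.
have ha : polydisk x r (x + rowf (upd u j w)).
  move=> i; rewrite !mxE (addrC (x 0 i)) addrK /upd; case: eqP => _.
    by apply: lt_le_trans hw _; rewrite ge_min lexx orbT.
  by apply: lt_le_trans (hu i) _; rewrite ge_min lexx orbT.
have [A HA] := differentiable_slice (delta_mx 0 j) (hf _ ha).
exists A => e e0; have [k [k0 Hk]] := HA e e0; exists k; split=> // h hk.
have := Hk h hk; rewrite add0r scale0r addr0.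
suff -> : x + rowf (upd u j w) + h *: delta_mx 0 j = x + rowf (upd u j (w + h)) by [].
apply/rowP => i; rewrite !mxE eqxx /= -addrA; congr (_ + _).
by rewrite /upd; case: eqP => _; rewrite ?mulr1 ?mulr0 ?addr0.
Qed.

Lemma holo_sub (S S' : set Cn) (f : Cn -> C) : S `<=` S' -> holo S' f -> holo S f.
Proof. by move=> SS hf a /SS /hf. Qed.

Lemma holo_monom (b : 'I_n -> nat) (S : set Cn) :
  holo S (fun z => monom (fun i => z 0 i) b).
Proof.
move=> a _; rewrite /monom.
elim: (index_enum _) => [|i s IH].
  under [fun z => _]funext do rewrite big_nil.
  exact: differentiable_cst.
under [fun z => _]funext do rewrite big_cons.
apply: (@differentiableM C CnN (fun z => z 0 i ^+ b i) _ _ _ IH).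
elim: (b i) => [|k IHk].
  by under [fun z => _]funext do rewrite expr0; exact: differentiable_cst.
under [fun z => _]funext do rewrite exprS.
apply: (@differentiableM C CnN (fun z : Cn => z 0 i) _ _ _ IHk).
exact: differentiable_coord.
Qed.

(* The local description of a holomorphic germ: near [x] it is dominated by finitely
   many monomials, each of which is also a lower bound on some point of every small
   torus centred at [x]. *)
Definition monomial_size (F : ('I_n -> C) -> C) (rho : R) (V : seq {ffun 'I_n -> nat})
    (B : R) : Prop :=
  [/\ 0 < rho, exists M, sepholo F (2 * rho) M,
    forall v, v \in V -> torus_lower F rho v &
    forall u : 'I_n -> C, (forall i, cabs (u i) <= rho) ->
     cabs (F u) <= B * \sum_(v <- V) monom (fun i => cabs (u i)) v].

Lemma sepholo_sub F (rb rb' M : R) : rb' <= rb -> sepholo F rb M -> @sepholo R n F rb' M.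
Proof.
move=> le [h1 h2]; split=> [u hu|u j hu w hw].
  by apply: h1 => i; apply: lt_le_trans (hu i) le.
apply: h2; last exact: lt_le_trans hw le.
by move=> i; apply: lt_le_trans (hu i) le.
Qed.

Theorem holo_local (f : Cn -> C) (x : Cn) (r : R) : 0 < r -> holo (polydisk x r) f ->
  exists (rho : R) (V : seq {ffun 'I_n -> nat}) (B : R),
    monomial_size (fun u => f (x + rowf u)) rho V B.
Proof.
move=> r0 hf; have [rb [M [rb0 rbr sF]]] := holo_sepholo r0 hf.
have [V [B [H1 H2]]] := finite_monomial_bound (divr_gt0 rb0 (ltr0Sn _ 2)) sF ltac:(lra).
exists (rb / 3 / 4), V, B; split=> //; first by rewrite !divr_gt0.
by exists M; apply: sepholo_sub sF; lra.
Qed.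

Lemma monom_local (b : {ffun 'I_n -> nat}) :
  exists rho : R, monomial_size (fun u => monom u b) rho [:: b] 1.
Proof.
have hm := @holo_monom b (polydisk 0 1).
have [rb [M [rb0 _ sF]]] := holo_sepholo ltr01 hm.
have e : (fun u => monom (fun i => (0 + rowf u) 0 i) b) = (fun u : 'I_n -> C => monom u b).
  by apply/funext => u; congr monom; apply/funext => i; rewrite !mxE add0r.
rewrite e in sF.
exists (rb / 2); split; first exact: divr_gt0.
- by exists M; rewrite mulrC divfK.
- move=> v; rewrite mem_seq1 => /eqP ->; exists 1; split=> // s s0.
  exists (fun i => Complex (s i) 0); split.
    by move=> i; rewrite cabs_real gtr0_norm //; case/andP: (s0 i).
  rewrite mul1r cabs_monom; apply: ler_prod => i _.
  have /andP[h _] := s0 i.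
  by rewrite exprn_ge0 ?(ltW h) //= cabs_real gtr0_norm.
- by move=> u _; rewrite big_seq1 mul1r cabs_monom.
Qed.

(** The variables are changed one at a time, each in the disc of radius s_j about [u0 j]. The bound
    [M'] is taken on the polydisk of radii 2s, which makes the estimate invariant under scaling. *)
Lemma sepholo_lipschitz (F : ('I_n -> C) -> C) (rb M M' k : R) (s : 'I_n -> R) (u0 u : 'I_n -> C) :
  sepholo F rb M -> (forall i, 0 < s i) -> (forall i, 2 * s i <= rb) ->
  (forall i, cabs (u0 i) = s i) ->
  (forall w, (forall i, cabs (w i) <= 2 * s i) -> cabs (F w) <= M') ->
  0 <= k <= 1 / 4 -> (forall i, cabs (u i - u0 i) <= k * s i) ->
  cabs (F u - F u0) <= n%:R * (32 * M' * k).
Proof.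
move=> [_ dF] s0 srb us FM' /andP[k0 k4] uu.
pose y m (i : 'I_n) := if (i < m)%N then u i else u0 i.
have y0 : y 0%N = u0 by [].
have yn : y n = u by apply/funext => i; rewrite /y ltn_ord.
have ks i : k * s i <= s i / 4 by have := s0 i; nra.
have ys m i : cabs (y m i) <= 5 / 4 * s i.
  rewrite /y; case: ifP => _; last by rewrite us; have := s0 i; lra.
  rewrite -(subrK (u0 i) (u i)); apply: le_trans (cabsD _ _) _; rewrite us.
  by have := uu i; have := ks i; have := s0 i; lra.
have yrb m i : cabs (y m i) < rb.
  by have := ys m i; have := srb i; have := s0 i; lra.
suff H m : (m <= n)%N -> cabs (F (y m) - F (y 0%N)) <= m%:R * (32 * M' * k).
  by rewrite -yn -y0; exact: H.
elim: m => [|m IH] mn; first by rewrite subrr cabs0 mul0r.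
rewrite (_ : F (y m.+1) - F (y 0%N) = (F (y m) - F (y 0%N)) + (F (y m.+1) - F (y m))); last by ring.
apply: le_trans (cabsD _ _) _; rewrite -natr1 mulrDl mul1r.
apply: lerD; first exact: IH (ltnW mn).
pose j := Ordinal mn.
have e1 : y m.+1 = upd (y m) j (u j).
  apply/funext => i; rewrite /y /upd; case: eqP => [->|/eqP ij]; first by rewrite /= ltnSn.
  by rewrite ltnS leq_eqVlt (_ : ((i : nat) == m) = false) //; apply/negbTE; exact: ij.
have e2 : y m = upd (y m) j (u0 j).
  by rewrite -[X in upd _ _ X](_ : y m j = _) ?upd_id // /y /= ltnn.
rewrite e1 [in X in _ - X]e2.
have M'0 : 0 <= M'.
  apply: le_trans (cabs_ge0 _) (FM' (fun=> 0) _) => i; rewrite cabs0.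
  by rewrite mulr_ge0 // ltW.
have rr : 0 < s j / 2 < s j by have := s0 j; lra.
have dsc w : cabs (w - u0 j) < s j -> cabs w < 2 * s j.
  move=> h; rewrite -(subrK (u0 j) w); apply: le_lt_trans (cabsD _ _) _.
  by rewrite us; lra.
have := @cauchy_lipschitz R (fun w => F (upd (y m) j w)) (s j) M' (u0 j) (u j) (s j / 2) _ _ rr.
move=> H; apply: le_trans (H _ _ _) _.
- by move=> w hw; apply: dF => //; apply: lt_le_trans (dsc w hw) (srb j).
- move=> w hw; apply: FM' => i; rewrite /upd; case: eqP => [->|_]; first exact/ltW/dsc.
  by apply: le_trans (ys m i) _; have := s0 i; lra.
- by have := uu j; have := ks j; lra.
have -> : 32 * M' * k = 16 * M' * (k * 2) by ring.
apply: ler_wpM2l; first by rewrite mulr_ge0.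
rewrite ler_pdivrMr ?divr_gt0 //; apply: le_trans (uu j) _.
by rewrite mulrACA mulrA mulfK //; lra.
Qed.

Lemma uniform_pos (T : eqType) (V : seq T) (P : T -> R -> Prop) :
  (forall v, v \in V -> exists c, 0 < c /\ P v c) ->
  (forall v c c', 0 < c' <= c -> P v c -> P v c') ->
  exists c, 0 < c /\ forall v, v \in V -> P v c.
Proof.
move=> H mono; elim: V H => [|v V IH] H; first by exists 1.
have [c [c0 Hc]] := IH (fun w wV => H w (mem_behead (s := v :: V) wV)).
have [d [d0 Hd]] := H v (mem_head _ _).
have m0 : 0 < Num.min c d by rewrite lt_min c0.
exists (Num.min c d); split=> // w; rewrite in_cons => /orP[/eqP ->|wV].
  by apply: mono Hd; rewrite m0 ge_min lexx orbT.
by apply: mono (Hc w wV); rewrite m0 ge_min lexx.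
Qed.

Lemma argmax_seq (T : eqType) (V : seq T) (q : T -> R) v0 : v0 \in V ->
  exists2 w, w \in V & forall v, v \in V -> q v <= q w.
Proof.
elim: V v0 => // a V IH v0 _; case: V IH => [|b V] IH.
  by exists a; rewrite ?mem_head // => v; rewrite mem_seq1 => /eqP ->.
have [w wV Hw] := IH b (mem_head _ _).
have [aw|wa] := leP (q a) (q w).
  exists w; first by rewrite in_cons wV orbT.
  by move=> v; rewrite in_cons => /orP[/eqP ->|/Hw].
exists a; first exact: mem_head.
by move=> v; rewrite in_cons => /orP[/eqP ->|/Hw h] //; apply: le_trans h (ltW wa).
Qed.

(** The estimate is made with the exponent [w] of [V] that maximises s^w rather than with [v]: |F|
    is at least c s^w at some point of the torus and O(s^w) on the polydisk of radii 2s, so that the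
    scale-invariant Lipschitz bound keeps half of c s^w, hence of c s^v, on a box of relative size
    [k]. *)
Lemma torus_box F (rho B : R) V (v : {ffun 'I_n -> nat}) : monomial_size F rho V B -> v \in V ->
  exists c k : R, [/\ 0 < c, 0 < k <= 1 / 4 & forall s : 'I_n -> R,
    (forall i, 0 < s i <= rho / 2) -> exists u0 : 'I_n -> C, (forall i, cabs (u0 i) = s i) /\
    forall u, (forall i, cabs (u i - u0 i) <= k * s i) -> c * monom s v <= cabs (F u)].
Proof.
move=> [rho0 [M sF] lo up] vV.
have [c [c0 Hc]] : exists c, 0 < c /\ forall w, w \in V -> forall s : 'I_n -> R, (forall i, 0 < s i <= rho) ->
    exists u, (forall i, cabs (u i) = s i) /\ c * monom s w <= cabs (F u).
  apply: uniform_pos => [w /lo //|w a a' /andP[a0 aa] H s s0].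
  have [u [us h]] := H s s0; exists u; split=> //; apply: le_trans h.
  by rewrite ler_wpM2r // monom_ge0 // => i; have /andP[/ltW] := s0 i.
pose K := \sum_(w <- V) monom (fun=> 2 : R) w.
have K0 : 0 <= K by apply: sumr_ge0 => w _; apply: monom_ge0.
pose N : R := (size V)%:R.
have N0 : 0 <= N by [].
pose Q := n%:R * (32 * (`|B| * (K * N))).
have Q0 : 0 <= Q by rewrite !mulr_ge0.
pose k := Num.min (1 / 4) (c / 2 / (1 + Q)).
have k0 : 0 < k by rewrite lt_min !divr_gt0 // ltr_wpDr.
have k4 : k <= 1 / 4 by rewrite ge_min lexx.
have kQ : Q * k <= c / 2.
  have : k <= c / 2 / (1 + Q) by rewrite ge_min lexx orbT.
  rewrite ler_pdivlMr ?ltr_wpDr // mulrDr mulr1 mulrC; lra.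
clearbody k.
exists (c / 2), k; split; rewrite ?k0 ?divr_gt0 // => s s0.
have sp i : 0 < s i by have /andP[] := s0 i.
have sr i : s i <= rho / 2 by have /andP[] := s0 i.
have [w wV Hw] := argmax_seq (fun w : {ffun 'I_n -> nat} => monom s w) vV.
have [u0 [us h0]] := Hc w wV s ltac:(by move=> i; rewrite sp; have := sr i; lra).
exists u0; split=> // u uu.
have mw0 : 0 < monom s w by exact: monom_gt0.
pose S (t : 'I_n -> R) := \sum_(v <- V) monom t v.
have SN : S s <= N * monom s w.
  rewrite /S big_seq; apply: le_trans (ler_sum _ (fun v vV => Hw v vV)) _.
  by rewrite -big_seq big_const_seq count_predT iter_addr_0 mulr_natl.
have S2 : S (fun i => 2 * s i) <= K * S s.
  rewrite /S mulr_sumr big_seq [leRHS]big_seq; apply: ler_sum => z zV.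
  rewrite monomM ler_wpM2r //; first by apply: monom_ge0 => i; exact: ltW.
  rewrite /K (big_rem z) //= lerDl; apply: sumr_ge0 => y _; exact: monom_ge0.
have FM' z : (forall i, cabs (z i) <= 2 * s i) -> cabs (F z) <= `|B| * (K * N) * monom s w.
  move=> hz; apply: le_trans (up z _) _.
    by move=> i; apply: le_trans (hz i) _; have := sr i; lra.
  have p0 : 0 <= \sum_(v <- V) monom (fun i => cabs (z i)) v.
    by apply: sumr_ge0 => y _; apply: monom_ge0 => i; exact: cabs_ge0.
  apply: le_trans (ler_wpM2r p0 (ler_norm B)) _; rewrite -mulrA ler_wpM2l //.
  rewrite -mulrA; apply: le_trans (ler_wpM2l K0 SN); apply: le_trans S2.
  apply: ler_sum => y _; apply: ler_prod => i _; rewrite exprn_ge0 ?cabs_ge0 //=.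
  by rewrite lerXn2r ?nnegrE ?cabs_ge0 ?mulr_ge0 // ltW.
have srb i : 2 * s i <= 2 * rho by have := sr i; have := rho0; lra.
have kk : 0 <= k <= 1 / 4 by rewrite (ltW k0).
have := sepholo_lipschitz sF sp srb us FM' kk uu.
rewrite (_ : n%:R * _ = Q * k * monom s w); last by rewrite /Q; ring.
move=> L; have := cabs_lower (F u0) (F u - F u0); rewrite (addrC (F u0)) subrK => h1.
have h2 : Q * k * monom s w <= c / 2 * monom s w by rewrite ler_wpM2r // ltW.
have h3 : c / 2 * monom s v <= c / 2 * monom s w.
  by apply: ler_wpM2l; [rewrite divr_ge0 // ltW|exact: Hw].
lra.
Qed.
End Holo.

(** * Convexity of the function associated to a toric psh function *)

Section LogSeries.
Variable R : realType.
Local Notation C := R[i].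
Local Notation Rez := complex.Re.
Local Notation Imz := complex.Im.

Lemma Re_sum (I : Type) (s : seq I) (F : I -> C) :
  Rez (\sum_(i <- s) F i) = \sum_(i <- s) Rez (F i).
Proof. by elim: s => [|i s IH]; rewrite ?big_nil // !big_cons ReD IH. Qed.

Lemma is_derive_ln_cmod2 (v : C) (x : R) : 0 < cmod2 (1 - Complex x 0 * v) ->
  is_derive x 1 (fun x : R => 2^-1 * ln (cmod2 (1 - Complex x 0 * v)))
    (Rez (- v / (1 - Complex x 0 * v))).
Proof.
case: v => a b N0.
have dl (c d : R) : is_derive x 1 (fun x : R => c + d * x) d.
  have h := is_deriveD (is_derive_cst c x (1 : R)) (is_deriveZ d (is_derive_id x (1 : R))).
  apply: is_derive_eq h _.
  by rewrite add0r -[d *: _]/(d * 1) mulr1.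
have h := is_deriveD (is_deriveM (dl 1 (- a)) (dl 1 (- a))) (is_deriveM (dl 0 (- b)) (dl 0 (- b))).
pose N (x : R) := (1 + (- a) * x) * (1 + (- a) * x) + (0 + (- b) * x) * (0 + (- b) * x).
have NE : (fun x : R => cmod2 (1 - Complex x 0 * Complex a b)) = N.
  by apply/funext => y; rewrite /cmod2 /N /=; ring.
have Nx : 0 < N x by rewrite -NE.
have h2 := is_deriveZ (2^-1 : R) (@is_derive1_comp R (@ln R) N x _ _ (is_derive1_ln Nx) h).
have -> : (fun x : R => 2^-1 * ln (cmod2 (1 - Complex x 0 * Complex a b))) = 2^-1 \*: (@ln R \o N).
  by apply/funext => y; rewrite -NE.
apply: is_derive_eq h2 _.
rewrite -[2^-1 *: _]/(2^-1 * ((N x)^-1 * (((1 + - a * x) * - a + (1 + - a * x) * - a) + ((0 + - b * x) * - b + (0 + - b * x) * - b)))).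
have Nx0 : N x != 0 by rewrite gt_eqF.
have M0 : (1 - x * a) ^+ 2 + (x * b) ^+ 2 != 0.
  by apply: contra_neq Nx0 => <-; rewrite /N; ring.
have NM : N x = (1 - x * a) ^+ 2 + (x * b) ^+ 2 by rewrite /N; ring.
rewrite NM /= !mul0r !subr0 !addr0 !sub0r ?sqrrN.
by field.
Qed.

(** Apply the mean value theorem on [0, 1] to ln |1 - xv| plus the partial sum of its series: the
    derivative is the real part of the tail of a geometric series. *)
Lemma log_series (v : C) (q : R) K : cabs v <= q -> q < 1 ->
  `|ln (cabs (1 - v)) + \sum_(k < K) Rez (v ^+ k.+1) / k.+1%:R| <= q ^+ K.+1 / (1 - q).
Proof.
move=> vq q1; have q0 : 0 <= q by exact: le_trans (cabs_ge0 _) vq.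
have c1 (x : R) : 0 <= x <= 1 -> 1 - q <= cabs (1 - Complex x 0 * v).
  move=> /andP[x0 x1]; have := cabs_lower 1 (- (Complex x 0 * v)).
  rewrite cabs1 cabsN cabsM cabs_real ger0_norm //.
  have : x * cabs v <= 1 * q by apply: ler_pM => //; exact: cabs_ge0.
  lra.
pose F (x : R) := 2^-1 * ln (cmod2 (1 - Complex x 0 * v)) +
   \sum_(k < K) Rez (v ^+ k.+1) / k.+1%:R * x ^+ k.+1.
pose dF (x : R) := Rez (- v / (1 - Complex x 0 * v)) + \sum_(k < K) Rez (v ^+ k.+1) * x ^+ k.
have N0 (x : R) : 0 <= x <= 1 -> 0 < cmod2 (1 - Complex x 0 * v).
  by move=> /c1 h; rewrite cmod2_cabs exprn_gt0 //; lra.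
have derF (x : R) : 0 <= x <= 1 -> is_derive x 1 F (dF x).
  move=> h; have h1 := is_derive_ln_cmod2 (N0 x h).
  pose G (k : 'I_K) : R -> R := (Rez (v ^+ k.+1) / k.+1%:R) \*: (id ^+ k.+1).
  have h2 (k : 'I_K) : is_derive x 1 (G k) (Rez (v ^+ k.+1) * x ^+ k).
    apply: is_derive_eq (is_deriveZ _ (is_deriveX k.+1 (is_derive_id x (1 : R)))) _.
    rewrite -[_ *: _]/(Rez (v ^+ k.+1) / k.+1%:R * (k.+1%:R * x ^+ k * 1)).
    by rewrite mulr1 mulrA divfK // pnatr_eq0.
  have := is_deriveD h1 (is_derive_sum h2).
  suff -> : F = (fun x : R => 2^-1 * ln (cmod2 (1 - Complex x 0 * v))) + \sum_(k < K) G k by [].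
  apply/funext => y; rewrite /F [in RHS]/GRing.add /=; congr (_ + _).
  by rewrite fct_sumE; apply: eq_bigr => k _; rewrite /G exprfctE.
have [c] : exists2 c, c \in `]0, 1[ & F 1 - F 0 = dF c * (1 - 0).
  apply: (@MVT R F dF 0 1 ltr01).
    by move=> x; rewrite in_itv /= => /andP[h1 h2]; apply: derF; rewrite !ltW.
  apply: derivable_within_continuous => x; rewrite in_itv /= => h.
  by have [] := derF x h.
rewrite in_itv /= subr0 mulr1 => /andP[x0 x1].
have -> : F 0 = 0.
  rewrite /F mul0r subr0 (_ : cmod2 1 = 1) ?ln1 ?mulr0 ?add0r; last first.
    by rewrite cmod2_cabs cabs1 expr1n.
  by rewrite big1 // => k _; rewrite expr0n mulr0.
have -> : F 1 = ln (cabs (1 - v)) + \sum_(k < K) Rez (v ^+ k.+1) / k.+1%:R.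
  have v1 : Complex 1 0 * v = v by rewrite mul1r.
  have p1 : 0 < cabs (1 - v).
    by rewrite -v1; apply: lt_le_trans (c1 1 _); [lra|rewrite ler01 lexx].
  rewrite /F v1 cmod2_cabs expr2 lnM ?posrE //; congr (_ + _); first by field.
  by apply: eq_bigr => k _; rewrite expr1n mulr1.
rewrite subr0 => ->.
have w1 : 1 - Complex c 0 * v != 0.
  rewrite -cabs_gt0; apply: lt_le_trans (c1 c _); [lra|by rewrite !ltW].
have -> : dF c = Rez (- v * (Complex c 0 * v) ^+ K / (1 - Complex c 0 * v)).
  rewrite /dF [in LHS](geom_split K w1) mulrDr ReD addrAC.
  suff -> : Rez (- v * \sum_(k < K) (Complex c 0 * v) ^+ k) +
     \sum_(k < K) Rez (v ^+ k.+1) * c ^+ k = 0 by rewrite add0r mulrA.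
  rewrite mulr_sumr Re_sum -big_split /= big1 // => k _.
  rewrite exprMn mulNr ReN mulrCA -exprS -[Complex c 0 ^+ k](rmorphXn (real_complex R)) /=.
  by rewrite ReM /= mul0r subr0 mulrC addNr.
apply: le_trans (Re_le_cabs _) _; rewrite !cabsM cabsN cabsV cabsX cabsM cabs_real.
rewrite gtr0_norm // exprS.
have cv0 : 0 <= c * cabs v by rewrite mulr_ge0 ?cabs_ge0 // ltW.
have cq : c * cabs v <= q.
  by apply: le_trans vq; rewrite ler_piMl ?cabs_ge0 // ltW.
apply: ler_pM.
- by rewrite mulr_ge0 ?cabs_ge0 // exprn_ge0.
- by rewrite invr_ge0 cabs_ge0.
- by apply: ler_pM; rewrite ?cabs_ge0 ?exprn_ge0 // lerXn2r ?nnegrE.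
- rewrite lef_pV2 ?posrE ?cabs_gt0 ?subr_gt0 //; apply: c1; rewrite !ltW //.
Qed.

Lemma ctsI_Re_mul (a b : R) (z : C) k : ctsI a b (fun t => Rez (z * expi t ^+ k)).
Proof.
have -> : (fun t => Rez (z * expi t ^+ k)) =
    (fun t => Rez z * cos (k%:R * t) - Imz z * sin (k%:R * t)).
  by apply/funext => t; rewrite expiX ReM.
by apply: ctsIB; apply: ctsIM; (exact: ctsIc || exact: ctsI_cos_mul || exact: ctsI_sin_mul).
Qed.

Lemma rint_Re_mul (z : C) k : (0 < k)%N -> rint 0 (2 * pi) (fun t => Rez (z * expi t ^+ k)) = 0.
Proof.
move=> k0; rewrite (@eq_rint _ _ _ _ (fun t => Rez z * cos (k%:R * t) - Imz z * sin (k%:R * t))).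
  rewrite rintB; try by apply: ctsIM; (exact: ctsIc || exact: ctsI_cos_mul || exact: ctsI_sin_mul).
  rewrite !rintZ ?ctsI_cos_mul ?ctsI_sin_mul //; try (exact: ctsI_cos_mul || exact: ctsI_sin_mul).
  have := @rint_cos R 0 k k0; have := @rint_sin R 0 k k0; rewrite add0r => -> ->.
  by rewrite !mulr0 subrr.
by move=> t _; rewrite expiX ReM.
Qed.

Lemma ctsI_ln_cabs (a b : R) (z : C) : cabs z < 1 ->
  ctsI a b (fun t => ln (cabs (1 - z * expi t))).
Proof.
move=> z1 t _.
have pos s : 0 < cabs (1 - z * expi s).
  have := cabs_lower 1 (- (z * expi s)).
  by rewrite cabs1 cabsN cabsM cabs_expi mulr1; lra.
have H : {for t, continuous (fun s => cmod2 (1 - z * expi s))}.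
  have -> : (fun s => cmod2 (1 - z * expi s)) = (fun s => (1 + cmod2 z) - 2 * Rez (z * expi s ^+ 1)).
    apply/funext => s; have := cos2Dsin2 s; rewrite expr1 /cmod2 !(ReD, ImD, ReN, ImN, ReM, ImM) /=.
    move=> h; transitivity (1 + (Rez z ^+ 2 + Imz z ^+ 2) * (cos s ^+ 2 + sin s ^+ 2)
      - 2 * (Rez z * cos s - Imz z * sin s)); [ring|by rewrite h mulr1].
  apply: continuousB; first exact: cst_continuous.
  apply: continuousM; first exact: cst_continuous.
  exact: (@ctsI_Re_mul t t z 1%N t ltac:(by rewrite lexx)).
apply: continuous_comp; last exact: continuous_ln.
by apply: continuous_comp => //; exact: sqrt_continuous.
Qed.

(** In the logarithmic series every positive power of e^{it} has mean zero, and the remainder tends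
    to zero uniformly. *)
Lemma ln_cabs_mean (z : C) : cabs z < 1 ->
  rint 0 (2 * pi) (fun t => ln (cabs (1 - z * expi t))) = 0.
Proof.
move=> z1; have p0 : 0 < pi :> R := pi_gt0 R.
have z0 := cabs_ge0 z.
apply/eqP; rewrite -normr_eq0 eq_le normr_ge0 andbT.
apply/ler_addgt0Pr => e e0; rewrite add0r.
have [K HK] : exists K, cabs z ^+ K.+1 / (1 - cabs z) * (2 * pi) <= e.
  have c0 : 0 < e * (1 - cabs z) / (2 * pi) by rewrite divr_gt0 ?mulr_gt0 // subr_gt0.
  have := @cvg_expr R (cabs z); rewrite ger0_norm // => /(_ z1) /cvgrPdist_le /(_ _ c0) [K _ HK].
  exists K; have := HK K.+1 (leqnSn _); rewrite sub0r normrN ger0_norm ?exprn_ge0 //.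
  by rewrite ler_pdivlMr ?mulr_gt0 // mulrAC ler_pdivrMr // subr_gt0.
pose S t := \sum_(k < K) Rez ((z * expi t) ^+ k.+1) / k.+1%:R.
have cS (k : nat) : ctsI 0 (2 * pi) (fun t => Rez ((z * expi t) ^+ k.+1) / k.+1%:R).
  apply: ctsIM; last exact: ctsIc.
  by under [fun t => _]funext do rewrite exprMn; exact: ctsI_Re_mul.
have cS' : ctsI 0 (2 * pi) S by apply: ctsI_sum => k; exact: cS.
have cl := @ctsI_ln_cabs 0 (2 * pi) z z1.
have -> : rint 0 (2 * pi) (fun t => ln (cabs (1 - z * expi t))) =
   rint 0 (2 * pi) (fun t => ln (cabs (1 - z * expi t)) + S t).
  rewrite rintD // [X in _ = _ + X](_ : _ = 0) ?addr0 //.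
  rewrite /S rint_sum //; last by rewrite mulr_ge0 // ltW.
  rewrite big1 // => k _.
  rewrite (@eq_rint _ _ _ _ (fun t => k.+1%:R^-1 * Rez (z ^+ k.+1 * expi t ^+ k.+1))).
    by rewrite rintZ ?rint_Re_mul ?mulr0 //; exact: ctsI_Re_mul.
  by move=> t _; rewrite exprMn mulrC.
apply: le_trans HK; rewrite -[X in _ <= _ * X]subr0; apply: rint_norm_le.
- by rewrite mulr_ge0 // ltW.
- exact: ctsID.
- move=> t _; apply: log_series => //; by rewrite cabsM cabs_expi mulr1.
Qed.

Lemma ln_cabs_quadratic (x t : R) : `|x| <= 1 / 2 ->
  `|ln (cabs (1 + Complex x 0 * expi t)) - (x * cos t - x ^+ 2 * cos (2 * t) / 2)| <= 2 * `|x| ^+ 3.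
Proof.
move=> x2; have h : cabs (- (Complex x 0 * expi t)) <= `|x|.
  by rewrite cabsN cabsM cabs_expi cabs_real mulr1.
have x1 : `|x| < 1 by lra.
have := log_series 2 h x1.
rewrite opprK !big_ord_recl big_ord0 addr0.
have -> : (- (Complex x 0 * expi t)) ^+ 2 = Complex (x ^+ 2) 0 * expi (2 * t).
  by rewrite sqrrN exprMn expiX -[Complex x 0 ^+ 2](rmorphXn (real_complex R)).
rewrite expr1 ReN !ReM /= !mul0r !subr0 divr1 => h2.
have -> : ln (cabs (1 + Complex x 0 * expi t)) - (x * cos t - x ^+ 2 * cos (2 * t) / 2) =
  ln (cabs (1 + Complex x 0 * expi t)) + (- (x * cos t) + x ^+ 2 * cos (2 * t) / 2) by ring.
apply: le_trans h2 _; rewrite mulrC; apply: ler_wpM2r; first by rewrite exprn_ge0.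
rewrite -[2]invrK lef_pV2 ?posrE //; lra.
Qed.
End LogSeries.

(** * Toric functions in logarithmic coordinates *)

Section Toric.
Variable R : realType.
Local Notation C := R[i].
Local Notation Rez := complex.Re.
Local Notation Imz := complex.Im.
Variable n : nat.
Local Notation Cn := 'rV[C]_n.
Local Notation Rn := 'rV[R]_n.

(** Without a maximum, the superlevel sets of the values of [G] on [K] generate a filter along which
    every point of [K] is eventually exceeded nearby; the near form of compactness then gives G p <
    G p for some p. *)
Lemma usc_max (T : topologicalType) (K : set T) (G : T -> \bar R) : compact K -> K !=set0 ->
  (forall p, K p -> forall t : \bar R, (G p < t)%E -> \forall q \near p, (G q < t)%E) ->
  exists2 p, K p & forall q, K q -> (G q <= G p)%E.
Proof.
move=> cK [k0 Kk0] usc; apply: contrapT => no.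
have nx p : K p -> exists2 q, K q & (G p < G q)%E.
  move=> Kp; apply: contrapT => no2; apply: no; exists p => // q Kq.
  by rewrite leNgt; apply/negP => h; apply: no2; exists q.
pose F : set_system T := [set A | exists2 p, K p & forall q, K q -> (G p <= G q)%E -> A q].
have FF : Filter F.
  split.
  - by exists k0.
  - move=> A B [a Ka HA] [b Kb HB].
    have [ab|ba] := leP (G a) (G b).
      by exists b => // q Kq bq; split; [apply: HA => //; exact: le_trans ab bq|exact: HB].
    by exists a => // q Kq aq; split; [exact: HA|apply: HB => //; exact: le_trans (ltW ba) aq].
  - by move=> A B AB [a Ka HA]; exists a => // q Kq h; apply: AB; exact: HA.
have := (compact_near_coveringP K).1 cK T F (fun i x => (G x < G i)%E) FF.
case.
  move=> x Kx; have [q Kq xq] := nx x Kx.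
  exists ([set x' | (G x' < G q)%E], [set i | (G q <= G i)%E]) => /=.
    by split; [exact: usc|exists q].
  by move=> [x' i] /= [h1 h2]; exact: lt_le_trans h1 h2.
move=> p Kp H; have := H p Kp (lexx _) p Kp; by rewrite /= ltxx.
Qed.

Lemma cvg_big_sum (T : Type) (F : set_system T) (FF : Filter F) (I : Type) (s : seq I)
    (f : I -> T -> R) (l : I -> R) : (forall i, f i @ F --> l i) ->
  (fun x => \sum_(i <- s) f i x) @ F --> \sum_(i <- s) l i.
Proof.
move=> H; elim: s => [|i s IH].
  under [fun x => _]funext do rewrite big_nil; rewrite big_nil; exact: cvg_cst.
by under [fun x => _]funext do rewrite big_cons; rewrite big_cons; exact: cvgD.
Qed.

Lemma lt_EFin_between (x : \bar R) (u : \bar R) : (x < u)%E ->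
  exists s : R, (x < s%:E)%E /\ (s%:E < u)%E.
Proof.
case: x => [x| |]; case: u => [u| |] //= h.
- exists ((x + u) / 2); rewrite !lte_fin in h *; split; lra.
- by exists (x + 1); rewrite lte_fin ltry; split=> //; lra.
- by exists (u - 1); rewrite lte_fin ltNyr; split=> //; lra.
- by exists 0; rewrite ltNyr ltry.
Qed.

Lemma small_pos (s : seq R) : all (fun x => 0 < x) s ->
  exists e, 0 < e /\ all (fun x => e < x) s.
Proof.
elim: s => [|a s IH] /=; first by exists 1; rewrite ltr01.
move=> /andP[a0 /IH[e [e0 He]]]; exists (Num.min (a / 2) e); split.
  by rewrite lt_min divr_gt0.
rewrite gt_min (_ : a / 2 < a) /=; last by lra.
by apply/allP => x xs; rewrite gt_min (allP He) // orbT.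
Qed.

Lemma ord_min_pos (D : 'I_n -> R) : (forall j, 0 < D j) -> exists d, 0 < d /\ forall j, d <= D j.
Proof.
move=> D0; exists (\big[Num.min/1]_j D j); split; first by apply: lt_bigmin.
by move=> j; exact: bigmin_le_cond.
Qed.

Lemma ord_max_ge (D : 'I_n -> R) : exists d, 0 <= d /\ forall j, D j <= d.
Proof.
exists (\big[Num.max/0]_j D j); split; first exact: bigmax_ge_id.
by move=> j; exact: le_bigmax_cond.
Qed.

Lemma ln_cabs_quadratic_split (X a t : R) : 0 < X -> X <= 1 / 2 -> `|a| <= X ->
  exists d c, [/\ ln (cabs (1 + Complex a 0 * expi t)) - a * cos t = d - a ^+ 2 * c / 2,
    c = cos (2 * t), `|d| <= 2 * X ^+ 3, `|a ^+ 2 * c / 2| <= X ^+ 2 / 2 & X ^+ 3 <= X ^+ 2 / 2].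
Proof.
move=> X0 X2 aX; have := ln_cabs_quadratic t (le_trans aX X2).
set l := ln _ => h; exists (l - (a * cos t - a ^+ 2 * cos (2 * t) / 2)), (cos (2 * t)).
have a3 : `|a| ^+ 3 <= X ^+ 3 by rewrite lerXn2r ?nnegrE // ltW.
split=> //.
- by ring.
- by apply: le_trans h _; rewrite ler_pM2l.
- have c1 : `|cos (2 * t)| <= 1 by rewrite ler_norml cos_geN1 cos_le1.
  rewrite 2!normrM [`|2^-1|]gtr0_norm // ler_pM2r // -[leRHS]mulr1.
  by apply: ler_pM => //; rewrite normrX lerXn2r ?nnegrE // ltW.
- by rewrite exprS mulrC; apply: ler_wpM2l; rewrite ?exprn_ge0 ?(ltW X0) //; lra.
Qed.

Lemma ln_cabs_linear (X a t : R) : 0 < X -> X <= 1 / 2 -> `|a| <= X ->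
  `|ln (cabs (1 + Complex a 0 * expi t)) - a * cos t| <= X.
Proof.
move=> X0 X2 aX; have [d [c [-> _ h1 h2 h3]]] := ln_cabs_quadratic_split t X0 X2 aX.
apply: le_trans (ler_normB _ _) _.
have : X ^+ 2 <= X / 2 by rewrite expr2; apply: ler_wpM2l; [exact: ltW|lra].
lra.
Qed.

Lemma ln_cabs_sqr (X a b t : R) : 0 < X -> X <= 1 / 2 -> `|a| <= X -> `|b| <= 1 ->
  (b + (ln (cabs (1 + Complex a 0 * expi t)) - a * cos t)) ^+ 2 <=
    b ^+ 2 - b * a ^+ 2 * cos (2 * t) + 6 * X ^+ 3.
Proof.
move=> X0 X2 aX b1; have [d [c [-> <- dX a2 X32]]] := ln_cabs_quadratic_split t X0 X2 aX.
have rX : `|d - a ^+ 2 * c / 2| <= 2 * X ^+ 2.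
  by apply: le_trans (ler_normB _ _) _; have : 0 <= X ^+ 2 := sqr_ge0 X; lra.
have r2 : (d - a ^+ 2 * c / 2) ^+ 2 <= 2 * X ^+ 3.
  rewrite -real_normK ?num_real //; apply: le_trans (_ : (2 * X ^+ 2) ^+ 2 <= _).
    rewrite lerXn2r ?nnegrE //; apply: mulr_ge0 => //; exact: sqr_ge0.
  have : X ^+ 3 * X <= X ^+ 3 * (1 / 2) by rewrite ler_wpM2l // exprn_ge0 // ltW.
  have -> : (2 * X ^+ 2) ^+ 2 = 4 * (X ^+ 3 * X) by ring.
  lra.
have bd : b * d <= 2 * X ^+ 3.
  apply: le_trans (ler_norm _) _; rewrite normrM; apply: le_trans dX.
  by rewrite ler_piMl.
have -> : (b + (d - a ^+ 2 * c / 2)) ^+ 2 = b ^+ 2 - b * a ^+ 2 * c + 2 * (b * d)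
   + (d - a ^+ 2 * c / 2) ^+ 2 by field.
lra.
Qed.

Section Fixed.
Variables (r : R) (phi : Cn -> \bar R).
Hypotheses (r0 : 0 < r) (Hpsh : psh (polydisk 0 r) phi) (Htor : toric r phi).

Lemma polydisk0E (z : Cn) : polydisk 0 r z <-> forall j, cabs (z 0 j) < r.
Proof. by split=> h j; have := h j; rewrite mxE subr0. Qed.

Definition inU (y : Rn) := forall j, y 0 j < ln r.

Lemma polydisk_cexp y : inU y -> polydisk 0 r (cexp y).
Proof.
move=> h; apply/polydisk0E => j; rewrite mxE cabs_real gtr0_norm ?expR_gt0 //.
by rewrite -[X in _ < X](lnK (x := r)) ?posrE // ltr_expR.
Qed.

Lemma toric_cabs (z w : Cn) : polydisk 0 r z ->
  (forall j, cabs (z 0 j) = cabs (w 0 j)) -> phi z = phi w.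
Proof.
move=> /polydisk0E pz zw.
have key (u : Cn) : (forall j, cabs (u 0 j) = cabs (z 0 j)) ->
    phi u = phi (\row_j Complex (cabs (z 0 j)) 0).
  move=> uz; have [th Hth] := choice (fun j => polarP (u 0 j)).
  rewrite -[RHS](Htor th); last by apply/polydisk0E => j; rewrite mxE cabs_real ger0_norm ?cabs_ge0.
  congr phi; apply/rowP => j; rewrite !mxE -uz mulrC; exact: (proj2 (Hth j)).
by rewrite (key z) // (key w).
Qed.

Lemma phi_log (z : Cn) : polydisk 0 r z -> (forall j, z 0 j != 0) ->
  phi z = phi (cexp (\row_j ln (cabs (z 0 j)))).
Proof.
move=> pz z0; apply: toric_cabs => // j.
by rewrite !mxE cabs_real gtr0_norm ?expR_gt0 // lnK // posrE cabs_gt0.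
Qed.

Definition gphi (y : Rn) : \bar R := phi (cexp y).

Lemma gphi_lty y : inU y -> (gphi y < +oo)%E.
Proof. by move=> /polydisk_cexp; exact: (proj1 Hpsh). Qed.

Lemma gphi_usc y (t : R) : inU y -> (gphi y < t%:E)%E ->
  exists d : R, 0 < d /\ forall y' : Rn, (forall j, `|y' 0 j - y 0 j| < d) -> (gphi y' < t%:E)%E.
Proof.
move=> Uy gt; have [d [d0 Hd]] := Hpsh.2.1 _ (polydisk_cexp Uy) t gt.
have [d' [d'0 Hd']] : exists d', 0 < d' /\ forall j (x : R), `|x - y 0 j| < d' -> `|expR x - expR (y 0 j)| < d.
  have cj j : exists d', 0 < d' /\ forall x : R, `|x - y 0 j| < d' -> `|expR x - expR (y 0 j)| < d.
    have := @continuous_expR R (y 0 j); move=> /cvgrPdist_lt /(_ _ d0) /nbhs_ballP[d' d'0 H].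
    exists d'; split=> // x hx; rewrite distrC; apply: H.
    by rewrite /ball /= distrC.
  have [D HD] := choice cj.
  have [m [m0 Hm]] := ord_min_pos (fun j => proj1 (HD j)).
  exists m; split=> // j x hx; apply: (proj2 (HD j)); exact: lt_le_trans hx (Hm j).
exists d'; split=> // y' hy; apply: Hd => j.
rewrite !mxE (_ : _ - _ = Complex (expR (y' 0 j) - expR (y 0 j)) 0) ?cabs_real.
  exact: Hd'.
by apply/eqP; rewrite eq_complex /= subr0 !eqxx.
Qed.

(** Logarithms of the moduli along the circle e^y (1 + x e^{it}). *)
Definition log_circle (y : Rn) (x : 'I_n -> R) (t : R) : Rn :=
  \row_j (y 0 j + ln (cabs (1 + Complex (x j) 0 * expi t))).

(** The mean value inequality on the disc centred at [cexp y] in the direction e^y x, on whose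
    boundary toricity identifies phi with [gphi] along [log_circle]. The majorant [q] is continuous
    so that its integral can be computed. *)
Lemma gphi_submean (y : Rn) (x : 'I_n -> R) (q : R -> R) : inU y ->
  (forall j, `|x j| <= 1 / 2) ->
  (forall j, expR (y 0 j) * (1 + `|x j|) < r) -> ctsI 0 (2 * pi) q ->
  (forall t, 0 <= t <= 2 * pi ->
    (gphi (log_circle y x t) <= (q t)%:E)%E) ->
  (gphi y <= ((2 * pi)^-1 * rint 0 (2 * pi) q)%:E)%E.
Proof.
move=> Uy x2 xr cq gq.
pose b : Cn := \row_j Complex (expR (y 0 j) * x j) 0.
have e0 j : 0 < expR (y 0 j) := expR_gt0 _.
have disc (z : C) j : cabs z <= 1 -> cabs ((cexp y + z *: b) 0 j) < r.
  move=> z1; apply: le_lt_trans (xr j); rewrite !mxE.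
  apply: le_trans (cabsD _ _) _; rewrite mulrDr mulr1 cabsM !cabs_real normrM (gtr0_norm (e0 j)).
  by rewrite lerD2l ler_piMl // mulr_ge0 // ltW.
apply: le_trans (Hpsh.2.2 (cexp y) b _) _.
  by move=> z z1; apply/polydisk0E => j; exact: disc.
have p0 : 0 < 2 * pi :> R by rewrite mulr_gt0 // pi_gt0.
rewrite EFinM -rint_EFin //; apply: lee_wpmul2l; first by rewrite lee_fin invr_ge0 ltW.
apply: le_integral_nomeas => t; rewrite /= in_itv /= => ht.
have z0 j : 1 + Complex (x j) 0 * expi t != 0.
  rewrite -cabs_gt0; have := cabs_lower 1 (Complex (x j) 0 * expi t).
  by rewrite cabs1 cabsM cabs_real cabs_expi mulr1; have := x2 j; lra.
apply: le_trans (gq t ht); rewrite le_eqVlt; apply/orP; left; apply/eqP.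
apply: toric_cabs; first by apply/polydisk0E => j; apply: disc; rewrite cabs_expi.
move=> j; rewrite !mxE cabs_real gtr0_norm ?expR_gt0 // expRD lnK ?posrE ?cabs_gt0 //.
rewrite -[X in _ = X * _](gtr0_norm (e0 j)) -cabs_real -cabsM; congr cabs.
rewrite mulrDr mulr1; congr (_ + _).
rewrite -[Complex (_ * _) 0]/(((_ * _)%R)%:C)%C rmorphM /=.
by rewrite [LHS]mulrC -mulrA.
Qed.

(* Viscosity argument: if [gphi] exceeded its chord, a tube around the chord would carry a
   function, strictly concave along the chord and convex across it, touching [gphi] from
   above, against the mean value inequality on a small disc. *)
Lemma gphi_convex (y0 y1 : Rn) (A B th : R) : inU y0 -> inU y1 -> 0 < th < 1 ->
  (gphi y0 < A%:E)%E -> (gphi y1 < B%:E)%E ->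
  (gphi ((1 - th) *: y0 + th *: y1) <= ((1 - th) * A + th * B)%:E)%E.
Proof.
move=> U0 U1 /andP[th0 th1] gA gB; rewrite leNgt; apply/negP => big.
pose v := y1 - y0.
have ythE : (1 - th) *: y0 + th *: y1 = y0 + th *: v + 0.
  by rewrite addr0 /v scalerBr scalerBl scale1r addrA addrAC.
rewrite ythE in big.
have [dA [dA0 HA]] := gphi_usc U0 gA.
have [dB [dB0 HB]] := gphi_usc U1 gB.
have [dU [dU0 HU]] := ord_min_pos (D := fun j => ln r - Num.max (y0 0 j) (y1 0 j))
  ltac:(by move=> j; rewrite subr_gt0 gt_max U0 U1).
have [eta [eta0 /= /and5P[etaA etaB etaU eta1 _]]] : exists e, 0 < e /\ all (fun x => e < x) [:: dA; dB; dU; 1].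
  by apply: small_pos; rewrite /= dA0 dB0 dU0 ltr01.
have inT (tau : R) (q : Rn) : 0 <= tau <= 1 -> (forall j, `|q 0 j| <= eta) -> inU (y0 + tau *: v + q).
  move=> /andP[t0 t1] hq j; rewrite /v !mxE.
  have := HU j; have := hq j; rewrite ler_norml => /andP[_ h1] h2.
  have h3 : y0 0 j <= Num.max (y0 0 j) (y1 0 j) by rewrite le_max lexx.
  have h4 : y1 0 j <= Num.max (y0 0 j) (y1 0 j) by rewrite le_max lexx orbT.
  have : y0 0 j + tau * (y1 0 j - y0 0 j) <= Num.max (y0 0 j) (y1 0 j) by nra.
  lra.
pose K : set (R * Rn) := (`[0%R, 1%R]%classic : set R) `*` [set q : Rn | forall j, `[- eta, eta]%classic (q 0 j)].
have cK : compact K.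
  apply: compact_setX; first exact: segment_compact.
  by apply: (@rV_compact R n (fun _ => `[- eta, eta]%classic)) => j; exact: segment_compact.
have KE p : K p <-> (0 <= p.1 <= 1 /\ forall j, `|p.2 0 j| <= eta).
  rewrite /K; split=> [[h1 h2]|[h1 h2]]; split=> /=.
  - by move: h1; rewrite /= in_itv.
  - by move=> j; have := h2 j; rewrite /= in_itv /= ler_norml.
  - by rewrite in_itv.
  - by move=> j; have := h2 j; rewrite in_itv /= ler_norml.
pose af (p : R * Rn) : Rn := y0 + p.1 *: v + p.2.
have KU p : K p -> inU (af p) by move=> /KE[h1 h2]; exact: inT.
have Kth : K (th, 0).
  apply/KE; split=> /=; first by rewrite !ltW.
  by move=> j; rewrite mxE normr0 ltW.
have continuous_af j : continuous (fun p : R * Rn => af p 0 j).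
  move=> p; have -> : (fun p : R * Rn => af p 0 j) = (fun p : R * Rn => y0 0 j + p.1 * v 0 j + p.2 0 j).
    by apply/funext => p'; rewrite /af !mxE.
  apply: cvgD; last by apply: (continuous_comp (f := snd) (g := fun q : Rn => q 0 j)); [exact: cvg_snd|exact: coord_continuous].
  apply: cvgD; first exact: cvg_cst.
  by apply: cvgM; [exact: cvg_fst|exact: cvg_cst].
have usc_af p (t : R) : K p -> (gphi (af p) < t%:E)%E -> \forall q \near p, (gphi (af q) < t%:E)%E.
  move=> Kp gt; have [d [d0 Hd]] := gphi_usc (KU _ Kp) gt.
  have : \forall q \near p, forall j, `|af q 0 j - af p 0 j| < d.
    apply: (@filter_forall _ _ (fun j q => `|af q 0 j - af p 0 j| < d) (nbhs p)) => j.
    have := continuous_af j p; move=> /cvgrPdist_lt /(_ _ d0); apply: filterS => q.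
    by rewrite distrC.
  by apply: filterS => q; exact: Hd.
have [M HM] : exists M : R, forall p, K p -> (gphi (af p) < M%:E)%E.
  have [|pM KpM HpM] := usc_max (G := fun p => gphi (af p)) cK (ex_intro _ _ Kth).
    move=> p Kp t /lt_EFin_between[t' [h1 h2]].
    by have := usc_af p t' Kp h1; apply: filterS => q h; apply: lt_trans h h2.
  have [M [h1 _]] := lt_EFin_between (gphi_lty (KU _ KpM)).
  by exists M => p Kp; apply: le_lt_trans (HpM p Kp) h1.
pose lin tau := (1 - tau) * A + tau * B.
have [dl [dl0 Hdl]] : exists dl, 0 < dl /\ ((lin th + dl)%:E < gphi (af (th, 0%R)))%E.
  have [s' [h1 h2]] := lt_EFin_between big; rewrite lte_fin in h1.
  exists (s' - lin th); rewrite subr_gt0; split=> //.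
  by rewrite addrC subrK.
(* On the lateral boundary of the tube, where some |q_j| = eta, the term k eta^2 alone lifts [Q]
   above [M], so that the maximum is not reached there. *)
pose k := (`|M| + `|A| + `|B| + 1) / eta ^+ 2.
have k0 : 0 < k by rewrite divr_gt0 ?exprn_gt0 // ltr_wpDl // !addr_ge0.
have keta : k * eta ^+ 2 = `|M| + `|A| + `|B| + 1 by rewrite /k divfK // expf_neq0 // gt_eqF.
(* As th (1 - th) <= 1, [gphi] still exceeds [Q] at (th, 0) by the choice of [dl], so that the
   maximum of [gphi - Q] is positive. *)
pose Q (p : R * Rn) := lin p.1 + dl * (p.1 * (1 - p.1)) + k * \sum_j (p.2 0 j) ^+ 2.
have cQ : continuous Q.
  move=> p; apply: cvgD; first apply: cvgD; first apply: cvgD.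
  - apply: cvgM; last exact: cvg_cst.
    by apply: cvgB; [exact: cvg_cst|exact: cvg_fst].
  - by apply: cvgM; [exact: cvg_fst|exact: cvg_cst].
  - apply: cvgM; first exact: cvg_cst.
    apply: cvgM; first exact: cvg_fst.
    by apply: cvgB; [exact: cvg_cst|exact: cvg_fst].
  - apply: cvgM; first exact: cvg_cst.
    apply: cvg_big_sum => j.
    have cj : (fun p : R * Rn => p.2 0 j) @ p --> p.2 0 j.
      by apply: (continuous_comp (f := snd) (g := fun q : Rn => q 0 j)); [exact: cvg_snd|exact: coord_continuous].
    by rewrite expr2; under [fun p => _]funext do rewrite expr2; exact: cvgM.
have uscG p : K p -> forall t : \bar R, (gphi (af p) - (Q p)%:E < t)%E ->
    \forall q \near p, (gphi (af q) - (Q q)%:E < t)%E.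
  move=> Kp t /lt_EFin_between[t' [h1 h2]].
  move: h1; rewrite lteBlDr // -EFinD => /lt_EFin_between[s' [h3 h4]]; rewrite lte_fin in h4.
  have h5 : 0 < t' + Q p - s' by rewrite subr_gt0.
  have := usc_af p s' Kp h3; have := cQ p; move=> /cvgrPdist_lt /(_ _ h5) a1 a2.
  apply: filterS2 a1 a2 => q; rewrite ltr_norml => /andP[_ b1] b2.
  apply: lt_trans h2; rewrite lteBlDr // -EFinD; apply: lt_trans b2 _.
  by rewrite lte_fin; lra.
have [[tau q] Kp Hmax] := usc_max cK (ex_intro _ _ Kth) uscG.
have Qth : Q (th, 0) <= lin th + dl.
  rewrite /Q /= big1 ?mulr0 ?addr0; last by move=> j _; rewrite mxE expr0n.
  by rewrite lerD2l -[leRHS]mulr1 ler_pM2l //; nra.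
have Qx : ((Q (tau, q))%:E < gphi (af (tau, q)))%E.
  have h1 : (0 < gphi (af (th, 0%R)) - (Q (th, 0%R))%:E)%E.
    by rewrite lteBrDr // add0e; apply: le_lt_trans Hdl; rewrite lee_fin.
  have := lt_le_trans h1 (Hmax _ Kth); by rewrite lteBrDr // add0e.
have /KE[/= /andP[tau0 tau1] qe] := Kp.
have [x gx] : exists x, gphi (af (tau, q)) = x%:E.
  move: Qx (gphi_lty (KU _ Kp)); case: (gphi _) => // x _ _; by exists x.
rewrite gx in Qx; rewrite lte_fin in Qx.
pose m := x - Q (tau, q).
have gle p : K p -> (gphi (af p) <= (Q p + m)%:E)%E.
  move=> Kp'; have := Hmax p Kp'; rewrite gx -EFinB => h.
  by rewrite addrC EFinD -leeBlDr.
have sq0 : 0 <= \sum_j (q 0 j) ^+ 2 by apply: sumr_ge0 => j _; exact: sqr_ge0.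
(* At the two ends of the tube upper semicontinuity keeps [gphi] below [A], respectively [B], hence
   below [Q]. *)
have tau_neq0 : tau != 0.
  apply/eqP => t0; have : (gphi (af (tau, q)) < A%:E)%E.
    apply: HA => j; rewrite /af /= t0 scale0r addr0 !mxE.
    rewrite (_ : _ - _ = q 0 j); last by ring.
    exact: le_lt_trans (qe j) etaA.
  rewrite gx lte_fin; move: Qx; rewrite /Q /lin /= t0 !mul0r mulr0 subr0 mul1r !addr0.
  by have : 0 <= k * \sum_j (q 0 j) ^+ 2 := mulr_ge0 (ltW k0) sq0; clear - R n r phi r0 Hpsh Htor; lra.
have tau_neq1 : tau != 1.
  apply/eqP => t0; have : (gphi (af (tau, q)) < B%:E)%E.
    apply: HB => j; rewrite /af /= t0 scale1r /v !mxE.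
    rewrite (_ : _ - _ = q 0 j); last by ring.
    exact: le_lt_trans (qe j) etaB.
  rewrite gx lte_fin; move: Qx; rewrite /Q /lin /= t0 subrr !mulr0 !mul0r mul1r !addr0 add0r.
  by have : 0 <= k * \sum_j (q 0 j) ^+ 2 := mulr_ge0 (ltW k0) sq0; clear - R n r phi r0 Hpsh Htor; lra.
have linge : - (`|A| + `|B|) <= lin tau.
  rewrite /lin; have h1 : - `|A| <= (1 - tau) * A.
    by have := ler_norm (- A); rewrite normrN; have := normr_ge0 A; move: tau0 tau1; clear - R n r phi r0 Hpsh Htor; nra.
  have h2 : - `|B| <= tau * B.
    by have := ler_norm (- B); rewrite normrN; have := normr_ge0 B; move: tau0 tau1; clear - R n r phi r0 Hpsh Htor; nra.
  by move: h1 h2; clear - R n r phi r0 Hpsh Htor; lra.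
have q_lt j : `|q 0 j| < eta.
  rewrite lt_neqAle qe andbT; apply/eqP => qj.
  have h1 : eta ^+ 2 <= \sum_j (q 0 j) ^+ 2.
    rewrite (bigD1 j) //= -qj real_normK ?num_real // lerDl.
    by apply: sumr_ge0 => i _; exact: sqr_ge0.
  have h2 : k * eta ^+ 2 <= k * \sum_j (q 0 j) ^+ 2 by rewrite ler_pM2l.
  have := HM _ Kp; rewrite gx lte_fin; move: Qx; rewrite /Q /=.
  have h3 : 0 <= dl * (tau * (1 - tau)) by apply: mulr_ge0; [exact: ltW|apply: mulr_ge0; rewrite ?subr_ge0].
  by have := ler_norm M; rewrite keta in h2; move: h2 h3 linge; clear - R n r phi r0 Hpsh Htor; lra.
have tp : 0 < tau by rewrite lt_def tau_neq0.
have t1p : tau < 1 by rewrite lt_neqAle tau_neq1.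
clear HM Hmax uscG cQ usc_af Hdl Qth linge cK.
have [W [W0 HW]] := ord_max_ge (fun j => `|v 0 j|).
have [rq [rq0 Hrq]] := ord_min_pos (D := fun j => eta - `|q 0 j|) (fun j => ltac:(by rewrite subr_gt0)).
have Uy : inU (af (tau, q)) := KU _ Kp.
set y := af (tau, q) in gx Uy.
have yE j : y 0 j = y0 0 j + tau * v 0 j + q 0 j by rewrite /y /af !mxE.
have afE p j : af p 0 j = y0 0 j + p.1 * v 0 j + p.2 0 j by rewrite /af !mxE.
clearbody y v af.
have [rr [rr0 Hrr]] := ord_min_pos (D := fun j => r / expR (y 0 j) - 1) (fun j => ltac:(
  by rewrite subr_gt0 ltr_pdivlMr ?expR_gt0 // mul1r -[X in _ < X](lnK (x := r)) ?posrE // ltr_expR)).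
have W1 : 0 < W + 1 by move: W0; clear - R n r phi r0 Hpsh Htor; lra.
have N0 : 0 <= n%:R * k :> R by rewrite mulr_ge0 // ltW.
pose E1 := 6 * (n%:R * k) * (W + 1) ^+ 3.
have E10 : 0 <= E1 by apply: mulr_ge0; [exact: mulr_ge0|exact: exprn_ge0 (ltW W1)].
have [e [e0 /= /and5P[e_tau e_tau1 e_W e_q /and3P[e_r e_d _]]]] : exists e, 0 < e /\
    all (fun x => e < x) [:: tau; 1 - tau; 1 / (2 * (W + 1)); rq / (W + 1); rr / (W + 1); dl / (2 * (E1 + 1))].
  apply: small_pos; rewrite /= !divr_gt0 ?mulr_gt0 ?subr_gt0 ?tp ?t1p //.
  by rewrite ltr_wpDl.
pose X := e * (W + 1).
have X0 : 0 < X by rewrite mulr_gt0.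
have X2 : X <= 1 / 2.
  move: e_W; rewrite ltr_pdivlMr ?mulr_gt0 // /X; clear - R n r phi r0 Hpsh Htor; lra.
have Xq : X < rq by rewrite /X -ltr_pdivlMr.
have Xr : X < rr by rewrite /X -ltr_pdivlMr.
have vX j : `|e * v 0 j| <= X.
  by rewrite normrM gtr0_norm // /X ler_pM2l //; have := HW j; clear - R n r phi r0 Hpsh Htor; lra.
(* Along the circle the point moves by e cos t on the chord and by a second-order amount across it.
   [qf] bounds [Q + m] there; its terms in cos t and cos 2t, collected in [al] and [be], have mean
   zero, and the mean [c0] is x - dl e^2/2 up to O(e^3). *)
pose al := B - A + dl * (1 - 2 * tau).
pose be := k * \sum_j (q 0 j) * (v 0 j) ^+ 2.
pose c0 := m + Q (tau, q) - dl * e ^+ 2 / 2 + 6 * (n%:R * k) * X ^+ 3.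
pose qf (t : R) := c0 + (e * al * cos (1%:R * t) + (- (dl * e ^+ 2 / 2) - e ^+ 2 * be) * cos (2%:R * t)).
have cqf : ctsI 0 (2 * pi) qf.
  apply: ctsID; first exact: ctsIc.
  by apply: ctsID; apply: ctsIM; (exact: ctsIc || exact: ctsI_cos_mul).
have main (t : R) : (gphi (log_circle y (fun j => (e * v 0 j)%R) t) <= (qf t)%:E)%E.
  pose q' : Rn := \row_j (q 0 j + (ln (cabs (1 + Complex (e * v 0 j) 0 * expi t)) - e * v 0 j * cos t)).
  have ct : `|cos t| <= 1 by rewrite ler_norml cos_geN1 cos_le1.
  have ec : `|e * cos t| <= e by rewrite normrM (gtr0_norm e0) ler_piMr // ltW.
  have -> : log_circle y (fun j => e * v 0 j) t = af (tau + e * cos t, q').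
    by apply/rowP => j; rewrite afE /log_circle /q' 2!mxE yE /=; ring.
  have Kp' : K (tau + e * cos t, q').
    apply/KE; split=> [|j] /=; first by move: ec e_tau e_tau1; rewrite ler_norml => /andP[]; clear - R n r phi r0 Hpsh Htor; lra.
    rewrite mxE; set l := ln _.
    have h2 : `|l - e * v 0 j * cos t| <= X := ln_cabs_linear t X0 X2 (vX j).
    clearbody l.
    apply: le_trans (ler_normD _ _) _; have := Hrq j; move: h2 Xq; clear - R n r phi r0 Hpsh Htor; lra.
  apply: le_trans (gle _ Kp') _; rewrite lee_fin /qf /c0 /Q /lin /=.
  rewrite mul1r.
  have S : \sum_j (q' 0 j) ^+ 2 <= \sum_j (q 0 j) ^+ 2 - e ^+ 2 * (\sum_j (q 0 j) * (v 0 j) ^+ 2) * cos (2 * t)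
      + n%:R * (6 * X ^+ 3).
    have -> : n%:R * (6 * X ^+ 3) = \sum_(j < n) (6 * X ^+ 3) by rewrite sumr_const card_ord mulr_natl.
    rewrite mulr_sumr mulr_suml -sumrB -big_split /=; apply: ler_sum => j _; rewrite mxE.
    have q1 : `|q 0 j| <= 1 by apply: le_trans (qe j) (ltW eta1).
    apply: le_trans (ln_cabs_sqr t X0 X2 (vX j) q1) _.
    by rewrite le_eqVlt; apply/orP; left; apply/eqP; ring.
  have kS := ler_wpM2l (ltW k0) S.
  have c2 : cos (2 * t) = 2 * cos t ^+ 2 - 1.
    by rewrite mulr_natl mulr2n cosD; have := cos2Dsin2 t; rewrite !expr2; clear - R n r phi r0 Hpsh Htor; lra.
  rewrite c2 /al /be; rewrite c2 in kS.
  move: kS; move: (\sum_j q' 0 j ^+ 2) (\sum_j q 0 j ^+ 2) (\sum_j _) (cos t) (X ^+ 3) (n%:R : R).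
  clear => S1 S2 S3 c X3 N; lra.
have xe j : `|e * v 0 j| <= 1 / 2 := le_trans (vX j) X2.
have yr j : expR (y 0 j) * (1 + `|e * v 0 j|) < r.
  rewrite mulrC -ltr_pdivlMr ?expR_gt0 //.
  by have := vX j; have := Hrr j; move: Xr; clear - R n r phi r0 Hpsh Htor; lra.
have := gphi_submean Uy xe yr cqf (fun t _ => main t).
have p0 : 0 < 2 * pi :> R by rewrite mulr_gt0 // pi_gt0.
have -> : rint 0 (2 * pi) qf = c0 * (2 * pi).
  rewrite /qf rintD; [|exact: ctsIc|by apply: ctsID; apply: ctsIM; (exact: ctsIc || exact: ctsI_cos_mul)].
  rewrite rintc ?(ltW p0) // subr0 rintD; try (by apply: ctsIM; (exact: ctsIc || exact: ctsI_cos_mul)).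
  rewrite !rintZ; try exact: ctsI_cos_mul.
  have := @rint_cos R 0 1 isT; have := @rint_cos R 0 2 isT; rewrite add0r => -> ->.
  by rewrite !mulr0 !addr0.
rewrite mulrC mulfK ?gt_eqF // gx lee_fin leNgt => /negP; apply.
have -> : x = m + Q (tau, q) by rewrite /m subrK.
rewrite /c0; suff : 6 * (n%:R * k) * X ^+ 3 < dl * e ^+ 2 / 2 by clear - R n r phi r0 Hpsh Htor; lra.
have -> : 6 * (n%:R * k) * X ^+ 3 = e * E1 * e ^+ 2 by rewrite /E1 /X; ring.
have -> : dl * e ^+ 2 / 2 = dl / 2 * e ^+ 2 by ring.
rewrite ltr_pM2r ?exprn_gt0 //.
move: e_d; rewrite ltr_pdivlMr ?mulr_gt0 ?ltr_wpDl //; move: E10 e0; clear - R n r phi r0 Hpsh Htor; nra.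
Qed.
End Fixed.
End Toric.

(** * Subgradients and Fourier-Motzkin elimination *)

Section Subgradient.
Variable R : realType.
Variable n : nat.
Local Notation Rn := 'rV[R]_n.

Lemma dotvDl (x x' y : Rn) : dotv (x + x') y = dotv x y + dotv x' y.
Proof. by rewrite /dotv -big_split /=; apply: eq_bigr => j _; rewrite mxE mulrDl. Qed.

Lemma dotvDr (x y y' : Rn) : dotv x (y + y') = dotv x y + dotv x y'.
Proof. by rewrite /dotv -big_split /=; apply: eq_bigr => j _; rewrite mxE mulrDr. Qed.

Lemma dotvZl c (x y : Rn) : dotv (c *: x) y = c * dotv x y.
Proof. by rewrite /dotv mulr_sumr; apply: eq_bigr => j _; rewrite mxE mulrA. Qed.

Lemma dotvZr c (x y : Rn) : dotv x (c *: y) = c * dotv x y.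
Proof. by rewrite /dotv mulr_sumr; apply: eq_bigr => j _; rewrite mxE mulrCA. Qed.

Lemma dotvC (x y : Rn) : dotv x y = dotv y x.
Proof. by apply: eq_bigr => j _; rewrite mulrC. Qed.

Lemma exists_inf (I : Type) (P : set I) (f : I -> R) (i0 : I) (b0 : R) : P i0 ->
  (forall i, P i -> b0 <= f i) ->
  exists m : R, (forall i, P i -> m <= f i) /\ forall b, (forall i, P i -> b <= f i) -> b <= m.
Proof.
move=> Pi0 lb; exists (inf (f @` P)); split.
  by move=> i Pi; apply: ge_inf; [exists b0 => _ [j Pj <-]; exact: lb|exists i].
move=> b hb; apply: lb_le_inf; first by exists (f i0); exists i0.
by move=> _ [j Pj <-]; exact: hb.
Qed.

Definition sublin (p : Rn -> R) := (forall u v, p (u + v) <= p u + p v) /\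
  (forall c v, 0 <= c -> p (c *: v) <= c * p v).

Lemma sublinZ (p : Rn -> R) c v : sublin p -> 0 <= c -> p (c *: v) = c * p v.
Proof.
move=> [sa hom] c0; apply/eqP; rewrite eq_le hom //=.
have [->|c1] := eqVneq c 0.
  have := hom 0 0 (lexx _); have := sa 0 0; rewrite addr0 !scale0r !mul0r; lra.
have cp : 0 < c by rewrite lt_def c1.
have := hom c^-1 (c *: v); rewrite invr_ge0 c0 scalerA mulVf // scale1r => /(_ isT).
by rewrite mulrC ler_pdivlMr // mulrC.
Qed.

(** One step of the Hahn-Banach theorem: [p' v] is the infimum over t >= 0 of p (v + t e) - t p
    e. *)
Lemma sublin_tighten (p : Rn -> R) (e : Rn) : sublin p ->
  exists p', [/\ sublin p', forall v, p' v <= p v & p' (- e) <= - p e].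
Proof.
move=> sp; have [sa hom] := sp.
have lb v t : 0 <= t -> - p (- v) <= p (v + t *: e) - t * p e.
  move=> t0; rewrite -(sublinZ e sp t0).
  have := sa (v + t *: e) (- v); rewrite addrAC subrr add0r; lra.
have [p' Hp'] := choice (fun v => exists_inf (P := [set t | 0 <= t]) (f := fun t => p (v + t *: e) - t * p e) (lexx 0) (lb v)).
have p'1 v t : 0 <= t -> p' v <= p (v + t *: e) - t * p e by move=> t0; exact: (proj1 (Hp' v)).
have p'2 v b : (forall t, 0 <= t -> b <= p (v + t *: e) - t * p e) -> b <= p' v by move=> h; exact: (proj2 (Hp' v)).
exists p'; split.
- split.
    move=> u v; rewrite -lerBlDr; apply: (p'2) => t t0; rewrite lerBlDr -lerBlDl.
    apply: (p'2) => s s0; rewrite lerBlDl.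
    apply: le_trans (p'1 _ (t + s) (addr_ge0 t0 s0)) _.
    have := sa (u + t *: e) (v + s *: e); rewrite addrACA -scalerDl; lra.
  move=> c v; rewrite le_eqVlt => /orP[/eqP<-|c0].
    rewrite scale0r mul0r; apply: le_trans (p'1 _ 0 (lexx _)) _.
    by rewrite scale0r addr0 mul0r subr0 -(scale0r 0) (sublinZ _ sp) // mul0r.
  rewrite mulrC -ler_pdivrMr //; apply: (p'2) => t t0; rewrite ler_pdivrMr //.
  apply: le_trans (p'1 _ (c * t) (mulr_ge0 (ltW c0) t0)) _.
  by rewrite -scalerA -scalerDr (sublinZ _ sp (ltW c0)); lra.
- by move=> v; apply: le_trans (p'1 v 0 (lexx _)) _; rewrite scale0r addr0 mul0r subr0.
- apply: le_trans (p'1 _ 1 ler01) _.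
  by rewrite scale1r addNr mul1r -(scale0r 0) (sublinZ _ sp) // mul0r sub0r.
Qed.

(** After tightening along every basis vector, [p'] is squeezed onto a linear form, whose
    coefficients give [x]. *)
Lemma sublin_minorant (p : Rn -> R) : sublin p -> exists x : Rn, forall v, dotv x v <= p v.
Proof.
move=> sp.
have [p' [a [sp' p'p H]]] : exists p' (a : 'I_n -> R), [/\ sublin p', forall v, p' v <= p v &
    forall j, p' (delta_mx 0 j) <= a j /\ p' (- delta_mx 0 j) <= - a j].
  suff [p' [a [h1 h2 h3]]] : exists p' (a : 'I_n -> R), [/\ sublin p', forall v, p' v <= p v &
    forall j, j \in enum 'I_n -> p' (delta_mx 0 j) <= a j /\ p' (- delta_mx 0 j) <= - a j].
    by exists p', a; split=> // j; apply: h3; rewrite mem_enum.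
  elim: (enum _) => [|i s [q [a [sq qp H]]]]; first by exists p, (fun=> 0); split.
  have [q' [sq' q'q q'e]] := sublin_tighten (delta_mx 0 i) sq.
  exists q', (fun j => if j == i then q (delta_mx 0 i) else a j); split=> //.
    by move=> v; exact: le_trans (q'q v) (qp v).
  move=> j; rewrite inE; have [->|_] /= := eqVneq j i; first by move=> _; split.
  by move=> /H[h1 h2]; split; [exact: le_trans h1|exact: le_trans h2].
have ub v : p' v <= \sum_j a j * v 0 j.
  rewrite {1}(row_sum_delta v).
  have : forall s : seq 'I_n, p' (\sum_(j <- s) v 0 j *: delta_mx 0 j) <= \sum_(j <- s) a j * v 0 j.
    elim=> [|j s IH]; first by rewrite !big_nil -(scale0r 0) (sublinZ _ sp') // mul0r.
    rewrite !big_cons; apply: le_trans (proj1 sp' _ _) _; apply: lerD IH.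
    have [h|h] := leP 0 (v 0 j).
      by rewrite (sublinZ _ sp') // mulrC ler_wpM2r //; exact: (proj1 (H j)).
    rewrite -[v 0 j]opprK scaleNr -scalerN (sublinZ _ sp') ?oppr_ge0 ?(ltW h) //.
    by have := proj2 (H j); nra.
  exact.
exists (\row_j a j) => v; apply: le_trans (p'p v).
have := ub (- v); have := proj1 sp' v (- v).
rewrite subrr -(scale0r 0) (sublinZ _ sp') // mul0r.
have -> : \sum_j a j * (- v) 0 j = - dotv (\row_j a j) v.
  by rewrite /dotv -sumrN; apply: eq_bigr => j _; rewrite !mxE mulrN.
lra.
Qed.

(** The one-sided directional derivative at [y], an infimum of difference quotients, is sublinear by
    convexity; any linear form below it is a subgradient. *)
Lemma subgradient (U : set Rn) (g : Rn -> R) (y : Rn) :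
  (forall v, exists2 t, 0 < t & U (y + t *: v)) ->
  (forall y0 y1 th, U y0 -> U y1 -> 0 <= th <= 1 ->
     U ((1 - th) *: y0 + th *: y1) /\
     g ((1 - th) *: y0 + th *: y1) <= (1 - th) * g y0 + th * g y1) ->
  exists x : Rn, forall y', U y' -> g y + dotv x (y' - y) <= g y'.
Proof.
move=> op cvx.
pose q (t : R) v := (g (y + t *: v) - g y) / t.
(* The step t makes y + t (u + v) the convex combination of y + s1 u and y + s2 v with weights
   s2/(s1 + s2) and s1/(s1 + s2). *)
have qD s1 s2 u v : 0 < s1 -> 0 < s2 -> U (y + s1 *: u) -> U (y + s2 *: v) ->
    let t := s1 * s2 / (s1 + s2) in U (y + t *: (u + v)) /\ q t (u + v) <= q s1 u + q s2 v.
  move=> s10 s20 U1 U2 t; have s0 : 0 < s1 + s2 by lra.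
  have th01 : 0 <= s1 / (s1 + s2) <= 1.
    by rewrite divr_ge0 ?(ltW s10) ?(ltW s0) //= ler_pdivrMr //; lra.
  have := cvx _ _ _ U1 U2 th01.
  have -> : (1 - s1 / (s1 + s2)) *: (y + s1 *: u) + (s1 / (s1 + s2)) *: (y + s2 *: v) = y + t *: (u + v).
    by apply/rowP => j; rewrite !mxE /t; field; rewrite gt_eqF.
  move=> [h1 h2]; split=> //.
  have t0 : 0 < t by rewrite divr_gt0 // mulr_gt0.
  rewrite {1}/q ler_pdivrMr // lerBlDr; apply: le_trans h2 _.
  by rewrite le_eqVlt; apply/orP; left; apply/eqP; rewrite /q /t; field; rewrite !gt_eqF.
have Uy : U y by have [t _] := op 0; rewrite scaler0 addr0.
pose S v : set R := [set t | 0 < t /\ U (y + t *: v)].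
have ex v : exists m, (forall t, S v t -> m <= q t v) /\
    forall b, (forall t, S v t -> b <= q t v) -> b <= m.
  have [t0 t00 Ut0] := op v; have [s s0 Us] := op (- v).
  apply: (exists_inf (i0 := t0) (b0 := - q s (- v))) => // t [tp Ut].
  have [_] := qD _ _ _ _ tp s0 Ut Us; rewrite subrr {1}/q scaler0 addr0 subrr mul0r; lra.
have [p Hp] := choice ex.
have sp : sublin p.
  split=> [u v|c v].
    rewrite -lerBlDr; apply: (proj2 (Hp u)) => t [t0 Ut]; rewrite lerBlDr -lerBlDl.
    apply: (proj2 (Hp v)) => s [s0 Us]; rewrite lerBlDl.
    have [h1 h2] := qD _ _ _ _ t0 s0 Ut Us; apply: le_trans h2.
    by apply: (proj1 (Hp _)); split=> //; rewrite divr_gt0 ?mulr_gt0 ?addr_gt0.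
  rewrite le_eqVlt => /orP[/eqP<-|c0].
    rewrite scale0r mul0r; have [t t0 Ut] := op 0.
    by have := proj1 (Hp 0) t (conj t0 Ut); rewrite /q scaler0 addr0 subrr mul0r.
  rewrite mulrC -ler_pdivrMr //; apply: (proj2 (Hp v)) => t [t0 Ut]; rewrite ler_pdivrMr //.
  have e : (t / c) *: (c *: v) = t *: v by rewrite scalerA divfK // gt_eqF.
  have := proj1 (Hp (c *: v)) (t / c); rewrite /S /= /q e => h.
  have -> : (g (y + t *: v) - g y) / t * c = (g (y + t *: v) - g y) / (t / c) by field; rewrite !gt_eqF.
  by apply: h; rewrite divr_gt0.
have [x Hx] := sublin_minorant sp; exists x => y' Uy'.
have e : y + 1 *: (y' - y) = y' by rewrite scale1r addrC subrK.
have := proj1 (Hp (y' - y)) 1; rewrite /S /= /q e divr1 => /(_ (conj ltr01 Uy')).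
by have := Hx (y' - y); lra.
Qed.
End Subgradient.

(** * Rational polyhedra by elimination *)

Section FourierMotzkin.
Variable R : realType.
Variable n : nat.
Local Notation Rn := 'rV[R]_n.
Local Notation Qn := 'rV[rat]_n.

Definition rdot (a : Qn) (x : Rn) : R := dotv (map_mx ratr a) x.

Lemma rdotE a x : rdot a x = \sum_j ratr (a 0 j) * x 0 j.
Proof. by apply: eq_bigr => j _; rewrite mxE. Qed.

Lemma rdotD a b x : rdot (a + b) x = rdot a x + rdot b x.
Proof. by rewrite !rdotE -big_split; apply: eq_bigr => j _ /=; rewrite mxE rmorphD mulrDl. Qed.

Lemma rdotZ c a x : rdot (c *: a) x = ratr c * rdot a x.
Proof. by rewrite !rdotE mulr_sumr; apply: eq_bigr => j _ /=; rewrite mxE rmorphM mulrA. Qed.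

Lemma rdot0 x : rdot 0 x = 0.
Proof. by rewrite rdotE big1 // => j _; rewrite mxE rmorph0 mul0r. Qed.

Lemma separating_value (I : finType) (l u : I -> R) (L U : pred I) :
  (forall i j, L i -> U j -> l i <= u j) ->
  exists t, (forall i, L i -> l i <= t) /\ (forall j, U j -> t <= u j).
Proof.
move=> H; have [[i0 Li0]|noL] := pselect (exists i, L i).
  exists (l [arg max_(i > i0 | L i) l i]%O); case: arg_maxP => // i Li Hi.
  by split=> // j Uj; exact: H.
have [[j0 Uj0]|noU] := pselect (exists j, U j).
  exists (u [arg min_(i < j0 | U i) u i]%O); case: arg_minP => // j Uj Hj.
  by split=> // i Li; case: noL; exists i.
by exists 0; split=> [i Li|i Ui]; [case: noL|case: noU]; exists i.
Qed.

Lemma eliminate_one (I : finType) (E c : I -> R) :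
  (exists t, forall i, E i + c i * t <= 0) <->
  (forall i, c i = 0 -> E i <= 0) /\
  (forall i j, 0 < c i -> c j < 0 -> - c j * E i + c i * E j <= 0).
Proof.
split=> [[t Ht]|[H0 H1]].
  split=> [i ci|i j ci cj]; first by have := Ht i; rewrite ci mul0r addr0.
  by have := Ht i; have := Ht j; nra.
have [i j ci cj|t [t1 t2]] := @separating_value I (fun i => - E i / c i) (fun i => - E i / c i)
    (fun i => c i < 0) (fun i => 0 < c i).
  by rewrite ler_ndivrMr // mulrAC ler_pdivrMr //; have := H1 j i cj ci; lra.
exists t => i; have [ci|ci|ci] := ltgtP (c i) 0; last by rewrite ci mul0r addr0 H0.
  by have := t1 i ci; rewrite ler_ndivrMr //; lra.
by have := t2 i ci; rewrite ler_pdivlMr //; lra.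
Qed.

(** The parameter [tau] homogenises the constants: tau = 1 gives points and tau = 0 directions.
    Rational data stay rational because elimination only forms sums and products of coefficients. *)
Lemma fourier_motzkin p (I : finType) (a : I -> Qn) (b : I -> rat) (d : I -> 'I_p -> rat) :
  exists (J : finType) (A : J -> Qn) (B : J -> rat), forall (x : Rn) (tau : R),
    (forall j, rdot (A j) x + ratr (B j) * tau <= 0) <->
    exists l : 'I_p -> R, forall i, rdot (a i) x + ratr (b i) * tau + \sum_j ratr (d i j) * l j <= 0.
Proof.
elim: p I a b d => [|p IH] I a b d.
  exists I, a, b => x tau; split=> [H|[l H] i].
    by exists (fun=> 0) => i; rewrite big_ord0 addr0.
  by have := H i; rewrite big_ord0 addr0.
pose c i := d i ord0.
(* One inequality for each pair of coefficients of opposite signs, and those free of the eliminated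
   variable; the other indices carry the trivial inequality 0 <= 0. *)
pose mix T (f : rat -> T -> T) (g : T -> T -> T) (z : T) (u : I -> T) (k : I + I * I) : T :=
  match k with
  | inl i => if c i == 0 then u i else z
  | inr (i, j) => if (0 < c i) && (c j < 0) then g (f (- c j) (u i)) (f (c i) (u j)) else z
  end.
have [J [A [B H]]] := IH (I + I * I)%type (mix Qn *:%R +%R 0 a) (mix rat *%R +%R 0 b)
  (fun k j => mix rat *%R +%R 0 (fun i => d i (lift ord0 j)) k).
exists J, A, B => x tau; rewrite H.
pose E (l : 'I_p -> R) i := rdot (a i) x + ratr (b i) * tau + \sum_j ratr (d i (lift ord0 j)) * l j.
have e l k : rdot (mix Qn *:%R +%R 0 a k) x + ratr (mix rat *%R +%R 0 b k) * tau +
     \sum_j ratr (mix rat *%R +%R 0 (fun i => d i (lift ord0 j)) k) * l j =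
   match k with
   | inl i => if c i == 0 then E l i else 0
   | inr (i, j) => if (0 < c i) && (c j < 0) then - ratr (c j) * E l i + ratr (c i) * E l j else 0
   end.
  have z : rdot 0 x + ratr 0 * tau + \sum_(j < p) ratr 0 * l j = 0.
    by rewrite rdot0 rmorph0 mul0r big1 ?addr0 // => j _; rewrite mul0r.
  case: k => [i|[i j]] /=; case: ifP => // _.
  rewrite rdotD !rdotZ rmorphD !rmorphM rmorphN /E.
  have -> : \sum_(k < p) ratr (- c j * d i (lift ord0 k) + c i * d j (lift ord0 k)) * l k =
     - ratr (c j) * (\sum_k ratr (d i (lift ord0 k)) * l k) + ratr (c i) * \sum_k ratr (d j (lift ord0 k)) * l k.
    rewrite !mulr_sumr -big_split; apply: eq_bigr => k _ /=.
    by rewrite rmorphD !rmorphM rmorphN; ring.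
  ring.
split=> [[l Hl]|[l Hl]].
  have [|t Ht] := proj2 (eliminate_one (E l) (fun i => ratr (c i))).
    split=> [i ci|i j ci cj].
      have := Hl (inl i); rewrite e ifT //.
      by move/eqP: ci; rewrite fmorph_eq0.
    have := Hl (inr (i, j)); rewrite e ifT //.
    by move: ci cj; rewrite ltr0q ltrq0 => -> ->.
  exists (fun j => if unlift ord0 j is Some j' then l j' else t) => i.
  rewrite big_ord_recl /= unlift_none; under eq_bigr do rewrite liftK.
  by have := Ht i; rewrite /E /c; lra.
exists (fun j => l (lift ord0 j)) => k; rewrite e.
have [h1 h2] : (forall i, ratr (c i) = 0 :> R -> E (fun j => l (lift ord0 j)) i <= 0) /\
  (forall i j, (0 : R) < ratr (c i) -> (ratr (c j) : R) < 0 -> - ratr (c j) * E (fun j => l (lift ord0 j)) i +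
    ratr (c i) * E (fun j => l (lift ord0 j)) j <= 0).
  apply/eliminate_one; exists (l ord0) => i; have := Hl i.
  by rewrite big_ord_recl /E /c /=; lra.
case: k => [i|[i j]]; case: ifP => //.
  by move/eqP => ci; apply: h1; rewrite ci rmorph0.
by case/andP=> ci cj; apply: h2; rewrite ?ltr0q ?ltrq0.
Qed.

Definition nonpos (y : Rn) := forall j, y 0 j <= 0.

(* In support function form: the sum of [orthant] and the convex hull of the [v k]. *)
Definition support_hull p (v : 'I_p -> Rn) : set Rn :=
  [set x | forall y, nonpos y -> exists k, dotv x y <= dotv (v k) y].

Lemma rdot_delta i (x : Rn) : rdot (delta_mx 0 i) x = x 0 i.
Proof.
rewrite rdotE (bigD1 i) //= big1 ?addr0; first by rewrite mxE !eqxx rmorph1 mul1r.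
by move=> k /negbTE ki; rewrite mxE eqxx ki rmorph0 mul0r.
Qed.

Definition minus_unit p (i j : 'I_p) : rat := if i == j then -1 else 0.

Lemma sum_minus_unit p (l : 'I_p -> R) i : \sum_j ratr (minus_unit i j) * l j = - l i.
Proof.
rewrite (bigD1 i) //= /minus_unit eqxx big1 ?addr0; first by rewrite rmorphN rmorph1 mulN1r.
by move=> j /negbTE ji; rewrite eq_sym ji rmorph0 mul0r.
Qed.

Lemma finType_rational_polyhedron (J : finType) (A : J -> Qn) (B : J -> rat) :
  rational_polyhedron [set x : Rn | forall j, rdot (A j) x <= ratr (B j)].
Proof.
exists #|J|, (fun i => A (enum_val i)), (fun i => B (enum_val i)).
apply/seteqP; split=> x /= H i; first exact: H.
by have := H (enum_rank i); rewrite enum_rankK.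
Qed.

(** Eliminating the weights from x >= sum l_j v_j, l >= 0, sum l_j = tau leaves rational
    inequalities in (x, tau). Tested on unit vectors with tau = 0, their normals turn out
    nonpositive, hence are among the [y] of the support description. Conversely, weights for [x]
    bound <x, y> by an average of the <v_j, y>. *)
Lemma support_hull_rational p (v : 'I_p -> Qn) :
  rational_polyhedron (support_hull (fun k => map_mx ratr (v k))).
Proof.
pose I := ('I_p + 'I_n + bool)%type.
pose a (i : I) : Qn := match i with inl (inr i) => - delta_mx 0 i | _ => 0 end.
pose b (i : I) : rat := match i with inr s => (-1) ^+ s | _ => 0 end.
pose d (i : I) (j : 'I_p) : rat := match i with inl (inl i) => minus_unit i j
  | inl (inr i) => v j 0 i | inr s => - (-1) ^+ s end.
have [J [A [B H]]] := fourier_motzkin a b d.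
have primal (x : Rn) tau : (forall j, rdot (A j) x + ratr (B j) * tau <= 0) <->
    exists l : 'I_p -> R, [/\ forall j, 0 <= l j, \sum_j l j = tau &
      forall i, \sum_j l j * ratr (v j 0 i) <= x 0 i].
  rewrite H; split=> [[l Hl]|[l [l0 l1 l2]]]; exists l.
    have h1 j : 0 <= l j.
      by have := Hl (inl (inl j)); rewrite /= rdot0 rmorph0 mul0r sum_minus_unit; lra.
    split=> //.
      apply/eqP; rewrite eq_le; apply/andP; split.
        have := Hl (inr true); rewrite /= rdot0 expr1 opprK -mulr_sumr rmorphN rmorph1; lra.
      by have := Hl (inr false); rewrite /= rdot0 expr0 -mulr_sumr rmorphN rmorph1; lra.
    move=> i; have := Hl (inl (inr i)); rewrite /= rmorph0 mul0r.
    rewrite -scaleN1r rdotZ rmorphN rmorph1 rdot_delta.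
    rewrite (eq_bigr (fun j => l j * ratr (v j 0 i))); first by lra.
    by move=> j _; rewrite mulrC.
  case=> [[j|i]|s] /=.
  - by rewrite rdot0 rmorph0 mul0r sum_minus_unit; have := l0 j; lra.
  - rewrite rmorph0 mul0r -scaleN1r rdotZ rmorphN rmorph1 rdot_delta.
    rewrite (eq_bigr (fun j => l j * ratr (v j 0 i))); first by have := l2 i; lra.
    by move=> j _; rewrite mulrC.
  - by rewrite rdot0 -mulr_sumr l1 rmorphN mulNr add0r subrr.
have -> : support_hull (fun k => map_mx ratr (v k)) = [set x : Rn | forall j, rdot (A j) x <= ratr (- B j)].
  apply/seteqP; split=> x /=.
    move=> Hx j.
    have np : nonpos (map_mx ratr (A j) : Rn).
      move=> i; have := (proj2 (primal (delta_mx 0 i) 0)) _ j; rewrite mulr0 addr0.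
      rewrite rdotE (bigD1 i) //= big1 ?addr0; last by move=> k /negbTE ki; rewrite !mxE eqxx ki mulr0.
      rewrite !mxE !eqxx mulr1; apply; exists (fun=> 0); split=> //; first by rewrite big1.
      by move=> k; rewrite big1 => [|? _]; rewrite ?mul0r // mxE; case: (_ && _).
    have [k hk] := Hx _ np; rewrite /rdot dotvC; apply: le_trans hk _; rewrite dotvC.
    have := (proj2 (primal (map_mx ratr (v k)) 1)) _ j; rewrite mulr1 rmorphN -/(rdot _ _).
    move=> h; rewrite -subr_le0 opprK; apply: h; exists (fun j => (j == k)%:R); split=> //.
      by rewrite (bigD1 k) //= eqxx big1 ?addr0 // => i /negbTE ->.
    move=> i; rewrite (bigD1 k) //= eqxx big1 ?addr0 ?mul1r ?mxE //.
    by move=> j' /negbTE ->; rewrite mul0r.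
  move=> Hx y y0.
  have [|l [l0 l1 l2]] := (proj1 (primal x 1)).
    by move=> j; have := Hx j; rewrite rmorphN mulr1; lra.
  have [k0 _] : exists k0 : 'I_p, True.
    apply: contrapT => no; move: l1; rewrite big1 => [/eqP|j _]; first by rewrite eq_sym oner_eq0.
    by case: no; exists j.
  exists [arg max_(k > k0) dotv (map_mx ratr (v k)) y]%O; case: arg_maxP => // k _ Hk.
  apply: (@le_trans _ _ (\sum_j l j * dotv (map_mx ratr (v j)) y)).
    rewrite {2}/dotv; under [leRHS]eq_bigr do rewrite mulr_sumr.
    rewrite exchange_big /=; apply: ler_sum => i _.
    under eq_bigr do rewrite mxE mulrA; rewrite -mulr_suml.
    by have := l2 i; have := y0 i; nra.
  rewrite -[leRHS]mul1r -l1 mulr_suml; apply: ler_sum => j _; apply: ler_wpM2l => //.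
  exact: Hk.
exact: finType_rational_polyhedron.
Qed.

(** Generating points are found by duality, eliminating the multipliers that certify <x, y> <= tau
    on [P]. In the resulting system A_j y + B_j tau <= 0 all B_j are nonpositive. If B_j < 0, then
    -A_j/B_j is a rational point of [P]; if B_j = 0, then A_j lies in the orthant and the inequality
    holds for all y <= 0. For such [y] the largest <v_k, y> is therefore an admissible [tau]. *)
Lemma rational_polyhedron_support (P : set Rn) (x0 : Rn) : rational_polyhedron P -> P x0 ->
  P `<=` @orthant R n -> exists p (v : 'I_p -> Qn),
    (forall k, P (map_mx ratr (v k))) /\ P `<=` support_hull (fun k => map_mx ratr (v k)).
Proof.
move=> [m [a [b ->]]] Px0 Porth.
pose I := ('I_m + 'I_n * bool + unit)%type.
pose a' (i : I) : Qn := match i with inl (inr (i, s)) => (-1) ^+ s *: delta_mx 0 i | _ => 0 end.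
pose b' (i : I) : rat := match i with inr _ => -1 | _ => 0 end.
pose d (i : I) (j : 'I_m) : rat := match i with inl (inl i) => minus_unit i j
  | inl (inr (i, s)) => - (-1) ^+ s * a j 0 i | inr _ => b j end.
have [J [A [B H]]] := fourier_motzkin a' b' d.
have dual (y : Rn) tau : (forall j, rdot (A j) y + ratr (B j) * tau <= 0) <->
    exists l : 'I_m -> R, [/\ forall j, 0 <= l j, \sum_j l j * ratr (b j) <= tau &
      forall i, \sum_j l j * ratr (a j 0 i) = y 0 i].
  rewrite H.
  have E2 (l : 'I_m -> R) i s : rdot ((-1) ^+ s *: delta_mx 0 i) y + ratr 0 * tau +
      \sum_j ratr (- (-1) ^+ s * a j 0 i) * l j = (-1) ^+ s * (y 0 i - \sum_j l j * ratr (a j 0 i)).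
    rewrite rdotZ rmorphXn rmorphN rmorph1 rmorph0 mul0r addr0 mulrBr; congr (_ + _).
      by rewrite rdot_delta.
    rewrite mulr_sumr -sumrN; apply: eq_bigr => j _.
    by rewrite rmorphM rmorphN rmorphXn rmorphN rmorph1; ring.
  have E3 (l : 'I_m -> R) : \sum_j ratr (b j) * l j = \sum_j l j * ratr (b j).
    by apply: eq_bigr => j _; rewrite mulrC.
  split=> [[l Hl]|[l [l0 l1 l2]]]; exists l.
    split.
    - by move=> j; have := Hl (inl (inl j)); rewrite /= rdot0 rmorph0 mul0r sum_minus_unit; lra.
    - by have := Hl (inr tt); rewrite /= rdot0 rmorphN rmorph1 E3; lra.
    - move=> i; have := Hl (inl (inr (i, true))); have := Hl (inl (inr (i, false))).
      by rewrite /= !E2 expr0 expr1; lra.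
  case=> [[j|[i s]]|t] /=.
  - by rewrite rdot0 rmorph0 mul0r sum_minus_unit; have := l0 j; lra.
  - by rewrite E2 l2 subrr mulr0.
  - by rewrite rdot0 rmorphN rmorph1 E3; lra.
have B0 j : B j <= 0.
  have h : ratr (B j) <= 0 :> R; last by rewrite -(ler_rat R) rmorph0.
  have := (proj2 (dual 0 1)) _ j; rewrite mulr1 /rdot => h.
  have -> : ratr (B j) = dotv (map_mx ratr (A j)) 0 + ratr (B j) :> R.
    by rewrite -[X in dotv _ X](scale0r 0) dotvZr mul0r add0r.
  apply: h; exists (fun=> 0); split=> //.
    by rewrite big1 => [|i _]; rewrite ?mul0r.
  by move=> i; rewrite mxE big1 // => k _; rewrite mul0r.
have AB i j : rdot (A j) (map_mx ratr (a i)) + ratr (B j) * ratr (b i) <= 0.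
  apply: (proj2 (dual _ _)); exists (fun k => (k == i)%:R); split=> //.
    by rewrite (bigD1 i) //= eqxx mul1r big1 ?addr0 // => k /negbTE ->; rewrite mul0r.
  move=> k; rewrite mxE (bigD1 i) //= eqxx mul1r big1 ?addr0 // => k' /negbTE ->.
  by rewrite mul0r.
have weak x y tau : [set x | forall i, dotv (map_mx ratr (a i)) x <= ratr (b i)] x ->
    (forall j, rdot (A j) y + ratr (B j) * tau <= 0) -> dotv x y <= tau.
  move=> /= Hx /dual[l [l0 l1 l2]]; apply: le_trans l1.
  rewrite /dotv; under eq_bigr do rewrite -l2 mulr_sumr.
  rewrite exchange_big /=; apply: ler_sum => j _.
  have := Hx j; rewrite /dotv => h; apply: le_trans (ler_wpM2l (l0 j) h).
  rewrite mulr_sumr; apply: ler_sum => i _; rewrite mxE; lra.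
pose S := [pred j | B j < 0].
(* Otherwise the ray from [x0] in the direction A_j, which stays in [P], would leave the orthant. *)
have recession j : B j = 0 -> @orthant R n (map_mx ratr (A j)).
  move=> Bj i; set w : Rn := map_mx ratr (A j); rewrite leNgt; apply/negP => lt0.
  pose t := (x0 0 i + 1) / - w 0 i.
  have x00 : 0 <= x0 0 i := Porth _ Px0 i.
  have t0 : 0 <= t by rewrite divr_ge0 ?addr_ge0 // oppr_ge0 ltW.
  have : 0 <= (x0 + t *: w) 0 i.
    apply: Porth => /= k; rewrite dotvDr dotvZr.
    have := AB k j; rewrite Bj rmorph0 mul0r addr0 /rdot dotvC => h.
    by have := Px0 k; nra.
  have -> : (x0 + t *: w) 0 i = x0 0 i + t * w 0 i by rewrite [LHS]mxE; congr (_ + _); rewrite [LHS]mxE.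
  have -> : t * w 0 i = - (x0 0 i + 1) by rewrite /t; field; rewrite lt_eqF.
  lra.
have key y tau : nonpos y -> (forall j, B j < 0 -> rdot (A j) y + ratr (B j) * tau <= 0) ->
    forall j, rdot (A j) y + ratr (B j) * tau <= 0.
  move=> y0 H1 j; have [Bj|] := ltP (B j) 0; first exact: H1.
  move=> Bj; have Bj0 : B j = 0 by apply/eqP; rewrite eq_le B0.
  rewrite Bj0 rmorph0 mul0r addr0; apply: sumr_le0 => i _.
  by have := recession j Bj0 i; have := y0 i; nra.
have neg j : B j < 0 -> ratr (B j) < 0 :> R by move=> h; rewrite ltrq0.
exists #|S|, (fun k => - (B (enum_val k))^-1 *: A (enum_val k)).
have vE j (y : Rn) : rdot (- (B j)^-1 *: A j) y = - (ratr (B j))^-1 * rdot (A j) y.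
  by rewrite rdotZ rmorphN fmorphV.
split=> [k i|x Px y y0].
  have := enum_valP k; rewrite inE => Bk; have := neg _ Bk => Bk'.
  rewrite dotvC -/(rdot _ _) vE; have := AB i (enum_val k).
  set u := rdot _ _; set be := ratr (B _) in Bk' *; set w := ratr (b i) => h.
  by rewrite mulNr -mulrN mulrC ler_ndivrMr //; lra.
(* If no B_j were negative, every [tau] would be admissible, in particular <x, y> - 1. *)
have [j0 Sj0] : exists j, S j.
  apply: contrapT => noS.
  have := weak x y (dotv x y - 1) Px; rewrite lerBrDr => h.
  suff : dotv x y + 1 <= dotv x y by lra.
  apply: h; apply: key => // j Bj; by case: noS; exists j.
exists (enum_rank_in Sj0 [arg max_(j > j0 | S j) rdot (- (B j)^-1 *: A j) y]%O).
case: arg_maxP => // j Sj Hj; rewrite enum_rankK_in //.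
apply: weak Px _; apply: key => // k Sk; have := Hj k Sk; rewrite -/(rdot _ _).
move: (rdot (- _ *: A j) y) => u; rewrite vE => h.
have be0 := neg _ Sk; have {}h : - ((ratr (B k))^-1 * rdot (A k) y) <= u by rewrite -mulNr.
have -> : rdot (A k) y = ratr (B k) * ((ratr (B k))^-1 * rdot (A k) y).
  by rewrite mulrA mulfV ?mul1r // lt_eqF.
by move: (_ * rdot _ _) h => z h; nra.
Qed.
End FourierMotzkin.

(** * Newton convex bodies *)

Section ToricConvex.
Variable R : realType.
Local Notation C := R[i].
Variable n : nat.
Local Notation Cn := 'rV[C]_n.
Local Notation Rn := 'rV[R]_n.

Lemma lee_real_ub (x y : \bar R) : (forall M : R, (y < M%:E)%E -> (x <= M%:E)%E) -> (x <= y)%E.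
Proof.
move=> H; rewrite leNgt; apply/negP => /lt_EFin_between[s [h1 h2]].
by have := H s h1; rewrite leNgt h2.
Qed.

Variables (r : R) (phi : Cn -> \bar R).
Hypotheses (r0 : 0 < r) (Hpsh : psh (polydisk 0 r) phi) (Htor : toric r phi).

Lemma expR_lt_near (d : R) : 0 < d -> exists L : R, forall x, x <= L -> expR x < d.
Proof.
move=> d0; exists (ln (d / 2)) => x hx.
apply: (@le_lt_trans _ _ (d / 2)); last by lra.
by rewrite -[leRHS](lnK (x := d / 2)) ?posrE ?divr_gt0 // ler_expR.
Qed.

(** Convexity on the line from [y'] through [y]: on its continuation the coordinates with y_j < y'_j
    tend to -oo, the points approach [z], where these coordinates vanish, and upper semicontinuity
    bounds [gphi] by [B]. A bounded value at parameter s influences the value at [y] by O(1/s). *)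
Lemma gphi_mono (y y' : Rn) : inU r y' -> (forall j, y 0 j <= y' 0 j) ->
  (gphi phi y <= gphi phi y')%E.
Proof.
move=> Uy' yy'; apply: lee_real_ub => M gM.
have Uy : inU r y by move=> j; exact: le_lt_trans (yy' j) (Uy' j).
pose z : Cn := \row_j (if y 0 j < y' 0 j then 0 else Complex (expR (y 0 j)) 0).
have pz : polydisk 0 r z.
  apply/polydisk0E => j; rewrite mxE; case: ifP => _; first by rewrite cabs0.
  by have /polydisk0E/(_ j) := polydisk_cexp r0 Uy; rewrite mxE.
have [B [pB _]] := lt_EFin_between (proj1 Hpsh _ pz).
have [d [d0 Hd]] := Hpsh.2.1 _ pz B pB.
have [L HL] := expR_lt_near d0.
have [s0 Hs0] : exists s0 : R, 0 < s0 /\ forall s, s0 <= s -> (gphi phi (y - s *: (y' - y)) < B%:E)%E.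
  have h1 j : exists s0 : R, 0 < s0 /\ forall s, s0 <= s -> y 0 j < y' 0 j -> y 0 j - s * (y' 0 j - y 0 j) <= L.
    have [lt|ge] := ltP (y 0 j) (y' 0 j); last by exists 1.
    have p : 0 < y' 0 j - y 0 j by lra.
    exists (`|y 0 j - L| / (y' 0 j - y 0 j) + 1); split.
      by rewrite ltr_wpDl // divr_ge0 // ltW.
    move=> s hs _; have : `|y 0 j - L| <= s * (y' 0 j - y 0 j) by rewrite -ler_pdivrMr //; lra.
    have := ler_norm (y 0 j - L); lra.
  have [f Hf] := choice h1; have [m [m0 Hm]] := ord_max_ge f.
  exists (m + 1); split; first by lra.
  move=> s hs; apply: Hd => j; rewrite !mxE; case: ifP => lt.
    rewrite subr0 cabs_real gtr0_norm ?expR_gt0 //; apply: HL.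
    by apply: (proj2 (Hf j)) => //; have := Hm j; lra.
  have -> : y' 0 j = y 0 j by apply/eqP; rewrite eq_le yy' leNgt lt.
  by rewrite subrr mulr0 subr0 subrr cabs0.
have lim (e : R) : 0 < e -> (gphi phi y <= (M + e)%:E)%E.
  move=> e0; pose s := Num.max s0 (`|B - M| / e).
  have s1 : s0 <= s by rewrite le_max lexx.
  have s2 : `|B - M| / e <= s by rewrite le_max lexx orbT.
  have sp : 0 < s := lt_le_trans (proj1 Hs0) s1.
  have sp1 : 0 < 1 + s by lra.
  have thE : 1 - s / (1 + s) = (1 + s)^-1 by field; rewrite gt_eqF.
  have th0 : 0 < s / (1 + s) < 1.
    by rewrite divr_gt0 //= ltr_pdivrMr // mul1r ltrDr.
  have Us : inU r (y - s *: (y' - y)).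
    move=> j; rewrite !mxE; apply: le_lt_trans (Uy j).
    by rewrite gerDl oppr_le0; apply: mulr_ge0; [exact: ltW|rewrite subr_ge0].
  have := gphi_convex r0 Hpsh Htor Us Uy' th0 (proj2 Hs0 s s1) gM.
  rewrite thE (_ : (1 + s)^-1 *: _ + _ = y); last first.
    by apply/rowP => j; rewrite !mxE; field; rewrite gt_eqF.
  move=> h; apply: le_trans h _; rewrite lee_fin.
  have -> : (1 + s)^-1 * B + s / (1 + s) * M = M + (B - M) / (1 + s) by field; rewrite gt_eqF.
  rewrite lerD2l ler_pdivrMr //; apply: le_trans (ler_norm _) _.
  by move: s2; rewrite ler_pdivrMr // => h2; nra.
case: (gphi phi y) lim => [x| |] lim.
- by rewrite lee_fin; apply/ler_addgt0Pr => e e0; have := lim e e0; rewrite lee_fin.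
- by have := lim 1 ltr01.
- by rewrite leNye.
Qed.

(** [y] lies strictly between [y0] and a point beyond [y], where [gphi] is below +oo; arbitrarily
    negative bounds at [y0] are passed on to [y] by convexity. *)
Lemma gphi_ninfty (y0 y : Rn) : inU r y0 -> inU r y -> gphi phi y0 = -oo%E -> gphi phi y = -oo%E.
Proof.
move=> U0 U g0.
have [s [s0 Us]] : exists s : R, 0 < s /\ inU r (y + s *: (y - y0)).
  have h j : exists s : R, 0 < s /\ forall s', 0 < s' -> s' <= s -> y 0 j + s' * (y 0 j - y0 0 j) < ln r.
    exists ((ln r - y 0 j) / (`|y 0 j - y0 0 j| + 1)); have p : 0 < `|y 0 j - y0 0 j| + 1 by rewrite ltr_wpDl.
    split; first by rewrite divr_gt0 // subr_gt0.
    move=> s' s'0; rewrite ler_pdivlMr // => h; have := ler_norm (y 0 j - y0 0 j).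
    set a := `|_| in h *; set b := y 0 j - _; nra.
  have [f Hf] := choice h; have [m [m0 Hm]] := ord_min_pos (fun j => proj1 (Hf j)).
  by exists m; split=> // j; rewrite !mxE; apply: (proj2 (Hf j)).
have [B [gB _]] := lt_EFin_between (gphi_lty r0 Hpsh Us).
have sp1 : 0 < 1 + s by lra.
have th0 : 0 < 1 / (1 + s) < 1.
  by rewrite divr_gt0 //= ltr_pdivrMr // mul1r ltrDl.
have key (M : R) : (gphi phi y <= M%:E)%E.
  pose A := (M - B / (1 + s)) * (1 + s) / s.
  have gA : (gphi phi y0 < A%:E)%E by rewrite g0 ltNyr.
  have := gphi_convex r0 Hpsh Htor U0 Us th0 gA gB.
  rewrite (_ : _ *: y0 + _ = y); last first.
    by apply/rowP => j; rewrite !mxE; field; rewrite gt_eqF.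
  rewrite (_ : _ * A + _ = M) //.
  by rewrite /A; field; rewrite !gt_eqF.
case: (gphi phi y) key => [x| |] // key.
- by have := key (x - 1)%R; rewrite lee_fin lerDl oppr_ge0 ler10.
- by have := key 0%R; rewrite leye_eq.
Qed.

Definition fill (s : 'I_n -> R) (z : Cn) : Cn :=
  \row_j (if z 0 j == 0 then Complex (s j) 0 else z 0 j).

(** The mean value inequality on a disc that moves all zero coordinates of [z] together; by toricity
    phi is constant on the boundary circle. It carries estimates from the complement of the
    coordinate hyperplanes to all points. *)
Lemma phi_le_fill (z : Cn) (s : 'I_n -> R) : polydisk 0 r z -> (forall j, 0 < s j < r) ->
  (phi z <= phi (fill s z))%E.
Proof.
move=> pz hs; set w := fill s z.
have pw : polydisk 0 r w.
  apply/polydisk0E => j; rewrite mxE; case: ifP => _; last by move/polydisk0E: pz.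
  by have /andP[h1 h2] := hs j; rewrite cabs_real gtr0_norm.
apply: lee_real_ub => B wB.
pose b : Cn := \row_j (if z 0 j == 0 then Complex (s j) 0 else 0).
have cb (x : C) j : cabs ((z + x *: b) 0 j) = if z 0 j == 0 then cabs x * s j else cabs (z 0 j).
  rewrite !mxE; have [->|_] := eqVneq; last by rewrite mulr0 addr0.
  rewrite add0r cabsM cabs_real gtr0_norm //; by have /andP[] := hs j.
have p0 : 0 < 2 * pi :> R by rewrite mulr_gt0 // pi_gt0.
apply: le_trans (Hpsh.2.2 z b _) _.
  move=> x x1; apply/polydisk0E => j; rewrite cb; case: ifP => _; last by move/polydisk0E: pz.
  by have /andP[h1 h2] := hs j; nra.
have -> : B%:E = (((2 * pi)^-1)%:E * (rint 0%R (2 * pi)%R (fun=> B))%:E)%E.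
  by rewrite -EFinM rintc ?(ltW p0) // subr0 mulrC mulfK // gt_eqF.
rewrite -rint_EFin //; last exact: ctsIc.
apply: lee_wpmul2l; first by rewrite lee_fin invr_ge0 ltW.
apply: le_integral_nomeas => t _; apply: le_trans (ltW wB); rewrite le_eqVlt; apply/orP; left; apply/eqP.
apply/esym/toric_cabs => // j; first exact: Htor.
rewrite cb mxE; case: ifP => // _.
by rewrite cabs_expi mul1r cabs_real gtr0_norm //; have /andP[] := hs j.
Qed.

Lemma inU_ex : inU r (const_mx (ln r - 1) : Rn).
Proof. by move=> j; rewrite mxE; lra. Qed.

Definition Gphi (y : Rn) : R := fine (gphi phi y).

Section Finite.
Hypothesis fin : exists2 y, inU r y & gphi phi y != -oo%E.

Lemma gphi_finE y : inU r y -> gphi phi y = (Gphi y)%:E.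
Proof.
move=> U; have [y0 U0 h] := fin; rewrite /Gphi.
have := gphi_lty r0 Hpsh U; have := @gphi_ninfty y y0 U U0.
case: (gphi phi y) => // k _; by rewrite k // eqxx in h.
Qed.

Lemma Gphi_mono (y y' : Rn) : inU r y' -> (forall j, y 0 j <= y' 0 j) -> Gphi y <= Gphi y'.
Proof.
move=> U h; have U' : inU r y by move=> j; exact: le_lt_trans (h j) (U j).
by rewrite -lee_fin -!gphi_finE //; exact: gphi_mono.
Qed.

Lemma Gphi_convex (y0 y1 : Rn) (th : R) : inU r y0 -> inU r y1 -> 0 <= th <= 1 ->
  Gphi ((1 - th) *: y0 + th *: y1) <= (1 - th) * Gphi y0 + th * Gphi y1.
Proof.
move=> U0 U1 /andP[t0 t1].
have [->|th0] := eqVneq th 0; first by rewrite subr0 !scale1r scale0r addr0 !mul1r mul0r addr0.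
have [->|th1] := eqVneq th 1; first by rewrite subrr !scale1r scale0r add0r !mul1r mul0r add0r.
have th01 : 0 < th < 1 by rewrite lt_def th0 t0 lt_neqAle th1 t1.
have U : inU r ((1 - th) *: y0 + th *: y1).
  by move=> j; rewrite !mxE; have := U0 j; have := U1 j; move/andP: th01 => [? ?]; nra.
apply/ler_addgt0Pr => e e0.
have := gphi_convex r0 Hpsh Htor U0 U1 th01 (A := Gphi y0 + e) (B := Gphi y1 + e).
by rewrite !gphi_finE // !lte_fin !lee_fin !ltrDl => /(_ e0 e0) h; lra.
Qed.

(** [Gphi] stays bounded above as y_j tends to -oo, so that a negative x_j would make <x, y> - Gphi
    y unbounded. *)
Lemma newton_orthant : newton r phi `<=` @orthant R n.
Proof.
move=> x [M HM] j; rewrite leNgt; apply/negP => xj.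
pose y (s : R) : Rn := \row_i (ln r - 1 - (if i == j then s else 0)).
have Uy s : 0 <= s -> inU r (y s) by move=> s0 i; rewrite mxE; case: ifP; lra.
have b s : 0 <= s -> dotv x (y s) <= M + Gphi (y 0).
  move=> s0; have := HM (y s) (Uy s s0).
  rewrite -[phi _]/(gphi phi (y s)) (gphi_finE (Uy s s0)) -EFinB lee_fin => h.
  have : Gphi (y s) <= Gphi (y 0).
    by apply: Gphi_mono => [|i]; [exact: Uy|rewrite !mxE; case: ifP; lra].
  lra.
have e s : dotv x (y s) = dotv x (y 0) - x 0 j * s.
  rewrite /dotv (bigD1 j) // [in RHS](bigD1 j) //= !mxE eqxx.
  rewrite (eq_bigr (fun i => x 0 i * y 0 0 i)); last by move=> i /negbTE ij; rewrite !mxE ij.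
  by rewrite subr0; ring.
pose s := (`|M + Gphi (y 0) - dotv x (y 0)| + 1) / - x 0 j.
have s0 : 0 <= s by rewrite divr_ge0 ?addr_ge0 // oppr_ge0 ltW.
have := b s s0; rewrite e.
have -> : x 0 j * s = - (`|M + Gphi (y 0) - dotv x (y 0)| + 1) by rewrite /s; field; rewrite lt_eqF.
by have := ler_norm (M + Gphi (y 0) - dotv x (y 0)); lra.
Qed.

Lemma newton_mem (x : Rn) : newton r phi x <->
  exists M : R, forall y : Rn, inU r y -> dotv x y <= M + Gphi y.
Proof.
split=> [[M HM]|[M HM]]; exists M => y U; have := HM y U;
  rewrite -[phi _]/(gphi phi y) (gphi_finE U) -EFinB lee_fin; lra.
Qed.

End Finite.
End ToricConvex.

Section NewtonFacts.
Variable R : realType.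
Local Notation C := R[i].
Variable n : nat.
Local Notation Cn := 'rV[C]_n.
Local Notation Rn := 'rV[R]_n.

Lemma newton_up (r : R) (phi : Cn -> \bar R) (x v : Rn) : newton r phi x -> @orthant R n v ->
  newton r phi (x + v).
Proof.
move=> [M HM] v0; exists (M + \sum_j v 0 j * ln r) => y hy.
rewrite dotvDl EFinD addeAC EFinD; apply: leeD; first exact: HM.
by rewrite lee_fin; apply: ler_sum => j _; apply: ler_wpM2l => //; exact: ltW.
Qed.

(** Lowering every coordinate by ln r - ln rho brings the domain into the smaller one, does not
    raise [Gphi] by monotonicity, and changes <x, y> by a constant. *)
Lemma newton_shrink (r rho : R) (phi : Cn -> \bar R) : 0 < rho -> rho <= r ->
  psh (polydisk 0 r) phi -> toric r phi -> newton rho phi = newton r phi.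
Proof.
move=> rho0 rhor Hp Ht; have r0 : 0 < r := lt_le_trans rho0 rhor.
have lnr : ln rho <= ln r by rewrite ler_ln.
apply/seteqP; split=> x; last first.
  by move=> [M HM]; exists M => y hy; apply: HM => j; exact: lt_le_trans (hy j) lnr.
move=> [M HM].
have sub (y : Rn) : inU rho y -> inU r y by move=> h j; exact: lt_le_trans (h j) lnr.
have fin : exists2 y, inU r y & gphi phi y != -oo%E.
  exists (const_mx (ln rho - 1)); first exact/sub/inU_ex.
  by apply/eqP => h; have := HM _ (@inU_ex R n rho); rewrite -[phi _]/(gphi phi _) h.
have [Hp' Ht'] : psh (polydisk 0 rho) phi /\ toric rho phi.
  have s : polydisk 0 rho `<=` polydisk (0 : Cn) r by move=> z h j; exact: lt_le_trans (h j) rhor.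
  split; last by move=> th z /s; exact: Ht.
  split; first by move=> z /s; exact: (proj1 Hp).
  split; first by move=> z /s; exact: Hp.2.1.
  by move=> a b h; apply: Hp.2.2 => z /h /s.
have fin' : exists2 y, inU rho y & gphi phi y != -oo%E.
  exists (const_mx (ln rho - 1)); first exact: inU_ex.
  by apply/eqP => h; have := HM _ (@inU_ex R n rho); rewrite -[phi _]/(gphi phi _) h.
have x0 : @orthant R n x by apply: (newton_orthant rho0 Hp' Ht' fin'); exists M.
apply/(newton_mem r0 Hp Ht fin).
exists (M + (ln r - ln rho) * \sum_j x 0 j) => y hy.
pose y' : Rn := y - const_mx (ln r - ln rho).
have Uy' : inU rho y' by move=> j; rewrite !mxE; have := hy j; lra.
have := HM y' Uy'; rewrite -[phi _]/(gphi phi y') (gphi_finE r0 Hp Ht fin (sub _ Uy')) -EFinB lee_fin.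
have : Gphi phi y' <= Gphi phi y.
  by apply: (Gphi_mono r0 Hp Ht fin) => // j; rewrite !mxE; lra.
have -> : dotv x y = dotv x y' + (ln r - ln rho) * \sum_j x 0 j.
  rewrite mulr_sumr -big_split /=; apply: eq_bigr => j _; rewrite !mxE; ring.
lra.
Qed.
End NewtonFacts.

(** * Plurisubharmonicity of the approximants *)

Section DecreasingIntegral.
Variable R : realType.
Local Notation mu := (@lebesgue_measure R).

(** Monotone convergence for the nonnegative functions M - F_k. The function [f] is only compared
    with the limit from above, so that its measurability does not enter and the limit may be -oo. *)
Lemma integral_decreasing_lower (a b : R) (F : nat -> R -> R) (f : R -> \bar R) (M L : R) :
  a <= b -> (forall k, ctsI a b (F k)) -> (forall k t, a <= t <= b -> F k t <= M) ->
  (forall k t, a <= t <= b -> F k.+1 t <= F k t) ->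
  (forall t, a <= t <= b -> forall x : R, (f t < x%:E)%E -> exists k, F k t <= x) ->
  (forall k, L <= rint a b (F k)) -> (L%:E <= \int[mu]_(t in `[a, b]) f t)%E.
Proof.
move=> ab cF FM dF lim LF.
pose D : set (measurableTypeR R) := `[a, b]%classic.
have mD : measurable D by exact: measurable_itv.
have DE t : D t -> a <= t <= b by rewrite /D /= in_itv.
pose g k t := (M - F k t)%:E.
have cg k : ctsI a b (fun t => M - F k t) by apply: ctsIB => //; exact: ctsIc.
have mg k := measurable_int mu (ctsI_integrable (cg k)).
have g0 k t : D t -> (0 <= g k t)%E by move=> /DE h; rewrite lee_fin subr_ge0 FM.
have ndg t : D t -> nondecreasing_seq (g ^~ t).
  move=> /DE h; apply/nondecreasing_seqP => k; rewrite lee_fin lerD2l lerN2; exact: dF.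
have ig k : (\int[mu]_(t in D) g k t = (M * (b - a) - rint a b (F k))%:E)%E.
  by rewrite (rint_EFin (cg k)) rintB ?rintc //; exact: ctsIc.
pose G t := limn (g ^~ t).
have G0 t : D t -> (0 <= G t)%E.
  move=> Dt; apply: lime_ge; first exact: ereal_nondecreasing_is_cvgn (ndg t Dt).
  by near=> k; exact: g0.
have mG : measurable_fun D G.
  apply: (@emeasurable_fun_cvg _ _ _ D g G) => // t Dt.
  exact: ereal_nondecreasing_is_cvgn (ndg t Dt).
have iG : (\int[mu]_(t in D) G t <= (M * (b - a) - L)%:E)%E.
  have := @monotone_convergence _ _ _ mu D mD g mg g0 ndg; rewrite -/G => ->.
  apply: lime_le.
    by apply: ereal_nondecreasing_is_cvgn => i j ij; apply: le_integral_nomeas => t Dt; exact: ndg.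
  by near=> k; rewrite ig lee_fin lerD2l lerN2.
have intG : mu.-integrable D G.
  apply/integrableP; split=> //; apply: le_lt_trans (_ : (\int[mu]_(t in D) G t < +oo)%E).
    by apply: le_integral_nomeas => t Dt; rewrite gee0_abs // G0.
  exact: le_lt_trans iG (ltry _).
have cM : ctsI a b (fun=> M) by exact: ctsIc.
have iM : mu.-integrable D (fun=> M%:E) := ctsI_integrable cM.
have := integralB mD iM intG; rewrite (rint_EFin cM) rintc // => e.
apply: (@le_trans _ _ (\int[mu]_(t in D) ((fun=> M%:E) \- G) t)%E).
  rewrite e; move: iG; have : (0 <= \int[mu]_(t in D) G t)%E by exact: integral_ge0.
  case: (\int[mu]_(x in D) _)%E => [x| |] //= _; rewrite -EFinB !lee_fin; lra.
apply: le_integral_nomeas => t Dt /=; apply: lee_real_ub => x fx.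
have [k Fk] := lim t (DE t Dt) x fx.
have h : ((M - x)%:E <= G t)%E.
  apply: lime_ge; first exact: ereal_nondecreasing_is_cvgn (ndg t Dt).
  near=> m; apply: (@le_trans _ _ (g k t)); first by rewrite lee_fin lerD2l lerN2.
  by apply: ndg => //; near: m; exact: nbhs_infty_ge.
have := G0 t Dt; move: h; case: (G t) => [y| |] //= h _; last by rewrite leNye.
by rewrite -EFinB lee_fin; move: h; rewrite lee_fin; lra.
Unshelve. all: by end_near. Qed.
End DecreasingIntegral.

(** * Mean values of logarithms of moduli *)

Section LogMean.
Variable R : realType.
Local Notation C := R[i].
Local Notation Rez := complex.Re.
Local Notation Imz := complex.Im.

Lemma cmod2D (z w : C) : cmod2 (z + w) = cmod2 z + cmod2 w + 2 * (Rez z * Rez w + Imz z * Imz w).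
Proof. by rewrite /cmod2 ReD ImD; ring. Qed.

Lemma cmod2_expi (t : R) : cmod2 (expi t : C) = 1.
Proof. by rewrite cmod2_cabs cabs_expi expr1n. Qed.

(* A positive trigonometric polynomial of degree one is a constant times [|1 - z e^{it}|^2]
   with [|z| < 1]. *)
Lemma cmod2_circle_factor (a b : C) (eta : R) : 0 < eta -> exists A z,
  [/\ cmod2 a + eta <= A, cabs z < 1 &
   forall t, cmod2 (a + expi t * b) + eta = A * cmod2 (1 - z * expi t)].
Proof.
move=> eta0; pose P := cmod2 a * cmod2 b; pose S := cmod2 a + cmod2 b + eta.
have a0 := cmod2_ge0 a; have b0 := cmod2_ge0 b.
pose Dl := S ^+ 2 - 4 * P.
have Dl_ge : (cmod2 a - cmod2 b + eta) ^+ 2 <= Dl.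
  by rewrite /Dl /S /P; nra.
have Dl0 : 0 <= Dl := le_trans (sqr_ge0 _) Dl_ge.
pose q := Num.sqrt Dl; have q0 : 0 <= q := sqrtr_ge0 _.
have q2 : q ^+ 2 = Dl by rewrite sqr_sqrtr.
pose A := (S + q) / 2.
have AP : A ^+ 2 + P = A * S.
  have -> : A ^+ 2 + P = A * S + (q ^+ 2 - (S ^+ 2 - 4 * P)) / 4 by rewrite /A; field.
  by rewrite q2 subrr mul0r addr0.
have Aa : cmod2 a + eta <= A.
  have : cmod2 a - cmod2 b + eta <= q.
    apply: le_trans (ler_norm _) _; rewrite -sqrtr_sqr; exact: ler_wsqrtr.
  rewrite /A /S; lra.
have A0 : 0 < A by lra.
have qp : 0 < q.
  rewrite sqrtr_gt0 (_ : Dl = (cmod2 a - cmod2 b) ^+ 2 + 2 * (eta * (cmod2 a + cmod2 b)) + eta ^+ 2); last first.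
    by rewrite /Dl /S /P; ring.
  by rewrite ltr_wpDl ?exprn_gt0 // addr_ge0 ?sqr_ge0 // mulr_ge0 // mulr_ge0 ?(ltW eta0) // addr_ge0.
have PA : P < A ^+ 2.
  have qE : q = 2 * A - S by rewrite /A; field.
  have : 0 < A * q by rewrite mulr_gt0.
  by rewrite qE; move: AP; clear; lra.
pose z := - Complex ((Rez a * Rez b + Imz a * Imz b) / A) ((Rez a * Imz b - Imz a * Rez b) / A) : C.
have z2 : cmod2 z = P / A ^+ 2.
  by rewrite /z /cmod2 /P /cmod2 /=; field; rewrite gt_eqF.
exists A, z; split=> //.
  rewrite -(ltr_pXn2r (n := 2)) ?nnegrE ?cabs_ge0 // expr1n -cmod2_cabs z2.
  by rewrite ltr_pdivrMr ?exprn_gt0 // mul1r.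
move=> t; rewrite !cmod2D cmod2M cmod2_expi mul1r.
have -> : cmod2 (- (z * expi t)) = P / A ^+ 2.
  by rewrite cmod2_cabs cabsN cabsM cabs_expi mulr1 -cmod2_cabs.
have -> : cmod2 (1 : C) = 1 by rewrite cmod2_cabs cabs1 expr1n.
have -> : cmod2 b = A + P / A - cmod2 a - eta.
  have -> : A + P / A = S by apply: (mulfI (negbT (gt_eqF A0))); rewrite -AP; field; rewrite gt_eqF.
  by rewrite /S; ring.
rewrite /z !ReN !ImN !ReM !ImM ReN ImN /=; field; by rewrite gt_eqF.
Qed.

(** [eta] removes the zeros on the circle; by [cmod2_circle_factor] the integrand is ln A plus a
    term of mean zero. *)
Lemma ln_cmod2_mean (a b : C) (eta : R) : 0 < eta ->
  ctsI 0 (2 * pi) (fun t => ln (cmod2 (a + expi t * b) + eta)) /\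
  ln (cmod2 a + eta) * (2 * pi) <= rint 0 (2 * pi) (fun t => ln (cmod2 (a + expi t * b) + eta)).
Proof.
move=> eta0; have [A [z [Aa z1 E]]] := cmod2_circle_factor a b eta0.
have a0 := cmod2_ge0 a; have A0 : 0 < A by lra.
have p0 : 0 < 2 * pi :> R by rewrite mulr_gt0 // pi_gt0.
have e : (fun t => ln (cmod2 (a + expi t * b) + eta)) =
    (fun t => ln A + 2 * ln (cabs (1 - z * expi t))).
  apply/funext => t; rewrite E; have c0 : 0 < cabs (1 - z * expi t).
    by apply: lt_le_trans (cabs_lower 1 (- (z * expi t))); rewrite cabs1 cabsN cabsM cabs_expi mulr1 subr_gt0.
  by rewrite cmod2_cabs lnM ?posrE ?exprn_gt0 // lnXn // mulr_natl.
have c1 := @ctsI_ln_cabs R 0 (2 * pi) z z1.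
have c2 : ctsI 0 (2 * pi) (fun t => 2 * ln (cabs (1 - z * expi t))).
  by apply: ctsIM c1; exact: ctsIc.
rewrite e; split; first by apply: ctsID => //; exact: ctsIc.
rewrite rintD //; last exact: ctsIc.
rewrite rintc ?(ltW p0) // rintZ // ln_cabs_mean // mulr0 addr0 subr0.
by rewrite ler_pM2r // ler_ln ?posrE //; lra.
Qed.
End LogMean.
Section MonomialLog.
Variable R : realType.
Local Notation C := R[i].
Variable n : nat.
Local Notation Cn := 'rV[C]_n.
Local Notation mu := (@lebesgue_measure R).

Lemma cvg_big_prod (T : Type) (F : set_system T) (FF : Filter F) (I : Type) (s : seq I)
    (f : I -> T -> R) (l : I -> R) : (forall i, f i @ F --> l i) ->
  (fun x => \prod_(i <- s) f i x) @ F --> \prod_(i <- s) l i.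
Proof.
move=> H; elim: s => [|i s IH].
  under [fun x => _]funext do rewrite big_nil; rewrite big_nil; exact: cvg_cst.
by under [fun x => _]funext do rewrite big_cons; rewrite big_cons; exact: cvgM.
Qed.

Lemma monom_right_continuous (s : 'I_n -> R) (b : 'I_n -> nat) (T : R) : monom s b < T ->
  exists eta, 0 < eta /\ forall e, 0 <= e <= eta -> monom (fun j => s j + e) b < T.
Proof.
move=> sT.
have c : (fun x : R => monom (fun j => s j + x) b) @ (0 : R) --> monom s b.
  rewrite /monom; apply: cvg_big_prod => j.
  have := @exprn_continuous R (b j) (s j).
  have : (fun x : R => s j + x) @ (0 : R) --> s j.
    by rewrite -[X in _ --> X]addr0; apply: cvgD; [exact: cvg_cst|exact: cvg_id].
  move=> h1 h2; exact: (cvg_comp _ _ h1 h2).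
have d0 : 0 < T - monom s b by rewrite subr_gt0.
move/cvgrPdist_lt/(_ _ d0)/nbhs_ballP: c => [e e0 He].
exists (e / 2); split; first by rewrite divr_gt0.
move=> x /andP[x0 xe]; have : `|monom s b - monom (fun j => s j + x) b| < T - monom s b.
  apply: He; rewrite /ball /= sub0r normrN ger0_norm //.
  by move: e0 => /= e0; lra.
by rewrite ltr_norml => /andP[h _]; lra.
Qed.

Lemma ler_monom (s t : 'I_n -> R) b : (forall j, 0 <= s j <= t j) -> monom s b <= monom t b.
Proof.
move=> st; apply: ler_prod => j _; have /andP[s0 h] := st j.
by rewrite exprn_ge0 //= lerXn2r ?nnegrE // (le_trans s0 h).
Qed.

Lemma ln_monom (s : 'I_n -> R) b : (forall j, 0 < s j) ->
  ln (monom s b) = \sum_j (b j)%:R * ln (s j).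
Proof.
move=> s0; rewrite /monom.
suff : 0 < \prod_j s j ^+ b j /\ ln (\prod_j s j ^+ b j) = \sum_j (b j)%:R * ln (s j) by case.
elim/big_ind2: _; first by rewrite ln1.
  by move=> x1 y1 x2 y2 [h1 <-] [h2 <-]; rewrite mulr_gt0 // lnM ?posrE.
by move=> j _; rewrite exprn_gt0 // lnXn // mulr_natl.
Qed.

Lemma cmod2_monom (u : 'I_n -> C) b : cmod2 (monom u b) = monom (fun j => cmod2 (u j)) b.
Proof.
rewrite cmod2_cabs cabs_monom /monom -prodrXl; apply: eq_bigr => j _.
by rewrite cmod2_cabs -!exprM mulnC.
Qed.

Definition clog (c K x : R) : \bar R := (c%:E * lne x%:E + K%:E)%E.

Section Clog.
Variables (c K : R).
Hypothesis c0 : 0 < c.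

Lemma clog_le0 x : x <= 0 -> clog c K x = -oo%E.
Proof. by move=> x0; rewrite /clog le0_lneNy ?lee_fin // gt0_muleNy ?lte_fin. Qed.

Lemma clog_gt0 x : 0 < x -> clog c K x = (c * ln x + K)%:E.
Proof. by move=> x0; rewrite /clog lne_EFin. Qed.

Lemma clog_lt x t : (clog c K x < t%:E)%E = (x < expR ((t - K) / c)).
Proof.
have [x0|x0] := leP x 0.
  by rewrite clog_le0 // ltNyr (le_lt_trans x0) ?expR_gt0.
rewrite clog_gt0 // lte_fin -[X in _ = (X < _)](lnK (x := x)) ?posrE // ltr_expR ltr_pdivlMr //.
by rewrite -ltrBrDr mulrC.
Qed.

Lemma clog_mono x y : x <= y -> (clog c K x <= clog c K y)%E.
Proof.
by move=> xy; apply: lee_real_ub => M; rewrite clog_lt => h; apply: ltW; rewrite clog_lt; exact: le_lt_trans xy h.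
Qed.

(** Each coordinate is regularised separately by 1/(k+1), so that the logarithm of the monomial
    splits into one-variable means. The regularised logarithms are continuous and decrease to the
    integrand. *)
Lemma clog_monom_submean (a b : 'I_n -> C) (be : 'I_n -> nat) :
  (clog c K (cmod2 (monom a be)) <= ((2 * pi)^-1)%:E *
     \int[mu]_(t in `[0%R, (2 * pi)%R]) clog c K (cmod2 (monom (fun j => a j + expi t * b j)%R be)))%E.
Proof.
have [z|nz] := eqVneq (cmod2 (monom a be)) 0; first by rewrite clog_le0 ?z // leNye.
have p0 : 0 < 2 * pi :> R by rewrite mulr_gt0 // pi_gt0.
have m0 : 0 < cmod2 (monom a be) by rewrite lt_def nz cmod2_ge0.
rewrite clog_gt0 //; set L := c * _ + K.
suff : ((L * (2 * pi))%:E <= \int[mu]_(t in `[0%R, (2 * pi)%R])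
    clog c K (cmod2 (monom (fun j => a j + expi t * b j)%R be)))%E.
  move=> h; have -> : L%:E = (((2 * pi)^-1)%:E * (L * (2 * pi))%:E)%E.
    by rewrite -EFinM mulrC mulfK // gt_eqF.
  by apply: lee_wpmul2l h; rewrite lee_fin invr_ge0 ltW.
pose eta k : R := k.+1%:R^-1.
have eta0 k : 0 < eta k by rewrite invr_gt0.
pose F k t := K + c * \sum_j (be j)%:R * ln (cmod2 (a j + expi t * b j) + eta k).
have FE k t : F k t = c * ln (monom (fun j => cmod2 (a j + expi t * b j) + eta k) be) + K.
  rewrite ln_monom; first exact: addrC.
  by move=> j; apply: ltr_wpDl; [exact: cmod2_ge0|exact: eta0].
have cln k j : ctsI 0 (2 * pi) (fun t => ln (cmod2 (a j + expi t * b j) + eta k)).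
  exact: (proj1 (ln_cmod2_mean _ _ (eta0 k))).
have cs k : ctsI 0 (2 * pi) (fun t => \sum_j (be j)%:R * ln (cmod2 (a j + expi t * b j) + eta k)).
  by apply: ctsI_sum => j; apply: ctsIM => //; exact: ctsIc.
apply: (integral_decreasing_lower (F := F)
   (M := K + c * \sum_j (be j)%:R * ln ((cabs (a j) + cabs (b j)) ^+ 2 + 1))).
- exact: ltW.
- by move=> k; apply: ctsID; [exact: ctsIc|apply: ctsIM => //; exact: ctsIc].
- move=> k t _; rewrite lerD2l ler_pM2l //; apply: ler_sum => j _; apply: ler_wpM2l => //.
  have e1 : eta k <= 1 by rewrite invf_le1 // ler1n.
  rewrite ler_ln ?posrE ?ltr_wpDl ?cmod2_ge0 ?sqr_ge0 //; apply: lerD => //.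
  rewrite cmod2_cabs lerXn2r ?nnegrE ?addr_ge0 ?cabs_ge0 //; apply: le_trans (cabsD _ _) _.
  by rewrite cabsM cabs_expi mul1r.
- move=> k t _; rewrite lerD2l ler_pM2l //; apply: ler_sum => j _; apply: ler_wpM2l => //.
  rewrite ler_ln ?posrE ?ltr_wpDl ?cmod2_ge0 //; apply: lerD => //.
  by rewrite lef_pV2 ?posrE // ler_nat.
- move=> t _ x; rewrite clog_lt cmod2_monom => /monom_right_continuous[e [e0 He]].
  exists (Num.truncn e^-1); apply: ltW; rewrite -lte_fin FE -clog_gt0 ?clog_lt; last first.
    by apply: monom_gt0 => j; rewrite ltr_wpDl // cmod2_ge0.
  apply: He; rewrite ltW //= /eta invf_ple ?posrE //.
  by apply: ltW; exact: truncnS_gt.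
- move=> k; rewrite /F rintD ?rintZ ?rintc ?(ltW p0) //; first last.
  + by apply: ctsIM => //; exact: ctsIc.
  + exact: ctsIc.
  rewrite rint_sum ?(ltW p0) //; last by move=> j; apply: ctsIM => //; exact: ctsIc.
  rewrite /L subr0 [(c * _ + K) * _]mulrDl addrC lerD2l -mulrA ler_pM2l //.
  have aj j : (be j)%:R * ln (cmod2 (a j) + eta k) * (2 * pi) <=
       rint 0 (2 * pi) (fun t => (be j)%:R * ln (cmod2 (a j + expi t * b j) + eta k)).
    rewrite rintZ // -mulrA; apply: ler_wpM2l => //; exact: (proj2 (ln_cmod2_mean _ _ (eta0 k))).
  apply: le_trans (ler_sum _ (fun j _ => aj j)); rewrite -mulr_suml ler_pM2r //.
  rewrite -ln_monom; last by move=> j; rewrite ltr_wpDl // cmod2_ge0.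
  rewrite ler_ln ?posrE //; last by apply: monom_gt0 => j; rewrite ltr_wpDl // cmod2_ge0.
  rewrite cmod2_monom; apply: ler_monom => j; rewrite cmod2_ge0 /=.
  by rewrite lerDl ltW.
Qed.
End Clog.
End MonomialLog.

(** * The functions max (phi, psi + K) *)

Section Approximants.
Variable R : realType.
Local Notation C := R[i].
Variable n : nat.
Local Notation Cn := 'rV[C]_n.
Local Notation Rn := 'rV[R]_n.

Variables (p : nat) (be : 'I_p -> 'I_n -> nat).

Definition mono_size (z : Cn) : R := \big[Num.max/0]_k cmod2 (monom (fun j => z 0 j) (be k)).

Lemma mono_size_ge0 z : 0 <= mono_size z.
Proof. exact: bigmax_ge_id. Qed.

Lemma le_mono_size (z : Cn) k : cmod2 (monom (fun j => z 0 j) (be k)) <= mono_size z.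
Proof. exact: le_bigmax_cond. Qed.

Definition approximant (phi : Cn -> \bar R) (c K : R) (z : Cn) : \bar R :=
  maxe (phi z) (clog c K (mono_size z)).

Variables (c : R) (c0 : 0 < c).

Lemma clog_mono_size_le K (z : Cn) x :
  (forall k, (clog c K (cmod2 (monom (fun j => z 0%R j) (be k))) <= x)%E) ->
  (clog c K (mono_size z) <= x)%E.
Proof.
move=> H; rewrite /mono_size; elim/big_ind: _ => [|a b ha hb|k _]; last exact: H.
  by rewrite clog_le0 // leNye.
by rewrite maxEle; case: ifP.
Qed.

Lemma mono_size_usc (a : Cn) (T : R) : mono_size a < T ->
  exists d : R, 0 < d /\ forall z, polydisk a d z -> mono_size z < T.
Proof.
move=> aT; have T0 : 0 < T := le_lt_trans (mono_size_ge0 a) aT.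
have hk k : monom (fun j => cmod2 (a 0 j)) (be k) < T.
  by rewrite -cmod2_monom; apply: le_lt_trans aT; exact: le_mono_size.
have [eta Heta] := choice (fun k => monom_right_continuous (hk k)).
have [e [e0 He]] := ord_min_pos (fun k => proj1 (Heta k)).
(* As d <= 1, (|a_j| + d)^2 <= |a_j|^2 + d (2|a_j| + 1) <= |a_j|^2 + e. *)
have [d [d0 Hd]] := ord_min_pos (D := fun j => Num.min 1 (e / (2 * cabs (a 0 j) + 1)))
  ltac:(by move=> j; rewrite lt_min ltr01 divr_gt0 // ltr_wpDl // mulr_ge0 // cabs_ge0).
exists d; split=> // z pz; apply: bigmax_lt => // k _.
rewrite cmod2_monom; apply: le_lt_trans (proj2 (Heta k) e _); last by rewrite (ltW e0) He.
apply: ler_monom => j; rewrite cmod2_ge0 /= !cmod2_cabs.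
have zj : cabs (z 0 j) <= cabs (a 0 j) + d.
  by rewrite -(subrK (a 0 j) (z 0 j)) addrC; apply: le_trans (cabsD _ _) _; rewrite lerD2l ltW.
apply: (@le_trans _ _ ((cabs (a 0 j) + d) ^+ 2)).
  by rewrite lerXn2r ?nnegrE ?addr_ge0 ?cabs_ge0 // ltW.
have := Hd j; rewrite le_min => /andP[d1]; rewrite ler_pdivlMr; last first.
  by rewrite ltr_wpDl // mulr_ge0 // cabs_ge0.
have := cabs_ge0 (a 0 j); move: (cabs _) => x x0; nra.
Qed.

Section Psh.
Variables (Om : set Cn) (phi : Cn -> \bar R).
Hypothesis Hpsh : psh Om phi.

Lemma approximant_psh K : psh Om (approximant phi c K).
Proof.
have [h1 [h2 h3]] := Hpsh; split; last split.
- move=> z Oz; rewrite /approximant gt_max h1 //=.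
  by have [s0|s0] := leP (mono_size z) 0; [rewrite clog_le0|rewrite clog_gt0 // ltry].
- move=> a Oa t; rewrite /approximant gt_max => /andP[at1 at2].
  have [d1 [d10 H1]] := h2 a Oa t at1.
  move: at2; rewrite clog_lt // => /mono_size_usc[d2 [d20 H2]].
  exists (Num.min d1 d2); rewrite lt_min d10 d20; split=> // z pz.
  rewrite gt_max H1 /=; last by move=> j; apply: lt_le_trans (pz j) _; rewrite ge_min lexx.
  by rewrite clog_lt //; apply: H2 => j; apply: lt_le_trans (pz j) _; rewrite ge_min lexx orbT.
- move=> a b ab.
  have i0 : (0 <= ((2 * pi)^-1 : R)%:E)%E by rewrite lee_fin invr_ge0 mulr_ge0 // pi_ge0.
  rewrite {1}/approximant ge_max; apply/andP; split.
    apply: le_trans (h3 a b ab) _; apply: lee_wpmul2l => //.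
    by apply: le_integral_nomeas => t _; rewrite /approximant le_max lexx.
  apply: clog_mono_size_le => k.
  apply: le_trans (clog_monom_submean K c0 (fun j => a 0 j) (fun j => b 0 j) (be k)) _.
  apply: lee_wpmul2l => //; apply: le_integral_nomeas => t _.
  rewrite /approximant le_max; apply/orP; right; apply: clog_mono => //.
  have -> : (fun j => a 0 j + expi t * b 0 j) = (fun j => (a + expi t *: b) 0 j).
    by apply/funext => j; rewrite !mxE.
  exact: le_mono_size.
Qed.
End Psh.

Lemma mono_size_rot th (z : Cn) : mono_size (Defs.rot th z) = mono_size z.
Proof.
apply: eq_bigr => k _; rewrite !cmod2_monom; congr monom; apply/funext => j.
by rewrite mxE cmod2M cmod2_expi mul1r.
Qed.

Lemma approximant_toric r (phi : Cn -> \bar R) K : toric r phi -> toric r (approximant phi c K).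
Proof. by move=> Ht th z pz; rewrite /approximant mono_size_rot (Ht _ _ pz). Qed.

(** As phi is below a translate of the second term, the maximum differs from it by a bounded amount;
    replacing the largest of [p] monomials by their sum costs at most c ln p. *)
Lemma approximant_analytic (r : R) (phi : Cn -> \bar R) K K' :
  (forall z, polydisk 0 r z -> (phi z <= clog c K' (mono_size z))%E) ->
  analytic_sing (polydisk 0 r) (approximant phi c K).
Proof.
move=> H x px.
have [e [e0 He]] := ord_min_pos (D := fun j => r - cabs (x 0 j)) ltac:(
  by move=> j; have := px j; rewrite mxE subr0 subr_gt0).
have sub : polydisk x e `<=` polydisk (0 : Cn) r.
  move=> z pz j; rewrite mxE subr0 -(subrK (x 0 j) (z 0 j)).
  by apply: le_lt_trans (cabsD _ _) _; have := pz j; have := He j; lra.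
exists e; split=> //; split=> //.
pose S (z : Cn) := \sum_(k < p) cmod2 (monom (fun j => z 0 j) (be k)).
(* Where [S] vanishes both terms are -oo, and [fine] gives the default value 0. *)
pose h z := fine (approximant phi c K z - clog c 0 (S z)).
have S0 z : 0 <= S z by apply: sumr_ge0 => k _; exact: cmod2_ge0.
have mS z : mono_size z <= S z.
  apply: bigmax_le => // k _; rewrite /S (bigD1 k) //= lerDl.
  by apply: sumr_ge0 => i _; exact: cmod2_ge0.
have Sm z : S z <= p%:R * mono_size z.
  rewrite mulr_natl -[X in _ *+ X]card_ord -sumr_const; apply: ler_sum => k _; exact: le_mono_size.
have key z : polydisk 0 r z -> 0 < S z -> exists v, approximant phi c K z = v%:E /\
    `|v - c * ln (S z)| <= `|K| + `|K'| + c * ln p%:R.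
  move=> pz Sp; have sp : 0 < mono_size z.
    rewrite lt_def mono_size_ge0 andbT; apply: contraTneq Sp => s0.
    by rewrite -leNgt; have := Sm z; rewrite s0 mulr0.
  have pp : 0 < p%:R :> R.
    by rewrite ltr0n lt0n; apply: contraTneq Sp => p0; rewrite -leNgt; have := Sm z; rewrite p0 mul0r.
  have l1 : ln (mono_size z) <= ln (S z) by rewrite ler_ln ?posrE.
  have l2 : ln (S z) <= ln p%:R + ln (mono_size z).
    by rewrite -lnM ?posrE // ler_ln ?posrE ?mulr_gt0.
  have lo : ((c * ln (mono_size z) + K)%:E <= approximant phi c K z)%E.
    by rewrite /approximant -clog_gt0 // le_max lexx orbT.
  have hi : (approximant phi c K z <= (c * ln (mono_size z) + `|K| + `|K'|)%:E)%E.
    rewrite /approximant ge_max clog_gt0 // lee_fin; apply/andP; split.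
      apply: le_trans (H z pz) _; rewrite clog_gt0 // lee_fin.
      by have := ler_norm K'; have := normr_ge0 K; lra.
    by have := ler_norm K; have := normr_ge0 K'; lra.
  move: lo hi; case: (approximant phi c K z) => [v| |] //; rewrite !lee_fin => lo hi.
  exists v; split=> //; rewrite ler_norml; apply/andP.
  have := ler_norm (- K); rewrite normrN; have := normr_ge0 K'; have := normr_ge0 K.
  set a := ln (mono_size z) in l1 l2 lo hi; set b := ln (S z) in l1 l2 *; set d := ln p%:R in l2 *.
  move=> *; have c1 : c * a <= c * b by rewrite ler_pM2l.
  have c2 : c * b <= c * d + c * a by rewrite -mulrDr ler_pM2l.
  by split; lra.
exists c, p, (fun k z => monom (fun j => z 0 j) (be k)), h, (`|K| + `|K'| + c * ln p%:R); split; first exact: ltW.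
split; first by move=> k; exact: holo_monom.
have zero z : polydisk 0 r z -> S z = 0 -> approximant phi c K z = -oo%E.
  move=> pz Sz; have sz : mono_size z <= 0 by rewrite -Sz.
  have := H z pz; rewrite /approximant !clog_le0 // leeNy_eq => /eqP ->.
  by rewrite maxxx.
split.
  move=> z /sub pz; rewrite /h; have [Sz|Sz] := ltP 0 (S z).
    by have [v [-> hv]] := key z pz Sz; rewrite clog_gt0 // -EFinB addr0.
  have Sz0 : S z = 0 by apply/eqP; rewrite eq_le Sz S0.
  rewrite (zero z pz Sz0) clog_le0 //= normr0 !addr_ge0 // mulr_ge0 ?(ltW c0) //.
  by case: (p) => [|p']; [rewrite ln0|rewrite ln_ge0 // ler1n].
move=> z /sub pz; have [Sz|Sz] := ltP 0 (S z).
  have [v [hv _]] := key z pz Sz; rewrite /h hv clog_gt0 // -EFinB addr0 [fine _]/=.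
  rewrite -/(S z) lne_EFin // -EFinM -EFinD; congr EFin; ring.
have Sz0 : S z = 0 by apply/eqP; rewrite eq_le Sz S0.
by rewrite (zero z pz Sz0) -/(S z) le0_lneNy ?lee_fin // gt0_muleNy ?lte_fin.
Qed.

Lemma approximant_decreasing (phi : Cn -> \bar R) K K' z : K' <= K ->
  (approximant phi c K' z <= approximant phi c K z)%E.
Proof.
move=> KK; rewrite /approximant ge_max !le_max lexx /=; apply/orP; right.
by rewrite /clog; apply: leeD2l; rewrite lee_fin.
Qed.

Lemma approximant_cvg (phi : Cn -> \bar R) z :
  (phi z < +oo)%E -> approximant phi c (- m%:R) z @[m --> \oo] --> phi z.
Proof.
move=> zy; have [s0|s0] := leP (mono_size z) 0.
  rewrite (_ : (fun m => _) = (fun=> phi z)); first exact: cvg_cst.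
  by apply/funext => m; rewrite /approximant clog_le0 // maxeNy.
have lim (x : R) : exists N, forall m, (N <= m)%N -> (clog c (- m%:R) (mono_size z) <= x%:E)%E.
  exists (Num.truncn (c * ln (mono_size z) - x)).+1 => m hm.
  rewrite clog_gt0 // lee_fin.
  have : (Num.truncn (c * ln (mono_size z) - x)).+1%:R <= m%:R :> R by rewrite ler_nat.
  by have := truncnS_gt (c * ln (mono_size z) - x); lra.
case E : (phi z) zy => [v| |] // _.
  have [N HN] := lim v; apply: cvg_near_cst; near=> m.
  rewrite /approximant E; apply/max_idPl; apply: HN; near: m; exact: nbhs_infty_ge.
apply/cvgeNyPler => A _; have [N HN] := lim A; near=> m.
rewrite /approximant E maxNye; apply: HN; near: m; exact: nbhs_infty_ge.
Unshelve. all: by end_near. Qed.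
End Approximants.

(** * Local integrability: sufficient condition *)

Section SingularKernel.
Variable R : realType.
Local Notation C := R[i].
Local Notation Rez := complex.Re.
Local Notation Imz := complex.Im.
Local Notation mu := (@lebesgue_measure R).
Variable dl : R.
Hypotheses (dl0 : 0 < dl) (dl1 : dl <= 1).

(** The power |s|^(dl - 1), integrable at 0; at s = 0 it has the default value 1. *)
Definition sing (s : R) : R := expR ((dl - 1) * ln `|s|).

Let q : R := expR ((1 - dl) * ln 2).
Let q1 : 1 <= q.
Proof. by rewrite -expR0 ler_expR mulr_ge0 ?subr_ge0 // ln_ge0 // ler1n. Qed.
Let q2 : q < 2.
Proof.
have l2 : 0 < ln 2 :> R by rewrite ln_gt0 // ltr1n.
have : q < expR (ln 2) by rewrite ltr_expR; have := mulr_gt0 dl0 l2; lra.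
by rewrite lnK ?posrE.
Qed.

Let A m : set (measurableTypeR R) := `[- 2^-1 ^+ m, 2^-1 ^+ m]%classic.
Let mA m : measurable (A m). Proof. exact: measurable_itv. Qed.
Let term m (s : R) : \bar R := (q ^+ m * \1_(A m) s)%:E.
(** A measurable majorant of [sing], up to the factor q = 2^(1 - dl): its terms integrate to at most
    2 (q/2)^m, summable as q < 2. Being +oo at 0, it also dominates whatever value the integrand
    takes there. *)
Let dyad (s : R) : \bar R := (\sum_(0 <= m <oo) term m s)%E.

Let term0 m s : (0 <= term m s)%E.
Proof. by rewrite lee_fin mulr_ge0 // exprn_ge0 // (le_trans ler01). Qed.

Let dyad_ge_term m s : (term m s <= dyad s)%E.
Proof.
apply: le_trans (_ : (\sum_(0 <= i < m.+1) term i s <= _)%E); last first.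
  by apply: nneseries_lim_ge => // i _ _; exact: term0.
by rewrite big_nat_recr //= leeDr // sume_ge0.
Qed.

Let dyad_0 : dyad 0 = +oo%E.
Proof.
have H N : (N%:R%:E <= dyad 0)%E.
  apply: le_trans (_ : (\sum_(0 <= i < N) term i 0 <= _)%E); last first.
    by apply: nneseries_lim_ge => // i _ _; exact: term0.
  elim: N => [|N IH]; first by rewrite big_geq.
  rewrite big_nat_recr //= -natr1 EFinD; apply: leeD => //.
  rewrite lee_fin indicE mem_set ?mulr1 ?exprn_ege1 //.
  by rewrite /A /= in_itv /= oppr_le0 exprn_ge0.
have : (0 <= dyad 0)%E by exact: (H 0%N).
case E : (dyad 0) => [v| |] // v0; have := H (Num.truncn v).+1.
by rewrite E lee_fin leNgt truncnS_gt.
Qed.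

Let sing_le_dyad s : s != 0 -> `|s| <= 1 -> ((sing s)%:E <= q%:E * dyad s)%E.
Proof.
move=> s0 s1; have sp : 0 < `|s| by rewrite normr_gt0.
have [m [m1 m2]] : exists m, `|s| <= 2^-1 ^+ m /\ 2^-1 ^+ m.+1 < `|s|.
  have [N hN] := geom_small 1 sp.
  elim: N hN => [|N IH]; first by rewrite expr0 divr1 ltNge s1.
  move=> h; have [h2|h2] := ltP (1 / 2 ^+ N) `|s|; first exact: IH.
  by exists N; rewrite !exprVn -(div1r (2 ^+ N)) -(div1r (2 ^+ N.+1)).
apply: (@le_trans _ _ (q%:E * term m s)%E); last first.
  by apply: lee_wpmul2l; [rewrite lee_fin (le_trans ler01)|exact: dyad_ge_term].
rewrite -EFinM lee_fin indicE mem_set; last first.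
  by move: m1; rewrite ler_norml /A /= in_itv.
rewrite mulr1 -exprS /q -expRM_natl ler_expR.
have h : - (m.+1%:R * ln 2) <= ln `|s|.
  rewrite mulr_natl -lnXn // -lnV ?posrE ?exprn_gt0 //.
  by rewrite ler_ln ?posrE ?invr_gt0 ?exprn_gt0 // -exprVn ltW.
have d1 : 0 <= 1 - dl by rewrite subr_ge0.
by have := ler_wpM2l d1 h; lra.
Qed.

Let I0 : R := 2 / (1 - q / 2).

Let mterm m : measurable_fun (setT : set (measurableTypeR R)) (term m).
Proof. by apply/measurable_EFinP; apply: measurable_funM => //; apply: measurable_indic; exact: mA. Qed.

Let integral_dyad (e : R) : (\int[mu]_(s in `[(- e)%R, e]) dyad s <= I0%:E)%E.
Proof.
rewrite integral_nneseries //; first last.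
- by move=> m; apply: measurable_funS (mterm m).
have rq : q / 2 < 1 by rewrite ltr_pdivrMr // mul1r.
have rq0 : 0 <= q / 2 by rewrite divr_ge0 // (le_trans ler01).
have tm m : (\int[mu]_(s in `[(- e)%R, e]) term m s <= (2 * (q / 2) ^+ m)%:E)%E.
  under eq_integral do rewrite /term EFinM.
  rewrite ge0_integralZl_EFin //; first last.
  - by rewrite exprn_ge0 // (le_trans ler01).
  - by apply/measurable_EFinP; apply: measurable_indic; exact: mA.
  rewrite (@integral_indic _ _ _ mu _ (measurable_itv _) _ (mA m)).
  apply: (@le_trans _ _ ((q ^+ m)%:E * mu (A m))%E).
    apply: lee_wpmul2l; first by rewrite lee_fin exprn_ge0 // (le_trans ler01).
    apply: le_measure; rewrite ?inE; [apply: measurableI; [exact: mA|exact: measurable_itv]|exact: mA|exact: subIsetl].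
  have h : - 2^-1 ^+ m < 2^-1 ^+ m :> R by rewrite gtrN // exprn_gt0.
  rewrite /A lebesgue_measure_itv /= lte_fin h -EFinD -EFinM lee_fin opprK.
  by rewrite exprMn; lra.
apply: lime_le.
  by apply: is_cvg_nneseries => m _ _; apply: integral_ge0 => s _; exact: term0.
near=> N; apply: le_trans (_ : (\sum_(0 <= m < N) (2 * (q / 2) ^+ m)%:E <= _)%E).
  by apply: lee_sum => m _; exact: tm.
rewrite sumEFin lee_fin -mulr_sumr /I0 ler_pM2l //.
rewrite -[leRHS]div1r ler_pdivlMr ?subr_gt0 // big_mkord mulrC -opprB mulNr -subrX1 opprB.
by rewrite gerBl exprn_ge0.
Unshelve. all: by end_near. Qed.

Lemma integral_sing_le (e K : R) (h : R -> \bar R) : e <= 1 -> 0 < K ->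
  (forall s, s != 0 -> `|s| <= e -> (h s <= (K * sing s)%:E)%E) ->
  (\int[mu]_(s in `[(- e)%R, e]) h s <= (K * (q * I0))%:E)%E.
Proof.
move=> e1 K0 H.
apply: (@le_trans _ _ (\int[mu]_(s in `[(- e)%R, e]) ((K * q)%:E * dyad s))%E).
  apply: le_integral_nomeas => s; rewrite /= in_itv /= -ler_norml => se.
  have [->|s0] := eqVneq s 0.
    by rewrite dyad_0 gt0_muley ?leey // lte_fin mulr_gt0 // (lt_le_trans ltr01).
  apply: le_trans (H s s0 se) _; rewrite !EFinM -muleA; apply: lee_wpmul2l.
    by rewrite lee_fin ltW.
  by apply: sing_le_dyad => //; exact: le_trans se e1.
rewrite ge0_integralZl_EFin //; first last.
- by rewrite mulr_ge0 ?(ltW K0) // (le_trans ler01).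
- by apply: (ge0_emeasurable_sum (P := xpredT)) => [m s _ _|m _]; [exact: term0|by apply: measurable_funS (mterm m)].
- by move=> s _; apply: nneseries_ge0 => i _ _; exact: term0.
rewrite mulrA EFinM; apply: lee_wpmul2l (integral_dyad e).
by rewrite lee_fin mulr_ge0 ?(ltW K0) // (le_trans ler01).
Qed.

Lemma integral_sing : exists I : R, 0 < I /\ forall (e K : R) (h : R -> \bar R), e <= 1 -> 0 < K ->
  (forall s, s != 0 -> `|s| <= e -> (h s <= (K * sing s)%:E)%E) ->
  (\int[mu]_(s in `[(- e)%R, e]) h s <= (K * I)%:E)%E.
Proof.
exists (q * I0); split; last exact: integral_sing_le.
apply: mulr_gt0; first exact: lt_le_trans ltr01 q1.
by rewrite divr_gt0 // subr_gt0 ltr_pdivrMr // mul1r; exact: q2.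
Qed.
End SingularKernel.

Section BoxFinite.
Variable R : realType.
Local Notation C := R[i].
Local Notation Rez := complex.Re.
Local Notation Imz := complex.Im.
Variable n : nat.
Local Notation Cn := 'rV[C]_n.

Definition off_axes (e : R) (w : C) :=
  [/\ Rez w != 0, `|Rez w| <= e, Imz w != 0 & `|Imz w| <= e].

(** Powers of the real and imaginary parts separately, to match the iterated integral in
    [boxint]. *)
Definition sing2 (dl : R) (w : C) : R := sing dl (Rez w) * sing dl (Imz w).

Lemma sing2_gt0 dl w : 0 < sing2 dl w.
Proof. by rewrite mulr_gt0 // expR_gt0. Qed.

Lemma shiftc_eq (z : Cn) (k : 'I_n) w : shiftc z k w 0 k = z 0 k + w.
Proof. by rewrite mxE eqxx. Qed.

Lemma shiftc_neq (z : Cn) (k : nat) w (j : 'I_n) : (j : nat) != k -> shiftc z k w 0 j = z 0 j.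
Proof. by move=> /negbTE jk; rewrite mxE jk. Qed.

(** Induction on the number of integrated coordinates; each complex coordinate brings two
    one-variable integrals, hence the power 2k. *)
Lemma boxint_sing (F : Cn -> \bar R) (x : Cn) (e dl K : R) : 0 < dl -> dl <= 1 -> e <= 1 -> 0 < K ->
  (forall z : Cn, (forall j, off_axes e (z 0%R j - x 0%R j)%R) ->
     (F z <= (K * \prod_j sing2 dl (z 0%R j - x 0%R j)%R)%:E)%E) ->
  (boxint F e n x < +oo)%E.
Proof.
move=> dl0 dl1 e1 K0 HF; have [I [I0 HI]] := integral_sing dl0 dl1.
have claim k : (k <= n)%N -> forall z : Cn, (forall j : 'I_n, (j < k)%N -> z 0 j = x 0 j) ->
    (forall j : 'I_n, (k <= j)%N -> off_axes e (z 0 j - x 0 j)) ->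
    (boxint F e k z <= (K * I ^+ (2 * k) * \prod_(j < n | (k <= j)%N) sing2 dl (z 0%R j - x 0%R j)%R)%:E)%E.
  elim: k => [|k IH] kn z zx zo.
    by rewrite muln0 expr0 mulr1; apply: HF => j; exact: zo.
  set P := \prod_(j < n | (k.+1 <= j)%N) _.
  have P0 : 0 < P by apply: prodr_gt0 => j _; exact: sing2_gt0.
  have K'0 : 0 < K * I ^+ (2 * k) * P by rewrite !mulr_gt0 // exprn_gt0.
  rewrite /= (_ : K * I ^+ (2 * k.+1) * P = (K * I ^+ (2 * k) * P * I) * I); last first.
    by rewrite mulnS add2n !exprS; ring.
  apply: (HI) => //; first by rewrite mulr_gt0.
  move=> s s0 se; rewrite mulrAC; apply: (HI) => //; first by rewrite mulr_gt0 // expR_gt0.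
  move=> t t0 te; pose ko := Ordinal kn.
  have zk : z 0 ko = x 0 ko by apply: zx.
  have sk : shiftc z k (Complex s t) 0 ko - x 0 ko = Complex s t.
    by rewrite (shiftc_eq z ko) zk addrAC subrr add0r.
  apply: le_trans (IH (ltnW kn) (shiftc z k (Complex s t)) _ _) _.
  - move=> j jk; rewrite shiftc_neq ?(ltn_eqF jk) //; apply: zx; exact: ltnW.
  - move=> j; rewrite leq_eqVlt => /orP[/eqP kj|kj]; last first.
      by rewrite shiftc_neq ?(gtn_eqF kj) //; exact: zo.
    by have -> : j = ko; [exact: val_inj|rewrite sk; split].
  rewrite lee_fin (bigD1 ko) //= sk.
  rewrite (_ : \prod_(j < n | (k <= j)%N && (j != ko)) _ = P).
    by rewrite /sing2 /= le_eqVlt; apply/orP; left; apply/eqP; ring.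
  apply: eq_big => [j|j].
    by rewrite [RHS]ltn_neqAle andbC; congr (_ && _); rewrite eq_sym.
  by move=> /andP[_ jk]; rewrite shiftc_neq.
apply: le_lt_trans (claim n (leqnn n) x _ _) (ltry _) => // j.
by rewrite leqNgt ltn_ord.
Qed.
End BoxFinite.

Section Sufficient.
Variable R : realType.
Local Notation C := R[i].
Local Notation Rez := complex.Re.
Local Notation Imz := complex.Im.
Variable n : nat.
Local Notation Cn := 'rV[C]_n.
Local Notation Rn := 'rV[R]_n.

Definition logv (z : Cn) : Rn := \row_j ln (cabs (z 0 j)).

Variables (r : R) (phi : Cn -> \bar R).
Hypotheses (r0 : 0 < r) (Hpsh : psh (polydisk 0 r) phi) (Htor : toric r phi).
Hypothesis fin : exists2 y, inU r y & gphi phi y != -oo%E.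

Lemma inU_logv (z : Cn) : polydisk 0 r z -> (forall j, z 0 j != 0) -> inU r (logv z).
Proof.
move=> pz z0 j; rewrite mxE; have := pz j; rewrite mxE subr0 => h.
by rewrite ltr_ln ?posrE // cabs_gt0.
Qed.

Lemma phi_Gphi (z : Cn) : polydisk 0 r z -> (forall j, z 0 j != 0) -> phi z = (Gphi phi (logv z))%:E.
Proof.
move=> pz z0; rewrite (phi_log Htor pz z0) -[phi _]/(gphi phi (logv z)).
by apply: (gphi_finE r0 Hpsh Htor fin); exact: inU_logv.
Qed.

Lemma off_axes_le (e : R) (w : C) : off_axes e w -> cabs w <= 2 * e.
Proof. by move=> [_ h1 _ h2]; apply: le_trans (cabs_le_ReIm w) _; lra. Qed.

(** From |Re w| |Im w| <= |w|^2. As dl <= 1, it bounds |w|^(2 dl - 2) by [sing2 dl w]. *)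
Lemma ln_off_axes (w : C) : Rez w != 0 -> Imz w != 0 ->
  ln `|Rez w| + ln `|Imz w| <= 2 * ln (cabs w).
Proof.
move=> a0 b0; have w0 : 0 < cabs w.
  by rewrite cabs_gt0; apply: contraNneq a0 => ->.
have ap : 0 < `|Rez w| by rewrite normr_gt0.
have bp : 0 < `|Imz w| by rewrite normr_gt0.
rewrite mulr_natl -lnXn // -lnM ?posrE // ler_ln ?posrE ?mulr_gt0 ?exprn_gt0 //.
rewrite cabs_sqr /cmod2 -(real_normK (num_real (Rez w))) -(real_normK (num_real (Imz w))).
nra.
Qed.

Lemma inJ_suff (x : Cn) (f : Cn -> C) (e0 rho B dl M d : R) (V : seq {ffun 'I_n -> nat}) :
  polydisk 0 r x -> 0 < e0 -> holo (polydisk x e0) f ->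
  monomial_size (fun u => f (x + rowf u)) rho V B ->
  0 < dl -> dl <= 1 -> 0 < d ->
  (forall g, g \in V -> forall z, polydisk x d z -> polydisk 0 r z -> (forall j, z 0 j != 0) ->
     \sum_(j | x 0 j == 0) ((g j)%:R + 1 - dl) * ln (cabs (z 0 j)) - M <= Gphi phi (logv z)) ->
  inJ (polydisk 0 r) phi x f.
Proof.
move=> px e00 hf [rho0 _ _ Fle] dl0 dl1 d0 H.
have [dx [dx0 Hdx]] := ord_min_pos (D := fun j => r - cabs (x 0 j)) ltac:(
  by move=> j; have := px j; rewrite mxE subr0 subr_gt0).
have D0 j : 0 < (if x 0 j == 0 then 1 else cabs (x 0 j)).
  by case: ifP => [_|/negbT h]; rewrite ?cabs_gt0 // ltr01.
have [mx [mx0 Hmx]] := ord_min_pos D0.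
have [e [ep /= /and5P[e_1 e_2 e_3 e_4 /and3P[e_5 e_6 _]]]] : exists e, 0 < e /\
    all (fun x => e < x) [:: e0 / 2; rho / 2; dx / 2; mx / 2; d / 2; 1 / 2].
  by apply: small_pos; rewrite /= !divr_gt0.
have near_le (z : Cn) (a : R) : polydisk x a z -> forall j, cabs (z 0 j) < cabs (x 0 j) + a.
  move=> pz j; rewrite -(subrK (x 0 j) (z 0 j)); apply: le_lt_trans (cabsD _ _) _.
  by have := pz j; lra.
have inOm (z : Cn) : polydisk x (2 * e) z -> polydisk 0 r z.
  move=> pz; apply/polydisk0E => j; have := near_le z _ pz j; have := Hdx j; lra.
exists e; split=> //; split; first by move=> z; exact: inOm.
split.
  by apply: holo_sub hf => z pz j; apply: lt_le_trans (pz j) _; lra.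
pose K := (B * (size V)%:R) ^+ 2 * expR (2 * M) + 1.
have K0 : 0 < K by rewrite ltr_wpDl // mulr_ge0 ?sqr_ge0 // expR_ge0.
apply: (boxint_sing (dl := dl) (K := K)) => //; first by lra.
move=> z zo; pose w j := z 0 j - x 0 j.
have w2 j : cabs (w j) <= 2 * e by apply: off_axes_le; exact: zo.
have pz (a : R) : 2 * e < a -> polydisk x a z by move=> ea j; apply: le_lt_trans (w2 j) ea.
have w0 j : w j != 0 by have [+ _ _ _] := zo j; rewrite -/(w j); apply: contraNneq => ->.
have z0 j : z 0 j != 0.
  have [xj|xj] := eqVneq (x 0 j) 0; first by have := w0 j; rewrite /w xj subr0.
  rewrite -cabs_gt0; have := Hmx j; rewrite (negbTE xj) => h.
  have := cabs_lower (x 0 j) (w j); rewrite /w (addrC (x 0 j)) subrK; have := w2 j; rewrite -/(w j); lra.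
have Oz : polydisk 0 r z.
  by apply/polydisk0E => j; have := near_le z dx (pz dx ltac:(lra)) j; have := Hdx j; lra.
have fz : cabs (f z) <= B * \sum_(v <- V) monom (fun i => cabs (w i)) v.
  have wr i : cabs (w i) <= rho by apply: le_trans (w2 i) _; lra.
  have := Fle w wr.
  suff -> : x + rowf w = z by [].
  by apply/rowP => j; rewrite !mxE /w (addrC (x 0 j)) subrK.
have -> : expeR (- (2%:E * phi z))%E = (expR (- (2 * Gphi phi (logv z))))%:E.
  by rewrite (phi_Gphi Oz z0).
rewrite -EFinM lee_fin.
set G := Gphi phi _.
have [V0|[v0 Vv0]] : V = [::] \/ exists v, v \in V.
  by case: (V) => [|v V']; [left|right; exists v; rewrite mem_head].
  rewrite V0 big_nil mulr0 in fz.
  have -> : cmod2 (f z) = 0.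
    by rewrite cmod2_cabs; apply/eqP; rewrite expf_eq0 /= eq_le fz cabs_ge0.
  by rewrite mul0r mulr_ge0 ?(ltW K0) // ltW // prodr_gt0 // => j _; exact: sing2_gt0.
(* The largest monomial at this point; it varies with [z], which is why the hypothesis ranges over
   all of [V]. *)
have [g Vg Hg] := argmax_seq (fun v : {ffun 'I_n -> nat} => monom (fun i => cabs (w i)) v) Vv0.
have wp j : 0 < cabs (w j) by rewrite cabs_gt0.
have m0 : 0 < monom (fun i => cabs (w i)) g by apply: monom_gt0.
set m := monom _ g in Hg m0.
have fm : cmod2 (f z) <= (B * (size V)%:R) ^+ 2 * m ^+ 2.
  have S0 : 0 <= \sum_(v <- V) monom (fun i => cabs (w i)) v.
    by apply: sumr_ge0 => v _; apply: monom_ge0 => i; exact: cabs_ge0.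
  have Sm : \sum_(v <- V) monom (fun i => cabs (w i)) v <= (size V)%:R * m.
    rewrite big_seq; apply: le_trans (ler_sum _ (fun v => Hg v)) _.
    by rewrite -big_seq big_const_seq count_predT iter_addr_0 mulr_natl.
  rewrite cmod2_cabs; apply: le_trans (_ : (B * \sum_(v <- V) monom (fun i => cabs (w i)) v) ^+ 2 <= _).
    by rewrite lerXn2r ?nnegrE ?cabs_ge0 // (le_trans (cabs_ge0 _) fz).
  rewrite [leLHS]exprMn [(B * (size V)%:R) ^+ 2]exprMn -[leRHS]mulrA; apply: ler_wpM2l; first exact: sqr_ge0.
  by rewrite -exprMn lerXn2r ?nnegrE // mulr_ge0 // ltW.
have key : m ^+ 2 * expR (- (2 * G)) <= expR (2 * M) * \prod_j sing2 dl (w j).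
  have -> : m ^+ 2 = expR (2 * \sum_j (g j)%:R * ln (cabs (w j))).
    by rewrite expRM_natl -ln_monom // lnK.
  rewrite -expRD.
  have -> : \prod_j sing2 dl (w j) = expR (\sum_j (dl - 1) * (ln `|Rez (w j)| + ln `|Imz (w j)|)).
    by rewrite expR_sum; apply: eq_bigr => j _; rewrite /sing2 /sing -expRD mulrDr.
  rewrite -expRD ler_expR.
  have := H g Vg z (pz d ltac:(lra)) Oz z0; rewrite -/G => h.
  (* Coordinate by coordinate: if x_j = 0, the missing 1 - dl is supplied by [sing2]; otherwise
     |w_j| <= 1 makes the left term nonpositive and the right one nonnegative. *)
  suff : 2 * (\sum_j (g j)%:R * ln (cabs (w j))) <=
    2 * (\sum_(j | x 0 j == 0) ((g j)%:R + 1 - dl) * ln (cabs (z 0 j))) +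
    \sum_j (dl - 1) * (ln `|Rez (w j)| + ln `|Imz (w j)|) by lra.
  rewrite [X in 2 * X + _]big_mkcond !mulr_sumr -big_split /=; apply: ler_sum => j _.
  have [wr wre wi wie] := zo j; rewrite -/(w j) in wr wre wi wie.
  have l1 := ln_off_axes wr wi.
  have l2 : ln (cabs (w j)) <= 0 by apply: ln_le0; have := w2 j; move: e_6; clear - R n r phi r0 Hpsh Htor fin; lra.
  have l3 : ln `|Rez (w j)| <= 0 by apply: ln_le0; move: wre e_6; clear - R n r phi r0 Hpsh Htor fin; lra.
  have l4 : ln `|Imz (w j)| <= 0 by apply: ln_le0; move: wie e_6; clear - R n r phi r0 Hpsh Htor fin; lra.
  have gj : 0 <= (g j)%:R :> R by [].
  case: ifP => [/eqP xj|_]; last by move: l1 l2 l3 l4 gj dl0 dl1; clear - R n r phi r0 Hpsh Htor fin; nra.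
  have -> : z 0 j = w j by rewrite /w xj subr0.
  by move: l1 l2 l3 l4 gj dl0 dl1; clear - R n r phi r0 Hpsh Htor fin; nra.
have P0 : 0 <= \prod_j sing2 dl (w j) by apply: prodr_ge0 => j _; rewrite ltW // sing2_gt0.
apply: le_trans (ler_wpM2r (expR_ge0 _) fm) _; rewrite -mulrA.
apply: le_trans (ler_wpM2l (sqr_ge0 _) key) _; rewrite mulrA; apply: ler_wpM2r => //.
by rewrite /K lerDl.
Qed.
End Sufficient.

(** * Local integrability: necessary condition *)

Section BoxLower.
Variable R : realType.
Local Notation C := R[i].
Local Notation Rez := complex.Re.
Local Notation Imz := complex.Im.
Local Notation mu := (@lebesgue_measure R).

Lemma integral_sum_itv (I : finType) (A a h : I -> R) (e : R) :
  (forall i, 0 <= A i) -> (forall i, 0 < h i) -> (forall i, `|a i| + h i <= e) ->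
  (\int[mu]_(s in `[(- e)%R, e]) (\sum_i A i * (`|s - a i| <= h i)%R%:R)%:E =
    (\sum_i A i * (2 * h i))%:E)%E.
Proof.
move=> A0 h0 he.
have mI i : measurable (`[a i - h i, a i + h i]%classic : set (measurableTypeR R)) by exact: measurable_itv.
under eq_integral do rewrite -sumEFin.
rewrite ge0_integral_sum //; first last.
- by move=> i s _; rewrite lee_fin mulr_ge0.
- move=> i; apply/measurable_EFinP; apply: measurable_funM => //.
  rewrite (_ : (fun s => _) = \1_(`[a i - h i, a i + h i]%classic)).
    by apply: measurable_indic; exact: mI.
  by apply/funext => s; rewrite indicE mem_setE /= in_itv /= ler_distl.
rewrite -sumEFin; apply: eq_bigr => i _.
have E s : (A i * (`|s - a i| <= h i)%R%:R)%:E = ((A i)%:E * (\1_(`[a i - h i, a i + h i]%classic) s)%:E)%E.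
  by rewrite -EFinM indicE mem_setE /= in_itv /= ler_distl.
under eq_integral do rewrite E.
rewrite ge0_integralZl_EFin //; last first.
  by apply/measurable_EFinP; apply: measurable_indic; exact: mI.
rewrite (@integral_indic _ _ _ mu _ (measurable_itv _) _ (mI i)).
have -> : `[a i - h i, a i + h i]%classic `&` `[(- e)%R, e]%classic = `[a i - h i, a i + h i]%classic :> set R.
  apply/setIidPl => s /=; rewrite !in_itv /= -ler_distl => hs; rewrite -ler_norml.
  rewrite -(subrK (a i) s); apply: le_trans (ler_normD _ _) _.
  by have := he i; lra.
have M : mu `[a i - h i, a i + h i]%classic = (2 * h i)%:E.
  rewrite lebesgue_measure_itv /= lte_fin ifT; last by have := h0 i; lra.
  by rewrite -EFinD; congr EFin; ring.
by rewrite EFinM -M.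
Qed.

Variable n : nat.
Local Notation Cn := 'rV[C]_n.

Definition in_square (h : R) (w : C) := (`|Rez w| <= h) && (`|Imz w| <= h).

(** A sum of indicators of boxes is integrated in place of [F], one coordinate at a time;
    disjointness ensures that at most one of them counts at each point. *)
Lemma boxint_lower (I : finType) (F : Cn -> \bar R) (x : Cn) (e : R) (v : I -> R)
    (a : I -> 'I_n -> C) (h : I -> 'I_n -> R) :
  (forall i, 0 <= v i) -> (forall z, 0 <= F z)%E -> (forall i j, 0 < h i j) ->
  (forall i j, `|Rez (a i j)| + h i j <= e /\ `|Imz (a i j)| + h i j <= e) ->
  (forall w : 'I_n -> C, forall i i', (forall j, in_square (h i j) (w j - a i j)) ->
     (forall j, in_square (h i' j) (w j - a i' j)) -> i = i') ->
  (forall i (z : Cn), (forall j, in_square (h i j) (z 0%R j - x 0%R j - a i j)%R) -> ((v i)%:E <= F z)%E) ->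
  ((\sum_i v i * \prod_j (2 * h i j) ^+ 2)%:E <= boxint F e n x)%E.
Proof.
move=> v0 F0 h0 he disj Fv.
pose ind (z : Cn) i (j : 'I_n) : R := (in_square (h i j) (z 0 j - x 0 j - a i j))%:R.
have claim k : (k <= n)%N -> forall z : Cn, (forall j : 'I_n, (j < k)%N -> z 0 j = x 0 j) ->
    ((\sum_i v i * \prod_(j < n | (j < k)%N) (2 * h i j) ^+ 2 * \prod_(j < n | (k <= j)%N) ind z i j)%:E
       <= boxint F e k z)%E.
  elim: k => [|k IH] kn z zx.
    rewrite /= (eq_bigr (fun i => v i * \prod_j ind z i j)); last first.
      by move=> i _; rewrite big_pred0 // mulr1.
    have [[i Hi]|none] := pselect (exists i, forall j, in_square (h i j) (z 0 j - x 0 j - a i j)).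
      rewrite (bigD1 i) //= [X in _ + X]big1 ?addr0.
        by rewrite big1 ?mulr1 => [|j _]; [exact: Fv Hi|rewrite /ind Hi].
      move=> i' /eqP i'i; have [j hj] : exists j, ~~ in_square (h i' j) (z 0 j - x 0 j - a i' j).
        apply: contrapT => no; apply: i'i; apply: (disj (fun j => z 0 j - x 0 j)) => // j.
        by apply: contrapT => hj; apply: no; exists j; apply/negP.
      by rewrite (bigD1 j) //= /ind (negbTE hj) mul0r mulr0.
    rewrite big1 // => i _.
    have [j hj] : exists j, ~~ in_square (h i j) (z 0 j - x 0 j - a i j).
      apply: contrapT => no; apply: none; exists i => j.
      by apply: contrapT => hj; apply: no; exists j; apply/negP.
    by rewrite (bigD1 j) //= /ind (negbTE hj) mul0r mulr0.
  pose ko := Ordinal kn.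
  pose Q i := v i * \prod_(j < n | (j < k)%N) (2 * h i j) ^+ 2 * \prod_(j < n | (k.+1 <= j)%N) ind z i j.
  have Q0 i : 0 <= Q i.
    by rewrite !mulr_ge0 //; [apply: prodr_ge0 => j _; exact: sqr_ge0|apply: prodr_ge0].
  have zk : z 0 ko = x 0 ko by apply: zx.
  rewrite (_ : \sum_i _ = \sum_i (Q i * (2 * h i ko)) * (2 * h i ko)); last first.
    apply: eq_bigr => i _; rewrite (bigD1 ko) //= (_ : \prod_(j < n | _ && _) _ = \prod_(j < n | (j < k)%N) (2 * h i j) ^+ 2).
      by rewrite /Q expr2; ring.
    by apply: eq_bigl => j; rewrite ltnS andbC [RHS]ltn_neqAle.
  have Qh i : 0 <= Q i * (2 * h i ko) by rewrite mulr_ge0 // mulr_ge0 // ltW.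
  rewrite -(@integral_sum_itv I (fun i => Q i * (2 * h i ko)) (fun i => Rez (a i ko)) (fun i => h i ko) e) //; last first.
    by move=> i; exact: (proj1 (he i ko)).
  rewrite [X in (_ <= X)%E]/=; apply: le_integral_nomeas => s _.
  rewrite (_ : \sum_i _ = \sum_i (Q i * (`|s - Rez (a i ko)| <= h i ko)%R%:R) * (2 * h i ko)); last first.
    by apply: eq_bigr => i _; rewrite mulrAC.
  rewrite -(@integral_sum_itv I (fun i => Q i * (`|s - Rez (a i ko)| <= h i ko)%R%:R) (fun i => Imz (a i ko)) (fun i => h i ko) e) //; first last.
  - by move=> i; exact: (proj2 (he i ko)).
  - by move=> i; rewrite mulr_ge0.
  apply: le_integral_nomeas => t _.
  apply: le_trans (IH (ltnW kn) (shiftc z k (Complex s t)) _); last first.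
    move=> j jk; rewrite shiftc_neq ?(ltn_eqF jk) //; apply: zx; exact: ltnW.
  rewrite lee_fin le_eqVlt; apply/orP; left; apply/eqP; apply: eq_bigr => i _.
  have -> : \prod_(j < n | (k <= j)%N) ind (shiftc z k (Complex s t)) i j =
      ind (shiftc z k (Complex s t)) i ko * \prod_(j < n | (k.+1 <= j)%N) ind z i j.
    rewrite (bigD1 ko) //=; congr (_ * _); apply: eq_big => [j|j].
      by rewrite [RHS]ltn_neqAle andbC; congr (_ && _); rewrite eq_sym.
    by move=> /andP[_ jk]; rewrite /ind shiftc_neq.
  have -> : ind (shiftc z k (Complex s t)) i ko = (`|s - Rez (a i ko)| <= h i ko)%R%:R * (`|t - Imz (a i ko)| <= h i ko)%R%:R.
    rewrite /ind (shiftc_eq z ko) zk (addrAC (x 0 ko)) subrr add0r /in_square ReD ImD ReN ImN /=.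
    by rewrite -natrM mulnb.
  by rewrite /Q; ring.
have := claim n (leqnn n) x (fun j _ => erefl); congr (_ <= _)%E; congr EFin.
apply: eq_bigr => i _.
rewrite [X in _ * X]big_pred0 ?mulr1; last by move=> j; rewrite leqNgt ltn_ord.
by congr (_ * _); apply: eq_bigl => j; rewrite ltn_ord.
Qed.
End BoxLower.

(** * Linear growth of convex functions from separated points *)

Section ConvexGrowth.
Variable R : realType.
Variable n : nat.
Local Notation Rn := 'rV[R]_n.
Variables (J : pred 'I_n) (L : R) (Z : 'I_n -> R).

Definition in_region (Y : Rn) := forall j, if J j then is_true (Y 0 j <= L) else Y 0 j = Z j.

Lemma in_region_segment (Y0 Y : Rn) (th : R) : in_region Y0 -> in_region Y -> 0 <= th <= 1 ->
  in_region ((1 - th) *: Y0 + th *: Y).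
Proof.
move=> h0 h /andP[t0 t1] j; have := h0 j; have := h j; rewrite !mxE; case: (J j).
  by move: (Y 0 j) (Y0 0 j) => a b; nra.
by move=> -> ->; ring.
Qed.

(* On a long segment where [H <= t0 + 1] there would be room for too many separated points. *)
Lemma separated_growth (H : Rn -> R) (C1 Ib : R) : 0 < C1 ->
  (forall Y0 Y th, in_region Y0 -> in_region Y -> 0 <= th <= 1 ->
     H ((1 - th) *: Y0 + th *: Y) <= (1 - th) * H Y0 + th * H Y) ->
  (forall N (Y : 'I_N -> Rn), (forall i, in_region (Y i)) ->
     (forall i i', i != i' -> exists2 j, J j & ln 2 <= `|Y i 0 j - Y i' 0 j|) ->
     \sum_i C1 * expR (- (2 * H (Y i))) <= Ib) ->
  exists dl M : R, 0 < dl /\ forall Y, in_region Y -> dl * (\sum_(j | J j) (L - Y 0 j)) - M <= H Y.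
Proof.
move=> C10 cvx sep.
pose Y0 : Rn := \row_j (if J j then L else Z j).
have rY0 : in_region Y0 by move=> j; rewrite mxE; case: (J j).
(* [v] is the least contribution of a point with [H <= t0 + 1]; [N] such points exceed [Ib], and [T]
   is the length that leaves room for [N] points at mutual distance ln 2. *)
pose t0 := H Y0; pose v := C1 * expR (- (2 * (t0 + 1))).
have v0 : 0 < v by rewrite mulr_gt0 // expR_gt0.
pose N := (Num.truncn (`|Ib| / v)).+1.
have Nv : Ib < N%:R * v.
  rewrite -ltr_pdivrMr //; apply: le_lt_trans (truncnS_gt _).
  by rewrite ler_pM2r ?invr_gt0 // ler_norm.
have Np : 0 < N%:R :> R by rewrite ltr0n.
have l2 : 0 < ln 2 :> R by rewrite ln_gt0 // ltr1n.
pose T : R := N%:R * ln 2; have T0 : 0 < T by rewrite mulr_gt0.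
have far Y j : in_region Y -> J j -> T <= L - Y 0 j -> t0 + 1 <= H Y.
  move=> rY Jj TY; rewrite leNgt; apply/negP => HY.
  have thi (i : 'I_N) : 0 <= i%:R / N%:R :> R /\ i%:R / N%:R <= 1 :> R.
    by split; [rewrite divr_ge0|rewrite ler_pdivrMr // mul1r ler_nat ltnW].
  pose P (i : 'I_N) : Rn := (1 - i%:R / N%:R) *: Y0 + (i%:R / N%:R) *: Y.
  have := sep N P; have rP i : in_region (P i) by apply: in_region_segment => //; apply/andP; exact: thi.
  move=> /(_ rP) h; suff : N%:R * v <= Ib by rewrite leNgt Nv.
  apply: le_trans (h _); last first.
    move=> i i' ii'; exists j => //; rewrite /P !mxE Jj.
    rewrite (_ : _ - _ = (i%:R - i'%:R) / N%:R * (Y 0 j - L)); last by field; rewrite gt_eqF.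
    rewrite 2!normrM normfV (ger0_norm (ltW Np)) [`|Y 0 j - L|]distrC.
    have d1 : 1 <= `|i%:R - i'%:R| :> R.
      have [lt|gt|e] := ltngtP i i'; last by case/eqP: ii'; apply: val_inj.
        by rewrite distrC -natrB ?(ltnW lt) // normr_nat ler1n subn_gt0.
      by rewrite -natrB ?(ltnW gt) // normr_nat ler1n subn_gt0.
    rewrite (ger0_norm (le_trans (ltW T0) TY)) mulrAC ler_pdivlMr //.
    apply: le_trans (ler_peMl (le_trans (ltW T0) TY) d1); apply: le_trans TY.
    by rewrite /T mulrC.
  rewrite (_ : N%:R * v = \sum_(i < N) v); last by rewrite sumr_const card_ord mulr_natl.
  apply: ler_sum => i _; rewrite /v ler_pM2l // ler_expR lerN2 ler_pM2l //.
  have [h0 h1] := thi i; apply: le_trans (cvx _ _ _ rY0 rY _) _; first by rewrite h0.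
  by move: HY h0 h1; rewrite -/t0; move: (_ / _) (H Y) => a b; nra.
(* A single point already bounds [H] from below. *)
have [M1 HM1] : exists M1, forall Y, in_region Y -> - M1 <= H Y.
  exists (ln ((`|Ib| + 1) / C1) / 2) => Y rY; rewrite leNgt; apply/negP => HY.
  have h : C1 * expR (- (2 * H Y)) <= Ib.
    have := sep 1%N (fun=> Y) (fun=> rY); rewrite big_ord1; apply => i i'.
    by rewrite (ord1 i) (ord1 i') eqxx.
  have p : 0 < (`|Ib| + 1) / C1 by rewrite divr_gt0 // ltr_wpDl.
  have : (`|Ib| + 1) / C1 < expR (- (2 * H Y)).
    by rewrite -[X in X < _](lnK (x := (`|Ib| + 1) / C1)) ?posrE // ltr_expR; lra.
  rewrite ltr_pdivrMr // mulrC; have := ler_norm Ib; lra.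
(* The sum over [J] is at most n + 1 times its largest term; n + 1 keeps [dl] positive when n =
   0. *)
pose dl := (n.+1%:R * T)^-1.
have n0 : 0 < n.+1%:R :> R by rewrite ltr0n.
have dl0 : 0 < dl by rewrite invr_gt0 mulr_gt0.
exists dl, (`|t0| + `|M1| + 1); split=> // Y rY.
have D0 j : J j -> 0 <= L - Y 0 j by move=> Jj; have := rY j; rewrite Jj subr_ge0.
have sumD D : 0 <= D -> (forall j, J j -> L - Y 0 j <= D) -> dl * (\sum_(j | J j) (L - Y 0 j)) <= D / T.
  move=> Dp h; have : \sum_(j | J j) (L - Y 0 j) <= n.+1%:R * D.
    apply: le_trans (ler_sum _ h) _; rewrite big_mkcond /=.
    apply: (@le_trans _ _ (\sum_(j < n) D)); first by apply: ler_sum => j _; case: ifP.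
    by rewrite sumr_const card_ord -[_ *+ n]mulr_natl ler_wpM2r // ler_nat.
  have -> : D / T = dl * (n.+1%:R * D) by rewrite /dl; field; rewrite !gt_eqF.
  by move=> h2; rewrite ler_pM2l.
have [[j1 Jj1 TD]|near0] := pselect (exists2 j, J j & T <= L - Y 0 j); last first.
  have : dl * (\sum_(j | J j) (L - Y 0 j)) <= T / T.
    apply: sumD; first exact: ltW.
    by move=> j Jj; rewrite leNgt; apply/negP => h; apply: near0; exists j => //; exact: ltW.
  rewrite divff ?gt_eqF //; have := HM1 Y rY; have := ler_norm M1; have := normr_ge0 t0; lra.
pose js := [arg max_(j > j1 | J j) (L - Y 0 j)]%O.
have [Jjs Hjs] : J js /\ forall j, J j -> L - Y 0 j <= L - Y 0 js by rewrite /js; case: arg_maxP.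
set D := L - Y 0 js in Hjs; have TDs : T <= D := le_trans TD (Hjs _ Jj1).
have Dp : 0 < D := lt_le_trans T0 TDs.
have th01 : 0 <= T / D <= 1 by rewrite divr_ge0 ?(ltW T0) ?(ltW Dp) //= ler_pdivrMr // mul1r.
have h1 := cvx _ _ _ rY0 rY th01; have rt := in_region_segment rY0 rY th01.
have h2 : t0 + 1 <= H ((1 - T / D) *: Y0 + (T / D) *: Y).
  apply: (far _ js) => //; rewrite !mxE Jjs.
  by rewrite (_ : L - _ = T) // /D; field; rewrite gt_eqF.
have h3 : D / T <= H Y - t0.
  rewrite ler_pdivrMr //.
  have : (1 - T / D) * t0 + T / D * H Y = t0 + (H Y - t0) * T / D by field; rewrite gt_eqF.
  move=> e; have : 1 <= (H Y - t0) * T / D by move: h1 h2; rewrite -/t0 e; lra.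
  by rewrite ler_pdivlMr // mul1r.
have := sumD D (ltW Dp) Hjs; have := ler_norm (- t0); rewrite normrN; have := normr_ge0 M1; lra.
Qed.
End ConvexGrowth.

Section Necessary.
Variable R : realType.
Local Notation C := R[i].
Local Notation Rez := complex.Re.
Local Notation Imz := complex.Im.
Variable n : nat.
Local Notation Cn := 'rV[C]_n.
Local Notation Rn := 'rV[R]_n.

Variables (r : R) (phi : Cn -> \bar R).
Hypotheses (r0 : 0 < r) (Hpsh : psh (polydisk 0 r) phi) (Htor : toric r phi).
Hypothesis fin : exists2 y, inU r y & gphi phi y != -oo%E.

Lemma in_square_cabs (h : R) (w : C) : in_square h w -> cabs w <= 2 * h.
Proof. by move=> /andP[h1 h2]; apply: le_trans (cabs_le_ReIm w) _; lra. Qed.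

Lemma inJ_nec (x : Cn) (f : Cn -> C) (e rho B : R) (V : seq {ffun 'I_n -> nat}) (g : {ffun 'I_n -> nat}) :
  polydisk 0 r x -> 0 < e ->
  (boxint (fun z => (cmod2 (f z))%:E * expeR (- (2%:E * phi z))) e n x < +oo)%E ->
  monomial_size (fun u => f (x + rowf u)) rho V B -> g \in V ->
  exists (dl M L : R) (Z : 'I_n -> R), [/\ 0 < dl, L < ln r, forall j, Z j < ln r &
    forall Y : Rn, in_region [pred j | x 0 j == 0] L Z Y ->
      \sum_(j | x 0 j == 0) ((g j)%:R + 1 - dl) * Y 0 j - M <= Gphi phi Y].
Proof.
move=> px e0 fint ms Vg; have [rho0 _ _ _] := ms.
have [c [k [c0 /andP[k0 k4] box]]] := torus_box ms Vg.
have D1 j : 0 < r - cabs (x 0 j) by have := px j; rewrite mxE subr0 subr_gt0.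
have [dx [dx0 Hdx]] := ord_min_pos D1.
have D2 j : 0 < (if x 0 j == 0 then 1 else cabs (x 0 j)).
  by case: ifP => [_|/negbT h]; rewrite ?cabs_gt0 // ltr01.
have [mx [mx0 Hmx]] := ord_min_pos D2.
have [s0 [s00 /= /and5P[s_1 s_2 s_3 s_4 _]]] : exists s, 0 < s /\
    all (fun x => s < x) [:: rho / 2; e / 2; dx / 2; mx / 2].
  by apply: small_pos; rewrite /= !divr_gt0.
pose J := [pred j | x 0 j == 0].
(* [L] keeps the radii e^{Y_j}/2 below [s0]. For x_j <> 0 the coordinate Y_j is frozen at Z_j, an
   upper bound of ln |z_j| on all the boxes, so that monotonicity gives Gphi (log z) <= Gphi Y. *)
pose L : R := Num.min (ln (2 * s0)) (ln r - 1).
pose Z j : R := ln (cabs (x 0 j) + 2 * s0).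
have Lr : L < ln r by rewrite /L gt_min; apply/orP; right; lra.
have Zr j : Z j < ln r.
  rewrite /Z ltr_ln ?posrE //; first by have := Hdx j; lra.
  by rewrite ltr_wpDl ?cabs_ge0 // mulr_gt0.
have regU Y : in_region J L Z Y -> inU r Y.
  move=> rY j; have := rY j; case: ifP => _ h; last by rewrite h.
  exact: le_lt_trans h Lr.
(* Half of e^{Y_j}, since on the box |z_j| may reach twice the radius of the torus. *)
pose s (Y : Rn) j := if J j then expR (Y 0 j) / 2 else s0.
have sp Y j : 0 < s Y j by rewrite /s; case: ifP => _ //; rewrite divr_gt0 // expR_gt0.
have ss Y j : in_region J L Z Y -> s Y j <= s0.
  move=> rY; have := rY j; rewrite /s; case: ifP => // _ h.
  rewrite ler_pdivrMr // mulrC -[leRHS](lnK (x := 2 * s0)) ?posrE ?mulr_gt0 // ler_expR.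
  by apply: le_trans h _; rewrite /L ge_min lexx.
pose H Y := Gphi phi Y - \sum_(j | J j) ((g j)%:R + 1) * Y 0 j.
pose K0 := \sum_j (if J j then ((g j)%:R + 1) * (- ln 2) else ((g j)%:R + 1) * ln s0).
pose C1 := c ^+ 2 * (k ^+ (2 * n) * expR (2 * K0)).
have C10 : 0 < C1 by rewrite !mulr_gt0 ?exprn_gt0 // expR_gt0.
pose F z := ((cmod2 (f z))%:E * expeR (- (2%:E * phi z)))%E.
have F0 z : (0 <= F z)%E by rewrite /F mule_ge0 ?lee_fin ?cmod2_ge0 // expeR_ge0.
have [Ib HIb] : exists Ib : R, (boxint F e n x <= Ib%:E)%E.
  move: fint; rewrite -/F; case: (boxint F e n x) => [v| |] // _; first by exists v.
  by exists 0; rewrite leNye.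
have ln_s Y j : ln (s Y j) = if J j then Y 0 j - ln 2 else ln s0.
  by rewrite /s; case: ifP => // _; rewrite ln_div ?posrE ?expR_gt0 // expRK.
(* Lower bound of the integrand times the volume of the box of half sides k s_j/2. The volume
   contributes s_j^2, which turns the exponent g_j into the g_j + 1 of [H]. *)
have weight Y : c ^+ 2 * monom (s Y) g ^+ 2 * expR (- (2 * Gphi phi Y)) *
    \prod_j (2 * (k * s Y j / 2)) ^+ 2 = C1 * expR (- (2 * H Y)).
  have -> : \prod_j (2 * (k * s Y j / 2)) ^+ 2 = k ^+ (2 * n) * monom (s Y) (fun=> 1%N) ^+ 2.
    rewrite (eq_bigr (fun j => k ^+ 2 * s Y j ^+ 1 ^+ 2)); last by move=> j _; rewrite expr1; field.
    by rewrite big_split /= prodr_const card_ord exprM -prodrXl.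
  have e1 : monom (s Y) g = expR (\sum_j (g j)%:R * ln (s Y j)).
    by rewrite -ln_monom // lnK // posrE monom_gt0.
  have e2 : monom (s Y) (fun=> 1%N) = expR (\sum_j ln (s Y j)).
    rewrite -[LHS]lnK ?posrE ?monom_gt0 // ln_monom //; congr expR.
    by apply: eq_bigr => j _; rewrite mul1r.
  have e3 : \sum_j (g j)%:R * ln (s Y j) + \sum_j ln (s Y j) = K0 + \sum_(j | J j) ((g j)%:R + 1) * Y 0 j.
    rewrite [X in _ = _ + X]big_mkcond /K0 -!big_split /=; apply: eq_bigr => j _.
    by rewrite ln_s /=; case: ifP => _; ring.
  have sq (t : R) : expR t ^+ 2 = expR (2 * t) by rewrite -expRM_natl.
  rewrite e1 e2 /C1 !sq /H.
  transitivity (c ^+ 2 * k ^+ (2 * n) * (expR (2 * \sum_j (g j)%:R * ln (s Y j)) *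
     expR (2 * \sum_j ln (s Y j)) * expR (- (2 * Gphi phi Y)))); first by ring.
  rewrite -!expRD [in RHS]mulrA -[RHS]mulrA -expRD; congr (_ * expR _).
  have := e3; set S1 := \sum_j _ * _; set S2 := \sum_j ln _; set S3 := \sum_(j | J j) _.
  by clearbody S1 S2 S3 K0; lra.
have sep N (Y : 'I_N -> Rn) : (forall i, in_region J L Z (Y i)) ->
     (forall i i', i != i' -> exists2 j, J j & ln 2 <= `|Y i 0 j - Y i' 0 j|) ->
     \sum_i C1 * expR (- (2 * H (Y i))) <= Ib.
  move=> rY far.
  have sr i j : 0 < s (Y i) j <= rho / 2 by rewrite sp /=; have := ss _ j (rY i); lra.
  have [u0 Hu0] := choice (fun i => box (s (Y i)) (sr i)).
  rewrite -lee_fin; apply: le_trans HIb; rewrite -(eq_bigr _ (fun i _ => weight (Y i))).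
  apply: (boxint_lower (I := 'I_N) (a := u0)) => //.
  - by move=> i; apply: mulr_ge0; [apply: mulr_ge0; exact: sqr_ge0|exact: expR_ge0].
  - by move=> i j; rewrite divr_gt0 // mulr_gt0.
  - move=> i j; have := proj1 (Hu0 i) j; have := ss _ j (rY i); have := sp (Y i) j.
    have := Re_le_cabs (u0 i j); have := Im_le_cabs (u0 i j).
    set S := s (Y i) j => h1 h2 h3 h4 h5; have : k * S <= S / 4 by move: k4 h3; clear - R n r phi r0 Hpsh Htor fin; nra.
    by move: h1 h2 h3 h4 h5 s_2; clear - R n r phi r0 Hpsh Htor fin; move=> *; split; lra.
  (* The radii of two boxes that meet differ by a factor less than 2, so that Y_j and Y'_j differ by
     less than ln 2. *)
  - move=> w i i' hi hi'; apply/eqP; apply: contrapT => /negP ii'.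
    have [j Jj hj] := far i i' ii'.
    have b1 := in_square_cabs (hi j); have b2 := in_square_cabs (hi' j).
    have c1 := proj1 (Hu0 i) j; have c2 := proj1 (Hu0 i') j.
    have t1 : cabs (u0 i j) <= cabs (w j) + cabs (w j - u0 i j).
      by rewrite -[X in cabs X](subKr (w j)); exact: cabsB.
    have t1' : cabs (w j) <= cabs (u0 i j) + cabs (w j - u0 i j).
      by rewrite -[X in cabs X](subrK (u0 i j)) addrC; exact: cabsD.
    have t2 : cabs (u0 i' j) <= cabs (w j) + cabs (w j - u0 i' j).
      by rewrite -[X in cabs X](subKr (w j)); exact: cabsB.
    have t2' : cabs (w j) <= cabs (u0 i' j) + cabs (w j - u0 i' j).
      by rewrite -[X in cabs X](subrK (u0 i' j)) addrC; exact: cabsD.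
    have q1 : 2 * s (Y i') j > s (Y i) j.
      by have := sp (Y i) j; have := sp (Y i') j; move: b1 b2 c1 c2 t1 t1' t2 t2' k0 k4; clear - R n r phi r0 Hpsh Htor fin; nra.
    have q2 : 2 * s (Y i) j > s (Y i') j.
      by have := sp (Y i) j; have := sp (Y i') j; move: b1 b2 c1 c2 t1 t1' t2 t2' k0 k4; clear - R n r phi r0 Hpsh Htor fin; nra.
    have lt (y y' : R) : expR y / 2 < 2 * (expR y' / 2) -> y - y' < ln 2.
      move=> h; rewrite -ltr_expR lnK ?posrE // expRB ltr_pdivrMr ?expR_gt0 //; move: h; clear - R n r phi r0 Hpsh Htor fin; lra.
    move: q1 q2; rewrite /s Jj => /lt q1 /lt q2.
    by move: hj; rewrite leNgt ltr_norml => /negP; apply; apply/andP; move: q1 q2; clear - R n r phi r0 Hpsh Htor fin; move=> q1 q2; split; lra.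
  - move=> i z hz; pose u j := z 0 j - x 0 j.
    have hu j : cabs (u j - u0 i j) <= k * s (Y i) j.
      by apply: le_trans (in_square_cabs (hz j)) _; lra.
    have fz : c * monom (s (Y i)) g <= cabs (f z).
      have := proj2 (Hu0 i) u hu; suff -> : x + rowf u = z by [].
      by apply/rowP => j; rewrite !mxE /u (addrC (x 0 j)) subrK.
    have c1 j : cabs (u0 i j) = s (Y i) j := proj1 (Hu0 i) j.
    have u_ge j : (3 / 4) * s (Y i) j <= cabs (u j).
      have : cabs (u0 i j) <= cabs (u j) + cabs (u j - u0 i j).
        by rewrite -[X in cabs X](subKr (u j)); exact: cabsB.
      by rewrite c1; have := hu j; have := sp (Y i) j; nra.
    have u_le j : cabs (u j) <= 2 * s (Y i) j.
      have : cabs (u j) <= cabs (u0 i j) + cabs (u j - u0 i j).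
        by rewrite -[X in cabs X](subrK (u0 i j)) addrC; exact: cabsD.
      by rewrite c1; have := hu j; have := sp (Y i) j; nra.
    have zE j : z 0 j = x 0 j + u j by rewrite /u (addrC (x 0 j)) subrK.
    have z_le j : cabs (z 0 j) <= cabs (x 0 j) + 2 * s (Y i) j.
      by rewrite zE; apply: le_trans (cabsD _ _) _; rewrite lerD2l.
    have z0 j : z 0 j != 0.
      rewrite -cabs_gt0; have := Hmx j; case: ifP => [/eqP xj _|_ hm].
        by rewrite zE xj add0r; have := u_ge j; have := sp (Y i) j; clear - R n r phi r0 Hpsh Htor fin; lra.
      rewrite zE; have := cabs_lower (x 0 j) (u j); have := u_le j; have := ss _ j (rY i); move: s_4 hm; clear - R n r phi r0 Hpsh Htor fin; lra.
    have Oz : polydisk 0 r z.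
      by apply/polydisk0E => j; have := z_le j; have := ss _ j (rY i); have := Hdx j; move: s_3; clear - R n r phi r0 Hpsh Htor fin; lra.
    have zY j : logv z 0 j <= Y i 0 j.
      have zp : 0 < cabs (z 0 j) by rewrite cabs_gt0.
      have := z_le j; have := ss _ j (rY i); have := rY i j; rewrite mxE /s /J /=.
      case: ifP => [/eqP xj _ _|_ -> _] h.
        rewrite -[leRHS]expRK ler_ln ?posrE ?expR_gt0 //; move: h; rewrite xj cabs0 add0r; clear - R n r phi r0 Hpsh Htor fin; lra.
      by rewrite /Z ler_ln ?posrE ?ltr_wpDl ?cabs_ge0 ?mulr_gt0.
    have GY : Gphi phi (logv z) <= Gphi phi (Y i).
      by apply: (Gphi_mono r0 Hpsh Htor fin) => //; exact: regU.
    rewrite /F (_ : expeR _ = (expR (- (2 * Gphi phi (logv z))))%:E); last first.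
      by rewrite (phi_Gphi r0 Hpsh Htor fin Oz z0).
    rewrite -EFinM lee_fin; apply: ler_pM.
    + by apply: mulr_ge0; exact: sqr_ge0.
    + exact: expR_ge0.
    + rewrite -exprMn cmod2_cabs lerXn2r ?nnegrE ?cabs_ge0 // mulr_ge0 ?(ltW c0) //.
      by apply: monom_ge0 => j; exact: ltW.
    + by rewrite ler_expR lerN2 ler_pM2l.
have cvx Y0 Y th : in_region J L Z Y0 -> in_region J L Z Y -> 0 <= th <= 1 ->
     H ((1 - th) *: Y0 + th *: Y) <= (1 - th) * H Y0 + th * H Y.
  move=> rY0 rY th01; have := Gphi_convex r0 Hpsh Htor fin (regU _ rY0) (regU _ rY) th01.
  rewrite /H; have -> : \sum_(j | J j) ((g j)%:R + 1) * ((1 - th) *: Y0 + th *: Y) 0 j =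
     (1 - th) * (\sum_(j | J j) ((g j)%:R + 1) * Y0 0 j) + th * \sum_(j | J j) ((g j)%:R + 1) * Y 0 j.
    by rewrite !mulr_sumr -big_split /=; apply: eq_bigr => j _; rewrite !mxE; ring.
  lra.
have [dl [M [dl0 HM]]] := separated_growth C10 cvx sep.
exists dl, (M - dl * \sum_(j | J j) L), L, Z; split=> // Y rY.
have := HM Y rY; rewrite /H big_split /= sumrN.
have -> : \sum_(j | J j) ((g j)%:R + 1 - dl) * Y 0 j =
   \sum_(j | J j) ((g j)%:R + 1) * Y 0 j - dl * \sum_(j | J j) Y 0 j.
  by rewrite mulr_sumr -sumrB; apply: eq_bigr => j _; ring.
lra.
Qed.
End Necessary.

(** * The two implications *)

Section Assembly.
Variable R : realType.
Local Notation C := R[i].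
Variable n : nat.
Local Notation Cn := 'rV[C]_n.
Local Notation Rn := 'rV[R]_n.

Definition up_closed (P : set Rn) := forall x v, P x -> @orthant R n v -> P (x + v).

(** For an up-closed set the lowest corner of a ball of the sup norm decides. *)
Lemma interior_up_closed (P : set Rn) (a : Rn) : up_closed P ->
  (interior P a <-> exists2 dl : R, 0 < dl & P (a - const_mx dl)).
Proof.
move=> up; split=> [/nbhs_ballP[e e0 He]|[dl dl0 Pd]].
  exists (e / 2); first by rewrite divr_gt0.
  apply: He; split=> [//|i j]; rewrite !mxE /ball /= opprB addrCA subrr addr0.
  by rewrite ger0_norm ?divr_ge0 ?(ltW e0) // ltr_pdivrMr // mulr2n mulrDr mulr1 ltrDl.
apply/nbhs_ballP; exists dl => // y [_ ay].
have -> : y = (a - const_mx dl) + (y - a + const_mx dl).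
  by apply/rowP => j; rewrite !mxE; ring.
apply: up => // j; have := ay 0 j; rewrite !mxE /ball /= ltr_norml; lra.
Qed.

Lemma psh_shrink (r rho : R) (phi : Cn -> \bar R) : rho <= r ->
  psh (polydisk 0 r) phi -> psh (polydisk 0 rho) phi.
Proof.
move=> rr [h1 [h2 h3]].
have s : polydisk 0 rho `<=` polydisk (0 : Cn) r by move=> z h j; exact: lt_le_trans (h j) rr.
split; first by move=> z /s; exact: h1.
split; first by move=> z /s; exact: h2.
by move=> a b h; apply: h3 => z /h /s.
Qed.

Lemma toric_shrink (r rho : R) (phi : Cn -> \bar R) : rho <= r -> toric r phi -> toric rho phi.
Proof. by move=> rr Ht th z pz; apply: Ht => j; exact: lt_le_trans (pz j) rr. Qed.

Lemma boxint_mono (F G : Cn -> \bar R) (e : R) k (z : Cn) : (forall w, (F w <= G w)%E) ->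
  (boxint F e k z <= boxint G e k z)%E.
Proof.
move=> FG; elim: k z => [|k IH] z; first exact: FG.
by apply: le_integral_nomeas => s _; apply: le_integral_nomeas => t _; exact: IH.
Qed.

Lemma inJ_mono (Om : set Cn) (phi psi : Cn -> \bar R) x f : (forall z, (phi z <= psi z)%E) ->
  inJ Om phi x f -> inJ Om psi x f.
Proof.
move=> pp [e [e0 [h1 [h2 h3]]]]; exists e; do 3![split=> //]; apply: le_lt_trans h3.
apply: boxint_mono => w; apply: lee_wpmul2l; first by rewrite lee_fin cmod2_ge0.
by rewrite lee_expeR leeN2; apply: lee_wpmul2l; rewrite ?lee_fin.
Qed.

Lemma common_denominator (I : finType) (w : I -> rat) : (forall i, 0 <= w i) ->
  exists (N : nat) (b : I -> nat), (0 < N)%N /\ forall i, w i = (b i)%:R / N%:R.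
Proof.
move=> w0.
have h i : exists ad : nat * nat, (0 < ad.2)%N /\ w i = ad.1%:R / ad.2%:R.
  exists (`|numq (w i)|%N, `|denq (w i)|%N); split=> /=; first by rewrite absz_gt0 denq_neq0.
  by rewrite !natr_absz ger0_norm ?numq_ge0 // gtr0_norm ?denq_gt0 // divq_num_den.
have [ad Had] := choice h.
exists (\prod_i (ad i).2)%N, (fun i => ((ad i).1 * \prod_(i' | i' != i) (ad i').2)%N).
split; first by rewrite prodn_gt0 // => i; exact: (proj1 (Had i)).
move=> i; have /= [_ ->] := Had i; 
have -> : (\prod_i0 (ad i0).2 = (ad i).2 * \prod_(i' | i' != i) (ad i').2)%N by rewrite (bigD1 i).
rewrite !natrM.
have d0 : ((ad i).2%:R : rat) != 0 by rewrite pnatr_eq0 -lt0n; exact: (proj1 (Had i)).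
have p0 : ((\prod_(i' | i' != i) (ad i').2)%N%:R : rat) != 0.
  by rewrite pnatr_eq0 -lt0n prodn_gt0 // => i'; exact: (proj1 (Had i')).
by field; rewrite d0 p0.
Qed.

Lemma not_fin (r : R) (phi : Cn -> \bar R) : 0 < r -> psh (polydisk 0 r) phi -> toric r phi ->
  ~ (exists2 y, inU r y & gphi phi y != -oo%E) -> forall z, polydisk 0 r z -> phi z = -oo%E.
Proof.
move=> r0 Hp Ht nf z pz; apply/eqP; rewrite -leeNy_eq.
have r2 : 0 < r / 2 by rewrite divr_gt0.
have r3 : r / 2 < r by rewrite ltr_pdivrMr // ltr_pMr // ltr1n.
have s j : 0 < (fun _ : 'I_n => r / 2) j < r by rewrite r2 r3.
apply: le_trans (phi_le_fill Hp Ht pz s) _.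
set w := fill _ _.
have w0 j : w 0 j != 0.
  by rewrite mxE; case: ifPn => // _; rewrite -cabs_gt0 cabs_real (gtr0_norm r2) r2.
have pw : polydisk 0 r w.
  apply/polydisk0E => j; rewrite mxE; case: ifP => _; last by move/polydisk0E: pz.
  by rewrite cabs_real (gtr0_norm r2) r3.
rewrite (phi_log Ht pw w0); rewrite leNgt; apply/negP => h; apply: nf.
exists (logv w); first exact: inU_logv.
by move: h; rewrite -[phi _]/(gphi phi (logv w)) => h; rewrite gt_eqF.
Qed.

(** A subgradient of [Gphi] has a finite conjugate, hence belongs to the Newton body. *)
Lemma newton_nonempty (r : R) (phi : Cn -> \bar R) : 0 < r -> psh (polydisk 0 r) phi -> toric r phi ->
  (exists2 y, inU r y & gphi phi y != -oo%E) -> forall y, inU r y ->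
  exists2 x, newton r phi x & forall y', inU r y' -> Gphi phi y + dotv x (y' - y) <= Gphi phi y'.
Proof.
move=> r0 Hp Ht fin y Uy.
have [||x Hx] := @subgradient R n (inU r) (Gphi phi) y.
- move=> v.
  have D0 j : 0 < (ln r - y 0 j) / (`|v 0 j| + 1) by rewrite divr_gt0 ?subr_gt0 // ltr_wpDl.
  have [m [m0 Hm]] := ord_min_pos D0; exists m => // j; rewrite !mxE.
  have := Hm j; rewrite ler_pdivlMr ?ltr_wpDl // => h.
  by have := ler_norm (v 0 j); have := normr_ge0 (v 0 j); nra.
- move=> y0 y1 th U0 U1 th01; split; last exact: (Gphi_convex r0 Hp Ht fin).
  move=> j; rewrite !mxE; have := U0 j; have := U1 j; move/andP: th01 => [t0 t1].
  move: (y0 0 j) (y1 0 j) => a b hb ha; have [ab|ba] := leP a b.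
    by apply: le_lt_trans hb; nra.
  by apply: le_lt_trans ha; nra.
exists x => //; apply/(newton_mem r0 Hp Ht fin); exists (dotv x y - Gphi phi y) => y' Uy'.
have := Hx y' Uy'; have -> : dotv x (y' - y) = dotv x y' - dotv x y.
  by rewrite dotvDr -scaleN1r dotvZr; ring.
lra.
Qed.
End Assembly.

(** * Monomial upper bounds and lifting of lattice points *)

Section Polyhedral.
Variable R : realType.
Local Notation C := R[i].
Variable n : nat.
Local Notation Cn := 'rV[C]_n.
Local Notation Rn := 'rV[R]_n.

Definition mdot (b : 'I_n -> nat) (y : Rn) : R := \sum_j (b j)%:R * y 0 j.

Lemma mdotD b y y' : mdot b (y + y') = mdot b y + mdot b y'.
Proof. by rewrite /mdot -big_split; apply: eq_bigr => j _ /=; rewrite mxE mulrDr. Qed.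

Lemma mdotZ b t y : mdot b (t *: y) = t * mdot b y.
Proof. by rewrite /mdot mulr_sumr; apply: eq_bigr => j _; rewrite mxE mulrCA. Qed.

Lemma ln_cmod2_monom (z : Cn) b : (forall j, z 0 j != 0) ->
  0 < cmod2 (monom (fun j => z 0 j) b) /\ ln (cmod2 (monom (fun j => z 0 j) b)) = 2 * mdot b (logv z).
Proof.
move=> z0; have zp j : 0 < cabs (z 0 j) by rewrite cabs_gt0.
have m0 : 0 < monom (fun j => cabs (z 0 j)) b by exact: monom_gt0.
rewrite cmod2_cabs cabs_monom exprn_gt0 //; split=> //.
by rewrite lnXn // ln_monom // mulr_natl /mdot; congr (_ *+ _); apply: eq_bigr => j _; rewrite mxE.
Qed.

Section Upper.
Variables (p : nat) (be : 'I_p -> 'I_n -> nat) (cc : R).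
Hypothesis cc0 : 0 < cc.

Lemma clog_mono_size_ge K (z : Cn) k : (forall j, z 0 j != 0) ->
  ((2 * cc * mdot (be k) (logv z) + K)%:E <= clog cc K (mono_size be z))%E.
Proof.
move=> z0; have [m0 m1] := ln_cmod2_monom (be k) z0.
apply: le_trans (clog_mono K cc0 (le_mono_size be z k)).
rewrite clog_gt0 // m1 lee_fin; lra.
Qed.

Lemma clog_mono_size_ub K (z : Cn) (X : R) : (forall j, z 0 j != 0) ->
  (forall k, 2 * cc * mdot (be k) (logv z) + K <= X) -> (clog cc K (mono_size be z) <= X%:E)%E.
Proof.
move=> z0 H; apply: clog_mono_size_le => // k; have [m0 m1] := ln_cmod2_monom (be k) z0.
by rewrite clog_gt0 // m1 lee_fin; have := H k; lra.
Qed.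

Variables (r rho : R) (phi : Cn -> \bar R).
Hypotheses (rho0 : 0 < rho) (rhor : rho < r).
Hypotheses (Hpsh : psh (polydisk 0 r) phi) (Htor : toric r phi).
Hypothesis fin : exists2 y, inU r y & gphi phi y != -oo%E.
Hypothesis HS : forall x y, newton r phi x -> nonpos y ->
  exists k, dotv x y <= 2 * cc * mdot (be k) y.

(** A subgradient [x] at log z lies in the Newton body, so that Gphi (log z) <= Gphi y0 + <x, log z
    - y0> is controlled by the support function. The point [y0] lies in the domain because rho <
    r. *)
Lemma phi_le_clog : exists K, forall z, polydisk 0 rho z -> (phi z <= clog cc K (mono_size be z))%E.
Proof.
have r0 : 0 < r := lt_trans rho0 rhor.
pose y0 : Rn := const_mx (ln rho).
have U0 : inU r y0 by move=> j; rewrite mxE ltr_ln.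
have [D [D0 HD]] : exists D, 0 <= D /\ forall k : 'I_p, - (2 * cc * mdot (be k) y0) <= D.
  exists (\big[Num.max/0]_k (- (2 * cc * mdot (be k) y0))); split; first exact: bigmax_ge_id.
  by move=> k; exact: le_bigmax_cond.
exists (Gphi phi y0 + D).
have sub : polydisk 0 rho `<=` polydisk (0 : Cn) r by move=> z h j; exact: lt_trans (h j) rhor.
have nz z : polydisk 0 rho z -> (forall j, z 0 j != 0) ->
    (phi z <= clog cc (Gphi phi y0 + D) (mono_size be z))%E.
  move=> pz z0; have Uz := inU_logv r0 (sub _ pz) z0.
  have [x Nx Hx] := newton_nonempty r0 Hpsh Htor fin Uz.
  have np : nonpos (logv z - y0).
    by move=> j; have := inU_logv rho0 pz z0 j; rewrite !mxE => h; rewrite subr_le0 ltW.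
  have [k hk] := HS Nx np.
  rewrite (phi_Gphi r0 Hpsh Htor fin (sub _ pz) z0).
  apply: le_trans (clog_mono_size_ge _ k z0); rewrite lee_fin.
  have := Hx y0 U0; have := HD k.
  have -> : y0 - logv z = (-1) *: (logv z - y0) by rewrite scaleN1r opprB.
  rewrite dotvZr; move: hk; rewrite mdotD -scaleN1r mdotZ.
  by move: (dotv x _) (mdot _ _) (mdot _ _) => a b d; lra.
(* Points with zero coordinates: fill these with a small [s] and use the upper semicontinuity of
   [mono_size]. *)
move=> z pz; apply: lee_real_ub => M; rewrite clog_lt // => h.
have [d [d0 Hd]] := mono_size_usc h.
pose s := Num.min (d / 2) (rho / 2).
have s0 : 0 < s by rewrite lt_min !divr_gt0.
have sd : s < d by rewrite gt_min; apply/orP; left; lra.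
have sr : s < rho by rewrite gt_min; apply/orP; right; rewrite ltr_pdivrMr // ltr_pMr // ltr1n.
have hs j : 0 < (fun _ : 'I_n => s) j < r by rewrite s0 /= (lt_trans sr).
apply: le_trans (phi_le_fill Hpsh Htor (sub _ pz) hs) _.
set w := fill _ _.
have pw : polydisk 0 rho w.
  apply/polydisk0E => j; rewrite mxE; case: ifP => _; last by move/polydisk0E: pz.
  by rewrite cabs_real (gtr0_norm s0).
have w0 j : w 0 j != 0.
  by rewrite mxE; case: ifPn => // _; rewrite -cabs_gt0 cabs_real (gtr0_norm s0).
apply: le_trans (nz w pw w0) _; apply: ltW; rewrite clog_lt //; apply: Hd => j.
rewrite mxE; case: ifPn => [/eqP ->|_]; last by rewrite subrr cabs0.
by rewrite subr0 cabs_real (gtr0_norm s0).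
Qed.
End Upper.

(* The facets of [P] not involving the coordinates outside [J] are tested on the ray
   [t a_i], the others hold for [N0] large. *)
Lemma lift_lattice_point (P : set Rn) (J : pred 'I_n) (g : 'I_n -> nat) (dl M L : R) (Z : 'I_n -> R)
    p (q : 'I_p -> Rn) :
  polyhedron P -> P `<=` @orthant R n -> up_closed P -> (forall k, P (q k)) ->
  0 < dl ->
  (forall Y : Rn, in_region J L Z Y -> exists k,
     \sum_(j | J j) ((g j)%:R + 1 - dl) * Y 0 j - M <= dotv (q k) Y) ->
  exists al : 'I_n -> nat, (forall j, J j -> al j = (g j).+1) /\ interior P (latpt R al).
Proof.
move=> [m [a [b PE]]] Port Pup Pq dl0 H.
pose Y0 : Rn := \row_j (if J j then L else Z j).
have rY0 : in_region J L Z Y0 by move=> j; rewrite mxE; case: (J j).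
have [k0 _] := H Y0 rY0.
have Pqi k i : dotv (a i) (q k) <= b i by have := Pq k; rewrite PE.
(* A positive coordinate of a normal would let the up-closed set [P] leave the half-space. *)
have ai_le i : nonpos (a i).
  move=> j; rewrite leNgt; apply/negP => aij.
  pose t := (`|b i - dotv (a i) (q k0)| + 1) / a i 0 j.
  have t0 : 0 <= t by rewrite divr_ge0 ?addr_ge0 // ltW.
  have : P (q k0 + t *: delta_mx 0 j).
    by apply: Pup => // j'; rewrite !mxE; case: (_ && _); rewrite /= ?mulr1 ?mulr0.
  rewrite PE => /(_ i); rewrite dotvDr dotvZr.
  have -> : dotv (a i) (delta_mx 0 j) = a i 0 j.
    rewrite /dotv (bigD1 j) //= big1 ?addr0; first by rewrite mxE !eqxx mulr1.
    by move=> j' /negbTE jj; rewrite mxE jj mulr0.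
  rewrite /t divfK ?gt_eqF //; have := ler_norm (b i - dotv (a i) (q k0)); lra.
(* The candidate lattice point lowered by [dl], the form in which interiority will be tested. *)
pose base N0 : Rn := \row_j (if J j then (g j)%:R + 1 - dl else N0 - dl).
have facet i : exists N1 : R, forall N0, N1 <= N0 -> dotv (a i) (base N0) <= b i.
  have [[j1 Jj1 aj1]|none] := pselect (exists2 j, ~~ J j & a i 0 j < 0).
    pose S := \sum_(j | j != j1) a i 0 j * base 0 0 j.
    exists (Num.max 0 ((`|b i - S| + 1) / - a i 0 j1 + dl)) => N0; rewrite ge_max => /andP[N00 hN].
    rewrite /dotv (bigD1 j1) //=.
    have : \sum_(j | j != j1) a i 0 j * base N0 0 j <= S.
      apply: ler_sum => j _; apply: ler_wnM2l; first exact: ai_le.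
      by rewrite !mxE; case: (J j) => //; lra.
    have -> : base N0 0 j1 = N0 - dl by rewrite mxE (negbTE Jj1).
    have : `|b i - S| + 1 <= (N0 - dl) * - a i 0 j1.
      by rewrite -ler_pdivrMr ?oppr_gt0 //; lra.
    have := ler_norm (- (b i - S)); rewrite normrN; lra.
  have a0 j : ~~ J j -> a i 0 j = 0.
    move=> Jj; apply/eqP; rewrite eq_le ai_le leNgt; apply/negP => h; apply: none; by exists j.
  exists 0 => N0 _; rewrite leNgt; apply/negP => big.
  set v := dotv (a i) (base N0) in big.
  have vE : v = \sum_(j | J j) a i 0 j * ((g j)%:R + 1 - dl).
    rewrite /v /dotv (bigID J) /= [X in _ + X]big1 ?addr0; last by move=> j /a0 ->; rewrite mul0r.
    by apply: eq_bigr => j Jj; rewrite mxE Jj.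
  pose B := \sum_(j | J j) ((g j)%:R + 1 - dl) * `|L|.
  have [D HD] : exists D, forall k, dotv (q k) (\row_j (if J j then - `|L| else Z j)) <= D.
    exists (\big[Num.max/0]_k dotv (q k) (\row_j (if J j then - `|L| else Z j))) => k.
    exact: le_bigmax_cond.
  (* On this ray the hypothesis reads t v - B - M <= D + t b_i, which fails for this value of t. *)
  pose t := (`|B + M + D| + 1) / (v - b i).
  have vb : 0 < v - b i by rewrite subr_gt0.
  have t0 : 0 <= t by apply: divr_ge0; [exact: addr_ge0|exact: ltW].
  pose Y : Rn := \row_j (if J j then - `|L| else Z j) + t *: a i.
  have rY : in_region J L Z Y.
    move=> j; rewrite !mxE; have [Jj|Jj] := boolP (J j); last by rewrite a0 // mulr0 addr0.
    have := ai_le i j; have := ler_norm (- L); rewrite normrN => h1 h2.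
    have h3 : t * a i 0 j <= 0 by rewrite mulr_ge0_le0.
    by move: h1 h3; clear; move: (t * _) => u; lra.
  have [k hk] := H Y rY.
  have eY : \sum_(j | J j) ((g j)%:R + 1 - dl) * Y 0 j = t * v - B.
    rewrite vE mulr_sumr -sumrB; apply: eq_bigr => j Jj; rewrite !mxE Jj; ring.
  have qY : dotv (q k) Y <= D + t * b i.
    rewrite dotvDr dotvZr; apply: lerD; first exact: HD.
    by apply: ler_wpM2l => //; rewrite dotvC; exact: Pqi.
  have : t * (v - b i) = `|B + M + D| + 1 by rewrite /t divfK // gt_eqF.
  move: hk; rewrite eY; have := ler_norm (B + M + D); lra.
have [N1 HN1] := choice facet.
have [NN [NN0 HNN]] : exists d, 0 <= d /\ forall i, N1 i <= d.
  by exists (\big[Num.max/0]_j N1 j); split; [exact: bigmax_ge_id|move=> i; exact: le_bigmax_cond].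
pose N0 := (Num.truncn NN).+1.
exists (fun j => if J j then (g j).+1 else N0); split; first by move=> j ->.
apply/(interior_up_closed _ Pup); exists dl => //.
have -> : latpt R (fun j => if J j then (g j).+1 else N0) - const_mx dl = base N0%:R.
  by apply/rowP => j; rewrite !mxE; case: (J j); rewrite // -natr1.
rewrite PE => i; apply: HN1; apply: le_trans (HNN i) _; apply: ltW; exact: truncnS_gt.
Qed.
End Polyhedral.

(** * From a polyhedron to a nice approximation *)

Section PolyhedronToApprox.
Variable R : realType.
Local Notation C := R[i].
Variable n : nat.
Local Notation Cn := 'rV[C]_n.
Local Notation Rn := 'rV[R]_n.

Lemma logv_cexp (Y : Rn) : logv (cexp Y) = Y.
Proof. by apply/rowP => j; rewrite !mxE cabs_real gtr0_norm ?expR_gt0 // expRK. Qed.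

Lemma cexp_neq0 (Y : Rn) j : cexp Y 0 j != 0 :> C.
Proof. by rewrite mxE -cabs_gt0 cabs_real gtr0_norm expR_gt0. Qed.

Lemma polydisk_min (x : Cn) (d : R) : 0 < d -> exists d', [/\ 0 < d', d' <= d &
  forall z j, polydisk x d' z -> x 0 j != 0 -> cabs (x 0 j) / 2 <= cabs (z 0 j)].
Proof.
move=> d0; have D2 j : 0 < (if x 0 j == 0 then 1 else cabs (x 0 j)).
  by case: ifP => [_|/negbT h]; rewrite ?cabs_gt0 // ltr01.
have [mx [mx0 Hmx]] := ord_min_pos D2.
exists (Num.min d (mx / 2)); split; first by rewrite lt_min d0 divr_gt0.
  by rewrite ge_min lexx.
move=> z j pz xj; have := Hmx j; rewrite (negbTE xj) => h.
have : cabs (z 0 j - x 0 j) < mx / 2 by apply: lt_le_trans (pz j) _; rewrite ge_min lexx orbT.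
have : cabs (x 0 j) <= cabs (z 0 j) + cabs (z 0 j - x 0 j).
  by rewrite -[X in cabs X <= _](subKr (z 0 j)); exact: cabsB.
lra.
Qed.

Section SameJ.
Variables (rho : R) (phi : Cn -> \bar R).
Hypotheses (rho0 : 0 < rho) (Hpsh : psh (polydisk 0 rho) phi) (Htor : toric rho phi).
Hypothesis fin : exists2 y, inU rho y & gphi phi y != -oo%E.
Variables (p : nat) (be : 'I_p -> 'I_n -> nat) (cc K K' : R).
Hypothesis cc0 : 0 < cc.
Hypothesis phi_le : forall z, polydisk 0 rho z -> (phi z <= clog cc K' (mono_size be z))%E.
Variable P : set Rn.
Hypotheses (Ppol : polyhedron P) (Port : P `<=` @orthant R n) (Pup : up_closed P).
Hypothesis Pbe : forall k, P ((2 * cc) *: latpt R (be k)).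
Hypothesis Pint : forall al, interior P (latpt R al) -> interior (newton rho phi) (latpt R al).

Let phim := approximant be phi cc K.
Let Hpshm : psh (polydisk 0 rho) phim := approximant_psh be cc0 Hpsh K.
Let Htorm : toric rho phim := approximant_toric be cc K Htor.
Let finm : exists2 y, inU rho y & gphi phim y != -oo%E.
Proof.
have [y Uy gy] := fin; exists y => //; apply: contra gy; rewrite -!leeNy_eq.
by apply: le_trans; rewrite /gphi /phim /approximant le_max lexx.
Qed.

Lemma Gphi_approximant_le (Y : Rn) : inU rho Y ->
  exists k, Gphi phim Y <= 2 * cc * mdot (be k) Y + Num.max K K'.
Proof.
move=> UY; apply: contrapT => no.
have lt k : 2 * cc * mdot (be k) Y + Num.max K K' < Gphi phim Y.
  by rewrite ltNge; apply/negP => h; apply: no; exists k.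
(* The base value [Gphi phim Y - 1] keeps [X] strictly below [Gphi phim Y] even when p = 0. *)
pose X := \big[Num.max/(Gphi phim Y - 1)]_k (2 * cc * mdot (be k) Y + Num.max K K').
have XG : X < Gphi phim Y by apply: bigmax_lt => [|k _]; [lra|exact: lt].
have ub : (clog cc (Num.max K K') (mono_size be (cexp Y)) <= X%:E)%E.
  apply: (clog_mono_size_ub cc0 (@cexp_neq0 Y)) => k; rewrite logv_cexp.
  by rewrite /X; apply: (@le_bigmax_cond _ _ _ _ _ xpredT (fun k => 2 * cc * mdot (be k) Y + Num.max K K')).
have mon a b : a <= b -> (clog cc a (mono_size be (cexp Y)) <= clog cc b (mono_size be (cexp Y)))%E.
  by move=> ab; rewrite /clog; apply: leeD2l; rewrite lee_fin.
have : (gphi phim Y <= X%:E)%E.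
  rewrite /gphi /phim /approximant ge_max; apply/andP; split; apply: le_trans ub.
    apply: le_trans (phi_le (polydisk_cexp rho0 UY)) _; apply: mon.
    by rewrite le_max lexx orbT.
  by apply: mon; rewrite le_max lexx.
by rewrite (gphi_finE rho0 Hpshm Htorm finm UY) lee_fin leNgt XG.
Qed.

Lemma inJ_approximant (x : Cn) (f : Cn -> C) : polydisk 0 rho x ->
  inJ (polydisk 0 rho) phim x f -> inJ (polydisk 0 rho) phi x f.
Proof.
move=> px [e [e0 [sub [hf bi]]]]; have e20 : 0 < 2 * e by rewrite mulr_gt0.
have [sg [V [B ms]]] := holo_local e20 hf.
pose J := [pred j | x 0 j == 0].
have [d [d0 d1 Hd]] := polydisk_min x ltr01.
(* One constant [c] plays the part of delta and, through its inverse, of the additive bound, so that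
   [Q] weakens as [c] decreases and [uniform_pos] gives a common value for all of [V]. *)
pose Q (g : {ffun 'I_n -> nat}) (c : R) := c <= 1 /\
  forall z, polydisk x d z -> polydisk 0 rho z -> (forall j, z 0 j != 0) ->
     \sum_(j | x 0 j == 0) ((g j)%:R + 1 - c) * ln (cabs (z 0 j)) - c^-1 <= Gphi phi (logv z).
have y_le0 z j : polydisk x d z -> x 0 j == 0 -> ln (cabs (z 0 j)) <= 0.
  move=> pz /eqP xj; apply: ln_le0; have := pz j; rewrite xj subr0; lra.
have Qmono g c c' : 0 < c' <= c -> Q g c -> Q g c'.
  move=> /andP[c'0 cc'] [c1 H]; split; first exact: le_trans cc' c1.
  move=> z pz pz0 z0; apply: le_trans (H z pz pz0 z0).
  apply: lerB; last by rewrite lef_pV2 // posrE // (lt_le_trans c'0).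
  apply: ler_sum => j xj; have := y_le0 z j pz xj; nra.
have [c [c0 c1 Hc]] : exists c, [/\ 0 < c, c <= 1 & forall g, g \in V -> Q g c].
  suff [c [c0 Hc]] : exists c, 0 < c /\ forall g, g \in V -> Q g c.
    have m0 : 0 < Num.min c 1 by rewrite lt_min c0 ltr01.
    exists (Num.min c 1); split=> //; first by rewrite ge_min lexx orbT.
    by move=> g /Hc; apply: Qmono; rewrite m0 ge_min lexx.
  apply: uniform_pos; last exact: Qmono.
  move=> g Vg.
  have [dl [M [L [Z [dl0 Lr Zr H]]]]] := inJ_nec rho0 Hpshm Htorm finm px e0 bi ms Vg.
  have H' (Y : Rn) : in_region J L Z Y -> exists k,
     \sum_(j | J j) ((g j)%:R + 1 - dl) * Y 0 j - (M + Num.max K K') <= dotv ((2 * cc) *: latpt R (be k)) Y.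
    move=> rY; have UY : inU rho Y.
      move=> j; have := rY j; case: ifP => _ h; last by rewrite h.
      exact: le_lt_trans h Lr.
    have [k hk] := Gphi_approximant_le UY; exists k; have := H Y rY.
    rewrite dotvZl (_ : dotv (latpt R (be k)) Y = mdot (be k) Y); last first.
      by apply: eq_bigr => j _; rewrite mxE.
    by move: hk; rewrite /=; lra.
  have [al [alJ /Pint]] := lift_lattice_point Ppol Port Pup Pbe dl0 H'.
  move=> /(interior_up_closed _ (@newton_up R n rho phi)) [dl' dl'0].
  move=> /(newton_mem rho0 Hpsh Htor fin) [M1 HM1].
  (* The coordinates with x_j <> 0: there |z_j| stays between |x_j|/2 and rho, so that a large
     [al j] changes the estimate only by this constant. *)
  pose D2 := \sum_(j | ~~ J j) `|(al j)%:R - dl'| * (`|ln (cabs (x 0 j) / 2)| + `|ln rho|).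
  pose c := Num.min 1 (Num.min dl' (`|M1 + D2| + 1)^-1).
  have W0 : 0 < `|M1 + D2| + 1 by rewrite ltr_wpDl.
  have c0 : 0 < c by rewrite !lt_min ltr01 dl'0 invr_gt0.
  have cdl : c <= dl' by rewrite /c !ge_min lexx orbT.
  have cV : `|M1 + D2| + 1 <= c^-1.
    by rewrite -[leLHS]invrK lef_pV2 ?posrE ?invr_gt0 // /c !ge_min lexx !orbT.
  exists c; split=> //; split; first by rewrite /c ge_min lexx.
  move=> z pz pz0 z0; have Uz := inU_logv rho0 pz0 z0.
  have := HM1 _ Uz; rewrite /dotv (bigID J) /=.
  have s1 : \sum_(j | x 0 j == 0) ((g j)%:R + 1 - c) * ln (cabs (z 0 j)) <=
     \sum_(j | x 0 j == 0) (latpt R al - const_mx dl') 0 j * logv z 0 j.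
    apply: ler_sum => j xj; rewrite !mxE alJ // -natr1.
    by have := y_le0 z j pz xj; nra.
  have s2 : - D2 <= \sum_(j | x 0 j != 0) (latpt R al - const_mx dl') 0 j * logv z 0 j.
    rewrite /D2 -sumrN; apply: ler_sum => j xj; rewrite !mxE.
    have h1 := Hd z j pz xj; have xp : 0 < cabs (x 0 j) / 2 by rewrite divr_gt0 ?cabs_gt0.
    have l1 : ln (cabs (x 0 j) / 2) <= ln (cabs (z 0 j)) by rewrite ler_ln ?posrE // (lt_le_trans xp).
    have l2 : ln (cabs (z 0 j)) <= ln rho by have := Uz j; rewrite mxE => /ltW.
    rewrite -lerNl -mulNr; apply: le_trans (ler_norm _) _; rewrite normrM normrN.
    apply: ler_wpM2l => //; rewrite ler_norml.
    have := ler_norm (- ln (cabs (x 0 j) / 2)); rewrite normrN.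
    have := ler_norm (ln rho); have := normr_ge0 (ln rho); have := normr_ge0 (ln (cabs (x 0 j) / 2)).
    by move=> a1 a2 a3 a4; apply/andP; split; lra.
  have := ler_norm (M1 + D2); lra.
apply: (inJ_suff rho0 Hpsh Htor fin px e20 hf ms c0 c1 d0 (M := c^-1)).
by move=> g /Hc [_]; exact.
Qed.
End SameJ.

Lemma polyhedron_nice_toric_approx (r : R) (phi : Cn -> \bar R) (P : set Rn) (c : R) :
  0 < r -> psh (polydisk 0 r) phi -> toric r phi ->
  polyhedron P -> P `<=` @orthant R n -> 0 < c -> rational_polyhedron (scale_set (2 / c) P) ->
  newton r phi `<=` P -> up_closed P ->
  (forall al, interior P (latpt R al) <-> interior (newton r phi) (latpt R al)) ->
  nice_toric_approx r phi.
Proof.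
move=> r0 Hp Ht Ppol Port c0 rat NP Pup Pint.
have [fin|nf] := pselect (exists2 y, inU r y & gphi phi y != -oo%E); last first.
  have all := not_fin r0 Hp Ht nf.
  (* For phi identically -oo the constant sequence serves; its singularity is described by an empty
     family of functions, since log 0 = -oo. *)
  exists r; split=> //; split=> //; exists (fun=> phi); split.
    move=> m; do 3![split=> //].
    move=> x px; have D1 j : 0 < r - cabs (x 0 j) by have := px j; rewrite mxE subr0 subr_gt0.
    have [e [e0 He]] := ord_min_pos D1.
    have sub : polydisk x e `<=` polydisk (0 : Cn) r.
      move=> z pz; apply/polydisk0E => j; rewrite -(subrK (x 0 j) (z 0 j)).
      by apply: le_lt_trans (cabsD _ _) _; have := pz j; have := He j; lra.
    exists e; do 2![split=> //].
    exists 1, 0%N, (fun _ _ => 0), (fun=> 0), 0; split; first exact: ler01.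
    split; first by case.
    split; first by move=> z _; rewrite normr0.
    by move=> z /sub /all ->; rewrite big_ord0 le0_lneNy // mul1e.
  by split=> // z pz; exact: cvg_cst.
pose rho := r / 2; have rho0 : 0 < rho by rewrite divr_gt0.
have rr : rho < r by rewrite ltr_pdivrMr // ltr_pMr // ltr1n.
have Hp' := psh_shrink (ltW rr) Hp; have Ht' := toric_shrink (ltW rr) Ht.
have sub y : inU rho y -> inU r y.
  by move=> h j; apply: lt_le_trans (h j) _; rewrite ler_ln ?posrE // ltW.
have fin' : exists2 y, inU rho y & gphi phi y != -oo%E.
  exists (const_mx (ln rho - 1)); first exact: inU_ex.
  by rewrite (gphi_finE r0 Hp Ht fin) //; apply: sub; exact: inU_ex.
have [x0 Nx0 _] := newton_nonempty r0 Hp Ht fin (@inU_ex R n r).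
have c2 : 0 < 2 / c by rewrite divr_gt0.
have Sorth : scale_set (2 / c) P `<=` @orthant R n.
  by move=> _ [x /Port xo <-] j; rewrite mxE mulr_ge0 // ltW.
have Sx0 : scale_set (2 / c) P ((2 / c) *: x0) by exists x0 => //; exact: NP.
have [p [v [Pv sup]]] := rational_polyhedron_support rat Sx0 Sorth.
have v0 (kj : 'I_p * 'I_n) : 0 <= v kj.1 0 kj.2.
  by have := Sorth _ (Pv kj.1) kj.2; rewrite mxE ler0q.
have [N [b [N0 Nb]]] := common_denominator v0.
(* The points v_k = be_k/N of (2/c) P correspond to c be_k/(2N) in [P]. As cc log |z^be|^2 has slope
   2 cc be, this requires cc = c/(4N). *)
pose be k j := b (k, j); pose cc : R := c / (4 * N%:R).
have NR : 0 < N%:R :> R by rewrite ltr0n.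
have cc0 : 0 < cc by rewrite divr_gt0 // mulr_gt0.
have vE k j : ratr (v k 0 j) = (be k j)%:R / N%:R :> R.
  by have /= -> := Nb (k, j); rewrite fmorph_div !rmorph_nat.
have Pbe k : P ((2 * cc) *: latpt R (be k)).
  have [x Px xE] := Pv k; suff -> : (2 * cc) *: latpt R (be k) = x by [].
  have : (c / 2) *: ((2 / c) *: x) = x.
    by rewrite scalerA (_ : c / 2 * (2 / c) = 1) ?scale1r //; field; rewrite gt_eqF.
  move=> <-; rewrite xE; apply/rowP => j; rewrite !mxE vE /cc; field.
  by rewrite gt_eqF.
have HS x y : newton r phi x -> nonpos y -> exists k, dotv x y <= 2 * cc * mdot (be k) y.
  move=> /NP Px y0; have Sx : scale_set (2 / c) P ((2 / c) *: x) by exists x.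
  have [k hk] := sup _ Sx y y0; exists k; move: hk; rewrite dotvZl.
  have -> : dotv (map_mx ratr (v k)) y = mdot (be k) y / N%:R.
    by rewrite /mdot mulr_suml; apply: eq_bigr => j _; rewrite mxE vE mulrAC.
  rewrite mulrAC ler_pdivrMr // => h.
  have -> : 2 * cc * mdot (be k) y = mdot (be k) y / N%:R * c / 2 by rewrite /cc; field; rewrite gt_eqF.
  by rewrite ler_pdivlMr // mulrC.
have [K' HK'] := phi_le_clog cc0 rho0 rr Hp Ht fin HS.
have Pint' al : interior P (latpt R al) -> interior (newton rho phi) (latpt R al).
  by move=> /Pint; rewrite (newton_shrink rho0 (ltW rr) Hp Ht).
exists rho; split=> //; split; first exact: ltW.
exists (fun m => approximant be phi cc (- m%:R)); split; last split.
- move=> m; split; first exact: approximant_psh.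
  split; first exact: approximant_toric.
  split; first exact: approximant_analytic HK'.
  move=> x px f; split; first exact: (inJ_approximant rho0 Hp' Ht' fin' cc0 HK' Ppol Port Pup Pbe Pint' px).
  by apply: inJ_mono => z; rewrite /approximant le_max lexx.
- by move=> m z _; apply: approximant_decreasing; rewrite lerN2 ler_nat.
- by move=> z pz; apply: approximant_cvg => //; exact: (proj1 Hp').
Qed.
End PolyhedronToApprox.

(** * From a nice approximation to a polyhedron *)

Section ApproxToPolyhedron.
Variable R : realType.
Local Notation C := R[i].
Local Notation Rez := complex.Re.
Local Notation Imz := complex.Im.
Variable n : nat.
Local Notation Cn := 'rV[C]_n.
Local Notation Rn := 'rV[R]_n.

(** On a box away from the coordinate hyperplanes the integrand is +oo, so that the integral exceeds
    every multiple of the volume [W]. *)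
Lemma inJ_ninfty (rho : R) (phi : Cn -> \bar R) (b : 'I_n -> nat) :
  (forall z, polydisk 0 rho z -> phi z = -oo%E) ->
  ~ inJ (polydisk 0 rho) phi 0 (fun z => monom (fun j => z 0 j) b).
Proof.
move=> pinf [e [e0 [sub [_ bi]]]].
set F := fun z : Cn => _ in bi.
have F0 z : (0 <= F z)%E by rewrite /F mule_ge0 ?lee_fin ?cmod2_ge0 // expeR_ge0.
have [Ib HIb] : exists Ib : R, (boxint F e n 0 <= Ib%:E)%E.
  move: bi; case: (boxint F e n 0) => [v| |] // _; first by exists v.
  by exists 0; rewrite leNye.
pose a (_ : 'I_1) (_ : 'I_n) : C := Complex (e / 2) (e / 2).
pose h (_ : 'I_1) (_ : 'I_n) : R := e / 4.
pose W := \prod_(j < n) (2 * (e / 4)) ^+ 2.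
have W0 : 0 < W by apply: prodr_gt0 => j _; rewrite exprn_gt0 // mulr_gt0 // divr_gt0.
have key (v : R) : 0 <= v -> v * W <= Ib.
  move=> v0; rewrite -lee_fin; apply: le_trans HIb.
  have := @boxint_lower R n 'I_1 F 0 e (fun=> v) a h; rewrite big_ord1; apply=> //.
  - by move=> i j; rewrite divr_gt0.
  - by move=> i j; rewrite /a /h /= ger0_norm; [split; lra|rewrite ltW // divr_gt0].
  - by move=> w i i' _ _; rewrite (ord1 i) (ord1 i').
  - move=> i z hz.
    have zb j : [/\ e / 4 <= Rez (z 0 j), `|Rez (z 0 j)| <= 3 * e / 4 & `|Imz (z 0 j)| <= 3 * e / 4].
      have := hz j; rewrite mxE subr0 /in_square ReD ImD ReN ImN /= !ler_distl /h.
      by move=> /andP[/andP[h1 h2] /andP[h3 h4]]; rewrite !ler_norml; split; lra.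
    have z0 j : z 0 j != 0.
      by apply/eqP => zj; have [+ _ _] := zb j; rewrite zj /=; lra.
    have pz : polydisk 0 rho z.
      apply: sub => j; rewrite mxE subr0; apply: le_lt_trans (cabs_le_ReIm _) _.
      by have [_ h1 h2] := zb j; lra.
    rewrite /F pinf // gt0_muleNy ?lte_fin //= gt0_muley ?leey // lte_fin.
    by rewrite cmod2_monom; apply: monom_gt0 => j; rewrite cmod2_cabs exprn_gt0 // cabs_gt0.
have v0 : 0 <= (`|Ib| + 1) / W by rewrite divr_ge0 ?addr_ge0 // ltW.
have := key _ v0; rewrite divfK ?gt_eqF //; have := ler_norm Ib; lra.
Qed.

(** The upper bound comes from the finite monomial bounds of the functions g_j. For the lower bound,
    toricity allows [z] to be replaced by a point of the same torus where the chosen monomial is, up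
    to a constant, a lower bound for some |g_j|. *)
Lemma analytic_sing_bounds (rho : R) (phi : Cn -> \bar R) : 0 < rho -> toric rho phi ->
  analytic_sing (polydisk 0 rho) phi ->
  exists (c s K : R) (p : nat) (v : 'I_p -> 'I_n -> nat), [/\ 0 < c, 0 < s /\ s <= rho /\ s <= 1,
    forall z, polydisk 0 s z -> (forall j, z 0 j != 0) ->
      phi z = -oo%E \/ exists i, (phi z <= (2 * c * mdot (v i) (logv z) + K)%:E)%E &
    forall z i, polydisk 0 s z -> (forall j, z 0 j != 0) ->
      ((2 * c * mdot (v i) (logv z) - K)%:E <= phi z)%E].
Proof.
move=> rho0 Ht /(_ 0) [|e [e0 [sub]]].
  by move=> j; rewrite subrr cabs0.
move=> [c [k [g [h [M [c0 [hg [hM hphi]]]]]]]].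
wlog {c0} c0 : c k g hg hphi / 0 < c.
  move: c0; rewrite le_eqVlt => /orP[/eqP c0 H|c0 H]; last exact: H c0.
  (* If c = 0 the function is bounded, and it is described instead by c = 1 and the constant
     function 1. *)
  apply: (H 1 1%N (fun _ _ => 1)) ; last exact: ltr01.
    move=> _; have := @holo_monom R n (fun=> 0%N) (polydisk 0 e).
    by congr holo; apply/funext => z; rewrite /monom big1.
  move=> z pz; rewrite hphi // -c0 mul0e add0e big_ord1 cmod2_cabs cabs1 expr1n lne1 mule0 add0e //.
have ex j : exists q : R * seq {ffun 'I_n -> nat} * R,
    monomial_size (fun u => g j (0 + rowf u)) q.1.1 q.1.2 q.2.
  by have [s [V [B ms]]] := holo_local e0 (hg j); exists (s, V, B).
have [q Hq] := choice ex.
pose V := flatten [seq (q j).1.2 | j <- enum 'I_k].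
pose v (i : 'I_(size V)) : {ffun 'I_n -> nat} := tnth (in_tuple V) i.
have vV w : w \in V -> exists i, v i = w by move=> /(tnthP (in_tuple V))[i ->]; exists i.
have Vq w : w \in V <-> exists j, w \in (q j).1.2.
  split=> [/flatten_mapP[j _ wj]|[j wj]]; first by exists j.
  by apply/flatten_mapP; exists j => //; rewrite mem_enum.
have qr j : 0 < (q j).1.1 by have [] := Hq j.
have [s1 [s10 Hs1]] := ord_min_pos qr.
pose s := Num.min (Num.min s1 e) (Num.min rho 1).
have sp : 0 < s by rewrite !lt_min s10 e0 rho0 ltr01.
have ss1 : s <= s1 by rewrite /s !ge_min lexx.
have se : s <= e by rewrite /s !ge_min lexx !orbT.
have sr : s <= rho by rewrite /s !ge_min lexx !orbT.
have s1' : s <= 1 by rewrite /s !ge_min lexx !orbT.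
pose S z := \sum_(j < k) cmod2 (g j z).
have S0 z : 0 <= S z by apply: sumr_ge0 => j _; exact: cmod2_ge0.
have pe (z : Cn) : polydisk 0 s z -> polydisk 0 e z by move=> pz j; exact: lt_le_trans (pz j) se.
have pr (z : Cn) : polydisk 0 s z -> polydisk 0 rho z by move=> pz j; exact: lt_le_trans (pz j) sr.
have zq (z : Cn) j i : polydisk 0 s z -> cabs (z 0 i) <= (q j).1.1.
  by move=> /polydisk0E/(_ i) hz; apply: ltW; apply: lt_le_trans hz _; exact: le_trans ss1 (Hs1 j).
have rowz (z : Cn) : 0 + rowf (fun i => z 0 i) = z by apply/rowP => i; rewrite !mxE add0r.
have lnm (z : Cn) b : (forall j, z 0 j != 0) ->
   0 < monom (fun i => cabs (z 0 i)) b /\ ln (monom (fun i => cabs (z 0 i)) b) = mdot b (logv z).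
  move=> z0; have zp j : 0 < cabs (z 0 j) by rewrite cabs_gt0.
  split; first exact: monom_gt0.
  by rewrite ln_monom //; apply: eq_bigr => j _; rewrite mxE.
pose A := \sum_(j < k) ((q j).2 * (size (q j).1.2)%:R) ^+ 2 + 1.
have A0 : 0 < A by rewrite ltr_wpDl // sumr_ge0 // => j _; exact: sqr_ge0.
have up (z : Cn) : polydisk 0 s z -> (forall j, z 0 j != 0) ->
      phi z = -oo%E \/ exists i, (phi z <= (2 * c * mdot (v i) (logv z) + (c * ln A + M))%:E)%E.
  move=> pz z0; have := hphi z (pe z pz); rewrite -/(S z) => ->.
  have [Sz|Sz] := leP (S z) 0.
    by left; rewrite le0_lneNy ?lee_fin // gt0_muleNy ?lte_fin.
  right; have gle j : cabs (g j (0 + rowf (fun i => z 0 i))) <=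
      (q j).2 * \sum_(v <- (q j).1.2) monom (fun i => cabs (z 0 i)) v.
    by have [_ _ _ gj] := Hq j; apply: gj => i; exact: zq.
  have [w Vw] : exists w, w \in V.
    apply: contrapT => no; have : S z = 0.
      apply: big1 => j _; have := gle j; rewrite rowz.
      have -> : (q j).1.2 = [::].
        case E : (q j).1.2 => [//|w V']; case: no; exists w; apply/Vq; exists j.
        by rewrite E mem_head.
      by rewrite big_nil mulr0 => gz; rewrite cmod2_cabs; apply/eqP; rewrite expf_eq0 /= eq_le gz cabs_ge0.
    by move=> Sz0; rewrite Sz0 ltxx in Sz.
  have [{}w {}Vw Hw] := argmax_seq (fun w : {ffun 'I_n -> nat} => monom (fun i => cabs (z 0 i)) w) Vw.
  have [m0 lm] := lnm z w z0; have [i iw] := vV w Vw; exists i.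
  set m := monom _ w in Hw m0 lm.
  have SA : S z <= A * m ^+ 2.
    apply: (@le_trans _ _ (\sum_(j < k) ((q j).2 * (size (q j).1.2)%:R) ^+ 2 * m ^+ 2)).
      apply: ler_sum => j _; have := gle j; rewrite rowz => gj.
      have X0 : 0 <= \sum_(v <- (q j).1.2) monom (fun i => cabs (z 0 i)) v.
        by apply: sumr_ge0 => u _; apply: monom_ge0 => l; exact: cabs_ge0.
      have Xm : \sum_(v <- (q j).1.2) monom (fun i => cabs (z 0 i)) v <= (size (q j).1.2)%:R * m.
        rewrite big_seq; apply: le_trans (ler_sum (G := fun=> m) _ _) _.
          by move=> u uq; apply: Hw; apply/Vq; exists j.
        by rewrite -big_seq big_const_seq count_predT iter_addr_0 mulr_natl.
      rewrite cmod2_cabs; apply: le_trans (_ : ((q j).2 * \sum_(v <- (q j).1.2) monom (fun i => cabs (z 0 i)) v) ^+ 2 <= _).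
        by rewrite lerXn2r ?nnegrE ?cabs_ge0 // (le_trans (cabs_ge0 _) gj).
      rewrite [leLHS]exprMn [((q j).2 * (size _)%:R) ^+ 2]exprMn -[leRHS]mulrA; apply: ler_wpM2l; first exact: sqr_ge0.
      by rewrite -exprMn lerXn2r ?nnegrE // mulr_ge0 // ltW.
    by rewrite -mulr_suml; apply: ler_wpM2r; rewrite ?sqr_ge0 // /A lerDl.
  rewrite lne_EFin // -EFinM -EFinD lee_fin iw -lm.
  have : ln (S z) <= ln A + 2 * ln m.
    by rewrite mulr_natl -lnXn // -lnM ?posrE ?exprn_gt0 // ler_ln ?posrE // mulr_gt0 // exprn_gt0.
  move=> hl; have := ler_norm (h z); have := hM z (pe z pz).
  have := ler_wpM2l (ltW c0) hl; lra.
have lo i : exists K, forall z, polydisk 0 s z -> (forall j, z 0 j != 0) ->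
    ((2 * c * mdot (v i) (logv z) - K)%:E <= phi z)%E.
  have [j vj] : exists j, v i \in (q j).1.2 by apply/Vq; exact: mem_tnth.
  have [_ _ /(_ _ vj) [c1 [c10 Hc1]] _] := Hq j.
  exists (M - c * ln (c1 ^+ 2)) => z pz z0.
  have zp l : 0 < cabs (z 0 l) <= (q j).1.1 by rewrite cabs_gt0 z0 /=; exact: zq.
  have [u [uz ug]] := Hc1 _ zp.
  pose w : Cn := 0 + rowf u.
  have wE l : w 0 l = u l by rewrite !mxE add0r.
  have zw : phi z = phi w.
    by apply: (toric_cabs Ht (pr z pz)) => l; rewrite wE uz.
  have pw : polydisk 0 s w by apply/polydisk0E => l; rewrite wE uz; move/polydisk0E: pz.
  have [m0 lm] := lnm z (v i) z0; set m := monom _ (v i) in m0 lm ug.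
  rewrite zw hphi; last exact: pe.
  rewrite -/(S w); have Sw : (c1 * m) ^+ 2 <= S w.
    rewrite /S (bigD1 j) //= -[leLHS]addr0; apply: lerD; last first.
      by apply: sumr_ge0 => l _; exact: cmod2_ge0.
    by rewrite cmod2_cabs lerXn2r ?nnegrE ?cabs_ge0 // mulr_ge0 // ltW.
  have cm : 0 < (c1 * m) ^+ 2 by rewrite exprn_gt0 // mulr_gt0.
  have Sp : 0 < S w := lt_le_trans cm Sw.
  rewrite lne_EFin // -EFinM -EFinD lee_fin -lm.
  have hl : ln (c1 ^+ 2) + 2 * ln m <= ln (S w).
    by rewrite mulr_natl -lnXn // -lnM ?posrE ?exprn_gt0 // -exprMn ler_ln ?posrE.
  have := ler_norm (- h w); rewrite normrN; have := hM w (pe w pw).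
  have := ler_wpM2l (ltW c0) hl; lra.
have [K2 HK2] := choice lo.
pose K := Num.max (c * ln A + M) (\big[Num.max/0]_i K2 i).
exists c, s, K, (size V), (fun i j => v i j); split=> //.
  move=> z pz z0; have [->|[i hi]] := up z pz z0; [by left|right; exists i].
  apply: le_trans hi _; rewrite lee_fin lerD2l /K le_max lexx //.
move=> z i pz z0; apply: le_trans (HK2 i z pz z0); rewrite lee_fin lerD2l lerN2 /K le_max.
by apply/orP; right; exact: le_bigmax_cond.
Qed.
End ApproxToPolyhedron.

Section Conclusion.
Variable R : realType.
Local Notation C := R[i].
Variable n : nat.
Local Notation Cn := 'rV[C]_n.
Local Notation Rn := 'rV[R]_n.

Definition scaled_hull (c : R) p (v : 'I_p -> 'I_n -> nat) : set Rn :=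
  [set x | forall y, nonpos y -> exists i, dotv x y <= 2 * c * mdot (v i) y].

Section Hull.
Variables (c : R) (c0 : 0 < c) (p : nat) (v : 'I_p -> 'I_n -> nat).
Local Notation P := (scaled_hull c v).

Let vq i : 'rV[rat]_n := \row_j (v i j)%:R.

Let dotv_vq i (y : Rn) : dotv (map_mx ratr (vq i)) y = mdot (v i) y.
Proof. by apply: eq_bigr => j _; rewrite !mxE rmorph_nat. Qed.

Lemma scaled_hullE x : P x <-> support_hull (fun i => map_mx ratr (vq i)) ((2 * c)^-1 *: x).
Proof.
have c2 : 0 < 2 * c by rewrite mulr_gt0.
split=> H y y0; have [i hi] := H y y0; exists i; by move: hi; rewrite dotvZl dotv_vq ler_pdivrMl.
Qed.

(** The constant of condition (i) is 4c, because 2/(4c) undoes the factor 2c carried by the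
    generating points 2c v_i. *)
Lemma scaled_hull_rational : rational_polyhedron (scale_set (2 / (4 * c)) P).
Proof.
have -> : scale_set (2 / (4 * c)) P = support_hull (fun i => map_mx ratr (vq i)); last exact: support_hull_rational.
have e : 2 / (4 * c) = (2 * c)^-1 by field; rewrite gt_eqF.
rewrite e; apply/seteqP; split=> [_ [x /scaled_hullE h <-] //|x hx].
have xE : (2 * c)^-1 *: ((2 * c) *: x) = x.
  by rewrite scalerA mulVf ?scale1r // gt_eqF // mulr_gt0.
by exists ((2 * c) *: x) => //; apply/scaled_hullE; rewrite xE.
Qed.

Lemma scaled_hull_polyhedron : polyhedron P.
Proof.
have [k [a [b E]]] := support_hull_rational R vq.
exists k, (fun i => (2 * c)^-1 *: map_mx ratr (a i)), (fun i => ratr (b i)).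
apply/seteqP; split=> x; rewrite scaled_hullE E /= => H i; have := H i; by rewrite dotvZl dotvZr.
Qed.

Lemma mdot_nonpos b (y : Rn) : nonpos y -> mdot b y <= 0.
Proof. by move=> y0; apply: sumr_le0 => j _; rewrite mulr_ge0_le0. Qed.

Lemma scaled_hull_orthant : P `<=` @orthant R n.
Proof.
move=> x Px j; have np : nonpos (- delta_mx 0 j : Rn).
  by move=> i; rewrite !mxE oppr_le0.
case: (Px _ np) => i; rewrite -scaleN1r dotvZr.
have -> : dotv x (delta_mx 0 j) = x 0 j.
  rewrite /dotv (bigD1 j) //= big1 ?addr0; first by rewrite mxE !eqxx mulr1.
  by move=> j' /negbTE jj; rewrite mxE jj mulr0.
have : 2 * c * mdot (v i) (-1 *: delta_mx 0 j) <= 0.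
  by rewrite mulr_ge0_le0 ?mulr_ge0 ?(ltW c0) // mdot_nonpos // scaleN1r.
lra.
Qed.

Lemma scaled_hull_up : up_closed P.
Proof.
move=> x w Px w0 y y0; have [i hi] := Px y y0; exists i; apply: le_trans hi.
by rewrite dotvDl gerDl; apply: sumr_le0 => j _; rewrite mulr_ge0_le0.
Qed.
End Hull.

Lemma nice_toric_approx_polyhedron (r : R) (phi : Cn -> \bar R) :
  0 < r -> psh (polydisk 0 r) phi -> toric r phi -> nice_toric_approx r phi ->
  exists P : set Rn,
     polyhedron P /\ P `<=` @orthant R n /\
     (exists c : R, 0 < c /\ rational_polyhedron (scale_set (2 / c) P)) /\
     (newton r phi `<=` P /\ up_closed P) /\
     (forall alpha : 'I_n -> nat,
        interior P (latpt R alpha) <-> interior (newton r phi) (latpt R alpha)).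
Proof.
move=> r0 Hp Ht [rho [rho0 [rr [phis [H1 [dec cv]]]]]].
have [Hp0 [Ht0 [Han HJ]]] := H1 0%N.
have Hpr := psh_shrink rr Hp; have Htr := toric_shrink rr Ht.
set phi0 := phis 0%N in Hp0 Ht0 Han HJ.
have phi_le (z : Cn) : polydisk 0 rho z -> (phi z <= phi0 z)%E.
  move=> pz; have m_le m : (phis m z <= phi0 z)%E.
    by elim: m => [//|m IH]; apply: le_trans IH; exact: dec.
  rewrite -(cvg_lim (@ereal_hausdorff R) (cv z pz)); apply: lime_le; last by near=> m.
  by apply/cvg_ex; exists (phi z); exact: cv.
have [c [s [K [p [v [c0 [s0 [sr s1]] up lo]]]]]] := analytic_sing_bounds rho0 Ht0 Han.
pose P := scaled_hull c v.
have Pup : up_closed P := scaled_hull_up (c := c) (v := v).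
have sub (y : Rn) : inU s y -> inU rho y.
  by move=> h j; apply: lt_le_trans (h j) _; rewrite ler_ln ?posrE.
have ps (y : Rn) : inU s y -> polydisk 0 s (cexp y) := @polydisk_cexp R n s s0 y.
have psr (z : Cn) : polydisk 0 s z -> polydisk (0 : Cn) rho z.
  by move=> pz j; exact: lt_le_trans (pz j) sr.
(* If <x, y0> exceeds every 2c <v_i, y0> by at least eta, then along t y0 + bb the difference of <x,
   y> and [phi0] grows like t eta, whereas [x] in the Newton body of phi <= phi0 keeps it
   bounded. *)
have NP : newton r phi `<=` P.
  move=> x; rewrite -(newton_shrink rho0 rr Hp Ht) => -[Mx HMx] y0 y00.
  apply: contrapT => no.
  have gap i : 0 < dotv x y0 - 2 * c * mdot (v i) y0.
    by rewrite subr_gt0 ltNge; apply/negP => h; apply: no; exists i.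
  have [eta [eta0 Heta]] := ord_min_pos gap.
  pose bb : Rn := const_mx (ln s - 1).
  pose D := \big[Num.max/0]_i (Mx + K + 2 * c * mdot (v i) bb - dotv x bb).
  have DD i : Mx + K + 2 * c * mdot (v i) bb - dotv x bb <= D by exact: le_bigmax_cond.
  have D0 : 0 <= D by exact: bigmax_ge_id.
  pose t := (D + 1) / eta.
  have t0 : 0 <= t by rewrite divr_ge0 ?addr_ge0 // ltW.
  pose y : Rn := t *: y0 + bb.
  have Uy : inU s y.
    by move=> j; rewrite !mxE; have : t * y0 0 j <= 0 by [rewrite mulr_ge0_le0]; lra.
  have hx : ((dotv x y)%:E - phi0 (cexp y) <= Mx%:E)%E.
    have h := HMx y (sub y Uy); apply: (le_trans _ h); apply: leeB => //; exact: phi_le (psr _ (ps y Uy)).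
  have [e|[i hi]] := up _ (ps y Uy) (@cexp_neq0 R n y); first by rewrite e in hx.
  rewrite logv_cexp in hi.
  have : ((dotv x y)%:E - (2 * c * mdot (v i) y + K)%:E <= Mx%:E)%E.
    by apply: le_trans hx; apply: leeB.
  rewrite -EFinB lee_fin dotvDr dotvZr mdotD mdotZ.
  have : D + 1 <= t * (dotv x y0 - 2 * c * mdot (v i) y0).
    by rewrite -[leLHS](divfK (x := eta)) ?gt_eqF // -/t; apply: ler_wpM2l.
  have := DD i; lra.
exists P; split; first exact: scaled_hull_polyhedron.
split; first exact: scaled_hull_orthant.
split; first by exists (4 * c); split; [rewrite mulr_gt0|exact: scaled_hull_rational].
split=> // al; split; last exact: filterS.
move=> /(interior_up_closed _ Pup)[dl1 dl10 Pdl1].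
(* Truncated at 1, as [inJ_suff] requires. *)
pose dl := Num.min dl1 1; have dl0 : 0 < dl by rewrite lt_min dl10 ltr01.
have dl_1 : dl <= 1 by rewrite ge_min lexx orbT.
have Pdl : P (latpt R al - const_mx dl).
  have -> : latpt R al - const_mx dl = latpt R al - const_mx dl1 + const_mx (dl1 - dl).
    by apply/rowP => j; rewrite !mxE; ring.
  by apply: Pup => // j; rewrite mxE subr_ge0 ge_min lexx.
(* Interior points of [P] have positive coordinates, so that the exponent alpha - 1 exists. *)
have al_gt0 j : (0 < al j)%N.
  have := scaled_hull_orthant c0 Pdl j; rewrite !mxE subr_ge0 => h.
  by rewrite -(ltr0n R); exact: lt_le_trans dl0 h.
(* As [P] has a point, there is at least one v_i, and its lower bound prevents [phi0] from being
   identically -oo. *)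
have [i0 _] := Pdl (0 : Rn) (fun j => ltac:(by rewrite mxE)).
have fin0 : exists2 y, inU rho y & gphi phi0 y != -oo%E.
  exists (const_mx (ln s - 1)); first by apply: sub; exact: inU_ex.
  have := lo _ i0 (ps _ (@inU_ex R n s)) (@cexp_neq0 R n _).
  by rewrite -/(gphi phi0 _); apply: contraTneq => ->; rewrite -ltNge ltNyr.
pose al' : {ffun 'I_n -> nat} := [ffun j => (al j).-1].
have alE j : (al' j)%:R + 1 = (al j)%:R :> R by rewrite ffunE natr1 prednK.
pose f (z : Cn) := monom (fun j => z 0 j) al'.
have [sg ms0] := @monom_local R n al'.
have fE : (fun u => monom u al') = (fun u : 'I_n -> C => f (0 + rowf u)).
  by apply/funext => u; congr monom; apply/funext => j; rewrite !mxE add0r.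
have ms : monomial_size (fun u => f (0 + rowf u)) sg [:: al'] 1 by rewrite -fE.
have p0 : polydisk 0 rho (0 : Cn) by move=> j; rewrite subrr cabs0.
have all0 (F : 'I_n -> R) : \sum_(j | (0 : Cn) 0 j == 0) F j = \sum_j F j.
  by apply: eq_bigl => j; rewrite mxE eqxx.
have J0 : inJ (polydisk 0 rho) phi0 0 f.
  apply: (inJ_suff rho0 Hp0 Ht0 fin0 p0 rho0 _ ms dl0 dl_1 s0 (M := K)).
    exact: holo_monom.
  move=> g; rewrite inE => /eqP -> z pz pz' z0; rewrite all0.
  have np : nonpos (logv z).
    move=> j; rewrite mxE; apply: ln_le0; have := pz j; rewrite mxE subr0 => h.
    exact: le_trans (ltW h) s1.
  have [i hi] := Pdl _ np; have := lo z i pz z0; rewrite (phi_Gphi rho0 Hp0 Ht0 fin0 pz' z0) lee_fin.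
  have -> : \sum_j ((al' j)%:R + 1 - dl) * ln (cabs (z 0 j)) = dotv (latpt R al - const_mx dl) (logv z).
    by apply: eq_bigr => j _; rewrite alE !mxE.
  lra.
have JJ : inJ (polydisk 0 rho) phi 0 f by apply/(HJ 0 p0 f).
have [fin|nf] := pselect (exists2 y, inU rho y & gphi phi y != -oo%E); last first.
  by case: (inJ_ninfty (not_fin rho0 Hpr Htr nf) JJ).
have [e [e0 [_ [_ bi]]]] := JJ.
have [dl2 [M [L [Z [dl20 Lr _ H]]]]] := inJ_nec rho0 Hpr Htr fin p0 e0 bi ms (mem_head _ _).
apply/(interior_up_closed _ (@newton_up R n r phi)); exists dl2 => //.
(* The estimate holds on the region Y_j <= L, which covers the domain of radius e^L; the Newton body
   does not change when computed there. *)
have eL : expR L <= r.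
  by apply: le_trans rr; rewrite -[leRHS](lnK (x := rho)) ?posrE // ler_expR ltW.
rewrite -(newton_shrink (expR_gt0 L) eL Hp Ht); exists M => y hy.
have rY : in_region [pred j | (0 : Cn) 0 j == 0] L Z y.
  by move=> j; rewrite /= mxE eqxx ltW // -[X in _ < X]expRK; exact: hy.
have Uy : inU rho y by move=> j; apply: lt_trans (hy j) _; rewrite expRK.
rewrite -[phi _]/(gphi phi y) (gphi_finE rho0 Hpr Htr fin Uy) -EFinB lee_fin.
have := H y rY; rewrite all0.
have -> : \sum_j ((al' j)%:R + 1 - dl2) * y 0 j = dotv (latpt R al - const_mx dl2) y.
  by apply: eq_bigr => j _; rewrite alE !mxE.
lra.
Unshelve. all: by end_near. Qed.
End Conclusion.

Theorem theorem1p2 (R : realType) (n : nat) (r : R)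
    (phi : 'rV[R[i]]_n -> \bar R) :
  0 < r -> psh (polydisk 0 r) phi -> toric r phi ->
  (nice_toric_approx r phi <->
   exists P : set 'rV[R]_n,
     polyhedron P /\ P `<=` @orthant R n /\
     (exists c : R, 0 < c /\ rational_polyhedron (scale_set (2 / c) P)) /\
     (newton r phi `<=` P /\
      (forall x v, P x -> @orthant R n v -> P (x + v))) /\
     (forall alpha : 'I_n -> nat,
        interior P (latpt R alpha) <-> interior (newton r phi) (latpt R alpha))).
Proof.
move=> r0 Hp Ht; split; first exact: nice_toric_approx_polyhedron.
move=> [P [h1 [h2 [[c [c0 h3]] [[h4 h5] h6]]]]].
exact: (polyhedron_nice_toric_approx r0 Hp Ht h1 h2 c0 h3 h4 h5 h6).
Qed.
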